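(* There exist positive constants $C_5,C_6$ and $0<\alpha<1$ such that for every $h$ with $0\le h\le 2h_c(T)$ and all $R,n$ with $2^{j_1}<R<n<L(h,\varepsilon_0)$, \[ C_5\frac Rn\le\mu_{T,h}\big(\mathcal B(1,0,R,n)\big)\le C_6\Big(\frac Rn\Big)^{\alpha}. \] In particular, $C_5n^{-1}\le\pi_{\rm cr}(n)\le C_6n^{-\alpha}$ for every $n\ge2^{j_1}$.
   Context: Ising model on $\mathbf{Z}^2$ with spins $\pm1$, nearest-neighbour ferromagnetic interaction, external field $h$, temperature $T$; $\mu_{T,h}$ the Gibbs measure (unique for $T>T_c$); $T>T_c$ fixed, $0\le h\le 2h_c(T)$. A $(+)$-path: successively adjacent ($|x-y|_1=1$) sites all with spin $+1$. $\mathbf C_0^+$ is the $(+)$-cluster of the origin $\mathbf O$; $h_c(T)=\inf\{h:\mu_{T,h}(\#\mathbf C_0^+=\infty)>0\}$; $\mu_{\rm cr}=\mu_{T,h_c(T)}$. $\mathcal B(1,0,R,n)$ is the event that there is a $(+)$-path in $[-n,n]^2\setminus(-R,R)^2$ from $\partial[-R,R]^2$ to $\partial[-n,n]^2$. $S(n)=[-n,n]^2$, $\partial_{in}S(n)=\{|x|_\infty=n\}$, $\pi_{\rm cr}(n)=\mu_{\rm cr}(\mathbf O$ is $(+)$-connected to $\partial_{in}S(n))$. $A^+(n,n)$: a $(+)$-path in $S(n)$ joins its left and right sides. $L(h,\varepsilon)=\min\{n:\mu_{T,h}(A^+(n,n))\ge1-\varepsilon\}$ if $h>h_c(T)$, $\min\{n:\mu_{T,h}(A^+(n,n))\le\varepsilon\}$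 if $h<h_c(T)$, $L(h_c(T),\varepsilon)=\infty$. $\varepsilon_0>0$ is a fixed small constant and $j_1$ a fixed sufficiently large integer chosen depending only on $\varepsilon_0$ (and $T$). *)

(* Defs.v *)
From HB Require Import structures.
From mathcomp Require Import all_boot all_order all_algebra.
From mathcomp Require Import all_classical all_reals all_analysis.
From mathcomp Require Import Rstruct Rstruct_topology.
Set Implicit Arguments. Unset Strict Implicit. Unset Printing Implicit Defensive.
Import Order.TTheory GRing.Theory Num.Theory.
Local Open Scope ring_scope.

Notation R := Rdefinitions.R.

Definition site := (int * int)%type.
Definition config := site -> bool.
Definition origin : site := (0, 0).
Definition spin (b : bool) : R := if b then 1 else -1.

Definition adj : rel site := fun x y =>
  (absz (x.1 - y.1) + absz (x.2 - y.2) == 1)%N.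
Definition normInf (x : site) : nat := maxn (absz x.1) (absz x.2).

Definition plus_path (s : config) (D : pred site) (x : site) (p : seq site) : bool :=
  path adj x p && all (fun y => D y && s y) (x :: p).

Definition Bev (Rr n : nat) (s : config) : Prop :=
  exists x p, [&& plus_path s (fun y => (Rr <= normInf y <= n)%N) x p,
                  normInf x == Rr & normInf (last x p) == n].

Definition Aplus (n : nat) (s : config) : Prop :=
  exists x p, [&& plus_path s (fun y => (normInf y <= n)%N) x p,
                  x.1 == - (n%:Z) & (last x p).1 == n%:Z].

Definition connO (n : nat) (s : config) : Prop :=
  exists p, plus_path s predT origin p && (normInf (last origin p) == n).

Definition boxsites (k : nat) : seq site :=
  [seq ((i%:Z - k%:Z), (j%:Z - k%:Z)) | i <- iota 0 (2 * k).+1, j <- iota 0 (2 * k).+1].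

Definition boxT (m : nat) := ('I_(2 * m).+1 * 'I_(2 * m).+1)%type.
Definition ext (m : nat) (c : {ffun boxT m -> bool}) : config := fun x =>
  if (normInf x <= m)%N then c (inord (absz (x.1 + m%:Z)), inord (absz (x.2 + m%:Z))) else true.

(* Boltzmann weight exp(-H/T), H = - sum_<xy> s_x s_y - h sum_x s_x, restricted to
   the terms that involve spins of [-m,m]^2 (up to an additive constant). *)
Definition weight (T h : R) {m : nat} (c : {ffun boxT m -> bool}) : R :=
  let s := ext c in
  expR (T^-1 * (\sum_(x <- boxsites m.+1)
                   (spin (s x) * spin (s (x.1 + 1, x.2)) + spin (s x) * spin (s (x.1, x.2 + 1)))
                + h * \sum_(x <- boxsites m) spin (s x))).

Definition muFin (T h : R) (m : nat) (E : config -> Prop) : R :=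
  (\sum_(c : {ffun boxT m -> bool}) (if `[< E (ext c) >] then weight T h c else 0))
  / (\sum_(c : {ffun boxT m -> bool}) weight T h c).

(* Infinite-volume Gibbs measure mu_{T,h}, evaluated on local events, as the
   thermodynamic limit of the finite-volume measures (unique for T > T_c). *)
Definition mu (T h : R) (E : config -> Prop) : R := limn (fun m => muFin T h m E).

Definition magn (T : R) : R := limn (fun m => 2 * muFin T 0 m (fun s => s origin) - 1).
Definition Tc : R := sup [set T : R | 0 < T /\ 0 < magn T].

(* mu_{T,h}(#C_0^+ = oo) = lim_n mu_{T,h}(O <-> d_in S(n)) *)
Definition perc (T h : R) : R := limn (fun n => mu T h (connO n)).
Definition hc (T : R) : R := inf [set h : R | 0 < perc T h].

Definition pi_cr (T : R) (n : nat) : R := mu T (hc T) (connO n).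

(* "n < L(h, eps)" (L(h_c, eps) = oo; the min of an empty set is oo) *)
Definition belowL (T h eps : R) (n : nat) : Prop :=
  if hc T < h then forall m : nat, (m <= n)%N -> mu T h (Aplus m) < 1 - eps
  else if h < hc T then forall m : nat, (m <= n)%N -> eps < mu T h (Aplus m)
  else True.

(* Main.v *)
Require Import Defs.
From HB Require Import structures.
From mathcomp Require Import all_boot all_order all_algebra.
From mathcomp Require Import all_classical all_reals all_analysis.
From mathcomp Require Import Rstruct Rstruct_topology.
From mathcomp Require Import exp ring lra zify.
Import Order.TTheory GRing.Theory Num.Theory.
Import numFieldNormedType.Exports.
Local Open Scope ring_scope.
Set Implicit Arguments. Unset Strict Implicit. Unset Printing Implicit Defensive.

(** The idea.  Above [Tc] the Ising measure mixes exponentially fast, uniformly in the field: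
    by Lebowitz' inequality the influence of the boundary is largest at zero field, and there
    Lieb's inequality and a differential inequality, obtained by exploring the random cluster of
    the boundary, give exponential decay unless the magnetization is positive at all lower
    temperatures.

    Plus paths and minus star paths are treated alike: the type [t = true] stands for plus spins
    with nearest-neighbour adjacency, [t = false] for minus spins with star adjacency.  By
    planar duality a square is crossed by [t] in one direction or by [~~ t] in the other.  A
    Russo-Seymour-Welsh argument, in which the spins on an axis are conditioned upon so that
    the reflection in the axis remains a symmetry, shows that at every scale and in every field
    circuits of one of the two types have probability bounded below.

    Suppose that a plus arm from S(w) to the boundary of S(N w) had probability close to 1.  Then
    all these circuits are plus circuits.  By the square root trick S(w) is joined to a fixed
    translate of itself at distance N w, and gluing such links along circuits gives plus
    crossings of long rectangles, with probability close to 1.  For h > h_c this is impossible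
    below the scale L(h, eps0).  For h <= h_c star arms become so rare that they decay
    exponentially even in a slightly smaller field, in which there is then percolation, against
    the definition of h_c.  So plus arms fail at each scale with probability bounded below,
    and by mixing the scales are almost independent: this is the upper bound.

    If h >= h_c and the arm from S(R) to the boundary of S(n) had probability much smaller than
    R / n, a branching argument over the O(n / R) translates of S(R) that cover the boundary of
    S(3 n) would give exponential decay, also in a slightly larger field, where there is
    percolation.  If h < h_c, a plus crossing of S(n), of probability at least eps0, starts in
    one of O(n / R) translates of S(R). *)

(** * Sums over spin configurations *)

Section ConfigSums.
Context {K : eqType}.
Implicit Types (l : seq K) (s t xi : K -> bool) (F G : (K -> bool) -> R).

(** The infinite-volume measure enters only as a limit of finite sums over spins; estimates are made
    in boxes and passed to the limit. Monotonicity gives convergence only for increasing functions.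
    A general local event is reached by adding its indicator to the number of plus spins of its box,
    which makes the sum increasing. The same device turns a bound on the influence on single spins
    into mixing for all local events, with an error relative to the probability of the distant
    event, so that it can be iterated over scales.

    The obstacle is that no symmetry relates plus paths to minus star paths, and in a given field
    nothing tells which type prevails at a given scale. The crossing estimate therefore compares
    squares of three side lengths: two of them favour the same type, and for that type
    Russo-Seymour-Welsh applies.

    The small changes of the field are possible because exponential decay of arms follows from one
    inequality for one local event, and such an inequality is open in h: finite-volume probabilities
    are continuous in h and the mixing error is uniform in h. *)

Definition upd s (x : K) (b : bool) : K -> bool := fun y => if y == x then b else s y.

(** The sum over the configurations that agree with [xi] off [l]. Recursion on the list turns a
    split of the volume ([ssum_cat]) into a nested sum, the form that the DLR equations need. *)
Fixpoint ssum l F xi : R :=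
  if l is x :: l' then ssum l' F (upd xi x true) + ssum l' F (upd xi x false) else F xi.

Definition agree l s xi := forall y, y \notin l -> s y = xi y.

Lemma upd_same s x b : upd s x b x = b. Proof. by rewrite /upd eqxx. Qed.

Lemma upd_updC s x y b c : x != y -> upd (upd s x b) y c = upd (upd s y c) x b.
Proof.
move=> nxy; apply: funext => z; rewrite /upd.
by have [->|//] := eqVneq z y; rewrite eq_sym (negbTE nxy).
Qed.

Lemma upd_id s x : upd s x (s x) = s.
Proof. by apply: funext => z; rewrite /upd; case: eqVneq => // ->. Qed.

Lemma agree_cons x l b s xi : agree l s (upd xi x b) -> agree (x :: l) s xi.
Proof.
move=> h y; rewrite inE negb_or => /andP[yx yl].
by rewrite h // /upd (negbTE yx).
Qed.

Lemma eq_ssum l F G xi :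
  (forall s, agree l s xi -> F s = G s) -> ssum l F xi = ssum l G xi.
Proof.
elim: l xi => [|x l IH] xi h /=; first exact: h.
by congr (_ + _); apply: IH => s /agree_cons; apply: h.
Qed.

Lemma ler_ssum l F G xi :
  (forall s, agree l s xi -> F s <= G s) -> ssum l F xi <= ssum l G xi.
Proof.
elim: l xi => [|x l IH] xi h /=; first exact: h.
by apply: lerD; apply: IH => s /agree_cons; apply: h.
Qed.

Lemma ssum0 l xi : ssum l (fun=> 0) xi = 0.
Proof. by elim: l xi => //= x l IH xi; rewrite !IH addr0. Qed.

Lemma ssum_ge0 l F xi : (forall s, agree l s xi -> 0 <= F s) -> 0 <= ssum l F xi.
Proof. by move=> h; rewrite -(ssum0 l xi); apply: ler_ssum. Qed.

Lemma ssum_gt0 l F xi : (forall s, 0 < F s) -> 0 < ssum l F xi.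
Proof. by move=> h; elim: l xi => //= x l IH xi; rewrite addr_gt0. Qed.

Lemma ssumD l F G xi : ssum l (fun s => F s + G s) xi = ssum l F xi + ssum l G xi.
Proof. by elim: l xi => //= x l IH xi; rewrite !IH addrACA. Qed.

Lemma ssumZ l c F xi : ssum l (fun s => c * F s) xi = c * ssum l F xi.
Proof. by elim: l xi => //= x l IH xi; rewrite !IH mulrDr. Qed.

Lemma ssumZr l c F xi : ssum l (fun s => F s * c) xi = ssum l F xi * c.
Proof. by rewrite mulrC -ssumZ; apply: eq_ssum => s _; rewrite mulrC. Qed.

Lemma ssumN l F xi : ssum l (fun s => - F s) xi = - ssum l F xi.
Proof. by elim: l xi => //= x l IH xi; rewrite !IH opprD. Qed.

Lemma ssumB l F G xi : ssum l (fun s => F s - G s) xi = ssum l F xi - ssum l G xi.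
Proof. by rewrite ssumD ssumN. Qed.

Lemma ssum_sum (I : Type) (r : seq I) (F : I -> (K -> bool) -> R) l xi :
  ssum l (fun s => \sum_(i <- r) F i s) xi = \sum_(i <- r) ssum l (F i) xi.
Proof.
elim: r => [|i r IH]; first by rewrite big_nil -[RHS](ssum0 l xi);
  apply: eq_ssum => s _; rewrite big_nil.
by rewrite big_cons -IH -ssumD; apply: eq_ssum => s _; rewrite big_cons.
Qed.

Lemma ssum_cst l c xi : ssum l (fun=> c) xi = 2 ^+ size l * c.
Proof.
elim: l xi => [|x l IH] xi /=; first by rewrite mul1r.
by rewrite !IH exprS; ring.
Qed.

Lemma ssum_cat l1 l2 F xi : ssum (l1 ++ l2) F xi = ssum l1 (ssum l2 F) xi.
Proof. by elim: l1 xi => //= x l IH xi; rewrite !IH. Qed.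

Lemma ssum_upd l x b F xi : x \notin l ->
  ssum l F (upd xi x b) = ssum l (fun s => F (upd s x b)) xi.
Proof.
elim: l xi => //= y l IH xi; rewrite inE negb_or => /andP[xy xl].
by rewrite !(upd_updC _ _ _ xy) !IH.
Qed.

Lemma ssum_swap x y l F xi : ssum [:: x, y & l] F xi = ssum [:: y, x & l] F xi.
Proof.
have [->//|xy] := eqVneq x y.
by rewrite /= !(upd_updC xi _ _ xy) addrACA.
Qed.

Lemma ssum_rot x l1 l2 F xi : ssum (x :: l1 ++ l2) F xi = ssum (l1 ++ x :: l2) F xi.
Proof.
elim: l1 xi => //= y l1 IH xi.
by rewrite -!IH; have := ssum_swap x y (l1 ++ l2) F xi => /= ->.
Qed.

Lemma ssum_catC3 l1 l2 l3 F xi :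
  ssum (l1 ++ l2 ++ l3) F xi = ssum (l2 ++ l1 ++ l3) F xi.
Proof.
elim: l1 xi => //= x l1 IH xi; rewrite -ssum_rot /= -!IH.
by rewrite !IH.
Qed.

Lemma ssum_perm l1 l2 F xi : perm_eq l1 l2 -> ssum l1 F xi = ssum l2 F xi.
Proof.
move=> /catCA_perm_ind h; apply/esym.
apply: (h (fun l => ssum l F xi = ssum l1 F xi)) => // a b c <-.
by rewrite ssum_catC3.
Qed.

Lemma ssum_agree l F xi xi' : agree l xi xi' -> ssum l F xi = ssum l F xi'.
Proof.
elim: l xi xi' => [|x l IH] xi xi' h /=; first by congr F; apply: funext => y; apply: h.
have h' b : agree l (upd xi x b) (upd xi' x b).
  by move=> y yl; rewrite /upd; case: eqVneq => // yx; apply: h; rewrite inE negb_or yx.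
by congr (_ + _); apply: IH.
Qed.

(** The group law of the spins: with [true] read as +1, boolean equality is the product. *)
Definition mulc s t : K -> bool := fun x => s x == t x.

Lemma ssum_mulc l F xi t : ssum l F xi = ssum l (fun s => F (mulc s t)) (mulc xi t).
Proof.
have mulcK s : mulc (mulc s t) t = s.
  by apply: funext => y; rewrite /mulc; case: (s y); case: (t y).
elim: l xi => [|x l IH] xi /=; first by rewrite mulcK.
have e b : mulc (upd xi x b) t = upd (mulc xi t) x (b == t x).
  by apply: funext => y; rewrite /mulc /upd; case: (eqVneq y x) => [->|].
rewrite !(IH (upd _ _ _)) !e; case: (t x) => //=.
by rewrite addrC.
Qed.

Lemma ssum_prod l (a b : K -> R) xi : uniq l ->
  \prod_(e <- l) (a e + b e) =
  ssum l (fun s => \prod_(e <- l) (if s e then a e else b e)) xi.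
Proof.
elim: l xi => [|x l IH] xi /=; first by rewrite !big_nil.
move=> /andP[xl ul]; rewrite big_cons mulrDl.
have h c : ssum l (fun s => \prod_(e <- x :: l) (if s e then a e else b e)) (upd xi x c) =
   (if c then a x else b x) * \prod_(e <- l) (a e + b e).
  rewrite (IH xi ul) -ssumZ ssum_upd //; apply: eq_ssum => s _.
  rewrite big_cons upd_same; congr (_ * _); rewrite big_seq [RHS]big_seq.
  apply: eq_bigr => y yl; rewrite /upd; case: eqVneq => // yx.
  by rewrite -yx yl in xl.
by rewrite !h.
Qed.

Definition dep_on (U : K -> bool) F := forall s t, (forall x, U x -> s x = t x) -> F s = F t.

(** The factor counts the configurations of the volume: both sums on the left run over all of [l],
    although each summand sees only a part of the sites. *)
Lemma ssum_indep l (U : K -> bool) F G xi : dep_on U F -> dep_on (fun x => ~~ U x) G ->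
  ssum l F xi * ssum l G xi = 2 ^+ size l * ssum l (fun s => F s * G s) xi.
Proof.
move=> hF hG.
suff H a b c : (forall x, U x -> a x = c x) -> (forall x, ~~ U x -> b x = c x) ->
    ssum l F a * ssum l G b = 2 ^+ size l * ssum l (fun s => F s * G s) c.
  exact: H.
have FF l0 u v : (forall x, U x -> u x = v x) -> ssum l0 F u = ssum l0 F v.
  elim: l0 u v => [|x l0 IH] u v h /=; first exact: hF.
  by congr (_ + _); apply: IH => y yU; rewrite /upd; case: eqP => // _; apply: h.
have GG l0 u v : (forall x, ~~ U x -> u x = v x) -> ssum l0 G u = ssum l0 G v.
  elim: l0 u v => [|x l0 IH] u v h /=; first exact: hG.
  by congr (_ + _); apply: IH => y yU; rewrite /upd; case: eqP => // _; apply: h.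
elim: l a b c => [|x l IH] a b c ha hb /=.
  by rewrite mul1r; congr (_ * _); [apply: hF|apply: hG].
have e k : ssum l (fun s => F s * G s) (upd c x k) * 2 ^+ size l =
   ssum l F (upd a x k) * ssum l G (upd b x k).
  rewrite mulrC (IH _ _ (upd c x k)) // => y hy; rewrite /upd; case: eqP => // _; auto.
have e' k := etrans (mulrC _ _) (e k).
case: (boolP (U x)) => hx.
  have e1 k k' : ssum l G (upd b x k) = ssum l G (upd b x k').
    by apply: GG => y yU; rewrite /upd; case: eqVneq => // exy; rewrite exy hx in yU.
  transitivity (2 * (2 ^+ size l * (ssum l (fun s => F s * G s) (upd c x true)
     + ssum l (fun s => F s * G s) (upd c x false)))); last by rewrite exprS; ring.
  rewrite [in RHS]mulrDr 2!e' (e1 false true); ring.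
have e1 k k' : ssum l F (upd a x k) = ssum l F (upd a x k').
  by apply: FF => y yU; rewrite /upd; case: eqVneq => // exy; rewrite exy (negbTE hx) in yU.
transitivity (2 * (2 ^+ size l * (ssum l (fun s => F s * G s) (upd c x true)
     + ssum l (fun s => F s * G s) (upd c x false)))); last by rewrite exprS; ring.
rewrite [in RHS]mulrDr 2!e' (e1 false true); ring.
Qed.

Definition orc s t : K -> bool := fun x => s x || t x.
Definition andc s t : K -> bool := fun x => s x && t x.

(** The one-site case of the four functions theorem. With p = c1 d0, both u = a0 b1 and v = a1 b0
    are at most p, and u v <= p c0 d1; then (p - u) (p - v) >= 0 bounds u + v by c1 d0 + c0 d1. *)
Lemma four_numbers (a0 a1 b0 b1 c0 c1 d0 d1 : R) :
  0 <= a0 -> 0 <= a1 -> 0 <= b0 -> 0 <= b1 -> 0 <= c0 -> 0 <= c1 -> 0 <= d0 -> 0 <= d1 ->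
  a0 * b0 <= c0 * d0 -> a0 * b1 <= c1 * d0 -> a1 * b0 <= c1 * d0 -> a1 * b1 <= c1 * d1 ->
  (a1 + a0) * (b1 + b0) <= (c1 + c0) * (d1 + d0).
Proof.
move=> a0p a1p b0p b1p c0p c1p d0p d1p h00 h01 h10 h11.
have [z|z] := eqVneq (c1 * d0) 0.
  have e1 : a0 * b1 = 0 by apply/eqP; rewrite eq_le mulr_ge0 // andbT -z.
  have e2 : a1 * b0 = 0 by apply/eqP; rewrite eq_le mulr_ge0 // andbT -z.
  have := mulr_ge0 c0p d1p; nra.
have p : 0 < c1 * d0 by rewrite lt_neqAle eq_sym z mulr_ge0.
have c1n : 0 < c1 by rewrite lt_neqAle c1p andbT; apply: contraNneq z => <-; rewrite mul0r.
have d0n : 0 < d0 by rewrite lt_neqAle d0p andbT; apply: contraNneq z => <-; rewrite mulr0.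
set u := a0 * b1; set v := a1 * b0.
have up : 0 <= u by rewrite mulr_ge0. have vp : 0 <= v by rewrite mulr_ge0.
have h1 : (c1 * d0 - u) * (c1 * d0 - v) >= 0 by rewrite mulr_ge0 ?subr_ge0.
have h2 : u * v <= (c0 * d0) * (c1 * d1).
  have -> : u * v = (a0 * b0) * (a1 * b1) by rewrite /u /v; ring.
  by apply: ler_pM => //; apply: mulr_ge0.
have h3 : u + v <= c1 * d0 + c0 * d1.
  rewrite -(ler_pM2l p).
  have -> : c1 * d0 * (c1 * d0 + c0 * d1) = (c1 * d0) ^+ 2 + (c0 * d0) * (c1 * d1) by ring.
  by have e := ler_wpM2l (ltW p) h2; rewrite expr2; nra.
have -> : (a1 + a0) * (b1 + b0) = a1 * b1 + a0 * b0 + (u + v) by rewrite /u /v; ring.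
have -> : (c1 + c0) * (d1 + d0) = c1 * d1 + c0 * d0 + (c1 * d0 + c0 * d1) by ring.
by apply: lerD => //; apply: lerD.
Qed.

(** The Ahlswede-Daykin theorem, by induction on the sites. The boundary conditions [s] and [t] are
    arbitrary, so that Holley's comparison also covers ordered boundary conditions. *)
Theorem four_functions l (A B C D : (K -> bool) -> R) :
  (forall s, 0 <= A s) -> (forall s, 0 <= B s) -> (forall s, 0 <= C s) ->
  (forall s, 0 <= D s) ->
  (forall s t, A s * B t <= C (orc s t) * D (andc s t)) ->
  forall s t, ssum l A s * ssum l B t <= ssum l C (orc s t) * ssum l D (andc s t).
Proof.
move=> pA pB pC pD H; elim: l => //= x l IH s t.
have eo a b : orc (upd s x a) (upd t x b) = upd (orc s t) x (a || b).
  by apply: funext => y; rewrite /orc /upd; case: eqP.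
have ea a b : andc (upd s x a) (upd t x b) = upd (andc s t) x (a && b).
  by apply: funext => y; rewrite /andc /upd; case: eqP.
have IH' a b : ssum l A (upd s x a) * ssum l B (upd t x b) <=
    ssum l C (upd (orc s t) x (a || b)) * ssum l D (upd (andc s t) x (a && b)).
  by rewrite -eo -ea; apply: IH.
apply: four_numbers; first [by apply: ssum_ge0 => u _ | idtac].
- exact: (IH' false false).
- exact: (IH' false true).
- exact: (IH' true false).
- exact: (IH' true true).
Qed.

Definition ltc s t := forall x, s x -> t x.
Definition incr F := forall s t, ltc s t -> F s <= F t.

Lemma orc_r s t : ltc s t -> orc s t = t.
Proof.
by move=> h; apply: funext => x; rewrite /orc; have := h x; case: (s x) => // ->.
Qed.

Lemma andc_l s t : ltc s t -> andc s t = s.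
Proof.
by move=> h; apply: funext => x; rewrite /andc; have := h x; case: (s x) => // ->.
Qed.

Lemma ltc_orl s t : ltc s (orc s t). Proof. by move=> x; rewrite /orc => ->. Qed.
Lemma ltc_orr s t : ltc t (orc s t). Proof. by move=> x; rewrite /orc orbC => ->. Qed.

Lemma holley l (w1 w2 : (K -> bool) -> R) F s t :
  (forall s, 0 <= w1 s) -> (forall s, 0 <= w2 s) -> (forall s, 0 <= F s) -> incr F ->
  (forall s t, w1 s * w2 t <= w2 (orc s t) * w1 (andc s t)) -> ltc s t ->
  ssum l (fun s => F s * w1 s) s * ssum l w2 t <= ssum l (fun s => F s * w2 s) t * ssum l w1 s.
Proof.
move=> p1 p2 pF iF H st.
have := @four_functions l (fun s => F s * w1 s) w2 (fun s => F s * w2 s) w1 _ _ _ _ _ s t.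
rewrite (orc_r st) (andc_l st); apply => // [u|u|u v]; rewrite ?mulr_ge0 // -!mulrA.
by apply: ler_pM; rewrite ?mulr_ge0 //; apply: iF (@ltc_orl _ _).
Qed.

Lemma fkg l w F G s :
  (forall s, 0 <= w s) -> (forall s, 0 <= F s) -> (forall s, 0 <= G s) ->
  incr F -> incr G ->
  (forall s t, w s * w t <= w (orc s t) * w (andc s t)) ->
  ssum l (fun s => F s * w s) s * ssum l (fun s => G s * w s) s <=
  ssum l (fun s => F s * G s * w s) s * ssum l w s.
Proof.
move=> pw pF pG iF iG H.
have := @four_functions l (fun s => F s * w s) (fun s => G s * w s)
  (fun s => F s * G s * w s) w.
move=> /(_ _ _ _ _ _ s s).
have -> : orc s s = s by apply: funext => x; rewrite /orc orbb.
have -> : andc s s = s by apply: funext => x; rewrite /andc andbb.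
apply => // [u|u|u|u v]; rewrite ?mulr_ge0 //.
have -> : F u * w u * (G v * w v) = F u * G v * (w u * w v) by ring.
rewrite -[leRHS]mulrA; apply: ler_pM; rewrite ?mulr_ge0 //.
by apply: ler_pM => //; [apply/iF/ltc_orl|apply/iG/ltc_orr].
Qed.

End ConfigSums.

Lemma ssum_map (K K' : eqType) (f : K -> K') (g : K' -> K) l (F : (K' -> bool) -> R) xi :
  cancel f g -> cancel g f ->
  ssum (map f l) F xi = ssum l (fun s => F (s \o g)) (xi \o f).
Proof.
move=> fg gf; elim: l xi => [|x l IH] xi /=.
  by congr F; apply: funext => y /=; rewrite gf.
have e b : upd xi (f x) b \o f = upd (xi \o f) x b.
  by apply: funext => y; rewrite /upd /= (can_eq fg).
by rewrite !IH !e.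
Qed.

Lemma ssum_exch (K K' : eqType) (l : seq K) (l' : seq K')
  (F : (K -> bool) -> (K' -> bool) -> R) xi xi' :
  ssum l (fun s => ssum l' (F s) xi') xi = ssum l' (fun t => ssum l (fun s => F s t) xi) xi'.
Proof. by elim: l xi => //= x l IH xi; rewrite !IH ssumD. Qed.

(** * The inequalities of Griffiths and Lebowitz *)

Section Correlations.
Context {K : eqType}.
Implicit Types (l : seq K) (s t xi : K -> bool) (F G : (K -> bool) -> R) (A B : seq K).

Definition chi A s : R := \prod_(a <- A) spin (s a).
Definition ctrue : K -> bool := fun=> true.

Lemma spin_sqr b : spin b * spin b = 1.
Proof. by case: b; rewrite /spin; ring. Qed.

Lemma spin_eqb b c : spin (b == c) = spin b * spin c.
Proof. by case: b; case: c; rewrite /spin /=; ring. Qed.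

Lemma chi_nil s : chi [::] s = 1. Proof. by rewrite /chi big_nil. Qed.
Lemma chi_cons a A s : chi (a :: A) s = spin (s a) * chi A s.
Proof. by rewrite /chi big_cons. Qed.
Lemma chi_cat A B s : chi (A ++ B) s = chi A s * chi B s.
Proof. by rewrite /chi big_cat. Qed.

Lemma chi_mulc A s t : chi A (mulc s t) = chi A s * chi A t.
Proof. by rewrite /chi -big_split /=; apply: eq_bigr => a _; rewrite /mulc spin_eqb. Qed.

Lemma chiP A s : chi A s = 1 \/ chi A s = -1.
Proof.
elim: A => [|a A [h|h]]; first by left; rewrite chi_nil.
- by rewrite chi_cons h; case: (s a); rewrite /spin; [left|right]; ring.
- by rewrite chi_cons h; case: (s a); rewrite /spin; [right|left]; ring.
Qed.

Lemma chi_le1 A s : chi A s <= 1. Proof. by have [->|->] := chiP A s; lra. Qed.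
Lemma chi_ge A s : -1 <= chi A s. Proof. by have [->|->] := chiP A s; lra. Qed.

(* The spin group acts on the boundary-plus configurations, so a character either is
   identically one on them or averages out to zero. *)
Lemma ssum_inv l F t : agree l t ctrue ->
  ssum l (fun s => F (mulc s t)) ctrue = ssum l F ctrue.
Proof.
move=> ht; rewrite (ssum_mulc _ F _ t); apply: ssum_agree => y yl.
by rewrite /mulc ht.
Qed.

Lemma gks1_chi l A : 0 <= ssum l (chi A) ctrue.
Proof.
case: (pselect (forall t, agree l t ctrue -> chi A t = 1)) => [h|].
  by apply: ssum_ge0 => s hs; rewrite h.
move=> /existsNP[t /not_implyP[ht hA]].
have e : chi A t = -1 by have [] := chiP A t.
have := ssum_inv (chi A) ht.
under eq_ssum do rewrite chi_mulc e.
by rewrite ssumZr; lra.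
Qed.

(** The nonnegative combinations of characters, for which Griffiths' first inequality holds. They
    are closed under sums, products and ferromagnetic exponentials. *)
Definition cone F := exists2 L : seq (R * seq K),
  all (fun u => 0 <= u.1) L & forall s, F s = \sum_(u <- L) u.1 * chi u.2 s.

Lemma cone_ext F G : (forall s, F s = G s) -> cone F -> cone G.
Proof. by move=> e [L h1 h2]; exists L => // s; rewrite -e. Qed.

Lemma coneZchi c A : 0 <= c -> cone (fun s => c * chi A s).
Proof. by move=> c0; exists [:: (c, A)] => [|s]; rewrite /= ?c0 // big_seq1. Qed.

Lemma cone_chi A : cone (chi A).
Proof. by apply: (cone_ext _ (coneZchi A ler01)) => s; rewrite mul1r. Qed.

Lemma cone_cst c : 0 <= c -> cone (fun=> c).
Proof. by move=> c0; apply: (cone_ext _ (coneZchi [::] c0)) => s; rewrite chi_nil mulr1. Qed.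

Lemma coneD F G : cone F -> cone G -> cone (fun s => F s + G s).
Proof.
move=> [L l0 h] [M m0 h']; exists (L ++ M) => [|s]; first by rewrite all_cat l0.
by rewrite big_cat h h'.
Qed.

Lemma coneM F G : cone F -> cone G -> cone (fun s => F s * G s).
Proof.
move=> [L l0 h] [M m0 h'].
exists [seq (u.1 * v.1, u.2 ++ v.2) | u <- L, v <- M] => [|s].
  apply/allP => w /allpairsP[[u v] /= [uL vM ->]] /=.
  by rewrite mulr_ge0 //; [apply: (allP l0)|apply: (allP m0)].
rewrite big_allpairs_dep h h' mulr_suml; apply: eq_bigr => u _.
by rewrite mulr_sumr; apply: eq_bigr => v _ /=; rewrite chi_cat; ring.
Qed.

Lemma cone_prod (I : Type) (r : seq I) (F : I -> (K -> bool) -> R) :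
  (forall i, cone (F i)) -> cone (fun s => \prod_(i <- r) F i s).
Proof.
move=> h; elim: r => [|i r IH].
  by apply: (cone_ext _ (cone_cst ler01)) => s; rewrite big_nil.
by apply: (cone_ext _ (coneM (h i) IH)) => s; rewrite big_cons.
Qed.

Definition ch (j : R) : R := (expR j + expR (- j)) / 2.
Definition sh (j : R) : R := (expR j - expR (- j)) / 2.

Lemma exp_pm (j c : R) : c = 1 \/ c = -1 -> expR (j * c) = ch j + sh j * c.
Proof. by move=> [->|->]; rewrite /ch /sh ?mulrN ?mulr1 ?mulrN1; field. Qed.

Lemma exp_chi j A s : expR (j * chi A s) = ch j + sh j * chi A s.
Proof. exact: exp_pm (chiP A s). Qed.

Lemma sh_ge0 j : 0 <= j -> 0 <= sh j.
Proof.
move=> j0; rewrite /sh divr_ge0 // subr_ge0 ler_expR; lra.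
Qed.

Lemma ch_ge1 j : 1 <= ch j.
Proof.
rewrite /ch expRN.
have p := expR_gt0 j; have := sqr_ge0 (expR j - 1).
rewrite ler_pdivlMr // mul1r => h.
have e : expR j * (expR j)^-1 = 1 by rewrite divff ?gt_eqF.
by rewrite -(ler_pM2l p) [leRHS]mulrDr e; nra.
Qed.

Definition ham (I : Type) (r : seq I) (c : I -> R) (f : I -> seq K) s : R :=
  \sum_(i <- r) c i * chi (f i) s.

Lemma cone_exp (I : Type) (r : seq I) c f :
  (forall i, 0 <= c i) -> cone (fun s => expR (@ham I r c f s)).
Proof.
move=> c0; apply: (@cone_ext (fun s => \prod_(i <- r) (ch (c i) + sh (c i) * chi (f i) s))).
  by move=> s; rewrite /ham expR_sum; apply: eq_bigr => i _; rewrite exp_chi.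
apply: cone_prod => i; apply: coneD; last exact/coneZchi/sh_ge0.
by apply: cone_cst; rewrite (le_trans ler01) // ch_ge1.
Qed.

Lemma gks1 l F : cone F -> 0 <= ssum l F ctrue.
Proof.
move=> [L l0 h]; under eq_ssum do rewrite h.
rewrite ssum_sum big_seq sumr_ge0 // => u uL.
by rewrite ssumZ mulr_ge0 ?gks1_chi //; apply: (allP l0).
Qed.

Lemma cone_exp_sub1 (I : Type) (r : seq I) c f :
  (forall i, 0 <= c i) -> cone (fun s => expR (@ham I r c f s) - 1).
Proof.
move=> c0; elim: r => [|i r IH].
  apply: (cone_ext _ (cone_cst (lexx 0))) => s.
  by rewrite /ham big_nil expR0 subrr.
have h1 : cone (fun s => (ch (c i) - 1) + sh (c i) * chi (f i) s).
  apply: coneD; last exact/coneZchi/sh_ge0.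
  by apply: cone_cst; rewrite subr_ge0 ch_ge1.
apply: (cone_ext _ (coneD h1 (coneM (cone_exp [:: i] f c0) IH))) => s.
by rewrite /ham !big_cons big_nil addr0 expRD exp_chi; ring.
Qed.

(** Ginibre's duplication. With the second replica written s' = s t, each coupling is multiplied by
    1 + chi t and each coefficient of F s - F s' by 1 - chi t. Both factors are nonnegative, so for
    every t the doubled covariance is a case of the first inequality. *)
Lemma gks2 l (I : Type) (r : seq I) c f F G :
  (forall i, 0 <= c i) -> cone F -> cone G ->
  forall W, W = (fun s => expR (@ham I r c f s)) ->
  ssum l (fun s => F s * W s) ctrue * ssum l (fun s => G s * W s) ctrue <=
  ssum l (fun s => F s * G s * W s) ctrue * ssum l W ctrue.
Proof.
move=> c0 cF cG W defW.
pose Q s s' := W s * W s' * (F s - F s') * (G s - G s').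
have pos : 0 <= ssum l (fun t => ssum l (fun s => Q s (mulc s t)) ctrue) ctrue.
  apply: ssum_ge0 => t _; apply: gks1.
  have d F0 : cone F0 -> cone (fun s => F0 s - F0 (mulc s t)).
    move=> [L l0 h]; exists [seq (u.1 * (1 - chi u.2 t), u.2) | u <- L] => [|s].
      apply/allP => v /mapP[u uL ->] /=; rewrite mulr_ge0 //; first exact: (allP l0).
      by rewrite subr_ge0 chi_le1.
    rewrite !h big_map -sumrB; apply: eq_bigr => u _ /=.
    by rewrite chi_mulc; ring.
  apply: coneM (d _ cG); apply: coneM (d _ cF).
  apply: (@cone_ext (fun s => expR (@ham I r (fun i => c i * (1 + chi (f i) t)) f s))).
    move=> s; rewrite defW -expRD; congr expR; rewrite /ham -big_split /=.
    by apply: eq_bigr => i _; rewrite chi_mulc; ring.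
  by apply: cone_exp => i; rewrite mulr_ge0 //; have := chi_ge (f i) t; lra.
have eq1 : ssum l (fun t => ssum l (fun s => Q s (mulc s t)) ctrue) ctrue =
   ssum l (fun s => ssum l (fun t => Q s t) ctrue) ctrue.
  rewrite ssum_exch; apply: eq_ssum => s hs.
  rewrite -(ssum_inv (Q s) hs); apply: eq_ssum => t _; congr Q.
  by apply: funext => y; rewrite /mulc eq_sym.
move: pos; rewrite eq1.
have -> : ssum l (fun s => ssum l [eta Q s] ctrue) ctrue =
  2 * (ssum l (fun s => F s * G s * W s) ctrue * ssum l W ctrue
   - ssum l (fun s => F s * W s) ctrue * ssum l (fun s => G s * W s) ctrue).
  transitivity (ssum l (fun s => (F s * G s * W s) * ssum l W ctrue
    + W s * ssum l (fun t => F t * G t * W t) ctrue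
    - (F s * W s * ssum l (fun t => G t * W t) ctrue
      + G s * W s * ssum l (fun t => F t * W t) ctrue)) ctrue).
    apply: eq_ssum => s _; rewrite -!ssumZ -!ssumD -ssumB.
    by apply: eq_ssum => t _; rewrite /Q; ring.
  by rewrite ssumB !ssumD !ssumZr; ring.
by rewrite pmulr_rge0 // subr_ge0.
Qed.

(* Supermodularity of the log partition function in the couplings. *)
Lemma gks_super l (I : Type) (r : seq I) (j1 j2 jm jM : I -> R) f F :
  cone F -> (forall i, 0 <= jm i) -> (forall i, jm i <= j1 i) -> (forall i, jm i <= j2 i) ->
  (forall i, j1 i + j2 i <= jm i + jM i) ->
  ssum l (fun s => F s * expR (ham r j1 f s)) ctrue * ssum l (fun s => expR (ham r j2 f s)) ctrue
  <= ssum l (fun s => F s * expR (ham r jM f s)) ctrue *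
     ssum l (fun s => expR (ham r jm f s)) ctrue.
Proof.
move=> cF h0 h1 h2 h3.
have cP : cone (fun s => F s * expR (ham r (fun i => j1 i - jm i) f s)).
  by apply: coneM => //; apply: cone_exp => i; rewrite subr_ge0.
have cQ : cone (fun s => expR (ham r (fun i => j2 i - jm i) f s)).
  by apply: cone_exp => i; rewrite subr_ge0.
have := @gks2 l I r jm f _ _ h0 cP cQ _ erefl.
have hamD a b s : ham r a f s + ham r b f s = ham r (fun i => a i + b i) f s.
  by rewrite /ham -big_split; apply: eq_bigr => i _ /=; ring.
under eq_ssum do rewrite -mulrA -expRD hamD.
under [X in _ * X <= _ -> _]eq_ssum do rewrite -expRD hamD.
have e j : (fun i => j i - jm i + jm i) = j by apply: funext => i; rewrite subrK.
rewrite !e => /le_trans; apply.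
apply: ler_wpM2r; first by apply: ssum_ge0 => s _; exact: expR_ge0.
under [X in X <= _]eq_ssum do rewrite -!mulrA -!expRD !hamD.
rewrite -subr_ge0 -ssumB; apply: gks1.
pose j' i := j1 i - jm i + (j2 i - jm i + jm i).
apply: (@cone_ext (fun s => F s * (expR (ham r j' f s) *
   (expR (ham r (fun i => jM i - j' i) f s) - 1)))).
  move=> s; rewrite [X in _ * X = _]mulrBr -expRD hamD mulr1 mulrBr.
  by congr (F s * expR _ - _); congr (ham r _ f s); apply: funext => i; rewrite addrC subrK.
apply: coneM => //; apply: coneM; first apply: cone_exp; last apply: cone_exp_sub1.
  by move=> i; rewrite /j'; have := h0 i; have := h1 i; have := h2 i; lra.
by move=> i; rewrite /j'; have := h3 i; lra.
Qed.

End Correlations.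

(** * Lebowitz' comparison of fields *)

Section FieldComparison.
Context {K : eqType}.
Implicit Types (l X : seq K) (EE : seq (K * K)) (s t : K -> bool) (o : K).

Definition edge_chars (e : K * K) : seq K := [:: e.1; e.2].

Definition bonds EE s : R := \sum_(e <- EE) chi (edge_chars e) s.
Definition energy EE X (b h : R) s : R := b * bonds EE s + h * \sum_(x <- X) spin (s x).

Lemma dep_ham (I : Type) (r : seq I) (c : I -> R) (f : I -> seq K) (U : K -> bool) :
  (forall i, c i = 0 \/ all U (f i)) -> dep_on U (fun s => expR (ham r c f s)).
Proof.
move=> h s t st; congr expR; apply: eq_bigr => i _.
have [->|/allP ha] := h i; first by rewrite !mul0r.
congr (_ * _); rewrite /chi big_seq [RHS]big_seq; apply: eq_bigr => x xf.
by rewrite st //; apply: ha.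
Qed.

Let fE := edge_chars.
Let cU (b : R) t (e : K * K) : R := 2 * b * (t e.1 && t e.2)%:R.
Let fD (i : K * K + K) : seq K := match i with inl e => edge_chars e | inr x => [:: x] end.
Let cD (b h : R) t (i : K * K + K) : R :=
  match i with inl e => 2 * b * (~~ t e.1 && ~~ t e.2)%:R | inr x => 2 * h * (~~ t x)%:R end.
Let rD EE X : seq (K * K + K) := map inl EE ++ map inr X.

(** In the second replica [mulc s t] a bond is multiplied by the product of the values of t at its
    ends, so the two contributions cancel on edges between {t = +} and {t = -}: the two regions
    decouple. *)
Let pair_energy EE X b h s t :
  energy EE X b h s + energy EE X b (- h) (mulc s t) =
  ham EE (cU b t) fE s + ham (rD EE X) (cD b h t) fD s.
Proof.
rewrite /energy /bonds /ham /rD big_cat !big_map /= addrACA [in RHS]addrA; congr (_ + _).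
  rewrite -mulrDr -!big_split mulr_sumr /=; apply: eq_bigr => e _.
  rewrite chi_mulc /cU /edge_chars !chi_cons !chi_nil.
  by case: (t e.1); case: (t e.2); rewrite /spin /=; ring.
rewrite mulNr -mulrBr -sumrB mulr_sumr; apply: eq_bigr => x _.
rewrite chi_cons chi_nil /mulc spin_eqb.
by case: (t x); rewrite /spin /=; ring.
Qed.

Let lebowitz_pos l EE X (b h : R) o (Z N : R -> R) : 0 <= b -> 0 <= h ->
  (forall h, Z h = ssum l (fun s => expR (energy EE X b h s)) ctrue) ->
  (forall h, N h = ssum l (fun s => spin (s o) * expR (energy EE X b h s)) ctrue) ->
  (N h * Z (- h) + N (- h) * Z h) * Z 0 <= 2 * N 0 * (Z h * Z (- h)).
Proof.
move=> b0 h0 defZ defN.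
have Zp k : 0 < Z k by rewrite defZ ssum_gt0 // => s; apply: expR_gt0.
pose Om h t := ssum l (fun s => expR (ham EE (cU b t) fE s) *
  expR (ham (rD EE X) (cD b h t) fD s)) ctrue.
pose n h t := ssum l (fun s => spin (s o) * expR (ham EE (cU b t) fE s) *
  expR (ham (rD EE X) (cD b h t) fD s)) ctrue.
pose Nt h t := (1 + spin (t o)) * n h t.
have eqZ k : Z k * Z (- k) = ssum l (Om k) ctrue.
  rewrite !defZ -ssumZr.
  transitivity (ssum l (fun s => ssum l (fun t =>
    expR (energy EE X b k s + energy EE X b (- k) (mulc s t))) ctrue) ctrue).
    apply: eq_ssum => s hs; rewrite -ssumZ -(ssum_inv _ hs).
    apply: eq_ssum => t _; rewrite -expRD; congr (expR (_ + energy _ _ _ _ _)).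
    by apply: funext => y; rewrite /mulc eq_sym.
  rewrite ssum_exch; apply: eq_ssum => t _; apply: eq_ssum => s _.
  by rewrite pair_energy expRD.
have eqN k : N k * Z (- k) + N (- k) * Z k = ssum l (Nt k) ctrue.
  rewrite !defZ !defN (mulrC (ssum _ (fun s => _ * expR (energy EE X b (- k) s)) _)).
  rewrite -!ssumZr -ssumD.
  transitivity (ssum l (fun s => ssum l (fun t => (spin (s o) + spin (mulc s t o)) *
    expR (energy EE X b k s + energy EE X b (- k) (mulc s t))) ctrue) ctrue).
    apply: eq_ssum => s hs; rewrite -!ssumZ -ssumD.
    rewrite -(ssum_inv _ hs); apply: eq_ssum => t _.
    have -> : mulc t s = mulc s t by apply: funext => y; rewrite /mulc eq_sym.
    by rewrite [in RHS]expRD; ring.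
  rewrite ssum_exch; apply: eq_ssum => t _; rewrite /Nt /n -ssumZ; apply: eq_ssum => s _.
  by rewrite -mulrA -expRD -pair_energy /mulc spin_eqb; ring.
have U0 t i : 0 <= cU b t i by rewrite mulr_ge0 ?mulr_ge0.
have D0 k t i : 0 <= k -> 0 <= cD b k t i by case: i => ? ?; rewrite /= !mulr_ge0.
have cspin : cone (fun s : K -> bool => spin (s o)).
  by apply: (cone_ext _ (cone_chi [:: o])) => s; rewrite chi_cons chi_nil mulr1.
have cPU t : cone (fun s => expR (ham EE (cU b t) fE s)) by apply: cone_exp.
have cPD k t : 0 <= k -> cone (fun s => expR (ham (rD EE X) (cD b k t) fD s)).
  by move=> k0; apply: cone_exp => i; apply: D0.
have Om0 k t : 0 <= k -> 0 <= Om k t by move=> k0; apply/gks1/coneM/cPD.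
have n0 k t : 0 <= k -> 0 <= n k t.
  by move=> k0; apply: gks1; apply: coneM (cPD _ _ k0); apply: coneM.
have depU t : dep_on t (fun s => expR (ham EE (cU b t) fE s)).
  apply: dep_ham => e; rewrite /cU /fE /=.
  by case: (t e.1); case: (t e.2); rewrite /= ?mulr0; auto.
have depD k t : dep_on (fun x => ~~ t x) (fun s => expR (ham (rD EE X) (cD b k t) fD s)).
  apply: dep_ham => -[e|x] /=; first by case: (t e.1); case: (t e.2); rewrite /= ?mulr0; auto.
  by case: (t x); rewrite /= ?mulr0; auto.
have p2 : 0 < 2 ^+ size l :> R by rewrite exprn_gt0.
(* The hypothesis of the four functions theorem for the law of t. The weights factorize over {t = +}
   and its complement. In the first factor the couplings of the union dominate; in the second those
   of the intersection do, because there the complement is larger and carries the field. *)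
have main t1 t2 : Nt h t1 * Om 0 t2 <= Nt 0 (orc t1 t2) * Om h (andc t1 t2).
  rewrite /Nt; case e1 : (t1 o); last first.
    have -> : 1 + spin false = 0 by rewrite /spin; ring.
    rewrite !mul0r mulr_ge0 ?mulr_ge0 ?Om0 ?n0 //.
    by case: (orc t1 t2 o); rewrite /spin; lra.
  have eo : orc t1 t2 o by rewrite /orc e1.
  rewrite eo -!mulrA; apply: ler_wpM2l; first by rewrite /spin; lra.
  have fac k t : t o -> 2 ^+ size l * n k t =
     ssum l (fun s => spin (s o) * expR (ham EE (cU b t) fE s)) ctrue *
     ssum l (fun s => expR (ham (rD EE X) (cD b k t) fD s)) ctrue.
    move=> to; rewrite -(@ssum_indep _ _ t) //.
    by move=> s s' ss; rewrite (depU t _ _ ss) ss.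
  have facO k t : 2 ^+ size l * Om k t =
     ssum l (fun s => expR (ham EE (cU b t) fE s)) ctrue *
     ssum l (fun s => expR (ham (rD EE X) (cD b k t) fD s)) ctrue.
    by rewrite -(@ssum_indep _ _ t).
  rewrite -(ler_pM2l (mulr_gt0 p2 p2)) [leLHS]mulrACA [leRHS]mulrACA.
  rewrite (facO 0 t2) (facO h) (fac h) // (fac 0) //.
  set u1 := ssum _ _ _; set d1 := ssum _ _ _; set u2 := ssum _ _ _; set d2 := ssum _ _ _.
  set u3 := ssum _ _ _; set d3 := ssum _ _ _; set u4 := ssum _ _ _; set d4 := ssum _ _ _.
  have -> : u1 * d1 * (u2 * d2) = (u1 * u2) * (d1 * d2) by ring.
  have -> : u3 * d3 * (u4 * d4) = (u3 * u4) * (d4 * d3) by ring.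
  have ge0 F : cone F -> 0 <= ssum l F ctrue by apply: gks1.
  apply: ler_pM.
  - by rewrite mulr_ge0 // ?/u1 ?/u2; apply: ge0 => //; apply: coneM.
  - by rewrite mulr_ge0 // ?/d1 ?/d2; apply: ge0; apply: cPD.
  - by apply: gks_super => // e; rewrite /cU /orc /andc -?mulrDr -?natrD;
      apply: ler_wpM2l; rewrite ?mulr_ge0 // ler_nat;
      case: (t1 e.1); case: (t1 e.2); case: (t2 e.1); case: (t2 e.2).
  - have := @gks_super _ l _ (rD EE X) (cD b h t1) (cD b 0 t2)
      (cD b 0 (orc t1 t2)) (cD b h (andc t1 t2)) fD (fun=> 1).
    rewrite /d1 /d2 /d3 /d4.
    have em1 (f : (K -> bool) -> R) : ssum l (fun s => 1 * f s) ctrue = ssum l f ctrue.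
      by apply: eq_ssum => s _; rewrite mul1r.
    rewrite !em1; apply.
    + exact: cone_cst.
    + by move=> i; apply: D0.
    + move=> [e|x]; rewrite /cD /orc /=; last by rewrite mulr0 mul0r mulr_ge0 ?mulr_ge0.
      apply: ler_wpM2l; rewrite ?mulr_ge0 // ler_nat.
      by case: (t1 e.1); case: (t1 e.2); case: (t2 e.1); case: (t2 e.2).
    + move=> [e|x]; rewrite /cD /orc /=; last by rewrite !mulr0 !mul0r.
      apply: ler_wpM2l; rewrite ?mulr_ge0 // ler_nat.
      by case: (t1 e.1); case: (t1 e.2); case: (t2 e.1); case: (t2 e.2).
    + move=> [e|x]; rewrite /cD /orc /andc /=; last first.
        rewrite !mulr0 !mul0r addr0 add0r.
        apply: ler_wpM2l; rewrite ?mulr_ge0 // ler_nat.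
        by case: (t1 x); case: (t2 x).
      rewrite -!mulrDr -!natrD; apply: ler_wpM2l; rewrite ?mulr_ge0 // ler_nat.
      by case: (t1 e.1); case: (t1 e.2); case: (t2 e.1); case: (t2 e.2).
have Nt0 k t : 0 <= k -> 0 <= Nt k t.
  by move=> k0; rewrite mulr_ge0 ?n0 //; case: (t o); rewrite /spin; lra.
have := @four_functions _ l (Nt h) (Om 0) (Nt 0) (Om h).
move=> /(_ _ _ _ _ main ctrue ctrue).
have -> : orc ctrue ctrue = ctrue :> (K -> bool) by [].
have -> : andc ctrue ctrue = ctrue :> (K -> bool) by [].
rewrite -!eqN -!eqZ oppr0 => H.
have {}H : (N h * Z (- h) + N (- h) * Z h) * (Z 0 * Z 0) <=
    (N 0 * Z 0 + N 0 * Z 0) * (Z h * Z (- h)).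
  by apply: H => t; auto.
by rewrite -(ler_pM2r (Zp 0)); lra.
Qed.

(* The influence of the boundary is largest at zero field.  The two replicas with
   fields h and -h are coupled through s' = s t; given t, the region {t = +} carries the
   boundary and no field, {t = -} carries the field and no boundary, and the law of t is
   monotone in h. *)
Lemma lebowitz l EE X (b h : R) o (Z N : R -> R) : 0 <= b ->
  (forall h, Z h = ssum l (fun s => expR (energy EE X b h s)) ctrue) ->
  (forall h, N h = ssum l (fun s => spin (s o) * expR (energy EE X b h s)) ctrue) ->
  N h / Z h + N (- h) / Z (- h) <= 2 * (N 0 / Z 0).
Proof.
move=> b0 defZ defN.
have Zp k : 0 < Z k by rewrite defZ ssum_gt0 // => s; apply: expR_gt0.
wlog h0 : h / 0 <= h => [H|].
  have [h0|h0] := leP 0 h; first exact: H.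
  have := H (- h); rewrite opprK addrC; apply; lra.
have H := lebowitz_pos b0 h0 defZ defN.
rewrite addf_div ?gt_eqF // mulrA ler_pdivrMr ?mulr_gt0 // mulrAC ler_pdivlMr //.
Qed.

End FieldComparison.

(** * Random clusters and sharpness *)

Section RandomCluster.
Context {K : eqType} (L : seq K) (EE : seq (K * K)) (b : R).
Hypothesis uE : uniq EE.
Hypothesis b0 : 0 <= b.
Implicit Types (s t : K -> bool) (om : K * K -> bool) (A B : seq K).

Definition compat om s := all (fun e => om e ==> (s e.1 == s e.2)) EE.
Definition ncompat A om : R := ssum L (fun s => (compat om s)%:R * chi A s) ctrue.
(* For A = [x] this says that x is joined to the boundary, for A = [x; y] that x is
   joined to y; in general, that every cluster off the boundary meets A evenly. *)
Definition forced A om : Prop := forall s, agree L s ctrue -> compat om s -> chi A s = 1.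
(** The weight p / (1 - p) of an open edge, for p = 1 - exp (- 2 b). *)
Definition fkv : R := expR (2 * b) - 1.
Definition fkw om : R := \prod_(e <- EE) (if om e then fkv else 1).

Lemma fkv_ge0 : 0 <= fkv.
Proof. by rewrite /fkv subr_ge0 -[leLHS]expR0 ler_expR mulr_ge0. Qed.

Lemma fkw_ge0 om : 0 <= fkw om.
Proof. by apply: prodr_ge0 => e _; case: ifP => _ //; apply: fkv_ge0. Qed.

Lemma compat_mulc om s t : compat om t -> compat om (mulc s t) = compat om s.
Proof.
move=> /allP ct; apply: eq_in_all => e eE; have := ct e eE; rewrite /mulc.
by case: (om e) => //= /eqP ->; case: (s e.1); case: (s e.2); case: (t e.2).
Qed.

Lemma compat_sub om om' s : (forall e, om e -> om' e) -> compat om' s -> compat om s.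
Proof.
move=> h /allP c; apply/allP => e eE; apply/implyP => /h oe.
by have := c e eE; rewrite oe.
Qed.

Lemma compat_prod om s : (compat om s)%:R = \prod_(e <- EE) (if om e then (s e.1 == s e.2)%:R else 1) :> R.
Proof.
rewrite /compat; elim: EE => [|e r IH]; first by rewrite big_nil.
rewrite big_cons /= -IH; case: (om e); rewrite ?mul1r //=.
by case: (_ == _); rewrite ?mul1r ?mul0r.
Qed.

Lemma forced_mono A om om' : (forall e, om e -> om' e) -> forced A om -> forced A om'.
Proof. by move=> h f s hs c; apply: f => //; apply: compat_sub c. Qed.

Lemma flip_sum0 (F : (K -> bool) -> R) t : agree L t ctrue ->
  (forall s, F (mulc s t) = - F s) -> ssum L F ctrue = 0.
Proof.
move=> ht h; have := ssum_inv F ht.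
under eq_ssum do rewrite h.
by rewrite ssumN; lra.
Qed.

Lemma not_forced A om : ~ forced A om ->
  exists t, [/\ agree L t ctrue, compat om t & chi A t = -1].
Proof.
move=> /existsNP[t /not_implyP[ht /not_implyP[ct hA]]]; exists t; split => //.
by have [] := chiP A t.
Qed.

(** If [A] is not forced, some compatible t has character -1 on [A]; multiplication by t preserves
    the compatible configurations and reverses the sign of the sum. *)
Lemma ncompat_forced A om : ncompat A om = ncompat [::] om * `[< forced A om >]%:R.
Proof.
case: (asboolP (forced A om)) => h; rewrite ?mulr1 ?mulr0.
  apply: eq_ssum => s hs; rewrite chi_nil; case E : (compat om s); rewrite ?mul0r //.
  by rewrite (h s).
have [t [ht ct e]] := not_forced h; apply: flip_sum0 ht _ => s.
by rewrite compat_mulc // chi_mulc e; ring.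
Qed.

Lemma ncompat_ge0 A om : 0 <= ncompat A om.
Proof.
rewrite ncompat_forced mulr_ge0 //; apply: ssum_ge0 => s _; by rewrite chi_nil mulr1.
Qed.

Lemma bond_factor s (e : K * K) :
  expR (b * chi (edge_chars e) s) = expR (- b) * (fkv * (s e.1 == s e.2)%:R + 1).
Proof.
rewrite /fkv !chi_cons chi_nil mulr1 -spin_eqb; case: (s e.1 == s e.2); rewrite /spin /=.
  by rewrite !mulr1 subrK -expRD; congr expR; ring.
by rewrite mulr0 add0r mulr1 mulrN1.
Qed.

Lemma exp_bonds s : expR (b * bonds EE s) =
  expR (- b) ^+ size EE * ssum EE (fun om => fkw om * (compat om s)%:R) ctrue.
Proof.
rewrite /bonds mulr_sumr expR_sum; under eq_bigr do rewrite bond_factor.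
rewrite big_split /=; congr (_ * _).
  by elim: EE => [|e r IH]; rewrite ?big_nil // big_cons exprS IH.
rewrite (ssum_prod _ _ ctrue uE); apply: eq_ssum => om _.
rewrite compat_prod /fkw -big_split; apply: eq_bigr => e _.
by case: (om e) => /=; rewrite ?mulr1.
Qed.

Lemma edwards_sokal A : ssum L (fun s => chi A s * expR (b * bonds EE s)) ctrue =
  expR (- b) ^+ size EE * ssum EE (fun om => fkw om * ncompat A om) ctrue.
Proof.
transitivity (ssum L (fun s => expR (- b) ^+ size EE *
    ssum EE (fun om => fkw om * ((compat om s)%:R * chi A s)) ctrue) ctrue).
  apply: eq_ssum => s _; rewrite exp_bonds mulrCA; congr (_ * _).
  by rewrite -ssumZ; apply: eq_ssum => om _; ring.
rewrite ssumZ ssum_exch; congr (_ * _).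
by apply: eq_ssum => om _; rewrite -ssumZ.
Qed.

(** The lattice condition for the cluster count. Pairs (s, s') compatible with [om1] and [om2] are
    grouped by their product t. This t is compatible with the intersection, and two pairs with the
    same t differ by a configuration compatible with the union. *)
Lemma ncompat_super om1 om2 :
  ncompat [::] om1 * ncompat [::] om2 <=
  ncompat [::] (orc om1 om2) * ncompat [::] (andc om1 om2).
Proof.
rewrite /ncompat [leRHS]mulrC -ssumZr.
pose c om s : R := (compat om s)%:R * chi [::] s.
have cE om s : c om s = (compat om s)%:R by rewrite /c chi_nil mulr1.
have -> : ssum L (fun s => c om1 s * ssum L (c om2) ctrue) ctrue =
   ssum L (fun t => ssum L (fun s => c om1 s * c om2 (mulc t s)) ctrue) ctrue.
  by rewrite ssum_exch; apply: eq_ssum => s hs; rewrite -(ssum_inv _ hs) ssumZ.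
rewrite -ssumZr; apply: ler_ssum => t ht; rewrite -/(c _ _) -/(c (orc om1 om2)).
case: (pselect (exists2 s0, agree L s0 ctrue & compat om1 s0 && compat om2 (mulc t s0))).
  move=> [s0 h0 /andP[c1 c2]].
  have mm : mulc (mulc t s0) s0 = t.
    by apply: funext => y; rewrite /mulc; case: (t y); case: (s0 y).
  have -> : c (andc om1 om2) t = 1.
    rewrite cE -mm compat_mulc; first by rewrite (compat_sub _ c2) // => e /andP[].
    by apply: compat_sub c1 => e /andP[].
  rewrite mul1r -(ssum_inv _ h0); apply: ler_ssum => s _; rewrite !cE compat_mulc //.
  have -> : mulc t (mulc s s0) = mulc s (mulc t s0).
    by apply: funext => y; rewrite /mulc; case: (t y); case: (s0 y); case: (s y).
  rewrite compat_mulc // -natrM ler_nat mulnb leq_eqVlt; apply/orP; left; apply/eqP.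
  congr nat_of_bool; rewrite /compat -all_predI; apply: eq_all => e /=; rewrite /orc.
  by case: (om1 e); case: (om2 e); case: (_ == _).
move=> h; have -> : ssum L (fun s => c om1 s * c om2 (mulc t s)) ctrue = 0.
  rewrite -[RHS](ssum0 L (@ctrue K)); apply: eq_ssum => s hs; rewrite !cE -natrM mulnb.
  by case: andP => // -[c1 c2]; case: h; exists s => //; rewrite c1.
by rewrite mulr_ge0 // ?cE //; apply: ssum_ge0 => s _; rewrite cE.
Qed.

Lemma fkw_mod om1 om2 : fkw om1 * fkw om2 = fkw (orc om1 om2) * fkw (andc om1 om2).
Proof.
rewrite /fkw -!big_split; apply: eq_bigr => e _ /=; rewrite /orc /andc.
by case: (om1 e); case: (om2 e) => //=; ring.
Qed.

Definition fk A : R := ssum EE (fun om => fkw om * ncompat A om) ctrue.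
Definition fkE (P : (K * K -> bool) -> Prop) : R :=
  ssum EE (fun om => `[< P om >]%:R * (fkw om * ncompat [::] om)) ctrue.

Lemma fk_forced A : fk A = fkE (forced A).
Proof. by apply: eq_ssum => om _; rewrite [LHS]mulrC ncompat_forced; ring. Qed.

Lemma fk_nil_gt0 : 0 < fk [::].
Proof.
have := edwards_sokal [::]; rewrite -/(fk [::]).
have : 0 < ssum L (fun s => chi [::] s * expR (b * bonds EE s)) ctrue.
  by apply: ssum_gt0 => s; rewrite chi_nil mul1r expR_gt0.
by move=> + e; rewrite e pmulr_rgt0 // exprn_gt0 // expR_gt0.
Qed.

Lemma fk_assoc A B : fk A * fk B <= fkE (fun om => forced A om /\ forced B om) * fk [::].
Proof.
have inc C : incr (fun om => `[< forced C om >]%:R : R).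
  move=> om om' h; rewrite ler_nat; case: (asboolP (forced C om)) => // f.
  by rewrite asboolT //; apply: forced_mono f.
have := @fkg _ EE (fun om => fkw om * ncompat [::] om)
  (fun om => `[< forced A om >]%:R) (fun om => `[< forced B om >]%:R) ctrue.
rewrite !fk_forced => /(_ _ _ _ (inc A) (inc B)) h; apply: le_trans (h _ _ _ _) _ => //.
- by move=> om; rewrite mulr_ge0 ?fkw_ge0 ?ncompat_ge0.
- move=> om1 om2; rewrite mulrACA [leRHS]mulrACA fkw_mod.
  by apply: ler_wpM2l; rewrite ?mulr_ge0 ?fkw_ge0 ?ncompat_super.
apply: ler_pM.
- by apply: ssum_ge0 => om _; rewrite !mulr_ge0 ?fkw_ge0 ?ncompat_ge0.
- by apply: ssum_ge0 => om _; rewrite !mulr_ge0 ?fkw_ge0 ?ncompat_ge0.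
- apply: ler_ssum => om _; rewrite -natrM mulnb.
  apply: ler_wpM2r; first by rewrite mulr_ge0 ?fkw_ge0 ?ncompat_ge0.
  by rewrite asbool_and.
- by rewrite -[fkE _]fk_forced.
Qed.

Definition conn om : K -> bool := fun x => `[< forced [:: x] om >].

Lemma chi1 x s : chi [:: x] s = spin (s x).
Proof. by rewrite chi_cons chi_nil mulr1. Qed.
Lemma chi2 x y s : chi [:: x; y] s = spin (s x == s y).
Proof. by rewrite !chi_cons chi_nil mulr1 spin_eqb. Qed.

Lemma spin1 c : spin c = 1 -> c.
Proof. by case: c => //; rewrite /spin => h; exfalso; lra. Qed.

(** The edge [e] separates the cluster of [o] from the boundary cluster: since [o] is not joined to
    the boundary, forcing of [[:: o; e.1]] means a connection of [e.1] to [o] itself. *)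
Definition one_arm (o : K) (e : K * K) om :=
  ~ forced [:: o] om /\ ((forced [:: o; e.1] om /\ forced [:: e.2] om) \/
                          (forced [:: o; e.2] om /\ forced [:: e.1] om)).

(** The three-point event contains two disjoint ones. The first gives the product of correlations by
    FKG, so in the derivative of the magnetization, which is a sum of covariances, the probability
    of [one_arm] remains as a gain. *)
Lemma fk_deriv_ge o e :
  fk [:: o] * fk (edge_chars e) + fkE (one_arm o e) * fk [::] <= fk [:: o, e.1 & [:: e.2]] * fk [::].
Proof.
apply: le_trans (lerD (fk_assoc _ _) (lexx _)) _.
rewrite -mulrDl; apply: ler_wpM2r; first exact/ltW/fk_nil_gt0.
rewrite fk_forced -ssumD; apply: ler_ssum => om _; rewrite -mulrDl.
apply: ler_wpM2r; first by rewrite mulr_ge0 ?fkw_ge0 ?ncompat_ge0.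
rewrite -natrD ler_nat.
have h1 : forced [:: o] om /\ forced (edge_chars e) om -> forced [:: o; e.1; e.2] om.
  move=> [f1 f2] s hs c; rewrite chi_cons -[chi _ _]/(chi (edge_chars e) s) f2 //.
  by have := f1 s hs c; rewrite chi1 => ->; ring.
have h2 : one_arm o e om -> forced [:: o; e.1; e.2] om.
  move=> [_ [] [f1 f2]] s hs c; have := f1 s hs c; have := f2 s hs c;
  rewrite !chi_cons chi_nil !mulr1 => e2 e1; first by rewrite e2 mulr1.
  by rewrite e2 mul1r.
case: (asboolP (_ /\ _)) => [p|np]; case: (asboolP (one_arm _ _ _)) => [q|nq] //.
- by case: q => q _; case: p => /q.
- by rewrite asboolT; auto.
- by rewrite asboolT; auto.
Qed.

(** * Exploration of the boundary cluster *)

Section Exploration.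
Variable s : K -> bool.
Let inside (e : K * K) := ~~ s e.1 && ~~ s e.2.
(** The Ising model with free boundary on {s = -}. The spins of {s = +} are idle and contribute a
    factor that cancels in ratios. *)
Definition zin A : R :=
  ssum L (fun u => chi A u * expR (b * bonds [seq e <- EE | inside e] u)) ctrue.
Let clear om : K * K -> bool := fun e => om e && ~~ inside e.

Let conn_edge om e : e \in EE -> om e -> conn om e.1 = conn om e.2.
Proof.
move=> eE oe; apply: asbool_equiv_eq; split => h u hu c; have := h u hu c;
 have := allP c e eE; by rewrite oe /= !chi1 => /eqP ->.
Qed.

(** Edges inside {s = -} do not influence whether {s = +} is the boundary cluster, so they stay
    unrevealed when this cluster is explored. *)
Let conn_clear om : (conn om = s) <-> (conn (clear om) = s).
Proof.
have cl e : clear om e -> om e by case/andP.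
split => h.
  have hE e : e \in EE -> om e -> s e.1 = s e.2 by move=> eE oe; rewrite -h conn_edge.
  apply: funext => v; case E : (s v).
    apply/asboolP => u hu c.
    have f : forced [:: v] om by apply/asboolP; rewrite -/(conn om v) h E.
    pose u' x := if s x then u x else true.
    have := f u'; rewrite !chi1 /u' E; apply.
      by move=> y yL; case: (s y) => //; rewrite hu.
    apply/allP => e eE; apply/implyP => oe; rewrite (hE e eE oe).
    case E2 : (s e.2) => //; have := allP c e eE.
    by rewrite /clear oe /inside (hE e eE oe) E2.
  apply/asboolP => f; have : conn om v by apply/asboolP; apply: forced_mono f.
  by rewrite h E.
have sL : agree L s ctrue.
  move=> y yL; rewrite -h; apply/asboolP => u hu _; by rewrite chi1 hu.
apply: funext => v; case E : (s v).
  apply/asboolP; apply: (@forced_mono _ (clear om)) => //; apply/asboolP.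
  by rewrite -/(conn _ v) h.
apply/asboolP => f; have := f s sL; rewrite chi1 E /spin => H.
suff /H : compat om s by lra.
apply/allP => e eE; apply/implyP => oe.
case I : (inside e); first by case/andP: I => /negbTE -> /negbTE ->.
have ce : clear om e by rewrite /clear oe I.
by have := conn_edge eE ce; rewrite h => ->.
Qed.

(** The domain Markov property: given the boundary cluster, the correlations on the rest are those
    of the free model. It is written as an identity of products, because the event that the cluster
    is {s = +} may have weight zero. *)
Lemma explore_factor A : all (fun x => ~~ s x) A ->
  ssum EE (fun om => `[< conn om = s >]%:R * (fkw om * ncompat A om)) ctrue * zin [::] =
  zin A * ssum EE (fun om => `[< conn om = s >]%:R * (fkw om * ncompat [::] om)) ctrue.
Proof.
move=> hA.
pose Ei := [seq e <- EE | inside e]; pose Eo := [seq e <- EE | ~~ inside e].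
have pE : perm_eq EE (Eo ++ Ei) by rewrite perm_sym perm_catC perm_filterC.
have uEi : uniq Ei by rewrite filter_uniq.
pose wo rho : R := \prod_(e <- Eo) (if rho e then fkv else 1).
pose co (rho : K * K -> bool) (u : K -> bool) : R := \prod_(e <- Eo) (if rho e then (u e.1 == u e.2)%:R else 1).
have key B : all (fun x => ~~ s x) B -> forall rho : K * K -> bool,
  2 ^+ size L * ssum Ei (fun om => `[< conn om = s >]%:R * (fkw om * ncompat B om)) rho =
  (`[< conn (clear rho) = s >]%:R * wo rho * expR b ^+ size Ei * ssum L (co rho) ctrue) * zin B.
  move=> hB rho.
  have e1 om : agree Ei om rho -> `[< conn om = s >] = `[< conn (clear rho) = s >].
    move=> ho; have -> : clear rho = clear om.
      apply: funext => e; rewrite /clear; case I : (inside e); rewrite ?andbF ?andbT //.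
      by rewrite ho // mem_filter I.
    exact/asbool_equiv_eq/conn_clear.
  have -> : ssum Ei (fun om => `[< conn om = s >]%:R * (fkw om * ncompat B om)) rho =
    `[< conn (clear rho) = s >]%:R * ssum Ei (fun om => fkw om * ncompat B om) rho.
    by rewrite -ssumZ; apply: eq_ssum => om ho; rewrite e1.
  case: (asboolP (conn (clear rho) = s)) => [hs|_]; last by rewrite !mul0r mulr0.
  rewrite !mul1r.
  have eo om : agree Ei om rho -> forall e, e \in Eo -> om e = rho e.
    by move=> ho e; rewrite mem_filter => /andP[ni _]; rewrite ho // mem_filter (negbTE ni).
  transitivity (2 ^+ size L * (wo rho * expR b ^+ size Ei *
      ssum L (fun u => co rho u * (chi B u * expR (b * bonds Ei u))) ctrue)).
    congr (_ * _).
    transitivity (ssum Ei (fun om => ssum L (fun u => wo rho * co rho u * chi B u *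
       \prod_(e <- Ei) (if om e then fkv * (u e.1 == u e.2)%:R else 1)) ctrue) rho).
      apply: eq_ssum => om ho; rewrite -ssumZ; apply: eq_ssum => u _.
      rewrite compat_prod /fkw !(perm_big _ pE) !big_cat /=.
      have -> : \prod_(e <- Eo) (if om e then fkv else 1) = wo rho.
        by rewrite /wo big_seq [RHS]big_seq; apply: eq_bigr => e /(eo _ ho) ->.
      have -> : \prod_(e <- Eo) (if om e then (u e.1 == u e.2)%:R else 1) = co rho u.
        by rewrite /co big_seq [RHS]big_seq; apply: eq_bigr => e /(eo _ ho) ->.
      have -> : \prod_(e <- Ei) (if om e then fkv * (u e.1 == u e.2)%:R else 1) =
        \prod_(e <- Ei) (if om e then fkv else 1) *
        \prod_(e <- Ei) (if om e then (u e.1 == u e.2)%:R else 1).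
        by rewrite -big_split; apply: eq_bigr => e _ /=; case: (om e); rewrite ?mulr1.
      ring.
    rewrite ssum_exch -ssumZ; apply: eq_ssum => u _; rewrite ssumZ -ssum_prod //.
    have -> : expR (b * bonds Ei u) =
       expR (- b) ^+ size Ei * \prod_(e <- Ei) (fkv * (u e.1 == u e.2)%:R + 1).
      rewrite /bonds mulr_sumr expR_sum; under eq_bigr do rewrite bond_factor.
      rewrite big_split /=; congr (_ * _).
      by elim: (Ei) => [|e r IH]; rewrite ?big_nil // big_cons exprS IH.
    have ebb : expR b ^+ size Ei * expR (- b) ^+ size Ei = 1.
      by rewrite -exprMn -expRD subrr expR0 expr1n.
    transitivity (wo rho * co rho u * chi B u *
      \prod_(e <- Ei) (fkv * (u e.1 == u e.2)%:R + 1) *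
      (expR b ^+ size Ei * expR (- b) ^+ size Ei)); last by ring.
    by rewrite ebb mulr1.
  rewrite mulrCA -(@ssum_indep _ L s); first by rewrite /zin -/Ei; ring.
    move=> u u' uu; rewrite /co big_seq [RHS]big_seq; apply: eq_bigr => e eE.
    case re : (rho e) => //.
    move: (eE); rewrite mem_filter => /andP[ni eEE].
    have ce : clear rho e by rewrite /clear re ni.
    have := conn_edge eEE ce; rewrite hs => se.
    case s1 : (s e.1); first by rewrite !uu // -?se ?s1.
    by rewrite /inside s1 -se s1 in ni.
  move=> u u' uu; congr (_ * expR (_ * _)).
    by apply: eq_big_seq => x xB; rewrite uu //; apply: (allP hB).
  apply: eq_big_seq => e; rewrite mem_filter => /andP[/andP[i1 i2] _].
  by rewrite !chi_cons !chi_nil !uu.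
rewrite !(ssum_perm _ _ pE) !ssum_cat.
have p2 : 2 ^+ size L != 0 :> R by rewrite expf_neq0 // pnatr_eq0.
pose D rho := `[< conn (clear rho) = s >]%:R * wo rho * expR b ^+ size Ei * ssum L (co rho) ctrue.
have k2 B : all (fun x => ~~ s x) B -> 2 ^+ size L * ssum Eo (ssum Ei
    (fun om => `[< conn om = s >]%:R * (fkw om * ncompat B om))) ctrue = ssum Eo D ctrue * zin B.
  by move=> hB; rewrite -ssumZ -ssumZr; apply: eq_ssum => rho _; apply: key.
by apply: (mulfI p2); rewrite mulrA (k2 A hA) [RHS]mulrCA (k2 [::]) //; ring.
Qed.

End Exploration.
End RandomCluster.

(** * Differentiation of partition sums *)

HB.instance Definition _ := NormedModule.copy R R^o.
HB.instance Definition _ := CompleteNormedModule.copy R R^o.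

Lemma is_derive_ssum (K : eqType) (l : seq K) (F F' : R -> (K -> bool) -> R) xi (x : R) :
  (forall s, is_derive x 1 (fun b => F b s) (F' x s)) ->
  is_derive x 1 (fun b => ssum l (F b) xi) (ssum l (F' x) xi).
Proof.
by move=> h; elim: l xi => [|y l IH] xi /=; [apply: h|apply: is_deriveD].
Qed.

Lemma is_derive_expM (c m x : R) : is_derive x 1 (fun b => c * expR (b * m)) (c * m * expR (x * m)).
Proof.
have d1 : is_derive x 1 (fun b : R => b * m) m.
  have := @is_deriveM _ _ (fun b : R => b) (cst m) x 1 1 0 (is_derive_id _ _) (is_derive_cst _ _ _).
  by move=> h; apply: (is_derive_eq h); rewrite scaler0 add0r /GRing.scale /= mulr1.
have d2 : is_derive x 1 (fun b : R => expR (b * m)) (expR (x * m) * m).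
  by apply: (is_derive1_comp (f := expR)).
have := @is_deriveZ _ _ _ (fun b : R => expR (b * m)) c x 1 _ d2.
move=> h; apply: (is_derive_eq h); rewrite /GRing.scale /=; ring.
Qed.

Lemma is_derive_ratio (f g : R -> R) (f' g' x : R) : is_derive x 1 f f' -> is_derive x 1 g g' ->
  g x != 0 -> is_derive x 1 (fun b => f b / g b) ((f' * g x - f x * g') / g x ^+ 2).
Proof.
move=> df dg gx.
have dV := @is_deriveV _ g x g' 1 gx dg.
have := @is_deriveM _ _ f (fun b => (g b)^-1) x 1 f' _ df dV.
move=> h; apply: (is_derive_eq h); rewrite /GRing.scale /=; by field.
Qed.

Lemma MVT_der (f f' : R -> R) (a b : R) : a < b -> (forall x : R, is_derive x 1 f (f' x)) ->
  exists c, [/\ a < c, c < b & f b - f a = f' c * (b - a)].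
Proof.
move=> ab h.
have h1 x : x \in `]a, b[ -> is_derive x 1 f (f' x) by move=> _; apply: h.
have h2 : {within `[a, b], continuous f}%classic.
  apply: continuous_subspaceT => x.
  apply/differentiable_continuous/derivable1_diffP.
  by have [] := h x.
have [c] := MVT ab h1 h2.
by rewrite in_itv /= => /andP[c1 c2] e; exists c.
Qed.

Lemma ssum_delta (K : eqType) (l : seq K) (c xi : K -> bool) : uniq l -> agree l c xi ->
  ssum l (fun s => `[< c = s >]%:R) xi = 1 :> R.
Proof.
elim: l xi => [|x l IH] xi /=.
  by move=> _ h; rewrite asboolT //; apply: funext => y; apply: h.
move=> /andP[xl ul] h.
have z b : b != c x -> ssum l (fun s => `[< c = s >]%:R) (upd xi x b) = 0 :> R.
  move=> nb; rewrite -[RHS](ssum0 l (upd xi x b)); apply: eq_ssum => s hs.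
  rewrite asboolF // => cs; move: nb; rewrite cs hs // upd_same eqxx //.
have o : ssum l (fun s => `[< c = s >]%:R) (upd xi x (c x)) = 1 :> R.
  apply: IH => // y yl; rewrite /upd; case: eqVneq => [->//|yx].
  by apply: h; rewrite inE negb_or yx.
case E : (c x) o z => o z.
  by rewrite o (z false) ?addr0.
by rewrite o (z true) ?add0r.
Qed.

(** * A differential inequality for the magnetization *)

Section Sharpness.
Context {K : eqType} (L : seq K) (EE : seq (K * K)) (o : K).
Hypothesis uL : uniq L.
Hypothesis uE : uniq EE.
Implicit Types (s : K -> bool) (b : R).

Definition mag b : R := ssum L (fun s => spin (s o) * expR (b * bonds EE s)) ctrue /
  ssum L (fun s => expR (b * bonds EE s)) ctrue.

Definition corr b s x : R := zin L EE b s [:: o; x] / zin L EE b s [::].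

(** The flux of the free correlations from [o] through the edge boundary of {s = -}: the quantity of
    Duminil-Copin and Tassion without the factor tanh b, which appears as [sh b / ch b] in Lieb's
    inequality. *)
Definition phi b s : R := \sum_(e <- EE)
  ((~~ s e.1 && s e.2)%:R * corr b s e.1 + (~~ s e.2 && s e.1)%:R * corr b s e.2).

Lemma zin_gt0 b s : 0 < zin L EE b s [::].
Proof. by apply: ssum_gt0 => u; rewrite chi_nil mul1r expR_gt0. Qed.

(** Decompose by the boundary cluster {s = +}. Given it, an edge across its boundary is in [one_arm]
    once its inner end is joined to [o], which by the Markov property has conditional probability
    [corr]. *)
Lemma explore_sum b (kappa : R) : 0 <= b ->
  (forall s, agree L s ctrue -> ~~ s o -> kappa <= phi b s) ->
  kappa * fkE L EE b (fun om => ~ forced L EE [:: o] om) <=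
  \sum_(e <- EE) fkE L EE b (one_arm L EE o e).
Proof.
move=> b0 H.
pose w om : R := fkw EE b om * ncompat L EE [::] om.
have w0 om : 0 <= w om by rewrite mulr_ge0 ?fkw_ge0 ?ncompat_ge0.
pose I s om : R := `[< conn L EE om = s >]%:R.
have I0 s om : 0 <= I s om by rewrite ler0n.
have agc om : agree L (conn L EE om) ctrue.
  by move=> y yL; apply/asboolP => u hu _; rewrite chi1 hu.
have split (G : (K * K -> bool) -> R) : ssum EE G ctrue =
    ssum L (fun s => ssum EE (fun om => I s om * G om) ctrue) ctrue.
  rewrite ssum_exch; apply: eq_ssum => om _.
  by rewrite ssumZr ssum_delta // mul1r.
rewrite /fkE split -ssumZ.
under [X in _ <= X]eq_bigr do rewrite split.
rewrite -ssum_sum; apply: ler_ssum => s hs.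
case so : (s o).
  have -> : ssum EE (fun om => I s om * (`[< ~ forced L EE [:: o] om >]%:R * w om)) ctrue = 0.
    rewrite -[RHS](ssum0 EE ctrue); apply: eq_ssum => om _; rewrite /I.
    case: asboolP => [e|_]; last by rewrite mul0r.
    by rewrite asboolF ?mul0r ?mulr0 //; apply; apply/asboolP; rewrite -/(conn L EE om o) e.
  rewrite mulr0; apply: sumr_ge0 => e _; apply: ssum_ge0 => om _.
  by rewrite !mulr_ge0 ?fkw_ge0 ?ncompat_ge0 ?I0.
apply: (@le_trans _ _ (phi b s * ssum EE (fun om => I s om * w om) ctrue)).
  apply: (@le_trans _ _ (kappa * ssum EE (fun om => I s om * w om) ctrue)); last first.
    apply: ler_wpM2r; last by apply: H => //; rewrite so.
    by apply: ssum_ge0 => om _; rewrite mulr_ge0.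
  rewrite le_eqVlt; apply/orP; left; apply/eqP; congr (_ * _); apply: eq_ssum => om _; rewrite /I.
  case: asboolP => [e|_]; last by rewrite !mul0r.
  by rewrite asboolT ?mul1r // => f; move: so; rewrite -e => /asboolP; apply.
rewrite /phi mulr_suml; apply: ler_sum => e _.
have corrE x : ~~ s x -> corr b s x * ssum EE (fun om => I s om * w om) ctrue =
   ssum EE (fun om => I s om * (fkw EE b om * ncompat L EE [:: o; x] om)) ctrue.
  move=> sx; rewrite /corr mulrAC; apply: (mulIf (lt0r_neq0 (zin_gt0 b s))).
  rewrite divfK ?gt_eqF ?zin_gt0 //; apply/esym; apply: explore_factor => //=.
  by rewrite so sx.
have bound x : ~~ s x -> (forall om, conn L EE om = s -> forced L EE [:: o; x] om ->
     one_arm L EE o e om) -> corr b s x * ssum EE (fun om => I s om * w om) ctrue <=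
     ssum EE (fun om => I s om * (`[< one_arm L EE o e om >]%:R * w om)) ctrue.
  move=> sx h; rewrite corrE //; apply: ler_ssum => om _; rewrite /I.
  case: asboolP => [hc|_]; last by rewrite !mul0r.
  rewrite !mul1r ncompat_forced mulrA [leRHS]mulrC; apply: (ler_wpM2l (w0 om)).
  rewrite ler_nat; case: (asboolP (forced _ _ _ _)) => // f.
  by rewrite asboolT //; apply: h.
have nf om : conn L EE om = s -> ~ forced L EE [:: o] om.
  by move=> hc f; move: so; rewrite -hc => /asboolP; apply.
have yf om x : conn L EE om = s -> s x -> forced L EE [:: x] om.
  by move=> hc; rewrite -hc => /asboolP.
have p0 : 0 <= ssum EE (fun om => I s om * (`[< one_arm L EE o e om >]%:R * w om)) ctrue.
  by apply: ssum_ge0 => om _; rewrite !mulr_ge0 ?fkw_ge0 ?ncompat_ge0 ?I0.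
case s1 : (s e.1); case s2 : (s e.2); rewrite /= ?mul0r ?mul1r ?add0r ?addr0 //.
- rewrite mul0r //.
- by apply: bound; rewrite ?s2 // => om hc f; split; [apply: nf|right; split => //; apply: yf hc s1].
- by apply: bound; rewrite ?s1 // => om hc f; split; [apply: nf|left; split => //; apply: yf hc s2].
- rewrite mul0r //.
Qed.

Let Zb b := ssum L (fun s => expR (b * bonds EE s)) ctrue.
Let Sb A b := ssum L (fun s => chi A s * expR (b * bonds EE s)) ctrue.

Let Zb_gt0 b : 0 < Zb b. Proof. by apply: ssum_gt0 => s; apply: expR_gt0. Qed.

Let SbE A b : Sb A b = expR (- b) ^+ size EE * fk L EE b A.
Proof. exact: edwards_sokal. Qed.

Let Zb_nil b : Zb b = Sb [::] b.
Proof. by apply: eq_ssum => s _; rewrite chi_nil mul1r. Qed.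

Let magE b : mag b = Sb [:: o] b / Sb [::] b.
Proof. by rewrite -Zb_nil; congr (_ / _); apply: eq_ssum => s _; rewrite chi1. Qed.

Let mag' b : R := (\sum_(e <- EE) (Sb (o :: edge_chars e) b * Zb b - Sb [:: o] b * Sb (edge_chars e) b)) /
  Zb b ^+ 2.

Let mag_der (x : R) : is_derive x 1 mag (mag' x).
Proof.
have dS A : is_derive x 1 (Sb A) (\sum_(e <- EE) Sb (A ++ edge_chars e) x).
  have := @is_derive_ssum K L (fun b s => chi A s * expR (b * bonds EE s))
    (fun b s => chi A s * bonds EE s * expR (b * bonds EE s)) ctrue x
    (fun s => is_derive_expM _ _ _).
  move=> h; apply: (is_derive_eq h); rewrite -ssum_sum; apply: eq_ssum => s _.
  rewrite /bonds mulr_sumr mulr_suml; apply: eq_bigr => e _.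
  by rewrite chi_cat.
have := @is_derive_ratio (Sb [:: o]) (Sb [::]) _ _ x (dS _) (dS _).
rewrite -Zb_nil gt_eqF // => /(_ isT) h.
have -> : mag = (fun b => Sb [:: o] b / Sb [::] b) by apply: funext => b; rewrite magE.
apply: (is_derive_eq h); rewrite /mag'; congr (_ / _).
by rewrite mulr_suml mulr_sumr -sumrB; apply: eq_bigr => e _.
Qed.

Lemma mag_deriv_ge b (kappa : R) : 0 <= b ->
  (forall s, agree L s ctrue -> ~~ s o -> kappa <= phi b s) ->
  kappa * (1 - mag b) <= mag' b.
Proof.
move=> b0 H.
have fp := fk_nil_gt0 L b uE.
have cp : 0 < expR (- b) ^+ size EE by rewrite exprn_gt0 // expR_gt0.
have -> : mag b = fk L EE b [:: o] / fk L EE b [::].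
  by rewrite magE !SbE -mulf_div divff ?mul1r // gt_eqF.
have -> : mag' b = (\sum_(e <- EE) (fk L EE b (o :: edge_chars e) * fk L EE b [::] -
     fk L EE b [:: o] * fk L EE b (edge_chars e))) / fk L EE b [::] ^+ 2.
  rewrite /mag' Zb_nil !SbE exprMn.
  under eq_bigr do rewrite !SbE mulrACA [X in _ - X]mulrACA -mulrBr.
  by rewrite -mulr_sumr -mulf_div divff ?mul1r // gt_eqF // mulr_gt0.
rewrite ler_pdivlMr ?exprn_gt0 //.
have -> : kappa * (1 - fk L EE b [:: o] / fk L EE b [::]) * fk L EE b [::] ^+ 2 =
   kappa * (fk L EE b [::] - fk L EE b [:: o]) * fk L EE b [::].
  by field; rewrite gt_eqF.
have -> : fk L EE b [::] - fk L EE b [:: o] = fkE L EE b (fun om => ~ forced L EE [:: o] om).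
  rewrite !fk_forced -ssumB; apply: eq_ssum => om _; rewrite -mulrBl; congr (_ * _).
  rewrite (asboolT (_ : forced L EE [::] om)); last by move=> s _ _; rewrite chi_nil.
  rewrite asbool_neg; case: asboolP => _ /=; ring.
apply: le_trans (ler_wpM2r (ltW fp) (explore_sum b0 H)) _.
rewrite mulr_suml; apply: ler_sum => e _.
by have := fk_deriv_ge L uE b0 o e; lra.
Qed.

Lemma mag_deriv_ge0 b : 0 <= b -> 0 <= mag' b.
Proof.
move=> b0; have := @mag_deriv_ge b 0 b0; rewrite mul0r; apply.
move=> s hs so; apply: sumr_ge0 => e _.
have c0 x : 0 <= corr b s x.
  rewrite divr_ge0 ?(ltW (zin_gt0 _ _)) //; apply: gks1; apply: coneM; first exact: cone_chi.
  apply: (cone_ext _ (@cone_exp _ _ [seq e <- EE | ~~ s e.1 && ~~ s e.2] (fun=> b)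
    (@edge_chars K) (fun=> b0))) => u.
  by rewrite /ham /bonds mulr_sumr.
by rewrite addr_ge0 // mulr_ge0.
Qed.

Lemma mag_mono b1 b2 : 0 <= b1 -> b1 <= b2 -> mag b1 <= mag b2.
Proof.
move=> b0; rewrite le_eqVlt => /predU1P[-> //|lt].
have [c [h1 h2 e]] := MVT_der lt mag_der.
rewrite -subr_ge0 e mulr_ge0 ?mag_deriv_ge0; lra.
Qed.

Lemma corr_mono b1 b2 s x : 0 <= b1 -> b1 <= b2 -> corr b1 s x <= corr b2 s x.
Proof.
move=> h0 h12; rewrite /corr ler_pdivrMr ?zin_gt0 // mulrAC ler_pdivlMr ?zin_gt0 //.
set Ei := [seq e <- EE | ~~ s e.1 && ~~ s e.2].
pose f := @edge_chars K.
have hamE c u : ham Ei (fun=> c) f u = c * bonds Ei u by rewrite /ham /bonds mulr_sumr.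
have cG : cone (fun u => expR (ham Ei (fun=> b2 - b1) f u)) by apply: cone_exp => _; lra.
have := @gks2 _ L _ Ei (fun=> b1) f (chi [:: o; x]) _ (fun=> h0) (cone_chi _) cG _ erefl.
have e A : ssum L (fun u => chi A u * expR (ham Ei (fun=> b2 - b1) f u) *
   expR (ham Ei (fun=> b1) f u)) ctrue = zin L EE b2 s A.
  apply: eq_ssum => u _; rewrite -mulrA -expRD !hamE; congr (_ * expR _); ring.
have e1 A : ssum L (fun u => chi A u * expR (ham Ei (fun=> b1) f u)) ctrue = zin L EE b1 s A.
  by apply: eq_ssum => u _; rewrite hamE.
rewrite e1 e -/(zin L EE b2 s [::]) => h.
have -> : zin L EE b1 s [::] = ssum L (fun u => expR (ham Ei (fun=> b1) f u)) ctrue.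
  by apply: eq_ssum => u _; rewrite chi_nil mul1r hamE.
apply: le_trans h; rewrite le_eqVlt; apply/orP; left; apply/eqP; congr (_ * _).
rewrite -e; apply: eq_ssum => u _; by rewrite chi_nil mul1r.
Qed.

Lemma phi_mono b1 b2 s : 0 <= b1 -> b1 <= b2 -> phi b1 s <= phi b2 s.
Proof.
by move=> h0 h12; apply: ler_sum => e _; apply: lerD; apply: ler_wpM2l => //; apply: corr_mono.
Qed.

(** The mean value theorem replaces integration. At the intermediate point the flux is at least its
    value at [b1], and 1 - [mag] at least its value at [b2], since [phi] and [mag] increase in b. *)
Lemma sharp_dichotomy b1 b2 (kappa : R) : 0 <= b1 -> b1 < b2 -> 0 <= kappa ->
  (forall s, agree L s ctrue -> ~~ s o -> kappa <= phi b1 s) ->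
  kappa * (b2 - b1) * (1 - mag b2) <= mag b2 - mag b1.
Proof.
move=> b0 lt k0 H; have [c [h1 h2 ->]] := MVT_der lt mag_der.
rewrite mulrAC; apply: ler_wpM2r; first lra.
have c0 : 0 <= c by lra.
apply: (le_trans _ (@mag_deriv_ge c kappa c0 _)).
  by apply: ler_wpM2l => //; have := mag_mono c0 (ltW h2); lra.
by move=> s hs so; apply: le_trans (H _ hs so) (phi_mono _ b0 (ltW h1)).
Qed.

End Sharpness.

(** * Newman's inequality *)

Section Newman.
Context {K : eqType} (L : seq K) (Ei : seq (K * K)) (b : R).
Hypothesis uE : uniq Ei.
Hypothesis b0 : 0 <= b.
Hypothesis inL : forall e, e \in Ei -> (e.1 \in L) && (e.2 \in L).
Implicit Types (s t : K -> bool) (om : K * K -> bool) (A : seq K).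

Let W s := expR (b * bonds Ei s).
Let kfac om s : R := \prod_(e <- Ei) (if om e then expR (2 * b * chi (edge_chars e) s) - 1 else 1).
Let kap A om : R := ssum L (fun s => chi A s * kfac om s) ctrue.

Let cone_kfac om : cone (kfac om).
Proof.
apply: cone_prod => e; case: (om e); last exact: (cone_cst ler01).
apply: (cone_ext _ (@cone_exp_sub1 K _ [:: e] (fun=> 2 * b) (@edge_chars K) _)).
  by move=> s; rewrite /ham big_seq1.
by move=> _; rewrite mulr_ge0.
Qed.

Let kap_ge0 A om : 0 <= kap A om.
Proof. by apply: gks1; apply: coneM; [apply: cone_chi|apply: cone_kfac]. Qed.

Let kap_forced A om : ~ forced L Ei A om -> kap A om = 0.
Proof.
move=> nf; have [t [ht ct e]] := not_forced nf.
apply: flip_sum0 ht _ => s; rewrite chi_mulc e mulrN1 mulNr; congr (- (_ * _)).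
apply: eq_big_seq => ed edE; case oe : (om ed) => //; congr (expR (_ * _) - 1).
rewrite chi_mulc -[RHS]mulr1; congr (_ * _).
by have := allP ct ed edE; rewrite oe /= chi2 => ->.
Qed.

(* The switching identity: with s' = s t, the product of two copies of the Boltzmann
   weight expands into a sum over the edge sets on which t is locally constant. *)
Let switching A B C : (forall s, chi A s * chi B s = chi C s) ->
  ssum L (fun s => chi A s * W s) ctrue * ssum L (fun s => chi B s * W s) ctrue =
  ssum Ei (fun om => ncompat L Ei B om * kap C om) ctrue.
Proof.
move=> hC; rewrite -ssumZr.
transitivity (ssum L (fun s => ssum L (fun t => ssum Ei (fun om =>
   ((compat Ei om t)%:R * chi B t) * (chi C s * kfac om s)) ctrue) ctrue) ctrue).
  apply: eq_ssum => s hs; rewrite -ssumZ -(ssum_inv _ hs); apply: eq_ssum => t _.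
  have -> : chi A s * W s * (chi B (mulc t s) * W (mulc t s)) =
     chi B t * chi C s * (W s * W (mulc t s)) by rewrite chi_mulc -hC; ring.
  have -> : W s * W (mulc t s) = ssum Ei (fun om => (compat Ei om t)%:R * kfac om s) ctrue.
    rewrite -expRD -mulrDr /bonds -big_split mulr_sumr expR_sum /=.
    transitivity (\prod_(e <- Ei) ((t e.1 == t e.2)%:R * (expR (2 * b * chi (edge_chars e) s) - 1) + 1)).
      apply: eq_bigr => e _; rewrite chi_mulc (chi2 _ _ t).
      case: (t e.1 == t e.2); rewrite /spin /=.
        by rewrite mul1r mul1r subrK; congr expR; ring.
      by rewrite mulN1r subrr mulr0 expR0 mul0r add0r.
    rewrite (ssum_prod _ _ ctrue uE); apply: eq_ssum => om _.
    rewrite compat_prod /kfac -big_split; apply: eq_bigr => e _ /=.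
    by case: (om e); rewrite ?mul1r.
  rewrite -ssumZ; apply: eq_ssum => om _; ring.
rewrite ssum_exch.
transitivity (ssum L (fun t => ssum Ei (fun om => ssum L (fun s =>
   (compat Ei om t)%:R * chi B t * (chi C s * kfac om s)) ctrue) ctrue) ctrue).
  by apply: eq_ssum => t _; rewrite ssum_exch.
rewrite ssum_exch; apply: eq_ssum => om _; rewrite /ncompat -ssumZr.
by apply: eq_ssum => t _; rewrite ssumZ.
Qed.

(** After switching, both sides carry the same factor [kap (o :: xs)], which vanishes unless every
    cluster meets [o :: xs] evenly. Then the cluster of [o] contains some x in [xs], and the term of
    this x alone dominates the left side. *)
Lemma newman (o : K) (xs : seq K) : o \in L ->
  ssum L (fun s => chi (o :: xs) s * W s) ctrue * ssum L W ctrue <=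
  \sum_(x <- xs) ssum L (fun s => chi [:: o; x] s * W s) ctrue *
                 ssum L (fun s => chi (x :: xs) s * W s) ctrue.
Proof.
move=> oL.
have -> : ssum L W ctrue = ssum L (fun s => chi [::] s * W s) ctrue.
  by apply: eq_ssum => s _; rewrite chi_nil mul1r.
rewrite (@switching _ _ (o :: xs)); last by move=> s; rewrite chi_nil mulr1.
under eq_bigr => x _.
  rewrite mulrC (@switching _ _ (o :: xs)); last first.
    move=> s; rewrite !chi_cons chi_nil mulr1.
    have := spin_sqr (s x); move: (spin (s x)) => u h.
    transitivity (u * u * (spin (s o) * chi xs s)); [ring|by rewrite h mul1r].
  over.
rewrite -ssum_sum; apply: ler_ssum => om _.
rewrite -mulr_suml.
case: (pselect (forced L Ei (o :: xs) om)) => [f|nf]; last by rewrite kap_forced // !mulr0.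
apply: ler_wpM2r => //.
have nc0 A : 0 <= ncompat L Ei A om by apply: ncompat_ge0.
suff [x xin fx] : exists2 x, x \in xs & forced L Ei [:: o; x] om.
  apply: (@le_trans _ _ (ncompat L Ei [:: o; x] om)); last first.
    by rewrite (big_rem x xin) /= lerDl sumr_ge0.
  by rewrite [leRHS]ncompat_forced asboolT // mulr1.
apply: contrapT => hx.
(* Minus on the cluster of [o], plus elsewhere: if this cluster missed [xs], this compatible
   configuration would have character -1 on [o :: xs]. *)
pose t := fun v => ~~ `[< forced L Ei [:: o; v] om >].
have ct : compat Ei om t.
  apply/allP => e eE; apply/implyP => oe; rewrite /t; apply/eqP; congr (~~ _).
  apply: asbool_equiv_eq; split => h s hs c; have := h s hs c;
   have := allP c e eE; by rewrite oe /= !chi2 => /eqP ->.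
have at_ : agree L t ctrue.
  move=> v vL; apply/asboolPn => h.
  pose u := fun y : K => y \notin L.
  have := h u; rewrite chi2 /u vL oL /= => hh.
  have : spin false = 1 by apply: hh; [move=> y -> |
     apply/allP => e eE; apply/implyP => _; have /andP[-> ->] := inL eE].
  by move=> /spin1.
have := f t at_ ct; rewrite chi_cons.
have -> : t o = false by apply/negbF/asboolP => s _ _; rewrite chi2 eqxx.
have -> : chi xs t = 1.
  rewrite /chi big_seq big1 // => x xin; rewrite /t asboolF //.
  by move=> fx; apply: hx; exists x.
by rewrite mulr1 => /spin1.
Qed.

End Newman.

(** * Lieb's inequality *)

Section Lieb.
Context {K : eqType} (L : seq K) (Ei Eo : seq (K * K)) (b : R) (U : K -> bool) (o : K).
Hypothesis uE : uniq Ei.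
Hypothesis b0 : 0 <= b.
Hypothesis inL : forall e, e \in Ei -> (e.1 \in L) && (e.2 \in L).
Hypothesis inU : forall e, e \in Ei -> (U e.1) && (U e.2).
Hypothesis outU : forall e, e \in Eo -> (~~ U e.1) && (~~ U e.2).
Hypothesis oL : o \in L.
Hypothesis oU : U o.
Implicit Types (s t : K -> bool) (A B : seq K) (X : seq (K * K)).

Let Wi s := expR (b * bonds Ei s).
Let Wo s := expR (b * bonds Eo s).
Let cross X s : R := \prod_(e <- X) expR (b * chi (edge_chars e) s).
Let T A B X : R := ssum L (fun s => chi A s * chi B s * (Wi s * Wo s * cross X s)) ctrue.
Let P A : R := ssum L (fun s => chi A s * Wi s) ctrue.

Let cone_bonds (E : seq (K * K)) : cone (fun s => expR (b * bonds E s)).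
Proof.
apply: (cone_ext _ (@cone_exp K _ E (fun=> b) (@edge_chars K) (fun=> b0))) => s.
by rewrite /ham /bonds mulr_sumr.
Qed.

Let T_ge0 A B X : 0 <= T A B X.
Proof.
apply: gks1; apply: coneM; first by apply: coneM; apply: cone_chi.
apply: coneM; first by apply: coneM; apply: cone_bonds.
apply: cone_prod => e; apply: (cone_ext _ (cone_bonds [:: e])) => s.
by rewrite /bonds big_seq1.
Qed.

Let P_ge0 A : 0 <= P A.
Proof. by apply: gks1; apply: coneM; [apply: cone_chi|apply: cone_bonds]. Qed.

Let T_cons A B e X : T A B (e :: X) = ch b * T A B X + sh b * T (e.1 :: A) (e.2 :: B) X.
Proof.
rewrite /T -!ssumZ -ssumD; apply: eq_ssum => s _.
by rewrite /cross big_cons exp_chi !chi_cons chi_nil; ring.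
Qed.

Let T_sq x A B X : T (x :: x :: A) B X = T A B X.
Proof.
apply: eq_ssum => s _; rewrite !chi_cons mulrA spin_sqr mul1r //.
Qed.

Let dep_chi (V : K -> bool) A : all V A -> dep_on V (chi A).
Proof. by move=> h s t st; apply: eq_big_seq => x xA; rewrite st //; apply: (allP h). Qed.

Let dep_W (V : K -> bool) (E : seq (K * K)) : (forall e, e \in E -> V e.1 && V e.2) ->
  dep_on V (fun s => expR (b * bonds E s)).
Proof.
move=> h s t st; congr (expR (_ * _)); apply: eq_big_seq => e eE.
by have /andP[v1 v2] := h e eE; rewrite !chi_cons !chi_nil !st.
Qed.

(** Induction on the edges across the boundary of [U], each expanded as ch b + sh b times its two
    spins. The second term puts one end into [A] and the other into [B]. When no edge is left the
    sum factorizes over [U] and its complement, and Newman's inequality applies to [o :: A]. *)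
Let lieb_gen X A B : all U A -> all (fun x => ~~ U x) B ->
  (forall e, e \in X -> U e.1 && ~~ U e.2) ->
  P [::] * T (o :: A) B X <= \sum_(a <- A) P [:: o; a] * T (a :: A) B X +
    \sum_(e <- X) (sh b / ch b) * P [:: o; e.1] * T A (e.2 :: B) X.
Proof.
have c1 := ch_ge1 b; have s0 := sh_ge0 b0.
have t0 : 0 <= sh b / ch b by rewrite divr_ge0 //; lra.
elim: X A B => [|e X IH] A B hA hB hX.
  rewrite big_nil addr0.
  have fac A' : all U A' -> 2 ^+ size L * T A' B [::] = P A' * ssum L (fun s => chi B s * Wo s) ctrue.
    move=> hA'; rewrite (@ssum_indep _ L U).
    - congr (_ * _); apply: eq_ssum => s _.
      have -> : cross [::] s = 1 by rewrite /cross big_nil.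
      ring.
    - move=> s t st; rewrite /Wi (dep_chi hA' st); congr (_ * _); exact: (dep_W inU st).
    - move=> s t st; rewrite /Wo (dep_chi hB st); congr (_ * _); exact: (dep_W outU st).
  have p2 : 0 < 2 ^+ size L :> R by rewrite exprn_gt0.
  rewrite -(ler_pM2l p2) mulrCA fac; last by rewrite /= oU.
  rewrite mulrA mulr_sumr big_seq.
  under eq_bigr => a aA do rewrite mulrCA fac ?mulrA /= ?hA ?(allP hA) //.
  rewrite -big_seq -mulr_suml; apply: ler_wpM2r.
    by apply: gks1; apply: coneM; [apply: cone_chi|apply: cone_bonds].
  have := newman uE b0 inL A oL; rewrite mulrC /P.
  have -> : ssum L (fun s => chi [::] s * Wi s) ctrue = ssum L Wi ctrue.
    by apply: eq_ssum => s _; rewrite chi_nil mul1r.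
  by [].
have hX' e' : e' \in X -> U e'.1 && ~~ U e'.2 by move=> h; apply: hX; rewrite inE h orbT.
have /andP[he1 he2] := hX e (mem_head _ _).
have h1 := IH A B hA hB hX'.
have h2 := IH (e.1 :: A) (e.2 :: B).
rewrite /= he1 he2 in h2; have {}h2 := h2 hA hB hX'.
have perm2 x y A' B' : T (x :: y :: A') B' X = T (y :: x :: A') B' X.
  by apply: eq_ssum => s _; rewrite !chi_cons; ring.
have perm3 x y A' B' : T A' (x :: y :: B') X = T A' (y :: x :: B') X.
  by apply: eq_ssum => s _; rewrite !chi_cons; ring.
rewrite T_cons (perm2 e.1 o).
move: h2; rewrite big_cons T_sq => h2.
rewrite big_cons T_cons.
have eA : \sum_(a <- A) P [:: o; a] * T (a :: A) B (e :: X) =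
   ch b * \sum_(a <- A) P [:: o; a] * T (a :: A) B X +
   sh b * \sum_(a <- A) P [:: o; a] * T (a :: e.1 :: A) (e.2 :: B) X.
  rewrite !mulr_sumr -big_split; apply: eq_bigr => a _ /=.
  by rewrite T_cons (perm2 e.1); ring.
have eX : \sum_(e' <- X) (sh b / ch b) * P [:: o; e'.1] * T A (e'.2 :: B) (e :: X) =
   ch b * \sum_(e' <- X) (sh b / ch b) * P [:: o; e'.1] * T A (e'.2 :: B) X +
   sh b * \sum_(e' <- X) (sh b / ch b) * P [:: o; e'.1] * T (e.1 :: A) (e'.2 :: e.2 :: B) X.
  rewrite !mulr_sumr -big_split; apply: eq_bigr => a _ /=.
  by rewrite T_cons (perm3 e.2); ring.
rewrite eA eX.
have h1' := ler_wpM2l (le_trans ler01 c1) h1.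
have h2' := ler_wpM2l s0 h2.
have h3 : 0 <= sh b / ch b * P [:: o; e.1] * (sh b * T (e.1 :: A) (e.2 :: e.2 :: B) X).
  apply: mulr_ge0; apply: mulr_ge0 => //.
have h4 : sh b / ch b * P [:: o; e.1] * (ch b * T A (e.2 :: B) X) =
   sh b * (P [:: o; e.1] * T A (e.2 :: B) X) by field; rewrite gt_eqF //; lra.
rewrite [in X in _ <= X]mulrDr h4 mulrDr.
rewrite !(mulrCA (P [::])).
by move: h1' h2' h3; rewrite !mulrDr; lra.
Qed.

Lemma lieb X w : (forall e, e \in X -> U e.1 && ~~ U e.2) ->
  w = (fun s => expR (b * bonds (Ei ++ X ++ Eo) s)) ->
  ssum L (fun s => expR (b * bonds Ei s)) ctrue * ssum L (fun s => spin (s o) * w s) ctrue <=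
  \sum_(e <- X) (sh b / ch b) * ssum L (fun s => chi [:: o; e.1] s * expR (b * bonds Ei s)) ctrue *
     ssum L (fun s => spin (s e.2) * w s) ctrue.
Proof.
move=> hX defw.
have eT A B : T A B X = ssum L (fun s => chi A s * chi B s * w s) ctrue.
  apply: eq_ssum => s _; rewrite defw /bonds !big_cat !mulrDr !expRD /cross /Wi /Wo.
  rewrite [expR (b * \sum_(i <- X) _)](_ : _ = cross X s); first by rewrite /cross; ring.
  by rewrite mulr_sumr expR_sum.
have := @lieb_gen X [::] [::] isT isT hX; rewrite big_nil add0r eT.
have -> : P [::] = ssum L (fun s => expR (b * bonds Ei s)) ctrue.
  by apply: eq_ssum => s _; rewrite chi_nil mul1r.
have -> : ssum L (fun s => chi [:: o] s * chi [::] s * w s) ctrue =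
  ssum L (fun s => spin (s o) * w s) ctrue.
  by apply: eq_ssum => s _; rewrite chi1 chi_nil mulr1.
move=> /le_trans; apply; apply: ler_sum => e _.
rewrite eT le_eqVlt; apply/orP; left; apply/eqP; congr (_ * _).
by apply: eq_ssum => s _; rewrite chi1 chi_nil mul1r.
Qed.

End Lieb.

(** * Gibbs measures on the square lattice *)

Definition e1 (x : site) : site := (x.1 + 1, x.2).
Definition e2 (x : site) : site := (x.1, x.2 + 1).
Definition d1 (x : site) : site := (x.1 - 1, x.2).
Definition d2 (x : site) : site := (x.1, x.2 - 1).
Definition nbrs (x : site) : seq site := [:: e1 x; e2 x; d1 x; d2 x].
Definition star_edges (x : site) : seq (site * site) :=
  [:: (x, e1 x); (x, e2 x); (d1 x, x); (d2 x, x)].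
Definition is_edge (e : site * site) := (e.2 == e1 e.1) || (e.2 == e2 e.1).

Lemma d1K : cancel d1 e1. Proof. by case=> x y; rewrite /e1 /d1 /= subrK. Qed.
Lemma d2K : cancel d2 e2. Proof. by case=> x y; rewrite /e2 /d2 /= subrK. Qed.

Lemma star_uniq x : uniq (star_edges x).
Proof.
case: x => x y; rewrite /= !inE /= !xpair_eqE /e1 /e2 /d1 /d2 /=.
lia.
Qed.

Lemma star_is_edge x e : e \in star_edges x -> is_edge e.
Proof.
by rewrite !inE => /or4P[] /eqP -> /=; rewrite /is_edge /= ?d1K ?d2K ?eqxx ?orbT.
Qed.

Lemma star_mem x e : is_edge e -> (e \in star_edges x) = (e.1 == x) || (e.2 == x).
Proof.
case: e => u v; rewrite /is_edge /= => /orP[] /eqP ->; rewrite !inE !xpair_eqE.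
- case: x => x y; case: u => u w; rewrite /e1 /e2 /d1 /d2 /= !xpair_eqE; lia.
- case: x => x y; case: u => u w; rewrite /e1 /e2 /d1 /d2 /= !xpair_eqE; lia.
Qed.

Lemma big_uniq_sub (I : eqType) (r r' : seq I) (G : I -> R) : uniq r -> uniq r' ->
  {subset r' <= r} -> (forall i, i \in r -> i \notin r' -> G i = 0) ->
  \sum_(i <- r) G i = \sum_(i <- r') G i.
Proof.
move=> ur ur' sub h; rewrite (bigID (mem r')) /= [X in _ + X]big1_seq ?addr0; last first.
  by move=> i /andP[ni ir]; apply: h.
rewrite -big_filter; apply: perm_big; apply: uniq_perm => //; first exact: filter_uniq.
by move=> i; rewrite mem_filter; case: (boolP (i \in r')) => //= /sub.
Qed.

Definition nsum (s : config) (x : site) : R := \sum_(y <- nbrs x) spin (s y).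

(** The single-site Gibbs ratios on [l]. They determine the weight up to a factor along changes in
    [l] ([good_ratio]), so the measure does not depend on which edges and sites are listed in the
    Hamiltonian, and a weight for a large volume also serves for its parts. *)
Definition good (b h : R) (l : seq site) (w : config -> R) : Prop :=
  (forall s, 0 < w s) /\ (forall x s, x \in l ->
     w (upd s x true) = expR (2 * b * (h + nsum s x)) * w (upd s x false)).

Definition suff (l : seq site) (EE : seq (site * site)) (X : seq site) :=
  [/\ uniq EE, all is_edge EE, uniq X, {subset l <= X} &
      forall x, x \in l -> {subset star_edges x <= EE}].

Definition wgt (b h : R) EE X : config -> R := fun s => expR (energy EE X b (b * h) s).

Lemma good_wgt b h l EE X : suff l EE X -> good b h l (wgt b h EE X).
Proof.
move=> [uE aE uX lX lE]; split=> [s|x s xl]; first exact: expR_gt0.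
rewrite /wgt -expRD; congr expR; rewrite /energy.
have f1 : \sum_(y <- X) spin (upd s x true y) - \sum_(y <- X) spin (upd s x false y) = 2.
  rewrite -sumrB (@big_uniq_sub _ _ [:: x]) //=.
  - by rewrite big_seq1 !upd_same /spin; ring.
  - by move=> y; rewrite inE => /eqP ->; apply: lX.
  - by move=> y _; rewrite inE => yx; rewrite /upd (negbTE yx) subrr.
have f2 : bonds EE (upd s x true) - bonds EE (upd s x false) = 2 * nsum s x.
  rewrite /bonds -sumrB (@big_uniq_sub _ _ (star_edges x)) //.
  - have nx : [/\ e1 x != x, e2 x != x, d1 x != x & d2 x != x].
      by case: (x) => a c; rewrite /e1 /e2 /d1 /d2 /= !xpair_eqE; split; lia.
    case: nx => n1 n2 n3 n4.
    rewrite /star_edges /nsum /nbrs !big_cons !big_nil !chi_cons !chi_nil /= !upd_same.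
    by rewrite /upd (negbTE n1) (negbTE n2) (negbTE n3) (negbTE n4) /spin; ring.
  - exact: star_uniq.
  - exact: lE.
  - move=> e eE; rewrite star_mem ?(allP aE) // negb_or => /andP[n1 n2].
    by rewrite !chi_cons !chi_nil /upd (negbTE n1) (negbTE n2) subrr.
have := f1; have := f2.
move: (bonds EE _) (bonds EE _) (\sum_(y <- X) _) (\sum_(y <- X) _) => B2 B1 S2 S1 g2 g1.
have -> : B1 = B2 + 2 * nsum s x by lra.
have -> : S1 = S2 + 2 by lra.
ring.
Qed.

Definition edges_of (l : seq site) := undup (flatten (map star_edges l)).

Lemma suff_edges_of l : suff l (edges_of l) (undup l).
Proof.
split; rewrite ?undup_uniq //.
- apply/allP => e; rewrite mem_undup => /flattenP[r /mapP[x _ ->]]; exact: star_is_edge.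
- by move=> x; rewrite mem_undup.
- move=> x xl e ex; rewrite mem_undup; apply/flattenP; exists (star_edges x) => //.
  exact: map_f.
Qed.

Lemma good_sub b h l l' w : {subset l' <= l} -> good b h l w -> good b h l' w.
Proof. by move=> sub [p q]; split => // x s /sub; apply: q. Qed.

Lemma good_ratio b h l w w' : good b h l w -> good b h l w' ->
  forall s xi, agree l s xi -> w s * w' xi = w' s * w xi.
Proof.
move=> [p q] [p' q']; have step x s c : x \in l -> w (upd s x c) * w' s = w' (upd s x c) * w s.
  move=> xl; have := q x s xl; have := q' x s xl.
  have ws v : v s = v (upd s x (s x)) :> R by rewrite upd_id.
  by rewrite (ws w) (ws w'); case: c; case: (s x) => h1 h2; rewrite ?h1 ?h2; ring.
have gen l0 : {subset l0 <= l} -> forall s xi, agree l0 s xi -> w s * w' xi = w' s * w xi.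
  elim: l0 => [|x l0 IH] sub s xi ha.
    have -> : s = xi by apply: funext => y; apply: ha.
    by rewrite mulrC.
  have xl : x \in l by apply: sub; rewrite mem_head.
  have hb : agree l0 s (upd xi x (s x)).
    move=> y yl; rewrite /upd; case: eqVneq => [->//|yx].
    by apply: ha; rewrite inE negb_or yx.
  have sub' : {subset l0 <= l} by move=> y yl; apply: sub; rewrite inE yl orbT.
  have := IH sub' _ _ hb; have := step x xi (s x) xl.
  set v := upd _ _ _ => h1 h2.
  apply: (mulfI (lt0r_neq0 (p v))); apply: (mulfI (lt0r_neq0 (p' v))).
  have -> : w' v * (w v * (w s * w' xi)) = (w s * w' v) * (w v * w' xi) by ring.
  by rewrite h1 h2; ring.
exact: gen.
Qed.

Definition pr (w : config -> R) (l : seq site) (xi : config) (F : config -> R) : R :=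
  ssum l (fun s => F s * w s) xi / ssum l w xi.

Lemma pr_good b h l w w' xi F : good b h l w -> good b h l w' -> pr w l xi F = pr w' l xi F.
Proof.
move=> g g'; have e := good_ratio g g'.
have [p _] := g; have [p' _] := g'.
have k (G : config -> R) : ssum l (fun s => G s * w s) xi * w' xi = ssum l (fun s => G s * w' s) xi * w xi.
  by rewrite -!ssumZr; apply: eq_ssum => s /e hs; rewrite -!mulrA hs.
have k1 : ssum l w xi * w' xi = ssum l w' xi * w xi.
  by rewrite -!ssumZr; apply: eq_ssum => s /e.
have d : 0 < ssum l w xi by apply: ssum_gt0.
have d' : 0 < ssum l w' xi by apply: ssum_gt0.
rewrite /pr; apply/eqP; rewrite (eqr_div _ _ (lt0r_neq0 d) (lt0r_neq0 d')); apply/eqP.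
apply: (mulfI (lt0r_neq0 (p xi))); apply: (mulfI (lt0r_neq0 (p' xi))).
transitivity ((ssum l (fun s => F s * w s) xi * w' xi) * (ssum l w' xi * w xi)); first by ring.
by rewrite k -k1; ring.
Qed.

Definition gibbs (b h : R) (l : seq site) (xi : config) (F : config -> R) : R :=
  pr (wgt b h (edges_of l) (undup l)) l xi F.

Lemma gibbsE b h l w xi F : good b h l w -> gibbs b h l xi F = pr w l xi F.
Proof. by move=> g; apply: pr_good g; apply/good_wgt/suff_edges_of. Qed.

Section FiniteVolume.
Variables (b h : R).
Hypothesis b0 : 0 <= b.
Implicit Types (l : seq site) (s t xi : config) (F G : config -> R).

Lemma pr_den w l xi : (forall s, 0 < w s) -> 0 < ssum l w xi.
Proof. by move=> p; apply: ssum_gt0. Qed.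

Let W l := wgt b h (edges_of l) (undup l).
Let W0 l s : 0 < W l s. Proof. exact: expR_gt0. Qed.

Lemma gibbs_ge0 l xi F : (forall s, agree l s xi -> 0 <= F s) -> 0 <= gibbs b h l xi F.
Proof.
move=> h0; rewrite divr_ge0 ?(ltW (pr_den _ _ (W0 l))) //.
by apply: ssum_ge0 => s hs; rewrite mulr_ge0 ?h0 ?(ltW (W0 l s)).
Qed.

Lemma gibbs_eq l xi F G : (forall s, agree l s xi -> F s = G s) ->
  gibbs b h l xi F = gibbs b h l xi G.
Proof. by move=> e; congr (_ / _); apply: eq_ssum => s /e ->. Qed.

Lemma gibbsD l xi F G : gibbs b h l xi (fun s => F s + G s) = gibbs b h l xi F + gibbs b h l xi G.
Proof.
by rewrite /gibbs /pr -mulrDl -ssumD; congr (_ / _); apply: eq_ssum => s _; rewrite mulrDl.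
Qed.

Lemma gibbsZ l xi c F : gibbs b h l xi (fun s => c * F s) = c * gibbs b h l xi F.
Proof.
by rewrite /gibbs /pr mulrA -ssumZ; congr (_ / _); apply: eq_ssum => s _; rewrite mulrA.
Qed.

Lemma gibbs_cst l xi c : gibbs b h l xi (fun=> c) = c.
Proof. by rewrite /gibbs /pr ssumZ mulfK // lt0r_neq0 // pr_den //; apply: W0. Qed.

Lemma gibbsB l xi F G : gibbs b h l xi (fun s => F s - G s) = gibbs b h l xi F - gibbs b h l xi G.
Proof.
rewrite gibbsD; congr (_ + _); rewrite -mulN1r -gibbsZ.
by apply: gibbs_eq => s _; rewrite mulN1r.
Qed.

Lemma gibbs_sum (I : Type) (r : seq I) (F : I -> config -> R) l xi :
  gibbs b h l xi (fun s => \sum_(i <- r) F i s) = \sum_(i <- r) gibbs b h l xi (F i).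
Proof.
elim: r => [|i r IH].
  by rewrite big_nil -[RHS](gibbs_cst l xi); apply: gibbs_eq => s _; rewrite big_nil.
by rewrite big_cons -IH -gibbsD; apply: gibbs_eq => s _; rewrite big_cons.
Qed.

Lemma gibbs_le l xi F G : (forall s, agree l s xi -> F s <= G s) ->
  gibbs b h l xi F <= gibbs b h l xi G.
Proof.
by move=> e; rewrite -subr_ge0 -gibbsB; apply: gibbs_ge0 => s hs; rewrite subr_ge0 e.
Qed.

Lemma gibbs_perm l l' xi F : perm_eq l l' -> gibbs b h l xi F = gibbs b h l' xi F.
Proof.
move=> p; rewrite /gibbs (@pr_good b h l _ (W l')).
- by rewrite /pr !(ssum_perm _ _ p).
- exact/good_wgt/suff_edges_of.
- apply: (@good_sub _ _ l'); last exact/good_wgt/suff_edges_of.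
  by move=> x; rewrite (perm_mem p).
Qed.

Lemma gibbs_agree l xi xi' F : agree l xi xi' -> gibbs b h l xi F = gibbs b h l xi' F.
Proof. by move=> e; rewrite /gibbs /pr !(ssum_agree _ e). Qed.

Lemma gibbs_dlr l1 l2 xi F :
  gibbs b h (l1 ++ l2) xi F = gibbs b h (l1 ++ l2) xi (fun s => gibbs b h l2 s F).
Proof.
have g : good b h (l1 ++ l2) (W (l1 ++ l2)) by apply/good_wgt/suff_edges_of.
have g2 : good b h l2 (W (l1 ++ l2)).
  by apply: good_sub g => x x2; rewrite mem_cat x2 orbT.
rewrite {1 2}/gibbs -/(W _) /pr !ssum_cat; congr (_ / _); apply: eq_ssum => s hs.
transitivity (ssum l2 (fun t => gibbs b h l2 s F * W (l1 ++ l2) t) s).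
  rewrite ssumZ (gibbsE _ _ g2) /pr divfK // gt_eqF // pr_den //.
by apply: eq_ssum => t ht; rewrite (gibbs_agree _ ht).
Qed.

Lemma spin_lattice a c a' c' : spin a * spin c + spin a' * spin c' <=
  spin (a || a') * spin (c || c') + spin (a && a') * spin (c && c').
Proof. by case: a; case: c; case: a'; case: c'; rewrite /spin /=; lra. Qed.

Lemma wgt_lattice h1 h2 EE X s t : h1 <= h2 ->
  wgt b h1 EE X s * wgt b h2 EE X t <= wgt b h2 EE X (orc s t) * wgt b h1 EE X (andc s t).
Proof.
move=> h12; rewrite /wgt -!expRD ler_expR /energy addrACA [leRHS]addrACA; apply: lerD.
  rewrite -!mulrDr; apply: ler_wpM2l => //; rewrite /bonds -!big_split.
  apply: ler_sum => e _ /=; rewrite !chi_cons !chi_nil !mulr1; exact: spin_lattice.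
rewrite -!mulrA -!mulrDr; apply: ler_wpM2l => //; rewrite !mulr_sumr -!big_split.
apply: ler_sum => x _ /=; rewrite /orc /andc.
by case: (s x); case: (t x); rewrite /spin /=; lra.
Qed.

End FiniteVolume.

Lemma perm_split (I : eqType) (l1 l2 : seq I) : uniq l1 -> uniq l2 -> {subset l2 <= l1} ->
  perm_eq l1 ([seq x <- l1 | x \notin l2] ++ l2).
Proof.
move=> u1 u2 sub; apply: uniq_perm => //.
  rewrite cat_uniq filter_uniq // u2 andbT /=; apply/hasPn => x x2.
  by rewrite /= mem_filter x2.
move=> x; rewrite mem_cat mem_filter.
by case: (boolP (x \in l2)) => [/sub ->|]; rewrite ?orbT ?orbF.
Qed.

Section Monotonicity.
Variable b : R.
Hypothesis b0 : 0 <= b.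
Implicit Types (l : seq site) (s t xi : config) (F G : config -> R).

Lemma gibbs_mono l h1 h2 xi xi' F M : h1 <= h2 -> ltc xi xi' -> incr F ->
  (forall s, - M <= F s) -> gibbs b h1 l xi F <= gibbs b h2 l xi' F.
Proof.
move=> h12 x12 iF bF.
have eM k y : gibbs b k l y F + M = gibbs b k l y (fun s => F s + M).
  by rewrite gibbsD gibbs_cst.
rewrite -(lerD2r M) !eM.
rewrite /gibbs /pr ler_pdivrMr; last by apply: pr_den => s; apply: expR_gt0.
rewrite mulrAC ler_pdivlMr; last by apply: pr_den => s; apply: expR_gt0.
apply: (@holley _ l (wgt b h1 (edges_of l) (undup l)) (wgt b h2 (edges_of l) (undup l))
  (fun s => F s + M)) => // [s|s|s|s t st|s t].
- exact: expR_ge0.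
- exact: expR_ge0.
- by have := bF s; lra.
- by rewrite lerD2r; apply: iF.
- exact: wgt_lattice.
Qed.

Lemma gibbs_fkg h l xi F G : (forall s, 0 <= F s) -> (forall s, 0 <= G s) ->
  incr F -> incr G ->
  gibbs b h l xi F * gibbs b h l xi G <= gibbs b h l xi (fun s => F s * G s).
Proof.
move=> F0 G0 iF iG; rewrite /gibbs /pr mulf_div.
have p : 0 < ssum l (wgt b h (edges_of l) (undup l)) xi by apply: pr_den => s; apply: expR_gt0.
rewrite ler_pdivrMr ?mulr_gt0 // mulrA divfK ?gt_eqF //.
by apply: fkg => // [s|s t]; [apply: expR_ge0|apply: wgt_lattice].
Qed.

Lemma gibbs_vol l1 l2 h F M : incr F -> (forall s, - M <= F s) ->
  gibbs b h (l1 ++ l2) (ctrue : config) F <= gibbs b h l2 (ctrue : config) F.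
Proof.
move=> iF bF; rewrite gibbs_dlr -[leRHS](gibbs_cst b h (l1 ++ l2) (ctrue : config)).
by apply: gibbs_le => s _; apply: gibbs_mono iF bF.
Qed.

Lemma gibbs_vol_sub l1 l2 h F M : uniq l1 -> uniq l2 -> {subset l2 <= l1} ->
  incr F -> (forall s, - M <= F s) ->
  gibbs b h l1 (ctrue : config) F <= gibbs b h l2 (ctrue : config) F.
Proof.
move=> u1 u2 sub iF bF.
have p := perm_split u1 u2 sub.
by rewrite (gibbs_perm b h _ _ p); apply: gibbs_vol iF bF.
Qed.

End Monotonicity.

Lemma mem_boxsites n x : (x \in boxsites n) = (normInf x <= n)%N.
Proof.
case: x => x y; rewrite /normInf /=; apply/allpairsP/idP => [[[i j] [+ + [-> ->]]]|h].
  by rewrite !mem_iota /=; lia.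
exists (absz (x + n%:Z), absz (y + n%:Z)); split; rewrite ?mem_iota /=; try lia.
by congr (_, _); lia.
Qed.

Lemma boxsites_uniq n : uniq (boxsites n).
Proof.
apply: allpairs_uniq; rewrite ?iota_uniq // => -[i j] [i' j'] _ _ /= [h1 h2].
by congr (_, _); lia.
Qed.

Lemma size_boxsites n : size (boxsites n) = ((2 * n).+1 ^ 2)%N.
Proof. by rewrite size_allpairs !size_iota mulnn. Qed.

Opaque boxsites.
Arguments boxsites : simpl never.

Definition box_edges n := map (fun x => (x, e1 x)) (boxsites n) ++ map (fun x => (x, e2 x)) (boxsites n).

Lemma suff_box n m : (n < m)%N -> suff (boxsites n) (box_edges m) (boxsites n).
Proof.
move=> nm; split; rewrite ?boxsites_uniq //.
- rewrite cat_uniq; apply/and3P; split.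
  + by rewrite map_inj_uniq ?boxsites_uniq // => u v [].
  + apply/hasPn => e /mapP[[x y] _ ->]; apply/negP => /mapP[[u v] _].
    by rewrite /e1 /e2 /= => -[-> ->]; lia.
  + by rewrite map_inj_uniq ?boxsites_uniq // => u v [].
- by rewrite all_cat !all_map; apply/andP; split; apply/allP => x _; rewrite /= /is_edge /= eqxx ?orbT.
- move=> x; rewrite mem_boxsites => hx e.
  have st : e \in star_edges x -> [|| e == (x, e1 x), e == (x, e2 x), e == (d1 x, x) | e == (d2 x, x)].
    by rewrite !inE.
  rewrite mem_cat => /st /or4P[] /eqP ->.
  + by apply/orP; left; apply/mapP; exists x => //; rewrite mem_boxsites; lia.
  + by apply/orP; right; apply/mapP; exists x => //; rewrite mem_boxsites; lia.
  + apply/orP; left; apply/mapP; exists (d1 x); rewrite ?d1K // mem_boxsites.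
    by move: hx; rewrite /normInf /d1 /=; lia.
  + apply/orP; right; apply/mapP; exists (d2 x); rewrite ?d2K // mem_boxsites.
    by move: hx; rewrite /normInf /d2 /=; lia.
Qed.

Definition ind (E : config -> Prop) (s : config) : R := (`[< E s >])%:R.

(* The finite-volume measures are indexed by functions on a square of ordinals; we
   reindex their sums by the sites of the box. *)
Lemma sum_ffun_ssum m (G : config -> R) :
  \sum_(c : {ffun boxT m -> bool}) G (ext c) = ssum (boxsites m) G (ctrue : config).
Proof.
pose toS (p : boxT m) : site := (Posz p.1 - m%:Z, Posz p.2 - m%:Z).
have toSin p : toS p \in boxsites m.
  by rewrite mem_boxsites; case: p => -[i hi] [j hj]; rewrite /normInf /toS /=; lia.
pose ofS (x : site) : boxT m := (inord (absz (x.1 + m%:Z)), inord (absz (x.2 + m%:Z))).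
have ofSK p : ofS (toS p) = p.
  case: p => -[i hi] [j hj]; rewrite /ofS /toS /=; congr (_, _); apply: val_inj => /=;
  by rewrite subrK absz_nat inordK.
have toSK x : x \in boxsites m -> toS (ofS x) = x.
  case: x => x y; rewrite mem_boxsites /normInf /ofS /toS /= => hx.
  by congr (_, _); rewrite inordK; lia.
have extE (c : {ffun boxT m -> bool}) x : ext c x = if x \in boxsites m then c (ofS x) else true.
  by rewrite /ext mem_boxsites.
have gen (l : seq site) : uniq l -> {subset l <= boxsites m} -> forall xi,
   agree (boxsites m) xi (ctrue : config) ->
   \sum_(c : {ffun boxT m -> bool} | [forall p, (toS p \notin l) ==> (c p == xi (toS p))]) G (ext c)
    = ssum l G xi.
  elim: l => [|x l IH] ul sub xi hxi /=.
    rewrite (big_pred1 [ffun p => xi (toS p)]).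
      congr G; apply: funext => y; rewrite extE; case: ifP => hy.
        by rewrite ffunE toSK.
      by rewrite hxi ?hy.
    move=> c; apply/forallP/eqP => [h|-> p]; last by rewrite ffunE.
    by apply/ffunP => p; rewrite ffunE; apply/eqP; exact: h p.
  move: ul => /= /andP[xl ul].
  have xb : x \in boxsites m by apply: sub; rewrite mem_head.
  have sub' : {subset l <= boxsites m} by move=> y yl; apply: sub; rewrite inE yl orbT.
  have hupd b : agree (boxsites m) (upd xi x b) (ctrue : config).
    by move=> y yb; rewrite /upd; case: eqVneq => [yx|_]; [rewrite yx xb in yb|apply: hxi].
  rewrite -!IH // (bigID (fun c : {ffun boxT m -> bool} => c (ofS x))) /=.
  congr (_ + _); apply: eq_bigl => c.
  + apply/andP/forallP => [[/forallP h cx] p|h].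
      apply/implyP => pl; rewrite /upd; case: (eqVneq (toS p) x) => [e|ne].
        by rewrite -(ofSK p) e cx.
      by have := h p; rewrite inE negb_or ne pl.
    split; last by have := h (ofS x); rewrite toSK // xl upd_same /= => /eqP.
    apply/forallP => p; apply/implyP; rewrite inE negb_or => /andP[ne pl].
    by have := h p; rewrite pl /upd (negbTE ne).
  + apply/andP/forallP => [[/forallP h cx] p|h].
      apply/implyP => pl; rewrite /upd; case: (eqVneq (toS p) x) => [e|ne].
        by rewrite -(ofSK p) e (negbTE cx).
      by have := h p; rewrite inE negb_or ne pl.
    split; last by have := h (ofS x); rewrite toSK // xl upd_same /= => /eqP ->.
    apply/forallP => p; apply/implyP; rewrite inE negb_or => /andP[ne pl].
    by have := h p; rewrite pl /upd (negbTE ne).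
rewrite -gen ?boxsites_uniq //; apply: eq_bigl => c.
by apply/esym/forallP => p; rewrite toSin.
Qed.

Lemma muFinE T h m E : muFin T h m E = gibbs T^-1 h (boxsites m) (ctrue : config) (ind E).
Proof.
have g := good_wgt T^-1 h (suff_box (ltnSn m)).
rewrite (gibbsE _ _ g) /muFin /pr.
have wE (c : {ffun boxT m -> bool}) : weight T h c = wgt T^-1 h (box_edges m.+1) (boxsites m) (ext c).
  rewrite /weight /wgt /energy /bonds /box_edges; move: (boxsites m.+1) (boxsites m) => r r'.
  rewrite big_cat !big_map /= -big_split /= mulrDr mulrA.
  congr (expR (_ * _ + _)); apply: eq_bigr => x _.
  by rewrite !chi_cons !chi_nil !mulr1.
congr (_ / _); last by under eq_bigr do rewrite wE; rewrite sum_ffun_ssum.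
under eq_bigr => c _ do rewrite wE.
rewrite -sum_ffun_ssum; apply: eq_bigr => c _; rewrite /ind.
by case: asboolP => _; rewrite ?mul1r ?mul0r.
Qed.

(** * Local events and the infinite-volume measure *)

Definition event := config -> Prop.
Definition local (N : nat) (E : event) : Prop :=
  forall s t : config, (forall x, (normInf x <= N)%N -> s x = t x) -> E s -> E t.
Definition tmono (c : bool) (E : event) : Prop :=
  forall s t : config, ltc s t -> if c then E s -> E t else E t -> E s.
Definition eand (E F : event) : event := fun s => E s /\ F s.
Definition enot (E : event) : event := fun s => ~ E s.
Definition eor (E F : event) : event := fun s => E s \/ F s.
Definition plus_at (x : site) : event := fun s => s x.

Lemma ind_ge0 E s : 0 <= ind E s. Proof. by rewrite /ind ler0n. Qed.
Lemma ind_le1 E s : ind E s <= 1. Proof. by rewrite /ind lern1; case: asboolP. Qed.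
Lemma ind_and E F s : ind (eand E F) s = ind E s * ind F s.
Proof. by rewrite /ind /eand asbool_and -natrM mulnb. Qed.
Lemma ind_not E s : ind (enot E) s = 1 - ind E s.
Proof. by rewrite /ind /enot asbool_neg; case: asboolP => _ /=; ring. Qed.
Lemma ind_le (E F : event) s : (E s -> F s) -> ind E s <= ind F s.
Proof. by move=> h; rewrite /ind ler_nat; case: (asboolP (E s)) => // /h hf; rewrite asboolT. Qed.
Lemma ind_true (E : event) s : E s -> ind E s = 1.
Proof. by move=> h; rewrite /ind asboolT. Qed.
Lemma ind_false (E : event) s : ~ E s -> ind E s = 0.
Proof. by move=> h; rewrite /ind asboolF. Qed.

Lemma localI N E F : local N E -> local N F -> local N (eand E F).
Proof. by move=> h1 h2 s t st [a c]; split; [apply: h1 a|apply: h2 c]. Qed.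
Lemma localU N E F : local N E -> local N F -> local N (eor E F).
Proof. by move=> h1 h2 s t st [a|a]; [left; apply: h1 a|right; apply: h2 a]. Qed.
Lemma localC N E : local N E -> local N (enot E).
Proof. by move=> h s t st a c; apply: a; apply: h c => x hx; rewrite st. Qed.
Lemma local_le N M E : (N <= M)%N -> local N E -> local M E.
Proof. by move=> le h s t st; apply: h => x hx; apply: st; apply: leq_trans le. Qed.

Lemma tmono_incr E : tmono true E -> incr (ind E).
Proof. by move=> h s t st; apply: ind_le; apply: (h s t st). Qed.
Lemma tmonoC c E : tmono c E -> tmono (~~ c) (enot E).
Proof. by move=> h s t st; have := h s t st; rewrite /enot; case: c {h} => /= h a c; auto. Qed.
Lemma tmonoI c E F : tmono c E -> tmono c F -> tmono c (eand E F).
Proof.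
by move=> h1 h2 s t st; have := h1 s t st; have := h2 s t st; rewrite /eand; case: c {h1 h2} => a d [e f]; auto.
Qed.

(** Raising a spin in S(N) raises this count by 1, which outweighs any change of c times an
    indicator local to S(N) when |c| <= 1. The sum is thus increasing, and arbitrary local events
    become differences of increasing functions. *)
Definition nplus N (s : config) : R := \sum_(x <- boxsites N) ind (plus_at x) s.

Lemma nplus_mono N : incr (nplus N).
Proof. by move=> s t st; apply: ler_sum => x _; apply: ind_le; apply: st. Qed.

Lemma nplus_ge0 N s : 0 <= nplus N s.
Proof. by apply: sumr_ge0 => x _; apply: ind_ge0. Qed.

Lemma nplus_jump N s t : ltc s t -> (exists2 x, (normInf x <= N)%N & s x != t x) ->
  nplus N s + 1 <= nplus N t.
Proof.
move=> st [x hx ne]; have xb : x \in boxsites N by rewrite mem_boxsites.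
have e u : nplus N u = ind (plus_at x) u + \sum_(y <- rem x (boxsites N)) ind (plus_at y) u.
  by rewrite /nplus (big_rem x xb).
rewrite !e.
have [sx tx] : s x = false /\ t x = true.
  by move: ne (st x); case: (s x); case: (t x) => // _ /(_ isT).
have -> : ind (plus_at x) t = 1 by apply: ind_true.
have -> : ind (plus_at x) s = 0 by apply: ind_false; rewrite /plus_at sx.
rewrite add0r addrC; apply: lerD => //; apply: ler_sum => y _; apply: ind_le; exact: st.
Qed.

Lemma nplus_addE N E (c : R) : local N E -> -1 <= c -> c <= 1 ->
  incr (fun s => nplus N s + c * ind E s).
Proof.
move=> lE c1 c2 s t st.
case: (pselect (exists2 x, (normInf x <= N)%N & s x != t x)) => [/(nplus_jump st) h|h].
  by have := ind_ge0 E s; have := ind_ge0 E t; have := ind_le1 E s; have := ind_le1 E t; nra.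
have st' x : (normInf x <= N)%N -> s x = t x.
  by move=> hx; apply: contrapT => ne; apply: h; exists x => //; apply/eqP.
have -> : ind E s = ind E t.
  congr (_%:R); congr nat_of_bool; apply: asbool_equiv_eq; split; apply: lE => x hx; by rewrite st'.
by rewrite lerD2r; apply: nplus_mono.
Qed.

Lemma nplus_addE_ge N E (c : R) s : -1 <= c -> - 1 <= nplus N s + c * ind E s.
Proof. by move=> h; have := nplus_ge0 N s; have := ind_ge0 E s; have := ind_le1 E s; nra. Qed.

Section InfiniteVolume.
Variables (T : R).
Hypothesis T0 : 0 < T.
Implicit Types (h : R) (E : event).

Let b := T^-1.
Let b0 : 0 <= b. Proof. by rewrite invr_ge0 ltW. Qed.
Let Pn h n (F : config -> R) := gibbs b h (boxsites n) (ctrue : config) F.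

Lemma box_sub n m : (n <= m)%N -> {subset boxsites n <= boxsites m}.
Proof. by move=> nm x; rewrite !mem_boxsites => /leq_trans; apply. Qed.

Lemma Pn_cvg h F M : incr F -> (forall s, - M <= F s) -> cvgn (fun n => Pn h n F).
Proof.
move=> iF bF; apply: nonincreasing_is_cvgn.
  move=> m n mn; apply: (gibbs_vol_sub b0 h (boxsites_uniq n) (boxsites_uniq m) _ iF bF).
  exact: box_sub.
exists (- M) => _ [n _ <-]; rewrite -(gibbs_cst b h (boxsites n) (ctrue : config) (- M)).
by apply: gibbs_le => s _; apply: bF.
Qed.

Lemma muFin_cvg h N E : local N E -> cvgn (fun m => muFin T h m E).
Proof.
move=> lE.
have c1 : cvgn (fun n => Pn h n (fun s => nplus N s + 1 * ind E s)).
  apply: (@Pn_cvg h _ 1); first by apply: nplus_addE => //; lra.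
  by move=> s; apply: nplus_addE_ge; lra.
have c2 : cvgn (fun n => Pn h n (nplus N)).
  apply: (@Pn_cvg h _ 0); first exact: nplus_mono.
  by move=> s; rewrite oppr0 nplus_ge0.
have -> : (fun m => muFin T h m E) =
  (fun n => Pn h n (fun s => nplus N s + 1 * ind E s)) - (fun n => Pn h n (nplus N)).
  apply: funext => n; rewrite muFinE /= -[RHS]gibbsB.
  by apply: gibbs_eq => s _; ring.
exact: is_cvgB.
Qed.

Lemma mu_cvg h N E : local N E -> (Pn h n (ind E) @[n --> \oo] --> mu T h E)%classic.
Proof.
move=> lE; have := @muFin_cvg h N E lE.
have -> : (fun n => Pn h n (ind E)) = (fun m => muFin T h m E).
  by apply: funext => n; rewrite muFinE.
by [].
Qed.

(** In place of an integral: [mu] acts on events only, and linear inequalities between indicators of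
    local events are what passes to the limit. *)
Lemma mu_lin h N (r : seq (R * event)) :
  (forall u, List.In u r -> local N u.2) ->
  (forall s, 0 <= \sum_(u <- r) u.1 * ind u.2 s) -> 0 <= \sum_(u <- r) u.1 * mu T h u.2.
Proof.
move=> lr pos.
have c : (Pn h n (fun s => \sum_(u <- r) u.1 * ind u.2 s) @[n --> \oo] -->
   \sum_(u <- r) u.1 * mu T h u.2)%classic.
  have -> : (fun n => Pn h n (fun s => \sum_(u <- r) u.1 * ind u.2 s)) =
     (fun n => \sum_(u <- r) u.1 * Pn h n (ind u.2)).
    apply: funext => n; rewrite /Pn gibbs_sum; apply: eq_bigr => u _; exact: gibbsZ.
  elim: r lr {pos} => [|u r IH] lr.
    rewrite big_nil; under eq_fun do rewrite big_nil; exact: cvg_cst.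
  rewrite big_cons; under eq_fun do rewrite big_cons.
  apply: cvgD; last by apply: IH => v vr; apply: lr; right.
  by apply: cvgMr; apply: (@mu_cvg h N); apply: lr; left.
apply: (cvgr_to_ge c); apply: nearW => n; apply: gibbs_ge0 => s _; exact: pos.
Qed.

Lemma mu_le h N E F : local N E -> local N F -> (forall s, E s -> F s) -> mu T h E <= mu T h F.
Proof.
move=> lE lF EF.
have := @mu_lin h N [:: (1, F); (-1, E)].
rewrite !big_cons !big_nil /= => H; have : 0 <= 1 * mu T h F + (-1 * mu T h E + 0).
  apply: H => [u [<-|[<-|[]]]|s] //.
  by rewrite !big_cons !big_nil /=; have := ind_le (EF s); lra.
lra.
Qed.

Lemma mu_eq h E F : (forall s, E s <-> F s) -> mu T h E = mu T h F.
Proof. by move=> e; congr (mu T h _); apply: funext => s; apply: propext. Qed.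

Lemma mu_ge0 h N E : local N E -> 0 <= mu T h E.
Proof.
move=> lE; have := @mu_lin h N [:: (1, E)]; rewrite big_seq1 /= mul1r; apply.
  by move=> u [<-|[]].
by move=> s; rewrite big_seq1 /= mul1r ind_ge0.
Qed.

Lemma mu_not h N E : local N E -> mu T h (enot E) = 1 - mu T h E.
Proof.
move=> lE; have lN := localC lE.
have c : (Pn h n (fun s => 1 - ind E s) @[n --> \oo] --> 1 - mu T h E)%classic.
  have -> : (fun n => Pn h n (fun s => 1 - ind E s)) = cst 1 - (fun n => Pn h n (ind E)).
    by apply: funext => n; rewrite /Pn gibbsB gibbs_cst.
  by apply: cvgB; [apply: cvg_cst|apply: mu_cvg lE].
have c' := mu_cvg (h := h) lN.
have e : (fun n => Pn h n (ind (enot E))) = (fun n => Pn h n (fun s => 1 - ind E s)).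
  by apply: funext => n; apply: gibbs_eq => s _; rewrite ind_not.
rewrite e in c'; exact: (cvg_unique _ c' c).
Qed.

Lemma mu_le1 h N E : local N E -> mu T h E <= 1.
Proof. by move=> lE; have := mu_ge0 h (localC lE); rewrite (mu_not h lE); lra. Qed.

Lemma mu_or h N E F : local N E -> local N F -> mu T h (eor E F) <= mu T h E + mu T h F.
Proof.
move=> lE lF.
have := @mu_lin h N [:: (1, F); (1, E); (-1, eor E F)].
rewrite !big_cons !big_nil /= => H; have : 0 <= 1 * mu T h F + (1 * mu T h E + (-1 * mu T h (eor E F) + 0)).
  apply: H => [u [<-|[<-|[<-|[]]]]|s] //=; first exact: localU.
  rewrite !big_cons !big_nil /=; have := ind_ge0 E s; have := ind_ge0 F s.
  case: (pselect (eor E F s)) => [[a|a]|a]; rewrite (ind_true a) || rewrite (ind_false a).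
  - by have := ind_le1 (eor E F) s; lra.
  - by have := ind_le1 (eor E F) s; lra.
  - by lra.
lra.
Qed.

Lemma mu_add h N E F : local N E -> local N F ->
  mu T h E = mu T h (eand E F) + mu T h (eand E (enot F)).
Proof.
move=> lE lF; have l1 := localI lE lF; have l2 := localI lE (localC lF).
have c : ((fun n => Pn h n (ind (eand E F))) + (fun n => Pn h n (ind (eand E (enot F)))) @ \oo -->
    mu T h (eand E F) + mu T h (eand E (enot F)))%classic.
  by apply: cvgD; apply: mu_cvg; eassumption.
have e : (fun n => Pn h n (ind E)) = (fun n => Pn h n (ind (eand E F))) + (fun n => Pn h n (ind (eand E (enot F)))).
  apply: funext => n; rewrite /= -[RHS]gibbsD; apply: gibbs_eq => s _.
  by rewrite !ind_and ind_not; ring.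
have c' := mu_cvg (h := h) lE; rewrite e in c'; exact: (cvg_unique _ c' c).
Qed.

Lemma mu_fkg1 h N E F : local N E -> local N F -> tmono true E -> tmono true F ->
  mu T h E * mu T h F <= mu T h (eand E F).
Proof.
move=> lE lF mE mF.
have c : ((fun n => Pn h n (ind E)) * (fun n => Pn h n (ind F)) @ \oo --> mu T h E * mu T h F)%classic.
  by apply: cvgM; apply: mu_cvg; eassumption.
apply: (ler_cvg_to c (mu_cvg (h := h) (localI lE lF))); apply: nearW => n.
have -> : Pn h n (ind (eand E F)) = Pn h n (fun s => ind E s * ind F s).
  by apply: gibbs_eq => s _; rewrite ind_and.
by apply: gibbs_fkg => //; first [exact: tmono_incr|move=> s; exact: ind_ge0].
Qed.

Lemma mu_fkg c h N E F : local N E -> local N F -> tmono c E -> tmono c F ->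
  mu T h E * mu T h F <= mu T h (eand E F).
Proof.
case: c => lE lF mE mF; first exact: (mu_fkg1 h lE lF).
have := mu_fkg1 h (localC lE) (localC lF) (tmonoC mE) (tmonoC mF).
rewrite (mu_not h lE) (mu_not h lF) => H.
have lnn := localI (localC lE) (localC lF).
have e1 := mu_add h lE lF.
have e2 := mu_add h (localC lE) lF; rewrite (mu_not h lE) in e2.
have e3 := mu_add h lF lE.
have e4 : mu T h (eand F E) = mu T h (eand E F) by apply: mu_eq => s; split => -[].
have e5 : mu T h (eand F (enot E)) = mu T h (eand (enot E) F) by apply: mu_eq => s; split => -[].
have e6 := mu_not h lE; have e7 := mu_not h lF.
by nra.
Qed.

End InfiniteVolume.

(** * Lattice symmetries and the spin flip *)

Definition isom (g g' : site -> site) :=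
  [/\ cancel g g', cancel g' g & forall x, perm_eq (nbrs (g x)) (map g (nbrs x))].

Lemma gibbs_isom b h l xi (F : config -> R) g g' : isom g g' ->
  gibbs b h (map g l) xi F = gibbs b h l (xi \o g) (fun s => F (s \o g')).
Proof.
move=> [gK g'K hn].
pose w := wgt b h (edges_of l) (undup l).
have [wp wg] : good b h l w by apply/good_wgt/suff_edges_of.
have gw : good b h (map g l) (fun s => w (s \o g)).
  split=> [s|_ s /mapP[x xl ->]] //.
  have e c : upd s (g x) c \o g = upd (s \o g) x c.
    by apply: funext => y; rewrite /upd /= (can_eq gK).
  rewrite !e wg //; congr (expR (_ * (_ + _)) * _).
  by rewrite /nsum (perm_big _ (hn x)) big_map.
rewrite (gibbsE _ _ gw) /pr !(ssum_map _ _ _ gK g'K) /gibbs -/w /pr.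
have e s : (s \o g') \o g = s :> config by apply: funext => y /=; rewrite gK.
by congr (_ / _); apply: eq_ssum => s _; rewrite e.
Qed.

Definition cfalse : config := fun=> false.
Definition negc (s : config) : config := fun x => ~~ s x.

Lemma gibbs_flip b h l xi (F : config -> R) :
  gibbs b h l xi F = gibbs b (- h) l (negc xi) (fun s => F (negc s)).
Proof.
have e s : mulc s cfalse = negc s by apply: funext => y; rewrite /mulc /negc /cfalse; case: (s y).
have we s : wgt b h (edges_of l) (undup l) (negc s) = wgt b (- h) (edges_of l) (undup l) s.
  rewrite /wgt /energy; congr expR; congr (_ * _ + _).
    apply: eq_bigr => ed _; rewrite !chi_cons !chi_nil /negc.
    by case: (s ed.1); case: (s ed.2); rewrite /spin /=; ring.
  rewrite mulrN mulNr -mulrN -sumrN; congr (_ * _); apply: eq_bigr => x _.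
  by rewrite /negc; case: (s x); rewrite /spin /=; ring.
rewrite /gibbs /pr (ssum_mulc _ _ _ cfalse) (ssum_mulc _ (wgt b h _ _) _ cfalse) e.
by congr (_ / _); apply: eq_ssum => s _; rewrite e we.
Qed.

(** * The influence of the boundary *)

Section Mixing.
Variables (b : R).
Hypothesis b0 : 0 <= b.

Definition mdec (n : nat) : R := gibbs b 0 (boxsites n) (ctrue : config) (fun s => spin (s origin)).

Lemma spin_ind (s : config) x : spin (s x) = 2 * ind (plus_at x) s - 1.
Proof.
case E : (s x); first by rewrite ind_true // /spin; ring.
by rewrite ind_false /plus_at ?E // /spin; ring.
Qed.

Lemma mdec_ind n h xi x : gibbs b h (boxsites n) xi (fun s => spin (s x)) =
  2 * gibbs b h (boxsites n) xi (ind (plus_at x)) - 1.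
Proof.
rewrite -gibbsZ -[X in _ - X](gibbs_cst b h (boxsites n) xi) -gibbsB.
by apply: gibbs_eq => s _; rewrite spin_ind.
Qed.

(** The spin flip turns the minus boundary in field h into the plus boundary in field - h, so the
    gap is half of the sum of magnetizations that [lebowitz] bounds by the zero-field value. *)
Lemma plus_gap h d : gibbs b h (boxsites d) (ctrue : config) (ind (plus_at origin)) -
  gibbs b h (boxsites d) cfalse (ind (plus_at origin)) <= mdec d.
Proof.
pose Z k := ssum (boxsites d) (fun s => expR (energy (box_edges d.+1) (boxsites d) b k s)) (ctrue : config).
pose N k := ssum (boxsites d) (fun s => spin (s origin) * expR (energy (box_edges d.+1) (boxsites d) b k s)) (ctrue : config).
have H := @lebowitz _ (boxsites d) (box_edges d.+1) (boxsites d) b (b * h) origin Z N b0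
  (fun=> erefl) (fun=> erefl).
have e k : gibbs b k (boxsites d) (ctrue : config) (fun s => spin (s origin)) = N (b * k) / Z (b * k).
  by rewrite (gibbsE _ _ (good_wgt b k (suff_box (ltnSn d)))).
have ef : gibbs b h (boxsites d) cfalse (fun s => spin (s origin)) =
   - gibbs b (- h) (boxsites d) (ctrue : config) (fun s => spin (s origin)).
  rewrite gibbs_flip (_ : negc cfalse = ctrue) //.
  rewrite -[RHS]mulN1r -gibbsZ; apply: gibbs_eq => s _.
  by rewrite /negc; case: (s origin); rewrite /spin /=; ring.
have := mdec_ind d h (ctrue : config) origin; have := mdec_ind d h cfalse origin.
rewrite ef !e mulrN => h1 h2.
have : mdec d = N 0 / Z 0 by rewrite /mdec e mulr0.
by lra.
Qed.

Lemma gibbs_vol_min l1 l2 h (F : config -> R) M : uniq l1 -> uniq l2 -> {subset l2 <= l1} ->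
  incr F -> (forall s, F s <= M) ->
  gibbs b h l2 cfalse F <= gibbs b h l1 cfalse F.
Proof.
move=> u1 u2 sub iF bF; rewrite gibbs_flip [leRHS]gibbs_flip.
rewrite -lerN2 -!(mulN1r (gibbs _ _ _ _ _)) -!gibbsZ.
apply: (gibbs_vol_sub b0 _ u1 u2 sub (M := M)).
  move=> s t st; rewrite !mulN1r lerN2; apply: iF => y; rewrite /negc.
  by move: (st y); case: (s y) => // ->.
by move=> s; rewrite mulN1r lerN2.
Qed.

Definition transl (z x : site) : site := (x.1 + z.1, x.2 + z.2).
Definition oppz (z : site) : site := (- z.1, - z.2).

Lemma isom_transl z : isom (transl z) (transl (oppz z)).
Proof.
split=> [[x y]|[x y]|[x y]]; rewrite /transl /oppz /=; first by rewrite !addrK.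
  by rewrite !subrK.
rewrite /nbrs /e1 /e2 /d1 /d2 /=.
rewrite (_ : x + z.1 + 1 = x + 1 + z.1); last by ring.
rewrite (_ : y + z.2 + 1 = y + 1 + z.2); last by ring.
rewrite (_ : x + z.1 - 1 = x - 1 + z.1); last by ring.
by rewrite (_ : y + z.2 - 1 = y - 1 + z.2); last by ring.
Qed.

Lemma gap_at h x d l : uniq l -> {subset map (transl x) (boxsites d) <= l} ->
  gibbs b h l (ctrue : config) (ind (plus_at x)) - gibbs b h l cfalse (ind (plus_at x)) <= mdec d.
Proof.
move=> ul sub.
have um : uniq (map (transl x) (boxsites d)).
  by rewrite map_inj_uniq ?boxsites_uniq //; apply: can_inj (_ : cancel _ (transl (oppz x))); case: (isom_transl x).
have ip : incr (ind (plus_at x)) by apply: tmono_incr => s t st; apply: st.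
have h1 := gibbs_vol_sub b0 h ul um sub ip (M := 0).
have h2 := gibbs_vol_min h ul um sub ip (M := 1).
have hn s : - 0 <= ind (plus_at x) s by rewrite oppr0 ind_ge0.
have hm s : ind (plus_at x) s <= 1 by apply: ind_le1.
have {}h1 := h1 hn; have {}h2 := h2 hm.
rewrite !(gibbs_isom _ _ _ _ _ (isom_transl x)) in h1 h2.
have e xi : gibbs b h (boxsites d) xi (fun s => ind (plus_at x) (s \o transl (oppz x))) =
   gibbs b h (boxsites d) xi (ind (plus_at origin)).
  apply: gibbs_eq => s _; rewrite /ind /plus_at /=; congr ((`[< is_true (s _) >])%:R).
  by rewrite /transl /oppz /origin; congr (_, _); rewrite subrr.
rewrite !e in h1 h2.
have := plus_gap h d; rewrite /comp in h1 h2; lra.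
Qed.

Definition Delta (n d : nat) : R := ((2 * n).+1 ^ 2)%:R * mdec d.

Lemma nplus_gap h n d : gibbs b h (boxsites (n + d)) (ctrue : config) (nplus n) -
  gibbs b h (boxsites (n + d)) cfalse (nplus n) <= Delta n d.
Proof.
rewrite /nplus !gibbs_sum -sumrB /Delta -size_boxsites.
have -> : (size (boxsites n))%:R * mdec d = \sum_(x <- boxsites n) mdec d.
  by rewrite big_const_seq count_predT iter_addr_0 mulr_natl.
rewrite big_seq [leRHS]big_seq; apply: ler_sum => x; rewrite mem_boxsites => hx.
apply: gap_at; first exact: boxsites_uniq.
move=> y /mapP[u]; rewrite !mem_boxsites => hu ->.
by move: hx hu; rewrite /normInf /transl /=; lia.
Qed.

Lemma mix_box h n d xi E : local n E ->
  `| gibbs b h (boxsites (n + d)) xi (ind E) - gibbs b h (boxsites (n + d)) (ctrue : config) (ind E) |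
  <= Delta n d.
Proof.
move=> lE; have := nplus_gap h n d; move: (boxsites (n + d)) => l hS.
have lo : gibbs b h l cfalse (nplus n) <= gibbs b h l xi (nplus n).
  apply: (gibbs_mono (M := 0) b0 l) => //; first exact: nplus_mono.
  by move=> s; rewrite oppr0 nplus_ge0.
have f (c : R) : -1 <= c -> c <= 1 -> gibbs b h l xi (nplus n) + c * gibbs b h l xi (ind E) <=
   gibbs b h l (ctrue : config) (nplus n) + c * gibbs b h l (ctrue : config) (ind E).
  move=> c1 c2; rewrite -!gibbsZ -!gibbsD.
  apply: (gibbs_mono (M := 1) b0 l) => //; first exact: nplus_addE.
  by move=> s; apply: nplus_addE_ge.
have f1 := f 1; have f2 := f (-1).
have {}f1 := f1 ltac:(lra) ltac:(lra); have {}f2 := f2 ltac:(lra) ltac:(lra).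
rewrite ler_norml; lra.
Qed.

End Mixing.

Lemma box_split n m : (n <= m)%N ->
  perm_eq (boxsites m) ([seq x <- boxsites m | x \notin boxsites n] ++ boxsites n).
Proof. by move=> nm; apply: perm_split; rewrite ?boxsites_uniq //; apply: box_sub. Qed.

Section Interface.
Variables (T : R).
Hypothesis T0 : 0 < T.
Let b := T^-1.
Let b0 : 0 <= b. Proof. by rewrite invr_ge0 ltW. Qed.
Let Pn h n (F : config -> R) := gibbs b h (boxsites n) (ctrue : config) F.

Lemma Pn_dlr h n m F : (n <= m)%N -> Pn h m F = Pn h m (fun s => gibbs b h (boxsites n) s F).
Proof.
move=> nm; have p := box_split nm.
by rewrite /Pn !(gibbs_perm b h _ _ p) [LHS]gibbs_dlr.
Qed.

Lemma mu_cvg' h N E : local N E -> (Pn h n (ind E) @[n --> \oo] --> mu T h E)%classic.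
Proof. exact: mu_cvg. Qed.

Lemma mu_le_of h N E (c : R) : local N E ->
  (exists m, forall n, (m <= n)%N -> Pn h n (ind E) <= c) -> mu T h E <= c.
Proof.
move=> lE [m H]; apply: (cvgr_to_le (mu_cvg' (h := h) lE)).
by exists m.
Qed.

Lemma mu_ge_of h N E (c : R) : local N E ->
  (exists m, forall n, (m <= n)%N -> c <= Pn h n (ind E)) -> c <= mu T h E.
Proof.
move=> lE [m H]; apply: (cvgr_to_ge (mu_cvg' (h := h) lE)).
by exists m.
Qed.

Lemma mix_mu h n d E : local n E ->
  `| mu T h E - Pn h (n + d) (ind E) | <= Delta b n d.
Proof.
move=> lE.
have H m : (n + d <= m)%N -> `| Pn h m (ind E) - Pn h (n + d) (ind E) | <= Delta b n d.
  move=> hm; rewrite (Pn_dlr _ _ hm).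
  rewrite -[X in _ - X](gibbs_cst b h (boxsites m) (ctrue : config)) -gibbsB ler_norml.
  rewrite -{1}(gibbs_cst b h (boxsites m) (ctrue : config) (- Delta b n d)).
  rewrite -{2}(gibbs_cst b h (boxsites m) (ctrue : config) (Delta b n d)).
  by apply/andP; split; apply: gibbs_le => s _; have := mix_box b0 h d s lE;
    rewrite ler_norml => /andP[].
have h1 : mu T h E <= Pn h (n + d) (ind E) + Delta b n d.
  apply: (mu_le_of lE); exists (n + d)%N => m /H; rewrite ler_norml; lra.
have h2 : Pn h (n + d) (ind E) - Delta b n d <= mu T h E.
  apply: (mu_ge_of lE); exists (n + d)%N => m /H; rewrite ler_norml; lra.
by rewrite ler_norml; lra.
Qed.

Definition outside (m : nat) (E : event) :=
  forall s t : config, (forall x, (m < normInf x)%N -> s x = t x) -> E s -> E t.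

(** The error multiplies [mu T h F], which permits iteration over scales. One [Delta] replaces the
    actual spins around the box by plus spins, the other replaces the box by infinite volume. *)
Lemma mix_prod h n d N E F : local n E -> local N F -> outside (n + d) F ->
  mu T h (eand E F) <= (mu T h E + 2 * Delta b n d) * mu T h F.
Proof.
move=> lE lF oF.
have cF := mu_cvg' (h := h) lF.
have cEF := mu_cvg' (h := h) (localI (local_le (leq_maxl n N) lE) (local_le (leq_maxr n N) lF)).
have c2 : (((cst (mu T h E + 2 * Delta b n d)) * (fun k => Pn h k (ind F))) k @[k --> \oo] -->
   (mu T h E + 2 * Delta b n d) * mu T h F)%classic.
  by apply: cvgM => //; apply: cvg_cst.
apply: (ler_cvg_to cEF c2); exists (n + d)%N => // m /= hm; rewrite -[leRHS]/((mu T h E + 2 * Delta b n d) * Pn h m (ind F)).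
rewrite (Pn_dlr _ _ hm) -[leRHS]gibbsZ; apply: gibbs_le => s _.
have -> : gibbs b h (boxsites (n + d)) s (ind (eand E F)) =
   ind F s * gibbs b h (boxsites (n + d)) s (ind E).
  rewrite -gibbsZ; apply: gibbs_eq => t ht; rewrite ind_and mulrC; congr (_ * _).
  have st x : (n + d < normInf x)%N -> t x = s x.
    by move=> hx; apply: ht; rewrite mem_boxsites -ltnNge.
  congr (_%:R); congr nat_of_bool; apply: asbool_equiv_eq; split; apply: oF => x hx.
    exact: st.
  by rewrite st.
rewrite mulrC; apply: ler_wpM2r; first exact: ind_ge0.
have := mix_box b0 h d s lE; have := mix_mu h d lE; rewrite !ler_norml /Pn; lra.
Qed.

(** The image of a box lies between two boxes, which sandwiches the expectations of increasing
    functions; the indicator is a difference of two of these. *)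
Lemma mu_isom h N k E g g' : isom g g' -> local N E ->
  (forall x, (normInf (g x) <= normInf x + k)%N) -> (forall x, (normInf x <= normInf (g x) + k)%N) ->
  mu T h (fun s => E (s \o g')) = mu T h E.
Proof.
move=> ig lE k1 k2; have [gK g'K _] := ig.
have kg' x : (normInf (g' x) <= normInf x + k)%N by have := k2 (g' x); rewrite g'K.
have lE' : local (N + k) (fun s => E (s \o g')).
  by move=> s t st; apply: lE => x hx /=; apply: st; apply: leq_trans (kg' x) _; rewrite leq_add2r.
pose f (c : R) s := nplus N s + c * ind E s.
have sq (c A : R) : -1 <= c -> c <= 1 -> (Pn h n (f c) @[n --> \oo] --> A)%classic ->
    (Pn h n (fun s => f c (s \o g')) @[n --> \oo] --> A)%classic.
  move=> c1 c2 cA.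
  have iF : incr (f c) by apply: nplus_addE.
  have bF s : - 1 <= f c s by apply: nplus_addE_ge.
  have cA2 : (Pn h (n + (k + k)) (f c) @[n --> \oo] --> A)%classic by rewrite (cvg_shiftn (k + k) (fun n => Pn h n (f c))).
  rewrite -(cvg_shiftn k (fun n => Pn h n (fun s => f c (s \o g')))).
  apply: (squeeze_cvgr _ cA2 cA); apply: nearW => n /=.
  have -> : Pn h (n + k) (fun s => f c (s \o g')) = gibbs b h (map g (boxsites (n + k))) (ctrue : config) (f c).
    by rewrite (gibbs_isom _ _ _ _ _ ig).
  have um : uniq (map g (boxsites (n + k))) by rewrite map_inj_uniq ?boxsites_uniq //; apply: can_inj gK.
  apply/andP; split; apply: (gibbs_vol_sub b0 h _ _ _ iF bF); rewrite ?boxsites_uniq //.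
    move=> y /mapP[x]; rewrite !mem_boxsites => hx ->.
    by apply: leq_trans (k1 x) _; rewrite addnA leq_add2r.
  move=> y; rewrite mem_boxsites => hy; apply/mapP; exists (g' y); rewrite ?g'K //.
  by rewrite mem_boxsites; apply: leq_trans (kg' y) _; rewrite leq_add2r.
have cE := mu_cvg' (h := h) lE.
have [A cA] : exists A : R, (Pn h n (f 0) @[n --> \oo] --> A)%classic.
  have c : cvgn (fun n => Pn h n (f 0)).
    apply: (@Pn_cvg T T0 h (f 0) 1); first by apply: nplus_addE => //; lra.
    by move=> s; apply: nplus_addE_ge; lra.
  by exists (limn (fun n => Pn h n (f 0))).
have cB : (Pn h n (f 1) @[n --> \oo] --> A + mu T h E)%classic.
  have -> : (fun n => Pn h n (f 1)) = (fun n => Pn h n (f 0)) + (fun n => Pn h n (ind E)).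
    by apply: funext => n; rewrite /= -[RHS]gibbsD; apply: gibbs_eq => s _; rewrite /f; ring.
  exact: cvgD.
have d0 := sq 0 A ltac:(lra) ltac:(lra) cA.
have d1 := sq 1 _ ltac:(lra) ltac:(lra) cB.
have d : (Pn h n (ind (fun s => E (s \o g'))) @[n --> \oo] --> A + mu T h E - A)%classic.
  have -> : (fun n => Pn h n (ind (fun s => E (s \o g')))) =
    (fun n => Pn h n (fun s => f 1 (s \o g'))) - (fun n => Pn h n (fun s => f 0 (s \o g'))).
    apply: funext => n; rewrite /= -[RHS]gibbsB; apply: gibbs_eq => s _.
    by rewrite /f /ind; ring.
  exact: cvgB.
have := cvg_unique (@norm_hausdorff _ R) (mu_cvg' (h := h) lE') d => ->.
ring.
Qed.

End Interface.

Lemma ssum_dep (K : eqType) (l : seq K) (V : K -> bool) (G : (K -> bool) -> R) xi xi' :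
  dep_on V G -> (forall x, V x -> x \notin l -> xi x = xi' x) -> ssum l G xi = ssum l G xi'.
Proof.
move=> dG; elim: l xi xi' => [|x l IH] xi xi' e /=; first by apply: dG => x hx; apply: e.
congr (_ + _); apply: IH => y Vy yl; rewrite /upd; case: eqVneq => // yx;
by apply: e => //; rewrite inE negb_or yx.
Qed.

Lemma nbrs_sym x y : (y \in nbrs x) = (x \in nbrs y).
Proof.
case: x => a c; case: y => a' c'; rewrite !inE /e1 /e2 /d1 /d2 /= !xpair_eqE; lia.
Qed.

Lemma dep_wgt b h l : dep_on (fun x => (x \in l) || has (mem l) (nbrs x)) (wgt b h (edges_of l) (undup l)).
Proof.
move=> s t st; rewrite /wgt /energy; congr expR; congr (_ * _ + _ * _).
  apply: eq_big_seq => e; rewrite mem_undup => /flattenP[r /mapP[x xl ->]] er.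
  have ex : s x = t x by apply: st; rewrite xl.
  have en y : y \in nbrs x -> s y = t y.
    move=> yx; apply: st; apply/orP; right; apply/hasP; exists x => //.
    by rewrite -nbrs_sym.
  have ei : e \in star_edges x -> [|| e == (x, e1 x), e == (x, e2 x), e == (d1 x, x) | e == (d2 x, x)].
    by rewrite !inE.
  move/ei: er => /or4P[] /eqP ->; rewrite !chi_cons !chi_nil /= ex en //; rewrite !inE eqxx ?orbT //.
apply: eq_big_seq => x; rewrite mem_undup => xl.
by rewrite st // xl.
Qed.

Lemma tleq_of t (s s' : config) : (forall x, s x == t -> s' x == t) ->
  if t then ltc s s' else ltc s' s.
Proof.
by case: t => H x; move: (H x); case: (s x); case: (s' x) => //= /(_ isT).
Qed.

Lemma tmono_of t (E : event) :
  (forall s s' : config, (forall x, s x == t -> s' x == t) -> E s -> E s') -> tmono t E.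
Proof.
by case: t => H s s' ss'; apply: H => x; move: (ss' x); case: (s x); case: (s' x) => //= /(_ isT).
Qed.

Lemma gibbs_dlr_sub b h l l2 xi F : uniq l -> uniq l2 -> {subset l2 <= l} ->
  gibbs b h l xi F = gibbs b h l xi (fun s => gibbs b h l2 s F).
Proof.
move=> u1 u2 sub; have p := perm_split u1 u2 sub.
by rewrite !(gibbs_perm b h _ _ p) [LHS]gibbs_dlr.
Qed.

Lemma gibbs_tmono b h : 0 <= b -> forall c l xi xi' E, (forall x, xi x == c -> xi' x == c) -> tmono c E ->
  gibbs b h l xi (ind E) <= gibbs b h l xi' (ind E).
Proof.
move=> b0 c l xi xi' E /tleq_of; case: c => st mE.
  apply: (gibbs_mono b0 l (M := 0)) => //; first exact: tmono_incr.
  by move=> s; rewrite oppr0 ind_ge0.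
have := @gibbs_mono b b0 l h h xi' xi (ind (enot E)) 0 (lexx _) st (tmono_incr (tmonoC mE)).
have hh : forall s, - 0 <= ind (enot E) s by move=> s; rewrite oppr0 ind_ge0.
move=> /(_ hh).
have e y : gibbs b h l y (ind (enot E)) = 1 - gibbs b h l y (ind E).
  rewrite -[X in X - _](gibbs_cst b h l y) -gibbsB; apply: gibbs_eq => s _; exact: ind_not.
rewrite !e; lra.
Qed.

(** * Finite energy, monotonicity and continuity in the field *)

Section Conditioning.
Variables (T : R).
Hypothesis T0 : 0 < T.
Let b := T^-1.
Let b0 : 0 <= b. Proof. by rewrite invr_ge0 ltW. Qed.
Let bp : 0 < b. Proof. by rewrite invr_gt0. Qed.
Let Pn h n (F : config -> R) := gibbs b h (boxsites n) (ctrue : config) F.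

Lemma gibbs_mu_lower h n E : local n E -> tmono true E ->
  gibbs b h (boxsites n) cfalse (ind E) <= mu T h E.
Proof.
move=> lE mE; apply: (mu_ge_of T0 lE); exists n => m nm.
rewrite (gibbs_dlr_sub _ _ _ _ (boxsites_uniq m) (boxsites_uniq n) (box_sub nm)) -[leLHS](gibbs_cst b h (boxsites m) (ctrue : config)).
by apply: gibbs_le => s _; apply: (@gibbs_tmono b h b0 true).
Qed.

Definition all_plus (r : nat) : event := fun s => forall x, (normInf x <= r)%N -> s x.

Lemma local_all_plus r : local r (all_plus r).
Proof. by move=> s t st a x hx; rewrite -st ?a. Qed.

Lemma tmono_all_plus r : tmono true (all_plus r).
Proof. by move=> s t st a x hx; apply: st; apply: a. Qed.

Lemma mu_all_plus h r : 0 < mu T h (all_plus r).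
Proof.
apply: lt_le_trans (gibbs_mu_lower h (@local_all_plus r) (@tmono_all_plus r)).
rewrite /gibbs /pr divr_gt0 //; last by apply: ssum_gt0 => s; apply: expR_gt0.
set w := wgt _ _ _ _.
have gen l xi : (forall s, agree l s xi -> (forall x, x \in l -> s x) -> all_plus r s) ->
  0 < ssum l (fun s => ind (all_plus r) s * w s) xi.
  elim: l xi => [|x l IH] xi H /=.
    by rewrite ind_true ?mul1r ?expR_gt0 //; apply: H.
  apply: ltr_pwDl; last by apply: ssum_ge0 => s _; rewrite mulr_ge0 ?ind_ge0 // expR_ge0.
  apply: IH => s hs hl; apply: H; first exact: agree_cons hs.
  move=> y; rewrite inE => /predU1P[->|]; last exact: hl.
  by case: (boolP (x \in l)) => [/hl//|xl]; rewrite hs // upd_same.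
by apply: gen => s hs hl x hx; apply: hl; rewrite mem_boxsites.
Qed.

Lemma mu_mono_h h1 h2 N E : local N E -> tmono true E -> h1 <= h2 -> mu T h1 E <= mu T h2 E.
Proof.
move=> lE mE h12; apply: (ler_cvg_to (mu_cvg T0 (h := h1) lE) (mu_cvg T0 (h := h2) lE)).
apply: nearW => n; apply: (gibbs_mono b0 _ (M := 0)) => //; first exact: tmono_incr.
by move=> s; rewrite oppr0 ind_ge0.
Qed.

Lemma nsum_bound s x : - 4 <= nsum s x <= 4.
Proof.
rewrite /nsum /nbrs !big_cons big_nil.
have h y : - 1 <= spin (s y) <= 1 by case: (s y); rewrite /spin; apply/andP; split; lra.
have := h (e1 x); have := h (e2 x); have := h (d1 x); have := h (d2 x); lra.
Qed.

Lemma gibbs_site h x xi (c : bool) : gibbs b h [:: x] xi (ind (fun s => s x = c)) <=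
  expR (2 * b * ((if c then h else - h) + 4)).
Proof.
have [wp wg] : good b h [:: x] (wgt b h (edges_of [:: x]) (undup [:: x])).
  exact/good_wgt/suff_edges_of.
rewrite /gibbs /pr /=; set w := wgt _ _ _ _ in wp wg *.
have e := wg x xi (mem_head _ _); have /andP[n1 n2] := nsum_bound xi x.
have pt := wp (upd xi x true); have pf := wp (upd xi x false).
rewrite ler_pdivrMr ?addr_gt0 //.
case: c.
  rewrite ind_true ?upd_same // ind_false ?upd_same // mul1r mul0r addr0 e.
  have le : expR (2 * b * (h + nsum xi x)) <= expR (2 * b * (h + 4)).
    by rewrite ler_expR; apply: ler_wpM2l; [by rewrite mulr_ge0|move: n2; lra].
  have k : 0 < expR (2 * b * (h + nsum xi x)) by apply: expR_gt0.
  by rewrite e in pt; nra.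
rewrite ind_false ?upd_same // ind_true ?upd_same // mul1r mul0r add0r e.
have le : 1 <= expR (2 * b * (- h + 4)) * expR (2 * b * (h + nsum xi x)).
  rewrite -expRD -[leLHS]expR0 ler_expR -mulrDr; apply: mulr_ge0; [by rewrite mulr_ge0|move: n1; lra].
have k : 0 < expR (2 * b * (- h + 4)) by apply: expR_gt0.
rewrite mulrDr mulrA; nra.
Qed.

Lemma mu_site h x (c : bool) : mu T h (fun s => s x = c) <= expR (2 * b * ((if c then h else - h) + 4)).
Proof.
have lE : local (normInf x) (fun s => s x = c) by move=> s t st <-; rewrite st.
apply: (mu_le_of T0 lE); exists (normInf x) => m hm.
rewrite (gibbs_dlr_sub _ h (l2 := [:: x]) _ _ (boxsites_uniq m)) //; last first.
  by move=> y; rewrite inE => /eqP ->; rewrite mem_boxsites.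
rewrite -[leRHS](gibbs_cst b h (boxsites m) (ctrue : config)); apply: gibbs_le => s _.
exact: gibbs_site.
Qed.

Lemma Pn_cont h n E (eps : R) : 0 < eps ->
  exists2 delta : R, 0 < delta & forall h', `|h' - h| < delta ->
    `| gibbs b h' (boxsites n) (ctrue : config) (ind E) - gibbs b h (boxsites n) (ctrue : config) (ind E) | < eps.
Proof.
move=> e0.
pose B s := expR (b * bonds (edges_of (boxsites n)) s).
pose m (s : config) : R := b * \sum_(x <- undup (boxsites n)) spin (s x).
pose f h := ssum (boxsites n) (fun s => ind E s * B s * expR (h * m s)) (ctrue : config).
pose z h := ssum (boxsites n) (fun s => B s * expR (h * m s)) (ctrue : config).
have gE k : gibbs b k (boxsites n) (ctrue : config) (ind E) = f k / z k.
  have we s : wgt b k (edges_of (boxsites n)) (undup (boxsites n)) s = B s * expR (k * m s).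
    by rewrite /wgt /energy expRD /B /m mulrA (mulrC b k).
  by congr (_ / _); apply: eq_ssum => s _; rewrite we ?mulrA.
have df := @is_derive_ssum _ (boxsites n) (fun h s => ind E s * B s * expR (h * m s))
  (fun h s => ind E s * B s * m s * expR (h * m s)) (ctrue : config) h
  (fun s => is_derive_expM _ _ _).
have dz := @is_derive_ssum _ (boxsites n) (fun h s => B s * expR (h * m s))
  (fun h s => B s * m s * expR (h * m s)) (ctrue : config) h
  (fun s => is_derive_expM _ _ _).
have zp : z h != 0 by apply: lt0r_neq0; apply: ssum_gt0 => s; rewrite mulr_gt0 ?expR_gt0.
have d := is_derive_ratio df dz zp.
have cc : {for h, continuous (fun k : R => f k / z k)}.
  apply/differentiable_continuous/derivable1_diffP; by have [] := d.
have := @cvgr_dist_lt _ _ _ _ _ (fun k : R => f k / z k) (f h / z h) cc eps e0.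
case=> delta /= dp H; exists delta => // h' hh'; rewrite !gE distrC; apply: H.
by rewrite /= distrC.
Qed.

End Conditioning.

(** * Exponential mixing above the critical temperature *)

Local Notation O := origin.

Lemma mdec_mag b n : mdec b n = mag (boxsites n) (box_edges n.+1) O b.
Proof.
rewrite /mdec (gibbsE _ _ (good_wgt b 0 (suff_box (ltnSn n)))) /pr /mag.
have e s : wgt b 0 (box_edges n.+1) (boxsites n) s = expR (b * bonds (box_edges n.+1) s).
  by rewrite /wgt /energy mulr0 mul0r addr0.
by congr (_ / _); apply: eq_ssum => s _; rewrite e.
Qed.

Lemma cone_expbonds b (EE : seq (site * site)) : 0 <= b -> cone (fun s => expR (b * bonds EE s)).
Proof.
move=> b0; apply: (cone_ext _ (@cone_exp _ _ EE (fun=> b) (@edge_chars site) (fun=> b0))) => s.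
by rewrite /ham /bonds mulr_sumr.
Qed.

Lemma mdec_ge0 b n : 0 <= b -> 0 <= mdec b n.
Proof.
move=> b0; rewrite mdec_mag /mag divr_ge0 //.
  apply: gks1; apply: coneM; last exact: cone_expbonds.
  by apply: (cone_ext _ (cone_chi [:: O])) => s; rewrite chi1.
by apply: ssum_ge0 => s _; apply: expR_ge0.
Qed.

Lemma mdec_box b n y : 0 <= b ->
  forall N, (n + normInf y <= N)%N ->
  gibbs b 0 (boxsites N) (ctrue : config) (fun s => spin (s y)) <= mdec b n.
Proof.
move=> b0 N hN; rewrite mdec_ind /mdec mdec_ind lerD2r; apply: ler_wpM2l => //.
have um : uniq (map (transl y) (boxsites n)).
  by rewrite map_inj_uniq ?boxsites_uniq //; apply: can_inj (_ : cancel _ (transl (oppz y))); case: (isom_transl y).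
have ip : incr (ind (plus_at y)) by apply: tmono_incr => s t st; apply: st.
have hn s : - 0 <= ind (plus_at y) s by rewrite oppr0 ind_ge0.
apply: (le_trans (gibbs_vol_sub b0 0 (boxsites_uniq N) um _ ip hn)).
  move=> u /mapP[v]; rewrite !mem_boxsites => hv ->.
  by move: hN hv; rewrite /normInf /transl /=; lia.
rewrite (gibbs_isom _ _ _ _ _ (isom_transl y)) le_eqVlt; apply/orP; left; apply/eqP.
apply: gibbs_eq => s _; rewrite /ind /plus_at /=; congr ((`[< is_true (s _) >])%:R).
by rewrite /transl /oppz /origin; congr (_, _); rewrite subrr.
Qed.

Lemma mdec_mono b n m : 0 <= b -> (n <= m)%N -> mdec b m <= mdec b n.
Proof. by move=> b0 nm; apply: mdec_box b0 _ _; rewrite addn0. Qed.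

Lemma box_edges_uniq n : uniq (box_edges n).
Proof.
case: n => [|n]; last by have [] := suff_box (ltnSn n).
rewrite cat_uniq; apply/and3P; split.
+ by rewrite map_inj_uniq ?boxsites_uniq // => u v [].
+ apply/hasPn => e /mapP[[x y] _ ->]; apply/negP => /mapP[[u v] _].
  by rewrite /e1 /e2 /= => -[-> ->]; lia.
+ by rewrite map_inj_uniq ?boxsites_uniq // => u v [].
Qed.

Lemma mem_box_edges n e : (e \in box_edges n) = is_edge e && (normInf e.1 <= n)%N.
Proof.
rewrite /box_edges mem_cat; apply/orP/andP => [[/mapP[x]|/mapP[x]]|[]].
- by rewrite mem_boxsites => hx ->; rewrite /is_edge /= eqxx.
- by rewrite mem_boxsites => hx ->; rewrite /is_edge /= eqxx orbT.
rewrite /is_edge => /orP[] /eqP he hx; [left|right]; apply/mapP; exists e.1;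
  by rewrite ?mem_boxsites // -he -surjective_pairing.
Qed.

Lemma edge_norm e : is_edge e -> (normInf e.2 <= (normInf e.1).+1)%N /\ (normInf e.1 <= (normInf e.2).+1)%N.
Proof.
case: e => -[x y] v /orP[] /eqP /= ->; rewrite /normInf /e1 /e2 /=; split; lia.
Qed.

(* The correlations inside a fixed set do not see the size of the ambient box. *)
Lemma zin_box b n N s A : (n <= N)%N -> agree (boxsites n) s ctrue -> all (fun x => ~~ s x) A ->
  exists2 k : R, 0 < k & zin (boxsites N) (box_edges N.+1) b s A = k * zin (boxsites n) (box_edges n.+1) b s A
   /\ zin (boxsites N) (box_edges N.+1) b s [::] = k * zin (boxsites n) (box_edges n.+1) b s [::].
Proof.
move=> nN hs hA.
have sb x : ~~ s x -> (normInf x <= n)%N.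
  by rewrite -mem_boxsites; apply: contraNT => xn; rewrite hs.
pose inside (e : site * site) := ~~ s e.1 && ~~ s e.2.
have pE : perm_eq [seq e <- box_edges N.+1 | inside e] [seq e <- box_edges n.+1 | inside e].
  apply: uniq_perm; rewrite ?filter_uniq ?box_edges_uniq // => e.
  rewrite !mem_filter !mem_box_edges; case: (boolP (inside e)) => // /andP[/sb h1 _].
  by rewrite (leq_trans h1) ?(leq_trans h1) //; lia.
have p := perm_split (boxsites_uniq N) (boxsites_uniq n) (box_sub nN).
pose k : R := 2 ^+ size [seq x <- boxsites N | x \notin boxsites n].
exists k; first by rewrite exprn_gt0.
have gen B : all (fun x => ~~ s x) B -> zin (boxsites N) (box_edges N.+1) b s B = k * zin (boxsites n) (box_edges n.+1) b s B.
  move=> hB; rewrite /zin (ssum_perm _ _ p) ssum_cat -(ssum_cst _ _ (ctrue : config)); apply: eq_ssum => u hu.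
  have -> : ssum (boxsites n) (fun u => chi B u * expR (b * bonds [seq e <- box_edges N.+1 | inside e] u)) u =
     ssum (boxsites n) (fun u => chi B u * expR (b * bonds [seq e <- box_edges n.+1 | inside e] u)) u.
    by apply: eq_ssum => v _; rewrite /bonds (perm_big _ pE).
  apply: (@ssum_dep _ _ (fun x => ~~ s x)).
    move=> v v' vv; congr (_ * expR (_ * _)).
      by apply: eq_big_seq => x xB; rewrite vv //; apply: (allP hB).
    apply: eq_big_seq => e; rewrite mem_filter => /andP[/andP[i1 i2] _].
    by rewrite !chi_cons !chi_nil !vv.
  by move=> x /sb hx; rewrite mem_boxsites hx.
by split; apply: gen.
Qed.

Lemma phi_box b n N s : (n <= N)%N -> agree (boxsites n) s ctrue -> ~~ s O ->
  phi (boxsites N) (box_edges N.+1) O b s = phi (boxsites n) (box_edges n.+1) O b s.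
Proof.
move=> nN hs so.
have sb x : ~~ s x -> (normInf x <= n)%N.
  by rewrite -mem_boxsites; apply: contraNT => xn; rewrite hs.
have ce x : ~~ s x -> corr (boxsites N) (box_edges N.+1) O b s x = corr (boxsites n) (box_edges n.+1) O b s x.
  move=> sx; rewrite /corr.
  have [|k kp [-> ->]] := @zin_box b n N s [:: O; x] nN hs; first by rewrite /= so sx.
  by rewrite -mulf_div divff ?mul1r // lt0r_neq0.
rewrite /phi (@big_uniq_sub _ (box_edges N.+1) (box_edges n.+1)) ?box_edges_uniq //.
- apply: eq_bigr => e _.
  by case s1 : (s e.1); case s2 : (s e.2); rewrite /= ?mul0r ?mul1r ?ce ?s1 ?s2.
- move=> e; rewrite !mem_box_edges => /andP[-> /=]; lia.
- move=> e; rewrite !mem_box_edges => /andP[ie _]; rewrite ie /= => hn.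
  have [h1 h2] := edge_norm ie.
  have s1 : s e.1 by apply: contraNT hn => /sb hx; apply: leqW.
  have s2 : s e.2 by apply: contraNT hn => /sb hx; apply: leq_trans h2 _.
  by rewrite s1 s2 /= !mul0r addr0.
Qed.

(** Lieb's inequality with {s = -} as the inner set. A site next to this set lies in S(n + 1), hence
    sees the boundary of S(N) at distance at least N - n - 1. *)
Lemma lieb_box b n N s : 0 <= b -> (n < N)%N -> agree (boxsites n) s ctrue -> ~~ s O ->
  mdec b N <= sh b / ch b * phi (boxsites n) (box_edges n.+1) O b s * mdec b (N - n.+1).
Proof.
move=> b0 nN hs so.
have sb x : ~~ s x -> (normInf x <= n)%N.
  by rewrite -mem_boxsites; apply: contraNT => xn; rewrite hs.
rewrite -(@phi_box b n N) ?(ltnW nN) //.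
have := box_edges_uniq N.+1; have := mem_box_edges N.+1; have := good_wgt b 0 (suff_box (ltnSn N)).
move: (box_edges N.+1) => EE EEg EEm EEu; set L := boxsites N.
pose U x := ~~ s x.
pose Ei := [seq e <- EE | U e.1 && U e.2].
pose Eo := [seq e <- EE | ~~ U e.1 && ~~ U e.2].
(* Listed edges point right or up, while Lieb's inequality wants the inner end first; the edges of
   [X2] are therefore reversed in [X]. *)
pose X1 := [seq e <- EE | U e.1 && ~~ U e.2].
pose X2 := [seq e <- EE | U e.2 && ~~ U e.1].
pose X := X1 ++ map (fun e : site * site => (e.2, e.1)) X2.
have UL x : U x -> x \in L by move=> /sb hx; rewrite mem_boxsites; lia.
pose Z := ssum L (fun s => expR (b * bonds EE s)) (ctrue : config).
pose S y := ssum L (fun s => spin (s y) * expR (b * bonds EE s)) (ctrue : config).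
have Zp : 0 < Z by apply: ssum_gt0 => u; apply: expR_gt0.
have SE y : S y / Z = gibbs b 0 L (ctrue : config) (fun s => spin (s y)).
  rewrite (gibbsE _ _ EEg) /pr.
  have e u : wgt b 0 EE L u = expR (b * bonds EE u).
    by rewrite /wgt /energy mulr0 mul0r addr0.
  by congr (_ / _); apply: eq_ssum => u _; rewrite e.
have Sy y : (normInf y <= n.+1)%N -> S y <= mdec b (N - n.+1) * Z.
  by move=> hy; rewrite -ler_pdivrMr // SE; apply: mdec_box => //; lia.
have bE u : bonds (Ei ++ X ++ Eo) u = bonds EE u.
  have mk (P : pred (site * site)) (G : site * site -> R) :
    \sum_(e <- [seq e <- EE | P e]) G e = \sum_(e <- EE) (if P e then G e else 0).
    by rewrite big_filter big_mkcond.
  rewrite /bonds /X /Ei /Eo /X1 /X2 !big_cat big_map !mk /= -!big_split; apply: eq_bigr => e _ /=.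
  rewrite !chi_cons !chi_nil.
  by case: (U e.1); case: (U e.2) => /=; ring.
have H := @lieb _ L Ei Eo b U O _ b0.
have inU e : e \in Ei -> U e.1 && U e.2 by rewrite mem_filter => /andP[].
have H1 : uniq Ei by rewrite filter_uniq.
have H2 e : e \in Ei -> (e.1 \in L) && (e.2 \in L) by move=> /inU /andP[/UL -> /UL ->].
have H3 e : e \in Eo -> ~~ U e.1 && ~~ U e.2 by rewrite mem_filter => /andP[].
have H4 e : e \in X -> U e.1 && ~~ U e.2.
  by rewrite mem_cat => /orP[|/mapP[e' he' ->]]; [|move: he']; rewrite mem_filter => /andP[].
have {H} := H H1 H2 inU H3 (UL O so) so X _ H4 erefl.
have eS y : ssum L (fun u => spin (u y) * expR (b * bonds (Ei ++ X ++ Eo) u)) (ctrue : config) = S y.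
  by apply: eq_ssum => u _; rewrite bE.
pose P y := zin L EE b s [:: O; y].
pose Pn := zin L EE b s [::].
have Pp : 0 < Pn by apply: zin_gt0.
rewrite eS; under eq_bigr do rewrite eS -/(P _).
have -> : ssum L (fun u => expR (b * bonds Ei u)) (ctrue : config) = Pn.
  by apply: eq_ssum => u _; rewrite chi_nil mul1r.
move=> H.
have t0 : 0 <= sh b / ch b by rewrite divr_ge0 ?sh_ge0 // (le_trans ler01) ?ch_ge1.
have P0 y : 0 <= P y by apply: gks1; apply: coneM; [apply: cone_chi|apply: cone_expbonds].
have H5 : Pn * S O <= \sum_(e <- X) sh b / ch b * P e.1 * (mdec b (N - n.+1) * Z).
  apply: le_trans H _; rewrite big_seq [leRHS]big_seq; apply: ler_sum => e eX.
  apply: ler_wpM2l; first by rewrite mulr_ge0 ?P0.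
  have /andP[u1 u2] := H4 e eX; apply: Sy.
  have ie : is_edge e \/ is_edge (e.2, e.1).
    move: eX; rewrite mem_cat => /orP[|/mapP[e' he' ->]].
      by rewrite mem_filter EEm => /andP[_ /andP[ie _]]; left.
    by right; move: he'; rewrite mem_filter EEm => /andP[_ /andP[ie _]] /=; case: (e') ie.
  have h1 := sb _ u1.
  have k : (normInf e.2 <= (normInf e.1).+1)%N by case: ie => /edge_norm [].
  exact: leq_trans k _.
have eP : \sum_(e <- X) P e.1 = Pn * phi L EE O b s.
  have mk (Q : pred (site * site)) (G : site * site -> R) :
    \sum_(e <- [seq e <- EE | Q e]) G e = \sum_(e <- EE) (if Q e then G e else 0).
    by rewrite big_filter big_mkcond.
  rewrite /X /X1 /X2 big_cat big_map !mk /= -big_split /phi mulr_sumr; apply: eq_bigr => e _ /=.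
  rewrite /U /corr -/(P e.1) -/(P e.2) -/Pn.
  by case: (s e.1); case: (s e.2); rewrite /= ?mul0r ?mul1r ?addr0 ?add0r ?mulr0 // mulrC divfK ?lt0r_neq0.
have -> : mdec b N = S O / Z by rewrite SE.
rewrite ler_pdivrMr // -(ler_pM2l Pp); apply: le_trans H5 _.
rewrite -mulr_suml -mulr_sumr eP le_eqVlt; apply/orP; left; apply/eqP; ring.
Qed.

Lemma sh_le_ch b : 0 <= b -> 0 <= sh b / ch b <= 1.
Proof.
move=> b0; have c1 := ch_ge1 b; have s0 := sh_ge0 b0.
have cp : 0 < ch b by lra.
rewrite divr_ge0 ?(ltW cp) //= ler_pdivrMr // mul1r /sh /ch.
have := expR_gt0 (- b); lra.
Qed.

Lemma sh_small b : 0 <= b -> b <= 1 -> sh b / ch b <= b * expR 1.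
Proof.
move=> bp b1; have cp : 0 < ch b by rewrite (lt_le_trans ltr01) ?ch_ge1.
rewrite ler_pdivrMr //.
have c1 := ch_ge1 b.
have h1 : expR b - 1 <= b * expR 1.
  have h : 1 + - b <= expR (- b) by apply: expR_ge1Dx.
  have hb : expR b <= expR 1 by rewrite ler_expR.
  have e : expR b * expR (- b) = 1 by rewrite -expRD subrr expR0.
  have p := expR_gt0 b; nra.
have h2 : 1 - expR (- b) <= b by have : 1 + - b <= expR (- b) := expR_ge1Dx _; lra.
have h3 : 1 <= expR 1 :> R by have : 1 + 1 <= expR 1 := @expR_ge1Dx R 1; lra.
have h4 : sh b <= b * expR 1 by rewrite /sh; nra.
have : 0 <= b * expR 1 by rewrite mulr_ge0 ?expR_ge0.
nra.
Qed.

Lemma mdec_le1 b n : mdec b n <= 1.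
Proof.
rewrite -[leRHS](gibbs_cst b 0 (boxsites n) (ctrue : config)); apply: gibbs_le => s _.
by case: (s O); rewrite /spin; lra.
Qed.

Lemma half_decay b n s : 0 <= b -> agree (boxsites n) s ctrue -> ~~ s O ->
  sh b / ch b * phi (boxsites n) (box_edges n.+1) O b s <= 1 / 2 ->
  forall k, mdec b (k * n.+1) <= 2^-1 ^+ k.
Proof.
move=> b0 hs so hp; elim=> [|k IH]; first by rewrite expr0 mdec_le1.
have lt : (n < k.+1 * n.+1)%N by rewrite mulSn; lia.
apply: le_trans (lieb_box b0 lt hs so) _.
have -> : (k.+1 * n.+1 - n.+1 = k * n.+1)%N by rewrite mulSn addKn.
rewrite exprS; have := mdec_ge0 (k * n.+1) b0; move: hp IH; nra.
Qed.

Lemma magn_cvg T : 0 < T -> (mdec T^-1 n @[n --> \oo] --> magn T)%classic.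
Proof.
move=> T0; have b0 : 0 <= T^-1 by rewrite invr_ge0 ltW.
have e : (fun m => 2 * muFin T 0 m (fun s => s origin) - 1) = (fun n => mdec T^-1 n).
  by apply: funext => n; rewrite muFinE /mdec mdec_ind.
rewrite /magn e; apply: nonincreasing_is_cvgn.
  by move=> m n mn; apply: mdec_mono.
by exists 0 => _ [n _ <-]; apply: mdec_ge0.
Qed.

Lemma half_pow_small (eps : R) : 0 < eps -> exists k, 2^-1 ^+ k < eps.
Proof.
move=> e0; have [k hk] : exists k : nat, eps^-1 < k%:R.
  by exists (Num.truncn eps^-1).+1; apply: truncnS_gt.
exists k; rewrite exprVn -[eps]invrK ltf_pV2 ?posrE ?invr_gt0 ?exprn_gt0 //.
apply: lt_le_trans hk _; rewrite -natrX ler_nat.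
exact/ltnW/ltn_expl.
Qed.

Lemma magn_le_mdec T n : 0 < T -> magn T <= mdec T^-1 n.
Proof.
move=> T0; have b0 : 0 <= T^-1 by rewrite invr_ge0 ltW.
by apply: (cvgr_to_le (magn_cvg T0)); exists n => // m /= hm; apply: mdec_mono.
Qed.

Lemma magn_le0 T n s : 0 < T -> agree (boxsites n) s ctrue -> ~~ s O ->
  sh T^-1 / ch T^-1 * phi (boxsites n) (box_edges n.+1) O T^-1 s <= 1 / 2 -> magn T <= 0.
Proof.
move=> T0 hs so hp; have b0 : 0 <= T^-1 by rewrite invr_ge0 ltW.
rewrite leNgt; apply/negP => m0; have [k hk] := half_pow_small m0.
have := half_decay b0 hs so hp k; have := magn_le_mdec (k * n.+1) T0; lra.
Qed.

Lemma phi_le b n s : 0 <= b ->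
  phi (boxsites n) (box_edges n.+1) O b s <= 2 * (size (box_edges n.+1))%:R.
Proof.
move=> b0.
have c1 x : corr (boxsites n) (box_edges n.+1) O b s x <= 1.
  rewrite /corr ler_pdivrMr ?zin_gt0 // mul1r; apply: ler_ssum => u _.
  by apply: ler_wpM2r; [apply: expR_ge0|rewrite chi_nil; apply: chi_le1].
have -> : 2 * (size (box_edges n.+1))%:R = \sum_(e <- box_edges n.+1) (2 : R).
  by rewrite big_const_seq count_predT iter_addr_0 mulr_natr.
apply: ler_sum => e _.
have := c1 e.1; have := c1 e.2.
by case: (s e.1); case: (s e.2); rewrite /= ?mul0r ?mul1r ?addr0 ?add0r; lra.
Qed.

(** The one-point set has small flux at high temperature. This bounds the set whose supremum is
    [Tc], so that [Tc] is a true least upper bound when this set is nonempty. *)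
Lemma high_temperature : exists2 T0 : R, 0 < T0 & forall T, T0 <= T -> magn T <= 0.
Proof.
pose C : R := 2 * (size (box_edges 1))%:R * expR 1.
have C0 : 0 <= C by rewrite /C !mulr_ge0 ?expR_ge0.
exists (2 * C + 1) => [|T hT]; first lra.
have T0 : 0 < T by lra.
have b0 : 0 <= T^-1 by rewrite invr_ge0 ltW.
have b1 : T^-1 <= 1 by rewrite invf_le1 //; lra.
pose s : config := fun x => x != O.
apply: (@magn_le0 T 0 s) => //; rewrite /s ?eqxx //.
  move=> x; rewrite mem_boxsites; case: (eqVneq x O) => [->|] //.
have h1 := sh_small b0 b1; have /andP[h0 _] := sh_le_ch b0.
have h2 := @phi_le T^-1 0 s b0.
apply: (le_trans (ler_wpM2l h0 h2)).
apply: (le_trans (ler_wpM2r _ h1)); first by rewrite mulr_ge0.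
have e : T^-1 * expR 1 * (2 * (size (box_edges 1))%:R) = C * T^-1 by rewrite /C; ring.
by rewrite e ler_pdivrMr //; lra.
Qed.

Lemma Tc_ge0 : 0 <= Tc.
Proof.
rewrite /Tc; set A := (X in sup X).
have [T0 T0p H] := high_temperature.
case: (pselect (A !=set0)%classic) => [[t At]|nA].
  apply: (le_trans (y := t)); first by case: At => /ltW.
  apply: ub_le_sup => //; exists T0 => u [_ mu0].
  by rewrite leNgt; apply/negP => /ltW /H; lra.
(* The supremum of the empty set is 0 by convention. *)
by rewrite sup_out // => -[/nA].
Qed.

Lemma magn_above T : Tc < T -> magn T <= 0.
Proof.
move=> hT; rewrite leNgt; apply/negP => m0; have T0 := le_lt_trans Tc_ge0 hT.
have [T1 T1p H] := high_temperature.
suff : T <= Tc by lra.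
apply: ub_le_sup; last by split.
exists T1 => u [_ mu0].
by rewrite leNgt; apply/negP => /ltW /H; lra.
Qed.

(* Sharpness: if every finite set had a boundary flux at least 1/2 at inverse temperature
   1/T, the differential inequality would produce spontaneous magnetization at every
   temperature below T, in particular above Tc. *)
Lemma mdec_exp T : Tc < T -> exists2 L, (0 < L)%N & forall k, mdec T^-1 (k * L) <= 2^-1 ^+ k.
Proof.
move=> hT; have T0 := le_lt_trans Tc_ge0 hT.
pose T1 := (Tc + T) / 2.
have c0 := Tc_ge0.
have hT1 : Tc < T1 by rewrite /T1; lra.
have T1T : T1 < T by rewrite /T1; lra.
have T10 : 0 < T1 by lra.
have b0 : 0 <= T^-1 by rewrite invr_ge0 ltW.
have b12 : T^-1 < T1^-1 by rewrite ltf_pV2 ?posrE.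
suff [n [s [hs so hp]]] : exists n s, [/\ agree (boxsites n) s ctrue, ~~ s O &
    phi (boxsites n) (box_edges n.+1) O T^-1 s < 1 / 2].
  exists n.+1 => //; apply: half_decay hs so _ => //.
  have /andP[h0 h1] := sh_le_ch b0.
  by apply: (le_trans (ler_wpM2l h0 (ltW hp))); move: h1; lra.
apply: contrapT => H.
have H' n s : agree (boxsites n) s ctrue -> ~~ s O -> 1 / 2 <= phi (boxsites n) (box_edges n.+1) O T^-1 s.
  by move=> hs so; rewrite leNgt; apply/negP => h; apply: H; exists n, s.
(* With [mdec] below 1/2 at the lower temperature, the differential inequality gives an increase of
   at least a quarter of the difference of the inverse temperatures, against the bound by an
   eighth. *)
pose eps : R := Num.min (1 / 2) ((T1^-1 - T^-1) / 8).
have e0 : 0 < eps by rewrite /eps lt_min; apply/andP; split; lra.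
have [n hn] : exists n, mdec T1^-1 n < eps.
  have m0 := magn_above hT1.
  have c := magn_cvg T10.
  have [n _ h] : (\forall n \near \oo, mdec T1^-1 n < eps)%classic.
    by apply: (cvgr_lt (magn T1)) => //; apply: le_lt_trans e0.
  by exists n; apply: h => /=.
have := @sharp_dichotomy _ (boxsites n) (box_edges n.+1) O (boxsites_uniq n) (box_edges_uniq n.+1)
  T^-1 T1^-1 (1 / 2) b0 b12 _ (H' n).
rewrite -!mdec_mag => /(_ _) h.
have {}h := h ltac:(lra).
have d0 := mdec_ge0 n b0.
have : eps <= 1 / 2 by rewrite /eps ge_min lexx.
have : eps <= (T1^-1 - T^-1) / 8 by rewrite /eps ge_min lexx orbT.
nra.
Qed.

(** Two powers pay for the sites of the box in [Delta]; the third makes [Delta] of order 1 / n, as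
    the lower bound of order R / n requires. *)
Lemma mdec_decay T (delta : R) : Tc < T -> 0 < delta ->
  exists N, forall n, (N <= n)%N -> ((2 * n).+1 ^ 3)%:R * mdec T^-1 n <= delta.
Proof.
move=> hT d0; have T0 := le_lt_trans Tc_ge0 hT.
have b0 : 0 <= T^-1 by rewrite invr_ge0 ltW.
have [L L0 H] := mdec_exp hT.
pose C : nat := (512 * L ^ 3)%N.
have [J hJ] : exists J : nat, C%:R / delta < J%:R.
  by exists (Num.truncn (C%:R / delta)).+1; apply: truncnS_gt.
exists (4 * L * J)%N => n hn.
pose q := (n %/ L)%N; pose j := (q %/ 4)%N.
have qJ : (4 * J <= q)%N by rewrite /q leq_divRL //; lia.
have jJ : (J <= j)%N by rewrite /j leq_divRL //; lia.
have nq : (n < L * (q.+1))%N by rewrite mulnC ltn_ceil.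
have qj : (q < 4 * j.+1)%N by rewrite mulnC ltn_ceil.
have jq : (4 * j <= q)%N by rewrite mulnC leq_trunc_div.
have m1 : mdec T^-1 n <= 2^-1 ^+ q.
  by apply: le_trans (H q); apply: mdec_mono => //; apply: leq_trunc_div.
have n1 : ((2 * n).+1 ^ 3 <= C * j.+1 ^ 3)%N.
  have : ((2 * n).+1 <= 8 * L * j.+1)%N by nia.
  rewrite -(leq_exp2r _ _ (isT : (0 < 3)%N)) => /leq_trans; apply.
  by rewrite !expnMn /C.
have p1 : 2^-1 ^+ q <= ((j.+1 ^ 4)%:R)^-1 :> R.
  rewrite exprVn lef_pV2 ?posrE ?exprn_gt0 ?ltr0n ?expn_gt0 //.
  rewrite -natrX ler_nat; apply: leq_trans (leq_pexp2l (isT : (0 < 2)%N) jq).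
  by rewrite mulnC expnM leq_exp2r //; apply: ltn_expl.
have m0 := mdec_ge0 n b0.
apply: (le_trans (y := (C * j.+1 ^ 3)%:R * ((j.+1 ^ 4)%:R)^-1)).
  by apply: ler_pM => //; [rewrite ler_nat|apply: le_trans m1 p1].
rewrite natrM !natrX exprS -mulrA.
have jp : 0 < j.+1%:R :> R by rewrite ltr0n.
have -> : j.+1%:R ^+ 3 / (j.+1%:R * j.+1%:R ^+ 3) = j.+1%:R^-1 :> R.
  by rewrite invfM mulrCA divff ?mulr1 // expf_neq0 // lt0r_neq0.
rewrite ler_pdivrMr // -ler_pdivrMl // mulrC.
apply: le_trans (ltW hJ) _; rewrite ler_nat; exact: leqW.
Qed.

(** * Planar topology *)

Definition sadj : rel site := fun x y => (maxn (absz (x.1 - y.1)) (absz (x.2 - y.2)) == 1)%N.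
(* Plus paths ([t = true]) use adj, minus paths ([t = false]) star adjacency. *)
Definition radj (t : bool) : rel site := if t then adj else sadj.

Lemma adj_sym : symmetric adj. Proof. by move=> x y; rewrite /adj; lia. Qed.
Lemma sadj_sym : symmetric sadj. Proof. by move=> x y; rewrite /sadj; lia. Qed.
Lemma radj_sym t : symmetric (radj t). Proof. by case: t; [apply: adj_sym|apply: sadj_sym]. Qed.
Lemma adj_sadj x y : adj x y -> sadj x y. Proof. by rewrite /adj /sadj; lia. Qed.
Lemma adj_radj t x y : adj x y -> radj t x y. Proof. by case: t => //=; apply: adj_sadj. Qed.
Lemma radj_sadj t x y : radj t x y -> sadj x y. Proof. by case: t => //=; apply: adj_sadj. Qed.

Lemma adj_cases (u v : site) : adj u v -> v = (u.1 + 1, u.2) \/ v = (u.1, u.2 + 1) \/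
  u = (v.1 + 1, v.2) \/ u = (v.1, v.2 + 1).
Proof.
rewrite /adj => h.
have [[e f]|[[e f]|[[e f]|[e f]]]] : (v.1 = u.1 + 1 /\ v.2 = u.2) \/ (v.1 = u.1 /\ v.2 = u.2 + 1) \/
       (u.1 = v.1 + 1 /\ u.2 = v.2) \/ (u.1 = v.1 /\ u.2 = v.2 + 1) by lia.
- by left; rewrite [v]surjective_pairing e f.
- by right; left; rewrite [v]surjective_pairing e f.
- by right; right; left; rewrite [u]surjective_pairing e f.
- by right; right; right; rewrite [u]surjective_pairing e f.
Qed.

Definition lk (r : rel site) (X : site -> bool) (x y : site) : Prop :=
  exists p, [/\ path r x p, all X (x :: p) & last x p = y].

Section Linked.
Variable r : rel site.
Implicit Types (X : site -> bool).

Lemma lk_refl X x : X x -> lk r X x x.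
Proof. by move=> h; exists [::]; rewrite /= h. Qed.

Lemma lk_trans X x y z : lk r X x y -> lk r X y z -> lk r X x z.
Proof.
move=> [p [pp ap lp]] [q [pq aq lq]]; exists (p ++ q); split.
- by rewrite cat_path pp lp.
- by move: ap aq; rewrite /= all_cat => /andP[-> ->] /andP[_ ->].
- by rewrite last_cat lp.
Qed.

Lemma lk_step X x y : X x -> X y -> r x y -> lk r X x y.
Proof. by move=> hx hy h; exists [:: y]; rewrite /= hx hy h. Qed.

Lemma lk_sub X (Y : site -> bool) x y : (forall z, X z -> Y z) -> lk r X x y -> lk r Y x y.
Proof. by move=> h [p [pp ap lp]]; exists p; split => //; apply: sub_all ap. Qed.

Lemma lk_fst X x y : lk r X x y -> X x.
Proof. by move=> [p [_ /= /andP[]]]. Qed.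

Lemma lk_ind X x (P : site -> Prop) : P x ->
  (forall u v, P u -> X u -> X v -> r u v -> P v) -> forall y, lk r X x y -> P y.
Proof.
move=> Px H y [p]; elim: p x Px => [|z p IH] x Px [/= pp ap lp]; first by rewrite -lp.
move: pp ap => /andP[xz pp] /and3P[Xx Xz ap].
by apply: (IH z); [apply: H Xz xz|split; rewrite //= Xz].
Qed.

Lemma lk_snd X x y : lk r X x y -> X y.
Proof. by move=> h; have h0 := lk_fst h; move: y h; apply: lk_ind. Qed.

Hypothesis rsym : symmetric r.

Lemma lk_sym X x y : lk r X x y -> lk r X y x.
Proof.
move=> h; have Xx := lk_fst h; move: y h; apply: lk_ind; first exact: lk_refl.
by move=> u v h Xu Xv uv; apply: lk_trans h; apply: lk_step => //; rewrite rsym.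
Qed.

End Linked.

Lemma lk_pre (r : rel site) X x p u : path r x p -> all X (x :: p) -> u \in x :: p -> lk r X x u.
Proof.
elim: p x => [|z p IH] x /=; first by rewrite inE => _ /andP[h _] /eqP ->; apply: lk_refl.
move=> /andP[xz pp] /and3P[Xx Xz ap]; rewrite inE => /predU1P[->|h]; first exact: lk_refl.
by apply: lk_trans (lk_step Xx Xz xz) _; apply: IH => //=; rewrite Xz.
Qed.

(** * A Jordan curve argument by parity of crossings *)

Fixpoint par (f : site -> site -> bool) (x : site) (p : seq site) : bool :=
  if p is y :: p' then f x y (+) par f y p' else false.

Lemma par_eq (f g : site -> site -> bool) (r : rel site) (X : site -> bool) x p :
  path r x p -> all X (x :: p) -> (forall u v, r u v -> X u -> X v -> f u v = g u v) ->
  par f x p = par g x p.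
Proof.
elim: p x => //= z p IH x /andP[xz pp] /and3P[Xx Xz ap] h.
by rewrite h // IH //= Xz.
Qed.

Lemma par_add f g x p : par (fun u v => f u v (+) g u v) x p = par f x p (+) par g x p.
Proof.
elim: p x => //= z p IH x; rewrite IH.
by case: (f x z); case: (g x z); case: (par f z p); case: (par g z p).
Qed.

Lemma par_cob (I : site -> bool) x p : par (fun u v => I u (+) I v) x p = I x (+) I (last x p).
Proof.
elim: p x => [|z p IH] x /=; first by rewrite addbb.
by rewrite IH; case: (I x); case: (I z); case: (I (last z p)).
Qed.

(* The step (u, w) of a star path crosses, between the rows v.2 and v.2 + 1, the half-line
   to the left of v. *)
Definition stp (v : site) (u w : site) : bool :=
  ((u.2 == v.2) && (w.2 == v.2 + 1) && (u.1 < v.1)) || ((w.2 == v.2) && (u.2 == v.2 + 1) && (w.1 < v.1)).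

Lemma ltS_neq (x a : int) : x != a -> (x < a + 1) = (x < a). Proof. by lia. Qed.
Lemma lt_near (x y a : int) : (absz (x - y) <= 1)%N -> x != a -> y != a -> (x < a) = (y < a). Proof. lia. Qed.
Lemma stp_right a b z w : z != (a, b) -> w != (a, b) -> stp (a, b) z w = stp (a + 1, b) z w.
Proof.
case: z w => [z1 z2] [w1 w2]; rewrite /stp /= !xpair_eqE => hz hw.
case: (eqVneq z2 b) hz => [->|h1] hz; case: (eqVneq w2 b) hw => [->|h2] hw //=;
  rewrite ?andbT ?ltS_neq //; by move: hz hw; rewrite ?andbT.
Qed.
Lemma stp_up a b z w (I := fun z : site => (z.2 == b + 1) && (z.1 < a)) : sadj z w ->
  z != (a, b) -> z != (a, b + 1) -> w != (a, b) -> w != (a, b + 1) ->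
  stp (a, b) z w (+) stp (a, b + 1) z w = I z (+) I w.
Proof.
case: z w => [z1 z2] [w1 w2]; rewrite /sadj /stp /I /= !xpair_eqE => h hz hz' hw hw'.
have h1 : (absz (z1 - w1) <= 1)%N by lia.
have [e|[e|e]] : w2 = z2 \/ w2 = z2 + 1 \/ z2 = w2 + 1 by lia.
- subst w2; clear h.
  have -> : (z2 == b) && (z2 == b + 1) = false by lia.
  have -> : (z2 == b + 1) && (z2 == b + 1 + 1) = false by lia.
  case: (eqVneq z2 (b + 1)) hz' hw' => [_|_] /=; rewrite ?andbF ?andFb //= !andbT => k1 k2.
  by rewrite (@lt_near z1 w1 a) // addbb.
- subst w2; clear h; have k : z2 + 1 == b = (z2 == b - 1) by lia.
  rewrite !(inj_eq (addIr 1)) !k !andbb.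
  have -> : (z2 == b - 1) && (z2 == b + 1) = false by lia.
  have -> : (z2 == b) && (z2 == b + 1 + 1) = false by lia.
  rewrite !andFb !orbF; move: hw' hz; rewrite (inj_eq (addIr 1)) => hw' hz.
  rewrite addbC; congr addb.
  case: (eqVneq z2 b) hw' hz => //= _; rewrite !andbT => k1 k2; exact: lt_near.
- subst z2; clear h; have k : w2 + 1 == b = (w2 == b - 1) by lia.
  rewrite !(inj_eq (addIr 1)) !k !andbb.
  have -> : (w2 == b - 1) && (w2 == b + 1) = false by lia.
  have -> : (w2 == b) && (w2 == b + 1 + 1) = false by lia.
  rewrite !andFb /=; move: hz' hw; rewrite (inj_eq (addIr 1)) => hz' hw.
  congr addb; case: (eqVneq w2 b) hz' hw => //= _; rewrite !andbT => k1 k2.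
  by apply: lt_near => //; lia.
Qed.

Lemma stp_int (z w : site) (b : int) : sadj z w ->
  ((z.2 == b) && (w.2 == b + 1)) || ((w.2 == b) && (z.2 == b + 1)) = (z.2 <= b) (+) (w.2 <= b).
Proof.
rewrite /sadj => h; have [->|[->|e]] : w.2 = z.2 \/ w.2 = z.2 + 1 \/ z.2 = w.2 + 1 by lia.
- by rewrite addbb; lia.
- by clear h; lia.
- by rewrite e; clear h e; lia.
Qed.

(** The parity with which the star path crosses the half-line to the left of v does not change when
    v moves along a disjoint lattice path. It is even at the left end, where the star path stays to
    the right, and odd at the right end, where the whole star path lies to the left. *)
Lemma cross_core (c d : int) x p y q :
  path adj x p -> path sadj y q ->
  all (fun z => (c <= z.2) && (z.2 <= d)) (x :: p) -> y.2 < c -> d < (last y q).2 ->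
  all (fun z => x.1 <= z.1) (y :: q) -> all (fun z => z.1 < (last x p).1) (y :: q) ->
  exists2 u, u \in x :: p & u \in y :: q.
Proof.
move=> px pq hp hy hq hl hr; apply: contrapT => H.
have nin u : u \in x :: p -> u \notin y :: q.
  by move=> h; apply/negP => h'; apply: H; exists u.
pose L v := par (stp v) y q.
have stepL u v : u \in x :: p -> v \in x :: p -> adj u v -> L u = L v.
  suff gen u' v' : u' \in x :: p -> v' \in x :: p -> (v' = (u'.1 + 1, u'.2) \/ v' = (u'.1, u'.2 + 1)) -> L u' = L v'.
    move=> hu hv /adj_cases[e|[e|[e|e]]].
    - by apply: gen => //; left.
    - by apply: gen => //; right.
    - by apply/esym/gen => //; left.
    - by apply/esym/gen => //; right.
  move=> hu hv hh.
  have nu z : z \in y :: q -> z != u' by move=> zq; apply: contraTneq zq => ->; apply: nin.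
  have nv z : z \in y :: q -> z != v' by move=> zq; apply: contraTneq zq => ->; apply: nin.
  pose X z := (z != u') && (z != v').
  have aX : all X (y :: q) by apply/allP => z zq; rewrite /X nu ?nv.
  case: hh => e.
    apply: (par_eq pq aX) => z w _ /andP[zu _] /andP[wu _].
    by rewrite e [u']surjective_pairing; apply: stp_right; rewrite -surjective_pairing.
  apply: (@addbI (L v')); rewrite addbb -par_add.
  pose I z := (z.2 == v'.2) && (z.1 < v'.1).
  transitivity (par (fun z w => I z (+) I w) y q).
    apply: (par_eq pq aX) => z w zw /andP[zu zv] /andP[wu wv].
    move: zu zv wu wv; rewrite /I e /=; case: (u') => a1 b1 /= zu zv wu wv.
    by rewrite addbC stp_up.
  rewrite par_cob /I.
  have /andP[k1 k2] := allP hp _ hv.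
  by rewrite (lt_eqF (lt_le_trans hy k1)) (gt_eqF (le_lt_trans k2 hq)).
have Lx : forall z, lk adj (fun z => z \in x :: p) x z -> L z = L x.
  apply: lk_ind => // u v <- hu hv uv; exact/esym/stepL.
have Ll : L (last x p) = L x.
  apply: Lx; apply: (lk_pre px) (mem_last _ _); exact/allP.
have L0 : L x = false.
  have -> : L x = par (fun z w => false (+) false) y q.
    apply: (par_eq pq hl) => z w _ hz hw; by rewrite /stp (ltNge z.1) (ltNge w.1) hz hw !andbF.
  by rewrite (par_cob (fun=> false)).
have : L (last x p) = true.
  pose I (z : site) := z.2 <= (last x p).2.
  have -> : L (last x p) = par (fun z w => I z (+) I w) y q.
    by apply: (par_eq pq hr) => z w zw hz hw; rewrite /stp /I hz hw !andbT; apply: stp_int.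
  rewrite par_cob /I; have /andP[k1 k2] := allP hp _ (mem_last x p).
  by rewrite (ltW (lt_le_trans hy k1)) leNgt (le_lt_trans k2 hq).
by rewrite Ll L0.
Qed.

Lemma cross_adj_sadj (a b c d : int) x p y q :
  path adj x p -> path sadj y q ->
  all (fun z => (c <= z.2) && (z.2 <= d)) (x :: p) -> all (fun z => (a <= z.1) && (z.1 <= b)) (y :: q) ->
  x.1 <= a -> b <= (last x p).1 -> y.2 <= c -> d <= (last y q).2 ->
  exists2 u, u \in x :: p & u \in y :: q.
Proof.
move=> px pq hp hq xa xb yc yd.
(* [cross_core] wants strict inequalities, so the paths are prolonged by one site; the common site
   found is then shown to be none of the added ones. *)
pose y0 : site := (y.1, y.2 - 1); pose yl : site := ((last y q).1, (last y q).2 + 1).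
pose xl : site := ((last x p).1 + 1, (last x p).2).
have px' : path adj x (rcons p xl).
  by rewrite rcons_path px /xl; clear; case: (last x p) => e f; rewrite /adj /=; lia.
have pq' : path sadj y0 (y :: rcons q yl).
  rewrite /= rcons_path pq /yl /y0; clear; case: (last y q) => e f; case: y => g h.
  by rewrite /sadj /=; lia.
have /andP[k1 k2] := allP hp _ (mem_last x p).
have /andP[k3 k4] := allP hq _ (mem_last y q).
have /andP[k5 k6] := allP hq _ (mem_head y q).
have lt1 (e f : int) : e <= f -> e < f + 1 by lia.
have h1 : all (fun z => x.1 <= z.1) (y :: q).
  by apply: sub_all hq => z /andP[h _]; apply: le_trans xa h.
have h2 : all (fun z => z.1 < xl.1) (y :: q).
  by apply: sub_all hq => z /andP[_ h]; apply: lt1; apply: le_trans h xb.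
have [|||||u ux uy] := @cross_core c d x (rcons p xl) y0 (y :: rcons q yl) px' pq'.
- by rewrite -rcons_cons all_rcons hp /xl k1 k2.
- by rewrite /y0 /=; move: yc; clear; lia.
- by rewrite last_cons last_rcons /yl /=; apply: lt1.
- move: h1; rewrite -rcons_cons [all _ (y0 :: _)]/= all_rcons /= => /andP[-> ->].
  by rewrite (le_trans xa k3).
- rewrite last_rcons; move: h2; rewrite -rcons_cons [all _ (y0 :: _)]/= all_rcons /= => /andP[-> ->].
  by rewrite lt1 // (le_trans k4 xb).
move: ux; rewrite -rcons_cons mem_rcons in_cons => ux.
move: uy; rewrite -rcons_cons in_cons mem_rcons in_cons => uy.
have uxl : u != xl.
  apply/eqP => e; have nq : xl \notin y :: q.
    by apply/negP => /(allP h2); rewrite ltxx.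
  move: uy; rewrite e (negbTE nq) orbF => /orP[] /eqP [].
    by move=> h _; move: (lt1 _ _ (le_trans k6 xb)); rewrite h ltxx.
  by move=> h _; move: (lt1 _ _ (le_trans k4 xb)); rewrite h ltxx.
have ux' : u \in x :: p by move: ux; rewrite (negbTE uxl).
exists u => //; have /andP[k7 k8] := allP hp _ ux'.
have : (u != y0) && (u != yl).
  apply/andP; split; apply/eqP => e; move: k7 k8; rewrite e /=.
    by move: yc; clear; lia.
  by move: yd; clear; lia.
by case/andP => h h'; move: uy; rewrite (negbTE h) (negbTE h').
Qed.

Lemma radj_cases t (u v : site) : radj t u v -> adj u v \/
  [/\ t = false, adj u (v.1, u.2) & adj (v.1, u.2) v].
Proof.
case: t => /=; first by left.
by case: u v => [u1 u2] [v1 v2]; rewrite /sadj /adj /= => h;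
  case: (boolP (absz (u1 - v1) + absz (u2 - v2) == 1)%N) => h'; [left|right; split => //; lia].
Qed.

Lemma lk_map (f : site -> site) (r r' : rel site) (X Y : site -> bool) x y :
  (forall u v, X u -> X v -> r u v -> r' (f u) (f v)) -> (forall z, X z -> Y (f z)) ->
  lk r X x y -> lk r' Y (f x) (f y).
Proof.
move=> hr hX h; have Xx := lk_fst h; move: y h; apply: lk_ind; first exact/lk_refl/hX.
by move=> u v h Xu Xv uv; apply: lk_trans h _; apply: lk_step; [exact: hX|exact: hX|exact: hr].
Qed.

Lemma lk_self (r : rel site) X x y : lk r X x y -> lk r (fun z => `[< lk r X x z >]) x y.
Proof.
move=> h; have Xx := lk_fst h.
suff [_ ?] : lk r X x y /\ lk r (fun z => `[< lk r X x z >]) x y by [].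
move: y h; apply: lk_ind; first by split; apply: lk_refl => //; apply/asboolP/lk_refl.
move=> u v [h1 h2] Xu Xv uv; have h3 := lk_trans h1 (lk_step Xu Xv uv).
by split => //; apply: lk_trans h2 _; apply: lk_step => //; apply/asboolP.
Qed.

Lemma lk_enter (r : rel site) (X : site -> bool) (f : site -> int) (a : int) x y :
  (forall u v, r u v -> (absz (f u - f v) <= 1)%N) -> lk r X x y -> f x <= a -> a <= f y ->
  exists x', [/\ f x' = a, lk r X x x' & lk r (fun z => X z && (a <= f z)) x' y].
Proof.
move=> fr h fx; have Xx := lk_fst h.
suff [_] : lk r X x y /\ (a <= f y ->
  exists x', [/\ f x' = a, lk r X x x' & lk r (fun z => X z && (a <= f z)) x' y]) by [].
move: y h; apply: lk_ind.
  split=> [|h]; first exact: lk_refl.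
  by exists x; split; [lia|exact: lk_refl|apply: lk_refl; rewrite Xx].
move=> u v [h1 h2] Xu Xv uv; have h3 := lk_trans h1 (lk_step Xu Xv uv).
split=> // av; have := fr _ _ uv; case: (leP a (f u)) => au l1.
  have [x' [e k1 k2]] := h2 au; exists x'; split => //.
  by apply: lk_trans k2 _; apply: lk_step; rewrite ?Xu ?Xv.
by exists v; split => //; [lia|apply: lk_refl; rewrite Xv].
Qed.

Lemma lk_cross (r : rel site) (X : site -> bool) (f : site -> int) (a b : int) x y : symmetric r ->
  (forall u v, r u v -> (absz (f u - f v) <= 1)%N) -> a <= b -> lk r X x y -> f x <= a -> b <= f y ->
  exists x' y', [/\ f x' = a, f y' = b, lk r X x x' & lk r (fun z => X z && (a <= f z <= b)) x' y'].
Proof.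
move=> rs fr ab h fx fy.
have [x' [e k1 k2]] := lk_enter fr h fx (le_trans ab fy).
have fr' u v : r u v -> (absz (- f u - - f v) <= 1)%N by move/fr; lia.
have [||y' [e' k3 k4]] := @lk_enter _ _ (fun z => - f z) (- b) _ _ fr' (lk_sym rs k2); rewrite ?e; [lia|lia|].
exists x', y'; split => //; first lia.
by apply: lk_sym => //; apply: lk_sub k4 => z; rewrite lerN2 -andbA.
Qed.

Lemma crossing (t : bool) X Y (a b c d : int) x x' y y' :
  lk (radj t) X x x' -> lk (radj (~~ t)) Y y y' ->
  (forall z, X z -> c <= z.2 <= d) -> (forall z, Y z -> a <= z.1 <= b) ->
  x.1 <= a -> b <= x'.1 -> y.2 <= c -> d <= y'.2 ->
  exists u, [/\ X u, lk (radj t) X x u & lk (radj (~~ t)) Y y u].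
Proof.
move=> [p [pp ap lp]] [q [pq aq lq]] hX hY xa xb yc yd.
have ap' : all (fun z => (c <= z.2) && (z.2 <= d)) (x :: p) by apply: sub_all ap => z /hX.
have aq' : all (fun z => (a <= z.1) && (z.1 <= b)) (y :: q) by apply: sub_all aq => z /hY.
suff [u up uq] : exists2 u, u \in x :: p & u \in y :: q.
  by exists u; split; [exact: allP ap _ up|exact: lk_pre pp ap up|exact: lk_pre pq aq uq].
case: t pp pq => /= pp pq; first by apply: (cross_adj_sadj pp pq ap' aq') => //; rewrite ?lp ?lq.
pose sw (z : site) : site := (z.2, z.1).
(* For [t = false] the coordinates are exchanged, so that the lattice path is again the horizontal
   one. *)
have sa : {mono sw : u v / adj u v} by move=> u v; rewrite /adj /= addnC.
have ss : {mono sw : u v / sadj u v} by move=> u v; rewrite /sadj /= maxnC.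
have [||||||||u] := @cross_adj_sadj c d a b (sw y) (map sw q) (sw x) (map sw p).
- by rewrite path_map (eq_path (e' := adj)) // => u v /=; apply: sa.
- by rewrite path_map (eq_path (e' := sadj)) // => u v /=; apply: ss.
- by rewrite -map_cons all_map.
- by rewrite -map_cons all_map.
- by [].
- by rewrite last_map lq.
- by [].
- by rewrite last_map lp.
have swK : involutive sw by case.
rewrite -!map_cons => /mapP[v vq ->]; rewrite mem_map; last exact: (can_inj swK).
by exists v.
Qed.

(** Two star paths can cross without a common site. Then one of them is thickened to a lattice path
    by filling in the corners of its diagonal steps; the other meets this path, hence comes next to
    the original one. *)
Lemma touch (t : bool) X Y (a b c d : int) x x' y y' :
  lk (radj t) X x x' -> lk (radj t) Y y y' ->
  (forall z, X z -> c <= z.2 <= d) -> (forall z, Y z -> a <= z.1 <= b) ->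
  x.1 <= a -> b <= x'.1 -> y.2 <= c -> d <= y'.2 ->
  exists u v, [/\ lk (radj t) X x u, lk (radj t) Y y v & u = v \/ radj t u v].
Proof.
move=> hx hy hX hY xa xb yc yd.
case: t hx hy => /= hx hy.
  move: hx hy => [p [pp ap lp]] [q [pq aq lq]].
  have ap' : all (fun z => (c <= z.2) && (z.2 <= d)) (x :: p) by apply: sub_all ap => z /hX.
  have aq' : all (fun z => (a <= z.1) && (z.1 <= b)) (y :: q) by apply: sub_all aq => z /hY.
  have pq' : path sadj y q by apply: sub_path pq => u v; apply: adj_sadj.
  have [||||u up uq] := cross_adj_sadj pp pq' ap' aq'; rewrite ?lp ?lq //.
  by exists u, u; split; [exact: lk_pre pp ap up|exact: lk_pre pq aq uq|left].
pose X' z := `[< exists u, [/\ lk sadj X x u, z.2 = u.2 & (absz (z.1 - u.1) <= 1)%N] >].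
have Xx := lk_fst hx.
have hx' : lk adj X' x x'.
  suff [] : lk sadj X x x' /\ lk adj X' x x' by [].
  move: (x') hx; apply: lk_ind.
    by split; apply: lk_refl => //; apply/asboolP; exists x; split; rewrite ?subrr //; exact: lk_refl.
  move=> u v [h1 h2] Xu Xv uv; have h3 := lk_trans h1 (lk_step Xu Xv uv).
  split=> //; apply: lk_trans h2 _.
  have Xu' : X' u by apply/asboolP; exists u; split; rewrite ?subrr.
  have Xv' : X' v by apply/asboolP; exists v; split; rewrite ?subrr.
  have [uv'|[_ k1 k2]] := @radj_cases false _ _ uv; first exact: lk_step.
  have Xc : X' (v.1, u.2).
    by apply/asboolP; exists u; split=> //=; move: k1; rewrite /adj /=; lia.
  exact: lk_trans (lk_step Xu' Xc k1) (lk_step Xc Xv' k2).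
have hX' z : X' z -> c <= z.2 <= d by move=> /asboolP[u [/lk_snd/hX + -> _]].
have [u [/asboolP[v [xv e1 e2]] _ yu]] := @crossing true X' Y a b c d _ _ _ _ hx' hy hX' hY xa xb yc yd.
exists v, u; split => //; case: (eqVneq v u) => [|ne]; [by left|right].
move: ne e1 e2; clear; case: u v => [u1 u2] [v1 v2]; rewrite xpair_eqE /sadj /=; lia.
Qed.

(** * Connectedness of inner boundaries *)

Definition rect (a b c d : int) (z : site) : bool := (a <= z.1 <= b) && (c <= z.2 <= d).

Fixpoint xsum (f : nat -> bool) (n : nat) : bool := if n is m.+1 then xsum f m (+) f m else false.

Section Boundary.
Variables (t : bool) (a b c d : int) (D A : site -> bool).
Let Bx := rect a b c d.
Hypothesis DB : forall z, D z -> Bx z.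
Hypothesis AB : forall z, A z -> Bx z.
Hypothesis DA : forall z, D z -> ~~ A z.
Hypothesis Acl : forall u v, A u -> Bx v -> radj t u v -> ~~ D v -> A v.
Hypothesis Dc : forall u v, D u -> D v -> lk (radj (~~ t)) D u v.
Hypothesis Ac : forall u v, A u -> A v -> lk (radj t) A u v.

(* The inner boundary of A along D is connected: the steps between A and its complement that
   touch the component of b0 in this boundary form a closed 1-form F on the rectangle, whose
   potential g is constant on A and on D. *)
Definition bdry u := A u && `[< exists v, D v /\ radj (~~ t) u v >].
Variable b0 : site.
Hypothesis Bb0 : bdry b0.
Let B1 u := `[< lk (radj t) bdry b0 u >].
Let F u v := (A u (+) A v) && (B1 u || B1 v).

Let B1B u : B1 u -> bdry u. Proof. by move=> /asboolP/lk_snd. Qed.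

Let B1N u : ~~ A u -> B1 u = false.
Proof. by move=> h; apply/negbTE/negP => /B1B/andP[h']; rewrite h' in h. Qed.

Let B1eq u v : bdry u -> bdry v -> radj t u v -> B1 u = B1 v.
Proof.
move=> hu hv uv; apply/asboolP/asboolP => h; apply: lk_trans h _; apply: lk_step => //.
by rewrite radj_sym.
Qed.

Let exD u v : A u -> Bx v -> ~~ A v -> radj t u v -> D v.
Proof. by move=> hu hv nv uv; apply: contraNT nv => nD; apply: Acl uv nD. Qed.

Let exB u v w : A u -> Bx v -> ~~ A v -> radj t u v -> A w -> radj (~~ t) w v -> bdry w.
Proof. by move=> hu hv nv uv hw wv; rewrite /bdry hw; apply/asboolP; exists v; split=> //; apply: exD uv. Qed.

Let exBa u v : A u -> Bx v -> ~~ A v -> adj u v -> bdry u.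
Proof. by move=> hu hv nv uv; apply: (exB hu hv nv) => //; apply: adj_radj. Qed.

Let three u w u' v : A u -> A w -> A u' -> ~~ A v -> Bx v -> adj u v -> adj u' v -> adj u w ->
  adj w u' -> sadj w v -> sadj u u' -> B1 u = B1 u'.
Proof.
move=> Au Aw Au' nv Bv uv u'v uw wu' wv uu'.
have bu := exBa Au Bv nv uv; have bu' := exBa Au' Bv nv u'v.
have ex := @exB u v w Au Bv nv (adj_radj _ uv) Aw.
case: (t) (B1eq) ex => /= eq ex; last exact: eq.
have bw := ex wv; rewrite (eq u w) // ?(eq w u') //; exact: adj_sadj.
Qed.

Let FC u v : F u v = F v u. Proof. by rewrite /F addbC orbC. Qed.

(** The form F is closed. Where its values do not cancel at once, they belong to boundary sites that
    are linked around the square, on which [B1] agrees. *)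
Let square p q r s : Bx p -> Bx q -> Bx r -> Bx s -> adj p q -> adj q r -> adj r s -> adj s p ->
  sadj p r -> sadj q s -> F p q (+) F q r = F p s (+) F s r.
Proof.
move=> hp hq hr hs pq qr rs sp pr qs.
have [qp rq sr ps] : [/\ adj q p, adj r q, adj s r & adj p s].
  by split; rewrite adj_sym.
have [rp sq] : sadj r p /\ sadj s q by split; rewrite sadj_sym.
rewrite /F; case: (boolP (A p)) => Ap; case: (boolP (A q)) => Aq; case: (boolP (A r)) => Ar;
  case: (boolP (A s)) => As //=; rewrite ?(B1N Ap) ?(B1N Aq) ?(B1N Ar) ?(B1N As) ?orbF ?addbF ?addbb //=.
- by rewrite (@three p q r s) // addbb.
- exact: (@three q p s r).
- exact: B1eq (exBa Aq hr Ar qr) (exBa Ap hs As ps) (adj_radj _ qp).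
- by rewrite (@three p s r q) // addbb.
- exact: B1eq (exBa Ap hq Aq pq) (exBa As hr Ar sr) (adj_radj _ ps).
- exact: (@three q r s p).
- exact: B1eq (exBa Aq hp Ap qp) (exBa Ar hs As rs) (adj_radj _ qr).
- exact: B1eq (exBa Ar hq Aq rq) (exBa As hp Ap sp) (adj_radj _ rs).
Qed.

(** The potential of F: its sum along the bottom row and then up the column. *)
Let g (z : site) := xsum (fun i => F (a + i%:Z, c) (a + i%:Z + 1, c)) (absz (z.1 - a)) (+)
  xsum (fun j => F (z.1, c + j%:Z) (z.1, c + j%:Z + 1)) (absz (z.2 - c)).

Let g_up (x y : int) : c <= y -> g (x, y + 1) = g (x, y) (+) F (x, y) (x, y + 1).
Proof.
move=> cy; have e : absz (y + 1 - c)%R = (absz (y - c)).+1 by lia.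
have e' : c + (absz (y - c))%:Z = y by lia.
by rewrite /g e /= e' addbA.
Qed.

Let g_right (x y : int) : Bx (x, y) -> Bx (x + 1, y) -> g (x + 1, y) = g (x, y) (+) F (x, y) (x + 1, y).
Proof.
rewrite /Bx /rect /= => /andP[/andP[h1 h2] /andP[h3 h4]] /andP[/andP[h5 h6] _].
have e : y = c + (absz (y - c))%:Z by lia.
move: (absz (y - c)) e => n e; subst y; clear h3.
have B0 m : (c + m%:Z <= d) -> Bx (x, c + m%:Z).
  by rewrite /Bx /rect /= h1 h2 => ->; rewrite /= andbT; lia.
have B2 m : (c + m%:Z <= d) -> Bx (x + 1, c + m%:Z).
  by rewrite /Bx /rect /= h5 h6 => ->; rewrite /= andbT; lia.
elim: n h4 => [|n IH] h.
  have e : absz (x + 1 - a)%R = (absz (x - a)).+1 by lia.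
  have e' : a + (absz (x - a))%:Z = x by lia.
  by rewrite addr0 /g subrr /= e /= e' !addbF.
have hn : c + n%:Z <= d by lia.
have en : c + n.+1%:Z = c + n%:Z + 1 by lia.
have cn : c <= c + n%:Z by lia.
have sq : F (x, c + n%:Z) (x + 1, c + n%:Z) (+) F (x + 1, c + n%:Z) (x + 1, c + n%:Z + 1) =
    F (x, c + n%:Z) (x, c + n%:Z + 1) (+) F (x, c + n%:Z + 1) (x + 1, c + n%:Z + 1).
  rewrite -en; apply: square; rewrite ?B0 ?B2 //;
  by rewrite /adj /sadj /= ?en; clear; lia.
by rewrite en !g_up // IH // -!addbA sq.
Qed.

Let g_adj u v : Bx u -> Bx v -> adj u v -> g v = g u (+) F u v.
Proof.
move=> hu hv /adj_cases [e|[e|[e|e]]]; rewrite e.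
- by rewrite g_right -?e -?surjective_pairing.
- rewrite g_up -?surjective_pairing //; by case/andP: hu => _ /andP[].
- by rewrite g_right -?e -?surjective_pairing // FC -addbA addbb addbF.
- rewrite g_up -?surjective_pairing // -?e; last by case/andP: hv => _ /andP[].
  by rewrite FC -addbA addbb addbF.
Qed.

Let Bcorner u v : Bx u -> Bx v -> Bx (v.1, u.2).
Proof. by move=> /andP[_ h] /andP[h' _]; rewrite /Bx /rect /= h h'. Qed.

Let FA u v : A u -> A v -> F u v = false.
Proof. by rewrite /F => -> ->. Qed.

Let FN u v : ~~ A u -> ~~ A v -> F u v = false.
Proof. by rewrite /F => /negbTE -> /negbTE ->. Qed.

Let FAN u v : A u -> ~~ A v -> F u v = B1 u.
Proof. by move=> h k; rewrite /F h (negbTE k) (B1N k) orbF. Qed.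

Let gA u v : A u -> A v -> g u = g v.
Proof.
move=> Au Av; have := Ac Au Av; clear Av; move: v; apply: lk_ind => // u' v -> Au' Av uv.
have [h|[tF k1 k2]] := radj_cases uv.
  by rewrite (@g_adj u' v) ?AB // FA // addbF.
have Bp := Bcorner (AB Au') (AB Av); set p := (v.1, u'.2) in k1 k2 Bp *.
rewrite (g_adj Bp (AB Av) k2) (g_adj (AB Au') Bp k1).
case: (boolP (A p)) => Ap; first by rewrite (FA Au' Ap) (FA Ap Av) !addbF.
rewrite (FAN Au' Ap) FC (FAN Av Ap) -addbA (_ : B1 u' (+) B1 v = false) ?addbF //.
rewrite (@B1eq u' v) ?addbb //; first exact: (exBa Au' Bp Ap).
by apply: (exBa Av Bp Ap); rewrite adj_sym.
Qed.

Let gD u v : D u -> D v -> g u = g v.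
Proof.
move=> Du Dv; have := Dc Du Dv; clear Dv; move: v; apply: lk_ind => // u' v -> Du' Dv uv.
have [h|[tF k1 k2]] := radj_cases uv.
  by rewrite (@g_adj u' v) ?DB // FN ?DA // addbF.
have Bp := Bcorner (DB Du') (DB Dv); set p := (v.1, u'.2) in k1 k2 Bp *.
rewrite (g_adj Bp (DB Dv) k2) (g_adj (DB Du') Bp k1).
case: (boolP (A p)) => Ap; last by rewrite (FN (DA Du') Ap) (FN Ap (DA Dv)) !addbF.
by rewrite (FC u') (FAN Ap (DA Du')) (FAN Ap (DA Dv)) -addbA addbb addbF.
Qed.

Theorem bdry_connected b1 : bdry b1 -> lk (radj t) bdry b0 b1.
Proof.
(* The potential jumps by [B1 b2] from A to D at [b2]. Since it is constant on both, the jump is the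
   same at every boundary site, and at [b0] it is 1. *)
have key b2 dd : bdry b2 -> D dd -> B1 b2 = g b0 (+) g dd.
  move=> Bb Dd; have Ab : A b2 by case/andP: Bb.
  have /andP[A0 _] := Bb0.
  have [_ /asboolP[d1 [Dd1 bd]]] := andP Bb.
  have gdd := gD Dd Dd1; rewrite gdd (gA A0 Ab); clear gdd.
  have [h|[tF k1 k2]] := radj_cases bd.
    by rewrite (g_adj (AB Ab) (DB Dd1) h) (FAN Ab (DA Dd1)) addbA addbb.
  have Bp := Bcorner (AB Ab) (DB Dd1); set p := (d1.1, b2.2) in k1 k2 Bp *.
  have t1 : t = true by case: (t) tF.
  case: (boolP (A p)) => Ap.
    rewrite (gA Ab Ap) (g_adj Bp (DB Dd1) k2) (FAN Ap (DA Dd1)) addbA addbb.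
    apply: B1eq => //; last exact: adj_radj.
    by apply: (exBa Ap (DB Dd1)) => //; apply: DA.
  have Dp : D p by apply: exD Ab Bp Ap _; apply: adj_radj.
  by rewrite (gD Dd1 Dp) (g_adj (AB Ab) Bp k1) (FAN Ab Ap) addbA addbb.
have [_ /asboolP[d0 [Dd0 _]]] := andP Bb0.
move=> Bb1; apply/asboolP; rewrite -/(B1 b1) (key _ d0 Bb1 Dd0) -(key _ d0 Bb0 Dd0).
by apply/asboolP/lk_refl.
Qed.

End Boundary.

(** * Exploration of a cluster and planar duality *)

Section Exploration.
Variables (t : bool) (a b c d : int).
Implicit Types (s : config) (u v w z : site).

Definition explC s z : bool := `[< exists y : site, y.1 = a /\
  lk (radj (~~ t)) (fun z => rect a b c d z && (s z == ~~ t)) y z >].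

(* explC is what the exploration of the [~~ t] cluster of the left side finds, explE the
   region it has to reveal for that. *)
Definition explE s u : bool := rect a b c d u &&
  `[< [\/ u.1 = a, explC s u | exists v, explC s v /\ radj (~~ t) u v] >].

Lemma explC_in s z : explC s z -> rect a b c d z && (s z == ~~ t).
Proof. by move=> /asboolP[y [_ /lk_snd]]. Qed.

Lemma explC_step s u v : explC s u -> rect a b c d v -> radj (~~ t) u v -> s v = ~~ t -> explC s v.
Proof.
move=> hu rv uv sv; have hu' := explC_in hu; move/asboolP: hu => [y [ya h]].
apply/asboolP; exists y; split => //; apply: lk_trans h _; apply: lk_step => //; by rewrite rv sv eqxx.
Qed.

Lemma explC_left s v : rect a b c d v -> v.1 = a -> s v = ~~ t -> explC s v.
Proof.
by move=> rv va sv; apply/asboolP; exists v; split => //; apply: lk_refl; rewrite rv sv eqxx.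
Qed.

Lemma explE_C s v : explC s v -> explE s v.
Proof. by move=> h; have /andP[h1 _] := explC_in h; rewrite /explE h1; apply/asboolP; apply: Or32. Qed.

Lemma explE_colour s v : explE s v -> explC s v = (s v == ~~ t).
Proof.
move=> /andP[rv /asboolP hv]; apply/idP/eqP => [/explC_in/andP[_ /eqP]//|sv].
case: hv => [h||[w [hw vw]]] //; first exact: explC_left.
by apply: (explC_step hw) => //; rewrite radj_sym.
Qed.

(** The stopping property: the spins on [explE s] alone determine the explored cluster, since every
    spin inspected in its growth lies there. *)
Lemma explC_agree s s' : (forall z, explE s z -> s z = s' z) -> explC s =1 explC s'.
Proof.
move=> ag z; apply/idP/idP => [/asboolP[y [ya h]]|/asboolP[y [ya h]]].
  have hy := lk_fst h.
  suff [] : explC s z /\ explC s' z by [].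
  move: z h; apply: lk_ind.
    move/andP: hy => [h1 /eqP h2]; have Cy := explC_left h1 ya h2.
    by split=> //; apply: explC_left; rewrite -?ag // explE_C.
  move=> u v [h1 h2] _ /andP[rv /eqP sv] uv; have Cv := explC_step h1 rv uv sv.
  by split=> //; apply: explC_step h2 rv uv _; rewrite -ag // explE_C.
have hy := lk_fst h; move: z h; apply: lk_ind.
  move/andP: hy => [h1 /eqP h2]; apply: explC_left => //; rewrite ag // /explE h1.
  by apply/asboolP; apply: Or31.
move=> u v h1 _ /andP[rv /eqP sv] uv; apply: (explC_step h1 rv uv); rewrite ag // /explE rv.
by apply/asboolP; apply: Or33; exists u; rewrite radj_sym.
Qed.

Lemma explE_agree s s' : (forall z, explE s z -> s z = s' z) -> explE s =1 explE s'.
Proof.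
move=> ag z; have e := explC_agree ag; rewrite /explE; congr (_ && _).
apply/asboolP/asboolP => -[h|h|[v [h1 h2]]].
- exact: Or31.
- by apply: Or32; rewrite -e.
- by apply: Or33; exists v; rewrite -e.
- exact: Or31.
- by apply: Or32; rewrite e.
- by apply: Or33; exists v; rewrite e.
Qed.

Section Miss.
Variable s : config.
Hypothesis (ab : a <= b) (cd : c <= d).
Hypothesis miss : forall z, explC s z -> z.1 < b.
(** A column is added on the left and counted into D. It connects the separate [~~ t] clusters of
    the left side and makes every row meet D, even where the left side has type t. *)
Let Bx := rect (a - 1) b c d.
Let D z := explC s z || ((z.1 == a - 1) && Bx z).
Let free z := Bx z && ~~ D z.
Definition expl_outer z := `[< lk (radj t) (fun z =>
  rect (a - 1) b c d z && ~~ (explC s z || ((z.1 == a - 1) && rect (a - 1) b c d z))) (b, c) z >].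
Let A := expl_outer.
(** The part of the component of the right side that faces D. It plays the role of the vertical t
    crossing nearest to the left side. *)
Definition barrier := bdry t D A.

Let rowlk (r : rel site) (X : site -> bool) x (y : int) n : (forall u v, adj u v -> r u v) ->
  (forall m : nat, (m <= n)%N -> X (x, y + m%:Z)) -> lk r X (x, y) (x, y + n%:Z).
Proof.
move=> hr; elim: n => [|n IH] h; first by rewrite addr0; apply: lk_refl; rewrite -(addr0 y) h.
apply: lk_trans (IH _) _ => [m hm|]; first by apply: h; rewrite ltnW.
apply: lk_step; [exact: h|exact: h|apply: hr]; rewrite /adj /=; lia.
Qed.

Lemma expl_outer_right y : c <= y <= d -> A (b, y).
Proof.
move=> hy; apply/asboolP.
have -> : y = c + (absz (y - c))%:Z by lia.
apply: rowlk => [u v|m hm]; first exact: adj_radj.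
have e : rect (a - 1) b c d (b, c + m%:Z) by rewrite /rect /=; lia.
rewrite e /= negb_or andbT; apply/andP; split; last by lia.
by apply/negP => /miss /=; rewrite ltxx.
Qed.

Lemma expl_outer_step u v : A u -> rect a b c d v -> ~~ explC s v -> radj t u v -> A v.
Proof.
move=> /asboolP h rv Cv uv; apply/asboolP; apply: lk_trans h (lk_step (lk_snd h) _ uv).
move: rv; rewrite /rect (negbTE Cv) /= => /andP[h1 ->]; lia.
Qed.

Let DC u0 v0 : D u0 -> D v0 -> lk (radj (~~ t)) D u0 v0.
Proof.
have lDs := fun x y (h : lk (radj (~~ t)) D x y) => lk_sym (radj_sym (~~ t)) h.
have col u : D u -> lk (radj (~~ t)) D (a - 1, c) u.
  move=> /orP[]; last first.
    case/andP => /eqP u1 hB; have e : u.2 = c + (absz (u.2 - c))%:Z.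
      by move: hB; rewrite /Bx /rect => /andP[_]; clear; lia.
    rewrite [u]surjective_pairing e u1; apply: rowlk => [x y|m hm]; first exact: adj_radj.
    by move: hB; rewrite /D /Bx /rect /= eqxx /= => /andP[_]; rewrite orbC; move: ab hm; clear; lia.
  move=> /asboolP[y [ya h]]; have hy := lk_fst h; have /andP[ry /eqP sy] := hy.
  suff [] : explC s u /\ lk (radj (~~ t)) D (a - 1, c) u by [].
  move: u h; apply: lk_ind.
    split; first exact: explC_left.
    have l1 : lk (radj (~~ t)) D (a - 1, c) (a - 1, y.2).
      have e : y.2 = c + (absz (y.2 - c))%:Z.
        by move: ry; rewrite /rect => /andP[_]; clear; lia.
      rewrite e; apply: rowlk => [x z|m hm]; first exact: adj_radj.
      by move: ry; rewrite /D /Bx /rect /= eqxx /= => /andP[_]; rewrite orbC; move: ab hm; clear; lia.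
    apply: lk_trans l1 (lk_step (lk_snd l1) _ _).
      by rewrite /D explC_left.
    by apply: adj_radj; rewrite /adj /= ya; clear; lia.
  move=> x v [h1 h2] _ /andP[rv /eqP sv] xv; have h3 := explC_step h1 rv xv sv.
  split=> //; apply: lk_trans h2 _; apply: lk_step => //; by rewrite /D ?h1 ?h3.
by move=> /col hu /col hv; apply: lk_trans (lDs _ _ hu) hv.
Qed.

Let Acl u v : A u -> Bx v -> radj t u v -> ~~ D v -> A v.
Proof.
move=> /asboolP h Bv uv Dv; apply/asboolP; apply: lk_trans h (lk_step (lk_snd h) _ uv).
by apply/andP.
Qed.

Let Ac u v : A u -> A v -> lk (radj t) A u v.
Proof.
have key w : A w -> lk (radj t) A (b, c) w by move=> /asboolP/lk_self.
by move=> /key hu /key hv; apply: lk_trans (lk_sym (radj_sym t) hu) hv.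
Qed.

Let AF z : A z -> free z. Proof. by move=> /asboolP/lk_snd. Qed.

Lemma barrier_connected u v : barrier u -> barrier v -> lk (radj t) barrier u v.
Proof.
move=> hu hv; rewrite /barrier; apply: (@bdry_connected t (a - 1) b c d D A) => //.
- move=> z /orP[/explC_in/andP[]|/andP[]//]; rewrite /rect => /andP[h ->] _; lia.
- by move=> z /AF/andP[].
- by move=> z Dz; apply/negP => /AF/andP[_]; rewrite Dz.
Qed.

Lemma barrier_in u : barrier u -> rect a b c d u && (s u == t).
Proof.
move=> /andP[/AF/andP[Bu]]; rewrite /D negb_or => /andP[nC]; rewrite Bu andbT => ne.
have ru : rect a b c d u by move: Bu ne; rewrite /Bx /rect => /andP[h1 ->]; clear -h1; lia.
move=> /asboolP[v [Dv uv]]; rewrite ru /=.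
suff : s u != ~~ t by case: (s u); case: (t).
apply/eqP => su; move/negP: nC; apply.
case/orP: Dv => [Cv|/andP[/eqP v1 _]]; first by apply: (explC_step Cv) => //; rewrite radj_sym.
apply: explC_left => //; move: ru uv => /andP[h1 _] /radj_sadj; rewrite /sadj v1; lia.
Qed.

Lemma barrier_mem u : A u -> explE s u -> barrier u.
Proof.
move=> Au /andP[ru /asboolP hu]; rewrite /barrier /bdry Au; apply/asboolP.
have /andP[_] := AF Au; rewrite /D negb_or => /andP[/negbTE nC _].
move: hu; rewrite nC => -[ua||[v [Cv uv]]] //; last by exists v; rewrite /D Cv.
exists (a - 1, u.2); split; last by apply: adj_radj; rewrite /adj /= ua; clear; lia.
move: ru; rewrite /D /Bx /rect /= eqxx /= => /andP[_ ->]; move: ab; rewrite orbC; clear; lia.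
Qed.

Lemma barrier_row (y : int) : c <= y <= d -> exists u, barrier u /\ u.2 = y.
Proof.
move=> hy; have hB x : a - 1 <= x <= b -> Bx (x, y) by rewrite /Bx /rect /= hy => ->.
suff gen n : (n%:Z <= b - (a - 1)) -> A (b - n%:Z, y) \/ exists u, barrier u /\ u.2 = y.
  have [|/AF/andP[_]|//] := gen (absz (b - (a - 1))%R); first by move: ab; clear; lia.
  have -> : b - (absz (b - (a - 1))%R)%:Z = a - 1 by move: ab; clear; lia.
  by rewrite /D eqxx hB ?orbT //; move: ab; clear; lia.
elim: n => [_|n IH hn]; first by left; rewrite subr0; apply: expl_outer_right.
have [|Au|] := IH; [by move: hn; clear; lia| |by right].
set v : site := (b - n.+1%:Z, y); case: (boolP (D v)) => Dv.
  right; exists (b - n%:Z, y); split=> //; rewrite /barrier /bdry Au; apply/asboolP.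
  by exists v; split=> //; apply: adj_radj; rewrite /adj /v /=; clear; lia.
left; apply: Acl Au _ _ Dv; first by apply: hB; move: hn ab; clear; lia.
by apply: adj_radj; rewrite /adj /v /=; clear; lia.
Qed.

End Miss.
End Exploration.

(** Explore the [~~ t] cluster of the left side: it reaches the right side, or its barrier is a
    connected set of type t that meets every row. *)
Lemma expl_dichotomy t (a b c d : int) (s : config) : a <= b -> c <= d ->
  (exists x y, [/\ x.1 = a, y.1 = b & lk (radj (~~ t)) (fun z => rect a b c d z && (s z == ~~ t)) x y]) \/
  (exists x y, [/\ x.2 = c, y.2 = d & lk (radj t) (fun z => rect a b c d z && (s z == t)) x y]).
Proof.
move=> ab cd; case: (pselect (exists z, explC t a b c d s z /\ b <= z.1)) => [[z [Cz bz]]|no].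
  left; have /andP[/andP[/andP[_ zb] _] _] := explC_in Cz.
  by move/asboolP: Cz => [y [ya h]]; exists y, z; split=> //; apply/le_anti/andP.
have miss z : explC t a b c d s z -> z.1 < b.
  by move=> Cz; rewrite ltNge; apply/negP => h; apply: no; exists z.
right; have [u [Bu uc]] := barrier_row ab cd miss (y := c) ltac:(by rewrite lexx).
have [v [Bv vd]] := barrier_row ab cd miss (y := d) ltac:(by rewrite cd lexx).
exists u, v; split=> //; apply: (lk_sub _ (barrier_connected ab cd Bu Bv)) => z; exact: (barrier_in ab cd).
Qed.

(** * Reflection in the axis *)

Definition fold (z : site) : site := (z.1, - `|z.2|).
Definition flip2 (z : site) : site := (z.1, - z.2).

Lemma fold_radj t u v : radj t u v -> radj t (fold u) (fold v).
Proof.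
case: u v => [u1 u2] [v1 v2]; case: t; rewrite /= /adj /sadj /fold /= => h.
  have -> : absz (- `|u2| - - `|v2|)%R = absz (u2 - v2)%R by lia.
  by [].
have -> : absz (- `|u2| - - `|v2|)%R = absz (u2 - v2)%R by lia.
by [].
Qed.

Lemma flip2_radj t u v : radj t (flip2 u) (flip2 v) = radj t u v.
Proof. by case: t; rewrite /= /adj /sadj /flip2 /= -opprD abszN. Qed.

Lemma fold_id z : z.2 <= 0 -> fold z = z.
Proof. by case: z => x y /= h; rewrite /fold /= ler0_norm // opprK. Qed.

Lemma fold_flip2 z : fold (flip2 z) = fold z.
Proof. by rewrite /fold /flip2 /= normrN. Qed.

Lemma rect_flip2 (r : int) z : rect (- r) r (- r) r (flip2 z) = rect (- r) r (- r) r z.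
Proof. by rewrite /rect /flip2 /=; congr andb; rewrite lerN2 lerNl andbC. Qed.

(* Above and below the axis the path avoids the explored set E and its mirror image, so the
   spins it uses have not been revealed. *)
Definition attach t (r : int) (E : site -> bool) : config -> Prop := fun s => exists x z u, [/\ x.1 = r,
  lk (radj t) (fun w => [&& rect (- r) r (- r) r w, s w == t & ~~ E (fold w)]) x z,
  radj t z u, E u & rect (- r) r (- r) r u].

(** Follow the path from the right side until it is about to enter E or the mirror image of E; this
    happens because the left side folds into E. If the entry lies above the axis, the reflected
    configuration attaches from below. *)
Lemma attach_or t (r : int) (E : site -> bool) s x y : (forall u, E u -> u.1 < r) ->
  (forall u, rect (- r) r (- r) r u -> u.1 = - r -> E (fold u)) ->
  x.1 = r -> y.1 = - r -> lk (radj t) (fun w => rect (- r) r (- r) r w && (s w == t)) x y ->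
  attach t r E s \/ attach t r E (s \o flip2).
Proof.
move=> Er El xr yr h; have hx := lk_fst h.
pose X (s : config) w := [&& rect (- r) r (- r) r w, s w == t & ~~ E (fold w)].
have nx : ~~ E (fold x) by apply/negP => /Er /=; rewrite xr ltxx.
suff [//|hh] : (attach t r E s \/ attach t r E (s \o flip2)) \/ lk (radj t) (X s) x y.
  have /and3P[ry _ /negP[]] := lk_snd hh; exact: El.
clear yr; move: y h; apply: lk_ind.
  by right; apply: lk_refl; rewrite /X nx; case/andP: hx => -> ->.
move=> u v [g|g] _ /andP[rv sv] uv; [by left|].
case: (boolP (E (fold v))) => Ev; last first.
  by right; apply: (lk_trans g (lk_step (lk_snd g) _ uv)); rewrite /X rv sv.
left; case: (leP v.2 0) => v2.
  by left; exists x, u, v; split=> //; rewrite -(fold_id v2).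
right; exists (flip2 x), (flip2 u), (flip2 v); split=> //.
- apply: (lk_map _ _ g) => [z w _ _|z]; first by rewrite flip2_radj.
  have fK : flip2 (flip2 z) = z by case: (z) => ? ?; rewrite /flip2 /= opprK.
  have e : (s \o flip2) (flip2 z) = s z by rewrite -[in RHS](fK).
  by rewrite /X e fold_flip2 rect_flip2.
- by rewrite flip2_radj.
- by move: Ev; rewrite /fold gtr0_norm.
- by rewrite rect_flip2.
Qed.

(** Folded into the lower half-plane, the path enters the rectangle from the right without touching
    E, so it runs in the component of the right side. The site where it meets E, or a corner beside
    it, then lies on the barrier. A path that ends beyond the right column meets E in that column,
    which belongs to the component too. *)
Lemma expl_link t (r k : int) s (E := explE t (- r) (k - r) (- k) 0 s) :
  0 <= r -> r < k -> k < 2 * r -> (forall z, explC t (- r) (k - r) (- k) 0 s z -> z.1 < k - r) ->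
  attach t r E s ->
  exists v1 v2 x, [/\ v1.2 = - k, v2.2 = 0, x.1 = r,
    lk (radj t) (fun w => rect (- r) (k - r) (- k) 0 w && (s w == t)) v1 v2 &
    lk (radj t) (fun w => (rect (- r) (k - r) (- k) 0 w || rect (- r) r (- r) r w) && (s w == t)) v1 x].
Proof.
move=> r0 rk k2 miss [x [z [u [xr xz zu Eu Ru]]]].
have ab : - r <= k - r by lia.
have cd : - k <= 0 :> int by lia.
pose S := rect (- r) (k - r) (- k) 0.
pose R0 := rect (- r) r (- r) r.
pose C := explC t (- r) (k - r) (- k) 0 s.
pose A := expl_outer t (- r) (k - r) (- k) 0 s.
pose B := barrier t (- r) (k - r) (- k) 0 s.
have Az w : w.1 = k - r -> S w -> A w.
  move=> w1; rewrite /S /rect => /andP[_ h]; rewrite [w]surjective_pairing w1.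
  exact: expl_outer_right.
have uS : S u by case/andP: Eu.
have /and3P[Rz sz Ez] := lk_snd xz.
have zfu : radj t (fold z) u.
  move: zu uS; rewrite /S /rect => zu /andP[_ /andP[_ u2]].
  case: (leP z.2 0) => [/fold_id -> //|z2].
  by move: (fold_radj zu); rewrite (fold_id u2).
have [p [Bp pR zp]] : exists p, [/\ B p, R0 p & radj t z p].
  case: (leP (fold z).1 (k - r)) => z1.
    have fS w : R0 w -> w.1 <= k - r -> S (fold w).
      rewrite /R0 /S /rect /fold /= => h1 h2; rewrite h2; move: h1; move: rk r0; clear; lia.
    have h : lk (radj t) (fun w => rect (- r) r (- r) 0 w && ~~ E w) (fold x) (fold z).
      apply: (lk_map _ _ xz) => [v w _ _|w /and3P[rw _ Ew]]; first exact: fold_radj.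
      rewrite Ew andbT; move: rw; rewrite /R0 /rect /fold /=; clear; lia.
    have [|||w [w1 h1 h2]] := @lk_enter _ _ (fun w => - w.1) (- (k - r)) _ _ _ h.
    - by move=> v w /radj_sadj; rewrite /sadj; clear; lia.
    - by rewrite /= xr; move: k2; clear; lia.
    - by move: z1; rewrite /=; clear; lia.
    have w1' : w.1 = k - r by move: w1; rewrite /=; clear => h; apply: oppr_inj.
    have Afz : A (fold z).
      have wS : S w.
        have /andP[+ _] := lk_snd h1; move: w1' rk r0; rewrite /S /rect; clear; lia.
      have Aw : A w by apply: Az.
      move: (fold z) h2; apply: lk_ind; first exact: Aw.
      move=> v v' Av _ /andP[/andP[rv' Ev'] bv'] vv'.
      have Sv' : S v' by move: rv' bv' rk r0; rewrite /S /rect; clear; lia.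
      apply: (expl_outer_step ab cd Av Sv' _ vv').
      by apply: contra Ev'; apply: explE_C.
    have fzS : S (fold z) by apply: fS.
    case: (boolP (C u)) => Cu; last first.
      exists u; split => //; apply: (barrier_mem ab) => //.
      exact: (expl_outer_step ab cd Afz uS Cu zfu).
    have nEz p : S p -> C p -> adj p (fold z) -> False.
      move=> pS Cp pz; move/negP: Ez; apply; rewrite /E /explE -/S fzS /=.
      by apply/asboolP/Or33; exists p; split=> //; apply: adj_radj; rewrite adj_sym.
    have [uz|[tf k3 k4]] := radj_cases (etrans (radj_sym t u (fold z)) zfu); first by case: (nEz u).
    set p := ((fold z).1, u.2) in k3 k4.
    have pS : S p.
      by move: uS fzS; rewrite /S /rect /p /fold /= => /andP[_ ->] /andP[->].
    have nCp : ~~ C p by apply/negP => Cp; exact: (nEz p).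
    have Ap : A p.
      by apply: (expl_outer_step ab cd Afz pS nCp); rewrite radj_sym; apply: adj_radj.
    exists p; split.
    - apply: (barrier_mem ab) => //; rewrite /explE -/S pS /=; apply/asboolP/Or33; exists u; split=> //.
      by apply: adj_radj; rewrite adj_sym.
    - by move: Ru Rz; rewrite /R0 /rect /p /fold /= => /andP[_ ->] /andP[->].
    - rewrite tf /=; move: zu; rewrite tf /=; move: k4 uS; rewrite /S /rect /adj /sadj /p /fold /=; clear; lia.
  have u1 : u.1 = k - r.
    by move: z1 uS (radj_sadj zfu); rewrite /S /rect /sadj; clear; lia.
  exists u; split=> //; apply: (barrier_mem ab) => //.
  exact: Az.
have [v1 [Bv1 e1]] := barrier_row ab cd miss (y := - k) ltac:(by rewrite lexx).
have [v2 [Bv2 e2]] := barrier_row ab cd miss (y := 0) ltac:(by rewrite lexx cd).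
exists v1, v2, x; split=> //.
  by apply: (lk_sub _ (barrier_connected ab cd Bv1 Bv2)) => w; exact: (barrier_in ab cd).
have l1 := barrier_connected ab cd Bv1 Bp.
apply: (lk_trans (lk_sub _ l1)) => [w /(barrier_in ab cd)/andP[-> ->]|] //.
have l2 : lk (radj t) (fun w => (S w || R0 w) && (s w == t)) x z.
  by apply: (lk_sub _ xz) => w /and3P[rw -> _]; rewrite /R0 rw orbT.
apply: (lk_sym (radj_sym t)); apply: (lk_trans l2 (lk_step (lk_snd l2) _ zp)).
have /andP[_ sp] := barrier_in ab cd Bp; by rewrite pR sp orbT.
Qed.

(** * Russo-Seymour-Welsh theory *)

Section Explore.
Variables (b h : R).
Hypothesis b0 : 0 <= b.
Implicit Types (l : seq site) (s xi : config) (F G : config -> R).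

(** Where the revealed region [q] borders unrevealed sites the pattern has type c, the boundary most
    favourable to [F]. Conditioning on the pattern therefore does not lower the probability of
    [F]. *)
Lemma gibbs_condition c l (q : site -> bool) (p xi : config) (F : event) : uniq l ->
  (forall x, q x -> x \in l) -> tmono c F ->
  (forall s s' : config, (forall x, ~~ q x -> s x = s' x) -> F s -> F s') ->
  (forall x y, q x -> y \in nbrs x -> y \in l -> ~~ q y -> p x = c) ->
  gibbs b h l xi (ind F) * gibbs b h l xi (ind (fun s => forall x, q x -> s x = p x)) <=
  gibbs b h l xi (ind (eand F (fun s => forall x, q x -> s x = p x))).
Proof.
move=> ul ql mF oF bd; set P : event := fun s => forall x, q x -> s x = p x.
pose l3 := [seq x <- l | ~~ q x].
have u3 : uniq l3 by rewrite filter_uniq.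
have s3 : {subset l3 <= l} by move=> x; rewrite mem_filter => /andP[].
pose xi0 : config := fun x => if q x then c else xi x.
pose g := gibbs b h l3 xi0 (ind F).
have out s x : agree l s xi -> x \notin l3 -> ~~ q x -> s x = xi x.
  by move=> hs xl qx; apply: hs; move: xl; rewrite mem_filter qx.
have le1 : gibbs b h l xi (ind F) <= g.
  rewrite (gibbs_dlr_sub _ _ _ _ ul u3 s3) -[leRHS](gibbs_cst b h l xi); apply: gibbs_le => s hs.
  pose s' : config := fun x => if x \in l3 then xi0 x else s x.
  rewrite (@gibbs_agree _ _ _ _ s'); last by move=> x xl; rewrite /s' (negbTE xl).
  apply: (@gibbs_tmono b h b0 c) => // x; rewrite /s' /xi0; case: (boolP (x \in l3)) => // xl.
  by case: (boolP (q x)) => // qx; rewrite (out s).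
have eqF s : agree l s xi -> P s -> gibbs b h l3 s (ind F) = g.
  move=> hs ps; rewrite /g /gibbs /pr.
  pose V x := ~~ q x || has (mem l3) (nbrs x).
  have dW : dep_on V (wgt b h (edges_of l3) (undup l3)).
    move=> u v uv; apply: dep_wgt => x /orP[hx|hx]; apply: uv; rewrite /V.
      by move: hx; rewrite mem_filter => /andP[->].
    by apply/orP; right.
  have dF : dep_on V (fun u => ind F u * wgt b h (edges_of l3) (undup l3) u).
    move=> u v uv; rewrite (dW _ _ uv) /ind; congr (_%:R * _); congr nat_of_bool.
    by apply: asbool_equiv_eq; split; apply: oF => x xq; rewrite uv // /V xq.
  have hV x : V x -> x \notin l3 -> s x = xi0 x.
    move=> Vx xl; rewrite /xi0; case: (boolP (q x)) => xq; last exact: out.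
    have /hasP[y yx yl] : has (mem l3) (nbrs x) by move: Vx; rewrite /V xq.
    move: yl; rewrite /= mem_filter => /andP[y1 y2].
    by rewrite ps //; apply: (bd x y).
  by rewrite (ssum_dep dF hV) (ssum_dep dW hV).
have eFp : gibbs b h l xi (ind (eand F P)) = g * gibbs b h l xi (ind P).
  rewrite (gibbs_dlr_sub _ _ _ _ ul u3 s3) -gibbsZ.
  apply: gibbs_eq => s hs.
  have -> : gibbs b h l3 s (ind (eand F P)) = ind P s * gibbs b h l3 s (ind F).
    rewrite -gibbsZ; apply: gibbs_eq => t ht; rewrite ind_and mulrC; congr (_ * _).
    have e x : q x -> t x = s x by move=> xq; apply: ht; rewrite mem_filter xq.
    congr (_%:R); congr nat_of_bool; apply: asbool_equiv_eq; split => hp x xq; by rewrite -hp // e.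
  case: (pselect (P s)) => hp; last by rewrite (ind_false hp) mul0r mulr0.
  by rewrite eqF // mulrC.
by rewrite eFp; apply: ler_wpM2r => //; apply: gibbs_ge0 => s _; apply: ind_ge0.
Qed.

(* Q s is the revealed region: by the stopping hypothesis, the possible outcomes of the
   exploration partition the configurations into patterns. *)
Lemma gibbs_explore c l xi (Q : config -> site -> bool) (V : event) (G : config -> event) (g0 : R) :
  uniq l -> (forall s x, Q s x -> x \in l) ->
  (forall s s', agree l s xi -> agree l s' xi -> (forall x, Q s x -> s x = s' x) ->
     [/\ Q s =1 Q s', V s -> V s' & forall w, G s w <-> G s' w]) ->
  (forall s, tmono c (G s)) ->
  (forall s (u w : config), (forall x, ~~ Q s x -> u x = w x) -> G s u -> G s w) ->
  (forall s x y, agree l s xi -> V s -> Q s x -> y \in nbrs x -> y \in l -> ~~ Q s y -> s x = c) ->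
  (forall s, agree l s xi -> V s -> g0 <= gibbs b h l xi (ind (G s))) ->
  g0 * gibbs b h l xi (ind V) <= gibbs b h l xi (ind (fun s => V s /\ G s s)).
Proof.
move=> ul Ql st mG oG bd lo.
pose key (s : config) : (size l).-tuple (option bool) :=
  map_tuple (fun x => if Q s x then Some (s x) else None) (in_tuple l).
have keyE s s' : key s = key s' -> forall x, Q s x -> s x = s' x.
  move=> /(congr1 val) /= e x qx; have xl := Ql _ _ qx.
  have := congr1 (fun r => nth None r (index x l)) e.
  rewrite !(nth_map x) ?index_mem // !nth_index // qx.
  by case: (Q s' x) => // -[].
have Kst s s' : agree l s xi -> agree l s' xi -> (forall x, Q s x -> s x = s' x) -> key s = key s'.
  move=> a a' e; have [q1 _ _] := st _ _ a a' e; apply: val_inj => /=; apply: eq_map => x.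
  by rewrite -q1; case: (boolP (Q s x)) => // /e ->.
pose W k : event := fun s => V s /\ key s = k.
pose W' k : event := fun s => (V s /\ G s s) /\ key s = k.
have dec (A : event) s : ind A s = \sum_(k : (size l).-tuple (option bool)) ind (fun s => A s /\ key s = k) s.
  rewrite (bigD1 (key s)) //= big1 ?addr0.
    by rewrite /ind; congr (_%:R); congr nat_of_bool; apply: asbool_equiv_eq; split=> [|[]].
  by move=> k nk; apply: ind_false => -[_ e]; rewrite e eqxx in nk.
have dg A := @gibbs_eq b h l xi (ind A) _ (fun s _ => dec A s).
rewrite (dg V) (dg (fun s => V s /\ G s s)) !gibbs_sum mulr_sumr.
apply: ler_sum => k _.
case: (pselect (exists2 s, agree l s xi & V s /\ key s = k)) => [[s0 a0 [V0 k0]]|no]; last first.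
  have -> : gibbs b h l xi (ind (fun s => V s /\ key s = k)) = 0.
    rewrite -(gibbs_cst b h l xi 0); apply: gibbs_eq => s hs; apply: ind_false => hh.
    by apply: no; exists s.
  by rewrite mulr0; apply: gibbs_ge0 => s _; apply: ind_ge0.
pose P : event := fun s => forall x, Q s0 x -> s x = s0 x.
have eW : gibbs b h l xi (ind (fun s => V s /\ key s = k)) = gibbs b h l xi (ind P).
  apply: gibbs_eq => s hs; rewrite /ind; congr (_%:R); congr nat_of_bool; apply: asbool_equiv_eq.
  split=> [[Vs ks] x qx|Ps].
    by apply/esym/(keyE s0 s) => //; rewrite k0 ks.
  have ag x : Q s0 x -> s0 x = s x by move/Ps.
  have [_ VV _] := st _ _ a0 hs ag.
  by split; [exact: VV|rewrite -k0; apply/esym/Kst].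
have eW' : gibbs b h l xi (ind (fun s => (V s /\ G s s) /\ key s = k)) = gibbs b h l xi (ind (eand (G s0) P)).
  apply: gibbs_eq => s hs; rewrite /ind; congr (_%:R); congr nat_of_bool; apply: asbool_equiv_eq.
  split=> [[[Vs Gs] ks]|[Gs Ps]].
    have ag x : Q s0 x -> s0 x = s x by apply: keyE; rewrite k0 ks.
    have [_ _ GG] := st _ _ a0 hs ag.
    by split; [apply/GG|move=> x /ag].
  have ag x : Q s0 x -> s0 x = s x by move/Ps.
  have [_ VV GG] := st _ _ a0 hs ag.
  by split; [split; [exact: VV|exact/GG]|rewrite -k0; apply/esym/Kst].
rewrite eW eW'; apply: le_trans (@gibbs_condition c l (Q s0) s0 xi (G s0) ul _ (mG _) _ _).
- by apply: ler_wpM2r; [apply: gibbs_ge0 => s _; apply: ind_ge0|exact: lo].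
- by move=> x; apply: Ql.
- exact: oG.
- by move=> x y qx yx yl qy; apply: bd qy.
Qed.

End Explore.

Lemma isom_flip2 : isom flip2 flip2.
Proof.
have K : cancel flip2 flip2 by case=> x y; rewrite /flip2 /= opprK.
split=> // -[x y]; rewrite /nbrs /flip2 /e1 /e2 /d1 /d2 /= opprD opprB addrC.
apply/permP => p; rewrite /=; set a := p _; set c := p _; set d := p _; set e := p _.
rewrite (addrC 1 (- y)) -/c.
lia.
Qed.

(** * The crossing estimate given the spins on an axis *)

Section RSW.
Variables (t : bool) (r k : nat).
Hypothesis (rk : (r < k)%N) (k2 : (k < 2 * r)%N).

Let rz : int := r%:Z.
Let kz : int := k%:Z.
Let S := rect (- rz) (kz - rz) (- kz) 0.
Let R0 := rect (- rz) rz (- rz) rz.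
Let C s := explC t (- rz) (kz - rz) (- kz) 0 s.
Let E s := explE t (- rz) (kz - rz) (- kz) 0 s.
Let l := [seq x : site <- boxsites k | x.2 != (0 : int)].

Definition cross_free : event := fun s => forall z, explC t (- rz) (kz - rz) (- kz) 0 s z -> z.1 < kz - rz.
Definition square_LR : event := fun s => exists x y, [/\ x.1 = rz, y.1 = - rz &
  lk (radj t) (fun w => rect (- rz) rz (- rz) rz w && (s w == t)) x y].
(** Half of a crossing of [k - 3 r, r] x [- k, r]: the other half is supplied by the mirror image in
    [rsw_crossing]. *)
Definition linked_cross : event := fun s => exists v1 v2 x, [/\ v1.2 = - kz, v2.2 = 0, x.1 = rz,
    lk (radj t) (fun w => rect (- rz) (kz - rz) (- kz) 0 w && (s w == t)) v1 v2 &
    lk (radj t) (fun w => (rect (- rz) (kz - rz) (- kz) 0 w || rect (- rz) rz (- rz) rz w) && (s w == t)) v1 x].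

(** The sites to the left of the rectangle are revealed too. Below the axis the revealed region then
    borders unrevealed spins only along sites of type t, as conditioning requires. *)
Let Q (s : config) (x : site) := [&& x \in l, x.2 < 0 & (x.1 < - rz) || E s x].

Let normS w : S w -> (normInf w <= k)%N.
Proof. rewrite /S /rect /normInf; move: rk k2; rewrite /rz /kz; clear; lia. Qed.
Let normR w : R0 w -> (normInf w <= k)%N.
Proof. rewrite /R0 /rect /normInf; move: rk k2; rewrite /rz /kz; clear; lia. Qed.
Let normRr w : R0 w -> (normInf w <= r)%N.
Proof. rewrite /R0 /rect /normInf; move: rk k2; rewrite /rz /kz; clear; lia. Qed.

Let ul : uniq l. Proof. by rewrite filter_uniq ?boxsites_uniq. Qed.
Let mem_l (x : site) : (x \in l) = (x.2 != (0 : int)) && (normInf x <= k)%N.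
Proof. by rewrite mem_filter mem_boxsites. Qed.

Let ES s z : E s z -> S z. Proof. by case/andP. Qed.

Let Eagree s s' xi : agree l s xi -> agree l s' xi -> (forall x, Q s x -> s x = s' x) ->
  forall z, E s z -> s z = s' z.
Proof.
move=> a a' h z Ez; have Sz := ES Ez; case: (boolP (z \in l)) => zl; last by rewrite a ?a'.
apply: h; rewrite /Q zl Ez orbT andbT /=; move: zl Sz; rewrite mem_l /S /rect => /andP[+ _].
move=> h1 /andP[_ /andP[_ h2]]; by rewrite lt_neqAle h1.
Qed.

Let stop s s' xi : agree l s xi -> agree l s' xi -> (forall x, Q s x -> s x = s' x) ->
  [/\ Q s =1 Q s', cross_free s -> cross_free s' & forall w, attach t rz (E s) w <-> attach t rz (E s') w].
Proof.
move=> a a' h; have ag := Eagree a a' h.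
have eE : E s = E s' by apply: funext; apply: explE_agree.
split; first by move=> x; rewrite /Q eE.
  by move=> cf z; rewrite -(explC_agree ag); apply: cf.
by rewrite eE.
Qed.

Let bd (s : config) (x y : site) : cross_free s -> Q s x -> y \in nbrs x -> y \in l -> ~~ Q s y -> s x = t.
Proof.
move=> cf /and3P[_ x2 Qx] yx yl; rewrite /Q yl /= => nQ; apply/eqP; apply: contraT => sx.
have sxt : s x = ~~ t by move: sx; case: (s x); case: (t).
have xy : adj x y.
  by move: yx; clear; case: x y => [x1 x2] [y1 y2]; rewrite !inE /e1 /e2 /d1 /d2 !xpair_eqE /adj /=; lia.
have y2 : y.2 < 0.
  move: yl xy x2; rewrite mem_l => /andP[+ _]; rewrite /adj; clear; lia.
move: nQ; rewrite y2 /= negb_or -leNgt => /andP[y1 nEy].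
have yk : - kz <= y.2.
  by move: yl; rewrite mem_l /normInf => /andP[_]; rewrite /kz; clear; lia.
case/orP: Qx => [x1|Ex].
  move/negP: nEy; case; rewrite /E /explE; apply/andP; split.
    by rewrite /rect; move: x1 xy y1 yk y2 rk; rewrite /adj /rz /kz; clear; lia.
  by apply/asboolP/Or31; move: x1 xy y1; rewrite /adj; clear; lia.
have Cx : C s x by rewrite /C (explE_colour Ex) sxt.
have x1 := cf _ Cx.
move/negP: nEy; case; rewrite /E /explE; apply/andP; split.
  by rewrite /rect; move: x1 xy y1 yk y2; rewrite /adj; clear; lia.
by apply/asboolP/Or33; exists x; split=> //; apply: adj_radj; rewrite adj_sym.
Qed.

Let att_mono A : tmono t (attach t rz A).
Proof.
apply: tmono_of => s s' ss [x [z [u [e h zu Au Ru]]]]; exists x, z, u; split=> //.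
by apply: lk_sub h => w /and3P[-> /ss -> ->].
Qed.

Let sq_mono : tmono t square_LR.
Proof.
apply: tmono_of => s s' ss [x [z [e e' h]]]; exists x, z; split=> //.
by apply: lk_sub h => w /andP[-> /ss ->].
Qed.

Let att_indep s (u w : config) : (forall x, ~~ Q s x -> u x = w x) ->
  attach t rz (E s) u -> attach t rz (E s) w.
Proof.
move=> uw [x [z [v [e h zv Av Rv]]]]; exists x, z, v; split=> //.
apply: lk_sub h => y /and3P[ry sy Ey]; rewrite ry Ey -uw ?sy //.
rewrite /Q; apply/negP => /and3P[_ y2 /orP[y1|Ey']].
  by move: ry y1; rewrite /rect; clear; lia.
by move/negP: Ey; apply; rewrite fold_id // ltW.
Qed.

Variables (b h : R).
Hypothesis b0 : 0 <= b.

Let axis (xi : config) : config := fun x => if (normInf x <= k)%N && (x.2 == 0) then xi x else ~~ t.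

(* Given the spins on the axis, the configuration with boundary condition [~~ t] is symmetric
   under the reflection, so the crossing attaches to the explored set from below with at least
   half of its probability. *)
Lemma explore_bound xi : 2^-1 * gibbs b h l (axis xi) (ind square_LR) * gibbs b h l xi (ind cross_free) <=
  gibbs b h l xi (ind linked_cross).
Proof.
apply: (@le_trans _ _ (gibbs b h l xi (ind (fun s => cross_free s /\ attach t rz (E s) s)))); last first.
  apply: gibbs_le => s _; apply: ind_le => -[cf at_]; apply: (expl_link _ _ _ _ at_) => //;
  by move: rk k2; rewrite /rz /kz; clear; lia.
apply: (@gibbs_explore b h b0 t l xi Q cross_free (fun s => attach t rz (E s))) => //.
- by move=> s x /and3P[].
- by move=> s s'; apply: stop.
- by move=> s x y _ cf qx yx yl qy; apply: bd qy.
move=> s _ cf.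
have ax x : axis xi x == t -> xi x == t by rewrite /axis; case: ifP => // _; case: (t).
apply: (le_trans _ (gibbs_tmono h b0 l ax (att_mono (E s)))).
have sym : gibbs b h l (axis xi) (ind (fun w => attach t rz (E s) (w \o flip2))) =
    gibbs b h l (axis xi) (ind (attach t rz (E s))).
  have fK : involutive flip2 by case=> x y; rewrite /flip2 /= opprK.
  have pe : perm_eq l (map flip2 l).
    apply: uniq_perm => //; first by rewrite map_inj_uniq //; apply: (can_inj fK).
    move=> x; rewrite -{2}[x]fK mem_map; last exact: (can_inj fK).
    by rewrite !mem_l /flip2 /normInf /= oppr_eq0 abszN.
  rewrite [RHS](gibbs_perm _ _ _ _ pe) (gibbs_isom _ _ _ _ _ isom_flip2).
  congr (gibbs _ _ _ _ _); apply: funext => -[x y].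
  by rewrite /axis /flip2 /normInf /= oppr_eq0 abszN; case: (eqVneq y 0) => [->|_]; rewrite ?oppr0 ?andbF.
have : gibbs b h l (axis xi) (ind square_LR) <= gibbs b h l (axis xi) (ind (attach t rz (E s))) +
   gibbs b h l (axis xi) (ind (fun w => attach t rz (E s) (w \o flip2))).
  rewrite -gibbsD; apply: gibbs_le => w _.
  case: (pselect (square_LR w)) => [|nn]; last first.
    by rewrite (ind_false nn) addr_ge0 ?ind_ge0.
  move=> [x [y [ex ey hl]]]; have [||at_|at_] := attach_or (E := E s) _ _ ex ey hl.
  - by move=> u /ES; rewrite /S /rect; move: k2; rewrite /rz /kz; clear; lia.
  - move=> u Ru u1; rewrite /E /explE; apply/andP; split; last by apply/asboolP/Or31.
    by move: Ru u1; rewrite /rect /fold /=; move: rk; rewrite /rz /kz; clear; lia.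
  - by apply: le_trans (ind_le1 _ _) _; rewrite (ind_true at_) lerDl ind_ge0.
  - by apply: le_trans (ind_le1 _ _) _; rewrite addrC (ind_true (E := fun w => attach t rz (E s) (w \o flip2)) at_) lerDl ind_ge0.
rewrite sym; lra.
Qed.

Lemma square_LR_local : local r square_LR.
Proof.
move=> s s' ss [x [z [e e' hl]]]; exists x, z; split=> //.
by apply: lk_sub hl => w /andP[Rw sw]; rewrite Rw -ss ?sw // normRr.
Qed.

Lemma linked_cross_local : local k linked_cross.
Proof.
move=> s s' ss [v1 [v2 [x [e1 e2 e3 h1 h2]]]]; exists v1, v2, x; split=> //.
  by apply: lk_sub h1 => w /andP[Rw sw]; rewrite Rw -ss ?sw // normS.
apply: lk_sub h2 => w /andP[Rw sw]; rewrite Rw -ss ?sw //.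
by case/orP: Rw => [/normS|/normR].
Qed.

Lemma cross_free_local : local k cross_free.
Proof.
move=> s s' ss cf z; rewrite -(@explC_agree t _ _ _ _ s s') => [|w Ew]; first exact: cf.
by apply: ss; apply: normS; case/andP: Ew.
Qed.

Lemma cross_free_mono : tmono t cross_free.
Proof.
apply: tmono_of => s s' ss cf z /asboolP[y [ya hl]]; apply: cf; apply/asboolP; exists y; split=> //.
apply: lk_sub hl => w /andP[-> /eqP sw] /=; move: (ss w); rewrite sw.
by case: (s w); case: (t) => //= /(_ isT).
Qed.

Definition tdir (F : config -> R) := (forall s, 0 <= F s <= 1) /\ if t then incr F else incr (fun s => 1 - F s).

Lemma gibbs_tdir lam xi xi' F : (forall x, xi x == t -> xi' x == t) -> tdir F ->
  gibbs b h lam xi F <= gibbs b h lam xi' F.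
Proof.
move=> st [F01 mF]; have := tleq_of st; move: mF; case: (t) => mF st'.
  apply: (gibbs_mono b0 lam (M := 0)) => // s; rewrite oppr0; by case/andP: (F01 s).
have := @gibbs_mono b b0 lam h h xi' xi _ 0 (lexx _) st' mF.
move=> /(_ (fun s => _)) H; have {}H := H ltac:(move=> s; rewrite oppr0 subr_ge0; by case/andP: (F01 s)).
by move: H; rewrite !gibbsB !gibbs_cst; lra.
Qed.

Lemma gibbs_fkg_tdir lam xi F G : tdir F -> tdir G ->
  gibbs b h lam xi F * gibbs b h lam xi G <= gibbs b h lam xi (fun s => F s * G s).
Proof.
move=> [F01 mF] [G01 mG]; move: mF mG; case: (t) => mF mG.
  by apply: gibbs_fkg => // s; [case/andP: (F01 s)|case/andP: (G01 s)].
have := @gibbs_fkg b b0 h lam xi _ _ _ _ mF mG.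
have F1 s : 0 <= 1 - F s by rewrite subr_ge0; case/andP: (F01 s).
have G1 s : 0 <= 1 - G s by rewrite subr_ge0; case/andP: (G01 s).
move=> /(_ F1 G1).
have -> : gibbs b h lam xi (fun s => (1 - F s) * (1 - G s)) =
    gibbs b h lam xi (fun s => (1 - F s) - (G s - F s * G s)) by apply: gibbs_eq => s _; ring.
rewrite !gibbsB !gibbs_cst; lra.
Qed.

Lemma tdir_gibbs lam (f : config -> config) A :
  (forall s s' : config, (forall x, s x == t -> s' x == t) -> forall x, f s x == t -> f s' x == t) ->
  tmono t A -> tdir (fun s => gibbs b h lam (f s) (ind A)).
Proof.
move=> hf mA; split=> [s|].
  rewrite gibbs_ge0 => [|s' _]; last exact: ind_ge0.
  by rewrite -(gibbs_cst b h lam (f s) 1); apply: gibbs_le => s' _; apply: ind_le1.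
have H s s' : (forall x, s x == t -> s' x == t) ->
  gibbs b h lam (f s) (ind A) <= gibbs b h lam (f s') (ind A).
  by move=> ss; apply: (gibbs_tmono h b0 _ (hf _ _ ss) mA).
move: H; case: (t) => H s s' ss.
  by apply: H => x; move: (ss x); case: (s x); case: (s' x) => // /(_ isT).
suff : gibbs b h lam (f s') (ind A) <= gibbs b h lam (f s) (ind A) by lra.
by apply: H => x; move: (ss x); case: (s x); case: (s' x) => // /(_ isT).
Qed.

Let sub_l : {subset l <= boxsites k}. Proof. by move=> x; rewrite mem_filter => /andP[]. Qed.

(** For fixed spins off [l], [explore_bound] gives a product of two conditional probabilities. Both
    are monotone in these spins in the direction of t, so FKG bounds the mean of the product below
    by the product of the means. *)
Lemma finite_rsw M : (k <= M)%N ->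
  2^-1 * gibbs b h (boxsites k) (fun=> ~~ t) (ind square_LR) *
    gibbs b h (boxsites M) (ctrue : config) (ind cross_free) <=
  gibbs b h (boxsites M) (ctrue : config) (ind linked_cross).
Proof.
move=> kM; pose v xi := gibbs b h l xi (ind cross_free).
pose g xi := gibbs b h l (axis xi) (ind square_LR).
have sM := box_sub kM.
have slM : {subset l <= boxsites M} by move=> x /sub_l /sM.
have tv : tdir v by apply: (@tdir_gibbs l id) => //; apply: cross_free_mono.
have tg : tdir g.
  by apply: (@tdir_gibbs l axis) => // s s' ss x; rewrite /axis; case: ifP => // _; apply: ss.
have uM := boxsites_uniq M; have uk := boxsites_uniq k.
rewrite [leRHS](gibbs_dlr_sub _ _ _ _ uM ul slM).
apply: (@le_trans _ _ (gibbs b h (boxsites M) (ctrue : config) (fun xi => 2^-1 * (g xi * v xi)))); last first.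
  by apply: gibbs_le => s _; rewrite mulrA; apply: explore_bound.
rewrite gibbsZ -mulrA ler_pM2l ?invr_gt0 //.
apply: le_trans (gibbs_fkg_tdir _ _ tg tv).
rewrite [X in _ * X](gibbs_dlr_sub _ _ _ _ uM ul slM); apply: ler_wpM2r.
  by apply: gibbs_ge0 => s _; case: tv => /(_ s) /andP[].
rewrite [leRHS](gibbs_dlr_sub _ _ _ _ uM uk sM) -[leLHS](gibbs_cst b h (boxsites M) (ctrue : config)).
apply: gibbs_le => s _.
have st x : (fun=> ~~ t) x == t -> s x == t by case: (t).
apply: (le_trans _ (gibbs_tdir (boxsites k) st tg)).
rewrite (gibbs_dlr_sub _ _ _ _ uk ul sub_l); apply: gibbs_le => s' hs'.
rewrite (@gibbs_agree _ _ _ s' (axis s')) // => x; rewrite mem_l negb_and negbK -ltnNge /axis => hx.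
case: ifP => // hn; rewrite hs' // mem_boxsites -ltnNge ltnNge.
by apply/negP => h1; move: hn hx; rewrite h1 /= => ->; rewrite ltnNge h1.
Qed.

End RSW.

Lemma rsw_step (T : R) (T0 : 0 < T) t r k h : (r < k)%N -> (k < 2 * r)%N ->
  2^-1 * (mu T h (square_LR t r) - 2 * Delta T^-1 r (k - r)) * mu T h (cross_free t r k) <=
  mu T h (linked_cross t r k).
Proof.
move=> rk k2; have b0 : 0 <= T^-1 by rewrite invr_ge0 ltW.
have lc := @cross_free_local t r k rk k2; have ll := @linked_cross_local t r k rk k2.
set g := gibbs T^-1 h (boxsites k) (fun=> ~~ t) (ind (square_LR t r)).
have cF := mu_cvg T0 (h := h) lc.
have c1 : ((cst (2^-1 * g) * (fun n => gibbs T^-1 h (boxsites n) (ctrue : config) (ind (cross_free t r k)))) n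
   @[n --> \oo] --> 2^-1 * g * mu T h (cross_free t r k))%classic.
  by apply: cvgM => //; apply: cvg_cst.
have H : 2^-1 * g * mu T h (cross_free t r k) <= mu T h (linked_cross t r k).
  apply: (ler_cvg_to c1 (mu_cvg T0 ll)); exists k => // M /= hM; exact: finite_rsw.
apply: le_trans H; apply: ler_wpM2r; first exact: mu_ge0 lc.
rewrite ler_pM2l ?invr_gt0 //; have ls := @square_LR_local t r k rk k2.
have e : (r + (k - r))%N = k by rewrite subnKC // ltnW.
have := mix_box b0 h (k - r) (fun=> ~~ t) ls; have := mix_mu T0 h (k - r) ls.
by rewrite e -/g !ler_norml; lra.
Qed.

(** * Crossing probabilities of rectangles *)

Definition LRev t (a b c d : int) : event := fun s => exists x y : site, [/\ x.1 = a, y.1 = b &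
  lk (radj t) (fun z => rect a b c d z && (s z == t)) x y].
Definition TBev t (a b c d : int) : event := fun s => exists x y : site, [/\ x.2 = c, y.2 = d &
  lk (radj t) (fun z => rect a b c d z && (s z == t)) x y].

Definition swap (z : site) : site := (z.2, z.1).

Lemma swap_radj t u v : radj t (swap u) (swap v) = radj t u v.
Proof. by case: t; rewrite /= /adj /sadj /swap /=; [rewrite addnC|rewrite maxnC]. Qed.

Lemma swapK : involutive swap. Proof. by case. Qed.

Lemma rect_swap a b c d z : rect a b c d (swap z) = rect c d a b z.
Proof. by rewrite /rect /swap /= andbC. Qed.

Lemma rect_norm a b c d z : rect a b c d z -> (normInf z <= absz a + absz b + absz c + absz d)%N.
Proof. by rewrite /rect /normInf; lia. Qed.

Lemma transl_radj t p u v : radj t (transl p u) (transl p v) = radj t u v.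
Proof.
have e (x y z : int) : x + z - (y + z) = x - y by ring.
by case: t; rewrite /= /adj /sadj /transl /= !e.
Qed.

Lemma oppzK z : oppz (oppz z) = z. Proof. by case: z => x y; rewrite /oppz /= !opprK. Qed.

Lemma isom_translV z : isom (transl (oppz z)) (transl z).
Proof. by have := isom_transl (oppz z); rewrite oppzK. Qed.

Lemma translK z : cancel (transl z) (transl (oppz z)). Proof. by case: (isom_transl z). Qed.
Lemma translVK z : cancel (transl (oppz z)) (transl z). Proof. by case: (isom_transl z). Qed.

Lemma isom_swap : isom swap swap.
Proof.
split; [exact: swapK|exact: swapK|move=> [x y]].
rewrite /nbrs /swap /e1 /e2 /d1 /d2 /=; apply/permP => p /=; lia.
Qed.

Lemma norm_transl z x : (normInf (transl z x) <= normInf x + normInf z)%N.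
Proof. rewrite /normInf /transl /=; lia. Qed.

Lemma norm_translV z x : (normInf x <= normInf (transl z x) + normInf z)%N.
Proof. rewrite /normInf /transl /=; lia. Qed.

Lemma norm_swap x : normInf (swap x) = normInf x.
Proof. by rewrite /normInf maxnC. Qed.

Lemma norm_oppz z : normInf (oppz z) = normInf z.
Proof. by rewrite /normInf /oppz /= !abszN. Qed.

Lemma TB_swap t a b c d s : TBev t a b c d s <-> LRev t c d a b (s \o swap).
Proof.
split=> -[x [y [e1 e2 h]]].
  exists (swap x), (swap y); split=> //; apply: (lk_map _ _ h) => [u v _ _|z]; first by rewrite swap_radj.
  by rewrite rect_swap /= swapK.
exists (swap x), (swap y); split=> //; apply: (lk_map _ _ h) => [u v _ _|z]; first by rewrite swap_radj.
by rewrite rect_swap.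
Qed.

Lemma rect_transl p a b c d z :
  rect (a + p.1) (b + p.1) (c + p.2) (d + p.2) (transl p z) = rect a b c d z.
Proof. by rewrite /rect /transl /= !lerD2r. Qed.

Lemma LR_transl t p a b c d s :
  LRev t (a + p.1) (b + p.1) (c + p.2) (d + p.2) s <-> LRev t a b c d (s \o transl p).
Proof.
split=> -[x [y [e1 e2 h]]].
  exists (transl (oppz p) x), (transl (oppz p) y); split.
  - by rewrite /transl /= e1 addrK.
  - by rewrite /transl /= e2 addrK.
  - apply: (lk_map _ _ h) => [u v _ _|z hz]; first by rewrite transl_radj.
    have e := translVK p z.
    suff : rect a b c d (transl (oppz p) z) && (s (transl p (transl (oppz p) z)) == t) by [].
    by rewrite e -(rect_transl p) e.
exists (transl p x), (transl p y); split.
- by rewrite /transl /= e1.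
- by rewrite /transl /= e2.
- apply: (lk_map _ _ h) => [u v _ _|z]; first by rewrite transl_radj.
  by rewrite rect_transl.
Qed.

Lemma LR_local t a b c d N : (forall z, rect a b c d z -> (normInf z <= N)%N) -> local N (LRev t a b c d).
Proof.
move=> hN s s' ss [x [y [e1 e2 h]]]; exists x, y; split=> //.
by apply: lk_sub h => z /andP[rz sz]; rewrite rz -ss ?sz ?hN.
Qed.

Lemma LR_mono t a b c d : tmono t (LRev t a b c d).
Proof.
apply: tmono_of => s s' ss [x [y [e1 e2 h]]]; exists x, y; split=> //.
by apply: lk_sub h => z /andP[-> /ss ->].
Qed.

Lemma TB_local t a b c d N : (forall z, rect a b c d z -> (normInf z <= N)%N) -> local N (TBev t a b c d).
Proof.
move=> hN s s' ss [x [y [e1 e2 h]]]; exists x, y; split=> //.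
by apply: lk_sub h => z /andP[rz sz]; rewrite rz -ss ?sz ?hN.
Qed.

Lemma TB_mono t a b c d : tmono t (TBev t a b c d).
Proof.
apply: tmono_of => s s' ss [x [y [e1 e2 h]]]; exists x, y; split=> //.
by apply: lk_sub h => z /andP[-> /ss ->].
Qed.

Lemma radj_fst t u v : radj t u v -> (absz (u.1 - v.1) <= 1)%N.
Proof. by move/radj_sadj; rewrite /sadj; lia. Qed.

Lemma lk_LR t (X : site -> bool) a b c d s x y : lk (radj t) X x y -> a <= b -> x.1 <= a -> b <= y.1 ->
  (forall z, X z -> a <= z.1 <= b -> rect a b c d z && (s z == t)) -> LRev t a b c d s.
Proof.
move=> h ab xa yb hX.
have [x' [y' [e1 e2 _ h']]] := lk_cross (f := fst) (radj_sym t) (@radj_fst t) ab h xa yb.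
by exists x', y'; split=> //; apply: lk_sub h' => z /andP[/hX].
Qed.

Lemma join t (X Y Z : site -> bool) (a b c d : int) x x' y y' :
  lk (radj t) X x x' -> lk (radj t) Y y y' -> (forall z, X z -> Z z) -> (forall z, Y z -> Z z) ->
  (forall z, X z -> c <= z.2 <= d) -> (forall z, Y z -> a <= z.1 <= b) ->
  x.1 <= a -> b <= x'.1 -> y.2 <= c -> d <= y'.2 -> lk (radj t) Z x y.
Proof.
move=> hx hy XZ YZ hX hY xa xb yc yd.
have [u [v [xu yv uv]]] := touch hx hy hX hY xa xb yc yd.
have xu' := lk_sub XZ xu; have yv' := lk_sub YZ yv.
apply: (lk_trans xu'); apply: (lk_sym (radj_sym t)); apply: (lk_trans yv').
case: uv => [->|uv]; first exact: lk_refl (lk_snd yv').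
by apply: lk_step; rewrite ?(lk_snd yv') ?(lk_snd xu') // radj_sym.
Qed.

Lemma le_of_eq (V : numDomainType) (x y : V) : x = y -> x <= y. Proof. by move=> ->. Qed.
Lemma ge_of_eq (V : numDomainType) (x y : V) : x = y -> y <= x. Proof. by move=> ->. Qed.

Section Crossings.
Variables (T : R).
Hypothesis T0 : 0 < T.
Variable h : R.

Definition crp t (w n : nat) : R := mu T h (LRev t 0 w 0 n).

Lemma mu_LR t (a b c d : int) w n : b = a + w%:Z -> d = c + n%:Z -> mu T h (LRev t a b c d) = crp t w n.
Proof.
move=> eb ed; rewrite /crp.
rewrite -(mu_isom T0 h (isom_translV (a, c)) (LR_local (t := t) (@rect_norm 0 w 0 n)) (k := normInf (a, c))).
- apply: (mu_eq T h) => s; have H := LR_transl t (a, c) 0 w 0 n s.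
  by rewrite [(a, c).1]/= [(a, c).2]/= !add0r in H; rewrite eb ed (addrC a) (addrC c).
- by move=> x; rewrite -(norm_oppz (a, c)) norm_transl.
- by move=> x; rewrite -(norm_oppz (a, c)) norm_translV.
Qed.

Lemma mu_TB t (a b c d : int) w n : b = a + n%:Z -> d = c + w%:Z -> mu T h (TBev t a b c d) = crp t w n.
Proof.
move=> eb ed; rewrite -(mu_LR t ed eb) .
rewrite -(mu_isom T0 h isom_swap (LR_local (t := t) (@rect_norm c d a b)) (k := 0)).
- by apply: (mu_eq T h) => s; apply: TB_swap.
- by move=> x; rewrite norm_swap addn0.
- by move=> x; rewrite norm_swap addn0.
Qed.

Lemma crp_mono t w w' n n' : (w' <= w)%N -> (n <= n')%N -> crp t w n <= crp t w' n'.
Proof.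
move=> ww nn; rewrite /crp.
apply: (mu_le T0 h (N := w + n' + w')).
- by apply: LR_local => z; rewrite /rect /normInf; move: ww nn; clear; lia.
- by apply: LR_local => z; rewrite /rect /normInf; move: ww nn; clear; lia.
move=> s [x [y [e1 e2 hl]]]; apply: (lk_LR hl) => //; rewrite ?e1 ?e2 //.
by move=> z /andP[rz ->] hz; rewrite andbT /rect hz /=; move: rz nn; rewrite /rect; clear; lia.
Qed.

Lemma crp_ge0 t w n : 0 <= crp t w n.
Proof. exact: (mu_ge0 T0 h (LR_local (@rect_norm _ _ _ _))). Qed.

Lemma crp_le1 t w n : crp t w n <= 1.
Proof. exact: (mu_le1 T0 h (LR_local (@rect_norm _ _ _ _))). Qed.

Lemma crp_dual t n : 1 <= crp t n n + crp (~~ t) n n.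
Proof.
have lA := @LR_local (~~ t) 0 n 0 n _ (@rect_norm _ _ _ _).
have lB := @TB_local t 0 n 0 n _ (@rect_norm _ _ _ _).
have eB : mu T h (TBev t 0 n 0 n) = crp t n n by apply: mu_TB; rewrite add0r.
suff : mu T h (enot (LRev (~~ t) 0 n 0 n)) <= crp t n n by rewrite (mu_not T0 h lA) -/(crp _ _ _); lra.
rewrite -eB; apply: (mu_le T0 h (localC lA) lB) => s nA.
have [[x [y [e1 e2 hl]]]|[x [y [e1 e2 hl]]]] := @expl_dichotomy t 0 n 0 n s ltac:(by []) ltac:(by []).
  by case: nA; exists x, y.
by exists x, y.
Qed.

(** The two rectangles overlap in a square of side n; a crossing of this square in the other
    direction glues their crossings. *)
Lemma crp_extend t w n m : (n <= w)%N -> (n <= m)%N ->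
  crp t m n * (crp t w n * crp t n n) <= crp t (m + (w - n)) n.
Proof.
move=> nw nm.
pose wi : int := m%:Z - n%:Z.
have l1 := @LR_local t 0 m 0 n _ (@rect_norm _ _ _ _).
have l2 := @LR_local t wi (wi + w%:Z) 0 n _ (@rect_norm _ _ _ _).
have l3 := @TB_local t wi m 0 n _ (@rect_norm _ _ _ _).
set N1 := (_ + _ + _ + _)%N in l1; set N2 := (_ + _ + _ + _)%N in l2; set N3 := (_ + _ + _ + _)%N in l3.
pose N := (N1 + N2 + N3 + (m + w))%N.
have {}l1 : local N (LRev t 0 m 0 n) by apply: local_le l1; rewrite /N; clear; lia.
have {}l2 : local N (LRev t wi (wi + w%:Z) 0 n) by apply: local_le l2; rewrite /N; clear; lia.
have {}l3 : local N (TBev t wi m 0 n) by apply: local_le l3; rewrite /N; clear; lia.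
have l4 : local N (LRev t 0 (m + (w - n))%N 0 n).
  by apply: LR_local => z; rewrite /rect /normInf /N; move: nw nm; clear; lia.
have e2 : mu T h (LRev t wi (wi + w%:Z) 0 n) = crp t w n by apply: mu_LR; rewrite ?add0r.
have e3 : mu T h (TBev t wi m 0 n) = crp t n n by apply: mu_TB; rewrite ?add0r // /wi subrK.
rewrite -e2 -e3.
have f1 := mu_fkg T0 h l2 l3 (@LR_mono _ _ _ _ _) (@TB_mono _ _ _ _ _).
have f2 := mu_fkg T0 h l1 (localI l2 l3) (@LR_mono _ _ _ _ _) (tmonoI (@LR_mono _ _ _ _ _) (@TB_mono _ _ _ _ _)).
have le0 := crp_ge0 t m n.
apply: (le_trans (ler_wpM2l le0 f1)); apply: (le_trans f2).
apply: (mu_le T0 h (localI l1 (localI l2 l3)) l4) => s.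
move=> [[x1 [y1 [a1 b1 h1]]] [[x2 [y2 [a2 b2 h2]]] [x3 [y3 [a3 b3 h3]]]]].
pose Z z := rect 0 (m + (w - n))%N 0 n z && (s z == t).
have Z1 z : rect 0 m 0 n z && (s z == t) -> Z z.
  by case/andP => + h'; rewrite /Z h' andbT /rect; move: nw nm; clear; lia.
have Z2 z : rect wi (wi + w%:Z) 0 n z && (s z == t) -> Z z.
  by case/andP => + h'; rewrite /Z h' andbT /rect /wi; move: nw nm; clear; lia.
have Z3 z : rect wi m 0 n z && (s z == t) -> Z z.
  by case/andP => + h'; rewrite /Z h' andbT /rect /wi; move: nw nm; clear; lia.
have j1 : lk (radj t) Z x1 x3.
  apply: (@join t _ _ Z wi m 0 n _ _ _ _ h1 h3 Z1 Z3); rewrite ?a1 ?b1 ?a3 ?b3 //.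
  - by move=> z /andP[/andP[_]].
  - by move=> z /andP[/andP[]].
  - by rewrite /wi; move: nm; clear; lia.
have j2 : lk (radj t) Z x2 x3.
  apply: (@join t _ _ Z wi m 0 n _ _ _ _ h2 h3 Z2 Z3); rewrite ?a2 ?b2 ?a3 ?b3 //.
  - by move=> z /andP[/andP[_]].
  - by move=> z /andP[/andP[]].
  - by rewrite /wi; move: nw; clear; lia.
exists x1, y2; split=> //; first by rewrite b2 /wi; move: nw nm; clear; lia.
apply: (lk_trans j1); apply: (lk_trans (lk_sym (radj_sym t) j2)).
exact: lk_sub h2.
Qed.

Lemma crp_long t w n i : (n <= w)%N -> crp t w n ^+ (2 * i + 1) <= crp t (w + i * (w - n)) n.
Proof.
move=> nw; elim: i => [|i IH]; first by rewrite mul0n addn0 muln0 add0n expr1.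
have := @crp_extend t w n (w + i * (w - n)) nw (leq_trans nw (leq_addr _ _)).
have e : (w + i.+1 * (w - n) = w + i * (w - n) + (w - n))%N by rewrite mulSn addnAC addnA addnAC.
rewrite e; apply: le_trans.
have e2 : (2 * i.+1 + 1 = (2 * i + 1) + 2)%N by rewrite mulnS addnAC addnC addnA addnAC -addnA.
rewrite e2 exprD; apply: ler_pM => //; rewrite ?exprn_ge0 ?crp_ge0 //.
by rewrite expr2; apply: ler_wpM2l; [exact: crp_ge0|apply: crp_mono].
Qed.

(* The crossing, its mirror image in the axis of the square of side k and a crossing of that
   square are glued. *)
Lemma rsw_crossing t r k : (r < k)%N -> (k < 2 * r)%N ->
  (2^-1 * (crp t (2 * r) (2 * r) - 2 * Delta T^-1 r (k - r)) * crp t k k) ^+ 2 * crp t k k <=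
  crp t (4 * r - k) (k + r) \/ crp t (2 * r) (2 * r) < 2 * Delta T^-1 r (k - r).
Proof.
move=> rk k2; case: (ltP (crp t (2 * r) (2 * r)) (2 * Delta T^-1 r (k - r))) => hD; [by right|left].
have := rsw_step T0 t h rk k2.
set Yv := linked_cross t r k; set Sq := square_LR t r.
have lY : local k Yv := @linked_cross_local t r k rk k2.
have lV := @cross_free_local t r k rk k2.
have eS : mu T h Sq = crp t (2 * r) (2 * r).
  rewrite -(@mu_LR t (- r%:Z) r%:Z (- r%:Z) r%:Z).
  - apply: (mu_eq T h) => s; split=> -[x [y [e1 e2 hl]]].
      by exists y, x; split=> //; apply: (lk_sym (radj_sym t)).
    by exists y, x; split=> //; apply: (lk_sym (radj_sym t)).
  - by clear; lia.
  - by clear; lia.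
have kV : crp t k k <= mu T h (cross_free t r k).
  rewrite -(@mu_TB t (- r%:Z) (k%:Z - r%:Z) (- k%:Z) 0); [|by clear; lia|by clear; lia].
  have lB : local k (TBev t (- r%:Z) (k%:Z - r%:Z) (- k%:Z) 0).
    by apply: TB_local => z; rewrite /rect /normInf; move: rk; clear; lia.
  apply: (mu_le T0 h lB lV) => s [x [y [e1 e2 hl]]] z Cz; rewrite ltNge; apply/negP => zb.
  move/asboolP: Cz => [u [ua hu]].
  have hl' : lk (radj (~~ ~~ t)) (fun z => rect (- r%:Z) (k%:Z - r%:Z) (- k%:Z) 0 z && (s z == t)) x y.
    by rewrite negbK.
  have rows (v : site) : rect (- r%:Z) (k%:Z - r%:Z) (- k%:Z) 0 v && (s v == ~~ t) -> - k%:Z <= v.2 <= 0.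
    by move=> /andP[/andP[_]].
  have cols (v : site) : rect (- r%:Z) (k%:Z - r%:Z) (- k%:Z) 0 v && (s v == t) -> - r%:Z <= v.1 <= k%:Z - r%:Z.
    by move=> /andP[/andP[]].
  have [w [w1 _ w2]] := crossing hu hl' rows cols (le_of_eq ua) zb (le_of_eq e1) (ge_of_eq e2).
  move: w1 (lk_snd w2) => /andP[_ /eqP ->] /andP[_]; by case: (t).
rewrite eS => rs.
set D := crp t (2 * r) (2 * r) - _ in rs *.
have D0 : 0 <= D by rewrite subr_ge0.
have {}rs : 2^-1 * D * crp t k k <= mu T h Yv.
  by apply: le_trans rs; apply: ler_wpM2l => //; rewrite mulr_ge0 ?invr_ge0.
have p0 : 0 <= 2^-1 * D * crp t k k by rewrite mulr_ge0 ?crp_ge0 // mulr_ge0 ?invr_ge0.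
(* The reflection in the vertical midline x = (k - 2 r) / 2 of the square of side k. *)
pose mir (z : site) : site := (k%:Z - 2 * r%:Z - z.1, z.2).
have mK : involutive mir by case=> x y; rewrite /mir /= opprB addrC subrK.
have im : isom mir mir.
  split=> [x|x|[x y]]; rewrite ?mK //; rewrite /nbrs /mir /e1 /e2 /d1 /d2 /=.
  have -> : k%:Z - 2 * r%:Z - (x + 1) = k%:Z - 2 * r%:Z - x - 1 by ring.
  have -> : k%:Z - 2 * r%:Z - (x - 1) = k%:Z - 2 * r%:Z - x + 1 by ring.
  apply/permP => p /=; lia.
have mr u v : radj t (mir u) (mir v) = radj t u v.
  have e (x y z : int) : z - x - (z - y) = - (x - y) by ring.
  by case: (t); rewrite /= /adj /sadj /mir /= !e abszN.
have eM : mu T h (fun s => Yv (s \o mir)) = mu T h Yv.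
  apply: (mu_isom T0 h im lY (k := (k + 2 * r)%N)) => x; rewrite /normInf /mir /=; clear; lia.
have lM : local (4 * k) (fun s => Yv (s \o mir)).
  move=> s s' ss; apply: lY => x hx /=; apply: ss; move: hx k2; rewrite /normInf /mir /=; clear -rk; lia.
have mY : tmono t Yv.
  apply: tmono_of => s s' ss [v1 [v2 [x [e1 e2 e3 h1 h2]]]]; exists v1, v2, x; split=> //.
    by apply: lk_sub h1 => z /andP[-> /ss ->].
  by apply: lk_sub h2 => z /andP[-> /ss ->].
have mM : tmono t (fun s => Yv (s \o mir)).
  by move: mY; case: (t) => mY s s' ss; apply: mY => x; apply: ss.
have lH : local (4 * k) (LRev t (- r%:Z) (k%:Z - r%:Z) (- k%:Z) 0).
  by apply: LR_local => z; rewrite /rect /normInf; move: rk; clear; lia.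
have {}lY : local (4 * k) Yv by apply: local_le lY; clear; lia.
have f1 := mu_fkg T0 h lY lM mY mM.
have f2 := mu_fkg T0 h (localI lY lM) lH (tmonoI mY mM) (@LR_mono _ _ _ _ _).
rewrite (@mu_LR t _ _ _ _ k k) in f2; [|by clear; lia|by clear; lia].
rewrite eM in f1.
have lR : local (4 * k) (LRev t (k%:Z - 3 * r%:Z) r (- k%:Z) r).
  by apply: LR_local => z; rewrite /rect /normInf; move: rk; clear; lia.
rewrite -(@mu_LR t (k%:Z - 3 * r%:Z) r (- k%:Z) r (4 * r - k) (k + r)); [|by move: k2; clear; lia|by clear; lia].
have {}f1 : (2^-1 * D * crp t k k) ^+ 2 <= mu T h (eand Yv (fun s => Yv (s \o mir))).
  by apply: le_trans f1; rewrite expr2; apply: ler_pM.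
apply: (le_trans (ler_wpM2r (crp_ge0 t k k) f1)); apply: (le_trans f2).
apply: (mu_le T0 h (localI (localI lY lM) lH) lR) => s.
move=> [[[v1 [v2 [x [e1 e2 e3 h1 h2]]]] [v1' [v2' [x' [e1' e2' e3' h1' h2']]]]] [p [q [ep eq hp]]]].
pose S := rect (- r%:Z) (k%:Z - r%:Z) (- k%:Z) 0.
pose Z z := rect (k%:Z - 3 * r%:Z) r (- k%:Z) r z && (s z == t).
have SZ z : S z && (s z == t) -> Z z.
  by case/andP => + h'; rewrite /Z h' andbT /S /rect; move: rk k2; clear; lia.
have WZ z : (S z || rect (- r%:Z) r (- r%:Z) r z) && (s z == t) -> Z z.
  by case/andP => + h'; rewrite /Z h' andbT /S /rect; move: rk k2; clear; lia.
have m1 : lk (radj t) (fun w => S w && (s w == t)) (mir v1') (mir v2').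
  apply: (lk_map _ _ h1') => [u v _ _|z /andP[rz ->]]; first by rewrite mr.
  by rewrite andbT; move: rz; rewrite /S /rect /mir /=; clear; lia.
have m2 : lk (radj t) Z (mir v1') (mir x').
  apply: (lk_map _ _ h2') => [u v _ _|z /andP[rz sz]]; first by rewrite mr.
  by rewrite /Z sz andbT; move: rz rk k2; rewrite /rect /mir /=; clear; lia.
have jn u u' : lk (radj t) (fun w => S w && (s w == t)) u u' -> u.2 = - k%:Z -> u'.2 = 0 -> lk (radj t) Z p u.
  move=> hu eu eu'; apply: (@join t _ _ Z (- r%:Z) (k%:Z - r%:Z) (- k%:Z) 0 _ _ _ _ hp hu SZ SZ); rewrite ?ep ?eq ?eu ?eu' //.
  - by move=> z /andP[/andP[_]].
  - by move=> z /andP[/andP[]].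
have j1 := jn _ _ h1 e1 e2; have j2 := jn _ _ m1 e1' e2'.
exists (mir x'), x; split=> //; first by rewrite /mir /= e3'; clear; lia.
apply: (lk_trans (lk_sym (radj_sym t) m2)); apply: (lk_trans (lk_sym (radj_sym t) j2)).
apply: (lk_trans j1); exact: lk_sub h2.
Qed.

End Crossings.

Lemma Delta_small (T : R) (K : nat) (eps : R) : Tc < T -> 0 < eps ->
  exists N, forall n d, (N <= d)%N -> (n <= K * d)%N -> Delta T^-1 n d <= eps.
Proof.
move=> hT e0; have T0 := le_lt_trans Tc_ge0 hT.
have b0 : 0 <= T^-1 by rewrite invr_ge0 ltW.
have K0 : 0 < (K.+1 ^ 2)%:R :> R by rewrite ltr0n expn_gt0.
have [N HN] := mdec_decay hT (divr_gt0 e0 K0).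
exists N => n d Nd nd; rewrite /Delta.
have md := mdec_ge0 d b0.
apply: (@le_trans _ _ ((K.+1 ^ 2)%:R * (((2 * d + 1) ^ 3)%:R * mdec T^-1 d))).
  rewrite mulrA -natrM; apply: ler_wpM2r => //; rewrite ler_nat.
  apply: (@leq_trans ((K.+1 * (2 * d + 1)) ^ 2)).
    by rewrite leq_exp2r //; move: nd; rewrite mulSn; lia.
  by rewrite expnMn leq_mul2l leq_pexp2l ?orbT ?addn1.
by rewrite mulrC -ler_pdivlMr // addn1; apply: HN.
Qed.

Lemma exp_le (x y : R) n : 0 <= x -> x <= y -> x ^+ n <= y ^+ n.
Proof. by move=> x0 xy; apply: lerXn2r; rewrite ?nnegrE // (le_trans x0). Qed.

(** 512 = 2 * 16 ^ 2 comes from one use of [rsw_crossing] with all square crossings of probability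
    at least 1/2, the exponent from 54 extensions in [crp_long]. *)
Definition strip_const : R := (512^-1) ^+ (2 * 54 + 1).

(** By duality each of the squares of sides 50 j, 70 j and 98 j is crossed by one type with
    probability at least 1/2, and two of them share the type. Any two of these lengths serve as k <
    2 r with r < k; the rectangles so crossed, 90 x 85, 126 x 119 and 146 x 99 times j, are longer
    than high, hence can be extended to length 360 j. *)
Lemma strip_prob_const (T : R) : Tc < T -> exists j0, forall j, (j0 <= j)%N -> forall h, exists t,
  strip_const <= crp T h t (360 * j) (120 * j).
Proof.
move=> hT; have T0 := le_lt_trans Tc_ge0 hT.
(* 49 is the largest ratio r / (k - r), attained for r = 49 j and k = 50 j. *)
have [N HN] := Delta_small 49 hT (ltac:(lra) : 0 < 8^-1 :> R).
exists N.+1 => j hj h; have c0 : 0 <= 512^-1 :> R by rewrite invr_ge0 ler0n.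
have base t r k : crp T h t (2 * r) (2 * r) >= 2^-1 -> crp T h t k k >= 2^-1 ->
   (r < k)%N -> (k < 2 * r)%N -> (r <= 49 * (k - r))%N -> (N <= k - r)%N ->
   512^-1 <= crp T h t (4 * r - k) (k + r).
  move=> h1 h2 rk k2 r49 Nk; have D := HN _ _ Nk r49.
  case: (rsw_crossing T0 h t rk k2); last by lra.
  apply: le_trans; set D' := Delta _ _ _ in D *; set p := crp _ _ _ _ _ in h1 *; set q := crp _ _ _ k k in h2 *.
  have e1 : 16^-1 <= 2^-1 * (p - 2 * D') * q.
    have : 4^-1 <= p - 2 * D' by lra.
    by move=> h3; nra.
  have : 256^-1 <= (2^-1 * (p - 2 * D') * q) ^+ 2.
    rewrite expr2; move: (2^-1 * _ * q) e1 => z e1; nra.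
  by move: ((2^-1 * (p - 2 * D') * q) ^+ 2) => z hz; nra.
have fin t W n : 512^-1 <= crp T h t W n -> (n <= W)%N -> (n <= 120 * j)%N -> (360 * j <= W + 54 * (W - n))%N ->
   strip_const <= crp T h t (360 * j) (120 * j).
  move=> h1 nW n1 n2.
  apply: le_trans (crp_mono T0 h t n2 n1); apply: le_trans (crp_long T0 h t 54 nW).
  exact: (exp_le _ c0 h1).
have col n : exists t, 2^-1 <= crp T h t n n.
  have := crp_dual T0 h true n => /=; case: (lerP 2^-1 (crp T h true n n)) => h1 h2; [by exists true|].
  by exists false; lra.
have [t1 h1] := col (50 * j)%N; have [t2 h2] := col (70 * j)%N; have [t3 h3] := col (98 * j)%N.
have s1 t : t = t1 -> t = t2 -> exists t, strip_const <= crp T h t (360 * j) (120 * j).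
  move=> e1 e2; exists t; subst t; apply: (fin _ (90 * j)%N (85 * j)%N); try by (clear; lia).
  have -> : (90 * j = 4 * (35 * j) - 50 * j)%N by clear; lia.
  have -> : (85 * j = 50 * j + 35 * j)%N by clear; lia.
  apply: base; try by (move: hj; clear; lia).
    by rewrite (_ : (2 * (35 * j) = 70 * j)%N) ?e2 //; clear; lia.
  by [].
have s2 t : t = t2 -> t = t3 -> exists t, strip_const <= crp T h t (360 * j) (120 * j).
  move=> e1 e2; exists t; subst t; apply: (fin _ (126 * j)%N (119 * j)%N); try by (clear; lia).
  have -> : (126 * j = 4 * (49 * j) - 70 * j)%N by clear; lia.
  have -> : (119 * j = 70 * j + 49 * j)%N by clear; lia.
  apply: base; try by (move: hj; clear; lia).
    by rewrite (_ : (2 * (49 * j) = 98 * j)%N) ?e2 //; clear; lia.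
  by [].
have s3 t : t = t1 -> t = t3 -> exists t, strip_const <= crp T h t (360 * j) (120 * j).
  move=> e1 e2; exists t; subst t; apply: (fin _ (146 * j)%N (99 * j)%N); try by (clear; lia).
  have -> : (146 * j = 4 * (49 * j) - 50 * j)%N by clear; lia.
  have -> : (99 * j = 50 * j + 49 * j)%N by clear; lia.
  apply: base; try by (move: hj; clear; lia).
    by rewrite (_ : (2 * (49 * j) = 98 * j)%N) ?e2 //; clear; lia.
  by [].
by case: t1 h1 s1 s3 => h1 s1 s3; case: t2 h2 s1 s2 => h2 s1 s2; case: t3 h3 s2 s3 => h3 s2 s3;
  first [exact: (s1 true)|exact: (s1 false)|exact: (s2 true)|exact: (s2 false)|exact: (s3 true)|exact: (s3 false)].
Qed.

Lemma strip_prob (T : R) : Tc < T -> exists2 c : R, 0 < c & exists j0, forall j, (j0 <= j)%N ->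
  forall h, exists t, c <= crp T h t (360 * j) (120 * j).
Proof.
move=> hT; exists strip_const; last exact: strip_prob_const.
by rewrite /strip_const; apply: exprn_gt0; rewrite invr_gt0 ltr0n.
Qed.

(** * Circuits and arms *)

Definition flip1 (z : site) : site := (- z.1, z.2).
(** Four symmetries of the square, one for each side: the chosen side is brought to the right. *)
Definition dir (p q : bool) (z : site) : site :=
  let w := if p then swap z else z in if q then flip1 w else w.
Definition dirV (p q : bool) (z : site) : site :=
  let w := if q then flip1 z else z in if p then swap w else w.

Lemma flip1K : involutive flip1. Proof. by case=> x y; rewrite /flip1 /= opprK. Qed.
Lemma dirK p q : cancel (dir p q) (dirV p q).
Proof. by move=> z; case: p q => [] []; rewrite /dir /dirV ?flip1K ?swapK. Qed.
Lemma dirVK p q : cancel (dirV p q) (dir p q).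
Proof. by move=> z; case: p q => [] []; rewrite /dir /dirV ?swapK ?flip1K. Qed.

Lemma flip1_radj t u v : radj t (flip1 u) (flip1 v) = radj t u v.
Proof. by case: t; rewrite /= /adj /sadj /flip1 /= -opprD abszN. Qed.

Lemma dir_radj t p q u v : radj t (dir p q u) (dir p q v) = radj t u v.
Proof. by case: p q => [] []; rewrite /dir ?flip1_radj ?swap_radj. Qed.

Lemma dirV_radj t p q u v : radj t (dirV p q u) (dirV p q v) = radj t u v.
Proof. by rewrite -(dir_radj t p q) !dirVK. Qed.

Lemma norm_flip1 z : normInf (flip1 z) = normInf z.
Proof. by rewrite /normInf /flip1 /= abszN. Qed.

Lemma norm_dir p q z : normInf (dir p q z) = normInf z.
Proof. by case: p q => [] []; rewrite /dir ?norm_flip1 ?norm_swap. Qed.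

Lemma norm_dirV p q z : normInf (dirV p q z) = normInf z.
Proof. by rewrite -(norm_dir p q) dirVK. Qed.

Lemma isom_flip1 : isom flip1 flip1.
Proof.
split; [exact: flip1K|exact: flip1K|move=> [x y]].
rewrite /nbrs /flip1 /e1 /e2 /d1 /d2 /= opprD opprB (addrC 1).
apply/permP => p /=; rewrite !addn0; move: (p _ : bool) (p _ : bool) (p _ : bool) (p _ : bool); lia.
Qed.

Lemma isom_comp g g' f f' : isom g g' -> isom f f' -> isom (g \o f) (f' \o g').
Proof.
move=> [gK g'K gn] [fK f'K fn]; split=> [x|x|x]; [by rewrite /= gK|by rewrite /= f'K|].
by rewrite map_comp; apply: (perm_trans (gn _)); apply/perm_map/fn.
Qed.

Lemma isom_dir p q : isom (dir p q) (dirV p q).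
Proof.
have i0 : isom id id by split=> // x; rewrite map_id.
case: p q => [] [].
- exact: isom_comp isom_flip1 isom_swap.
- exact: isom_swap.
- exact: isom_flip1.
- exact: i0.
Qed.

Lemma join_iso t p q (X Y Z : site -> bool) (a b c d : int) x x' y y' :
  lk (radj t) X x x' -> lk (radj t) Y y y' -> (forall z, X z -> Z z) -> (forall z, Y z -> Z z) ->
  (forall z, X z -> c <= (dir p q z).2 <= d) -> (forall z, Y z -> a <= (dir p q z).1 <= b) ->
  (dir p q x).1 <= a -> b <= (dir p q x').1 -> (dir p q y).2 <= c -> d <= (dir p q y').2 ->
  lk (radj t) Z x y.
Proof.
move=> hx hy XZ YZ hX hY xa xb yc yd.
have mp (W : site -> bool) u v : lk (radj t) W u v -> lk (radj t) (W \o dirV p q) (dir p q u) (dir p q v).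
  by apply: lk_map => [w w' _ _|w]; rewrite ?dir_radj //= dirK.
have := @join t _ _ (Z \o dirV p q) a b c d _ _ _ _ (mp _ _ _ hx) (mp _ _ _ hy).
move=> /(_ (fun z => XZ _) (fun z => YZ _)) H.
have : lk (radj t) (Z \o dirV p q) (dir p q x) (dir p q y).
  by apply: H => // z /=; [move/hX; rewrite dirVK|move/hY; rewrite dirVK].
move=> h; rewrite -(dirK p q x) -(dirK p q y); apply: lk_map h => [w w' _ _|w]; rewrite ?dirV_radj //.
Qed.

Definition strip t (a : nat) p q : event := fun s => TBev t a (3 * a)%N (- (3 * a)%N%:Z) (3 * a)%N (s \o dirV p q).
(** Four strip crossings stand for a circuit in the annulus between radii a and 3 a. No closed path
    is constructed; what is used is that they block arms of the other type ([ring_block]) and join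
    arms of their own ([ring_hub]). *)
Definition ring t (a : nat) : event := fun s => forall p q, strip t a p q s.

Section Ring.
Variables (t : bool) (a : nat) (s : config).
Let X p q z := rect a (3 * a)%N (- (3 * a)%N%:Z) (3 * a)%N (dir p q z) && (s z == t).

Lemma strip_path p q : strip t a p q s -> exists y y',
  [/\ (dir p q y).2 = - (3 * a)%N%:Z, (dir p q y').2 = (3 * a)%N & lk (radj t)
   (fun z => rect a (3 * a)%N (- (3 * a)%N%:Z) (3 * a)%N (dir p q z) && (s z == t)) y y'].
Proof.
move=> [y [y' [e1 e2 h]]]; exists (dirV p q y), (dirV p q y'); rewrite !dirVK; split=> //.
by apply: lk_map h => [w w' _ _|w]; rewrite ?dirV_radj // dirVK.
Qed.

Let XZ p q z : X p q z -> (normInf z <= 3 * a)%N && (s z == t).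
Proof.
by move=> /andP[h ->]; rewrite andbT -(norm_dir p q); move: h; rewrite /rect /normInf; clear; lia.
Qed.

Lemma arm_exit (r : rel site) (W : site -> bool) x y (n : nat) : symmetric r ->
  (forall u v, r u v -> sadj u v) -> lk r W x y -> (normInf x <= n)%N -> (n <= normInf y)%N ->
  exists2 y', normInf y' = n & lk r (fun z => W z && (normInf z <= n)%N) x y'.
Proof.
move=> rs ra h hx hy.
have [|||y' [e _ h']] := @lk_enter r W (fun z => - (normInf z)%:Z) (- n%:Z) _ _ _ (lk_sym rs h).
- by move=> u v /ra; rewrite /sadj /normInf; clear; lia.
- by move: hy; clear; lia.
- by move: hx; clear; lia.
exists y'; first by move: e; clear; lia.
by apply: (lk_sym rs); apply: lk_sub h' => z; rewrite lerN2 lez_nat.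
Qed.

Lemma arm_side (r : rel site) (W : site -> bool) x y : symmetric r -> (forall u v, r u v -> sadj u v) ->
  lk r W x y -> (normInf x <= a)%N -> (3 * a <= normInf y)%N ->
  exists p q x' y', [/\ lk r (fun z => W z && (normInf z <= 3 * a)%N) x x',
    (dir p q x').1 = a, (dir p q y').1 = (3 * a)%N &
    lk r (fun z => (W z && (normInf z <= 3 * a)%N) && (a%:Z <= (dir p q z).1 <= (3 * a)%N)) x' y'].
Proof.
move=> rs ra h hx hy.
have [|y1 e1 h1] := arm_exit rs ra h _ hy; first by apply: leq_trans hx _; clear; lia.
have [p [q e]] : exists p q, (dir p q y1).1 = (3 * a)%N.
  have [e|[e|[e|e]]] : y1.1 = (3 * a)%N \/ - y1.1 = (3 * a)%N \/ y1.2 = (3 * a)%N \/ - y1.2 = (3 * a)%N.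
    by move: e1; rewrite /normInf; clear; lia.
  - by exists false, false.
  - by exists false, true.
  - by exists true, false.
  - by exists true, true.
have fr (u v : site) : r u v -> (absz ((dir p q u).1 - (dir p q v).1) <= 1)%N.
  by move=> /ra uv; apply: (@radj_fst false); rewrite dir_radj.
have fx : (dir p q x).1 <= a.
  by move: hx; rewrite -(norm_dir p q x) /normInf; move: (dir p q x) => z; clear; lia.
have a3 : a%:Z <= (3 * a)%N by clear; lia.
have [x' [y' [e2 e3 h2 h3]]] := lk_cross rs fr a3 h1 fx (ge_of_eq e).
by exists p, q, x', y'.
Qed.

Lemma ring_block x y : ring t a s -> (normInf x <= a)%N -> (3 * a <= normInf y)%N ->
  ~ lk (radj (~~ t)) (fun z => s z == ~~ t) x y.
Proof.
move=> rg hx hy h.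
have [p [q [x' [y' [_ e1 e2 h1]]]]] := arm_side (radj_sym _) (@radj_sadj _) h hx hy.
have [u [u' [f1 f2 h2]]] := strip_path (rg p q).
have mp (r : rel site) (W : site -> bool) v w : (forall u v, r (dir p q u) (dir p q v) = r u v) ->
   lk r W v w -> lk r (W \o dirV p q) (dir p q v) (dir p q w).
  by move=> hr; apply: lk_map => [z z' _ _|z]; rewrite ?hr //= dirK.
have k1 := mp _ _ _ _ (dir_radj _ p q) h1; have k2 := mp _ _ _ _ (dir_radj _ p q) h2.
have k2' := k2; rewrite -{1}(negbK t) in k2'.
have rows (z : site) : ((fun z => ((s z == ~~ t) && (normInf z <= 3 * a)%N) &&
   (a%:Z <= (dir p q z).1 <= (3 * a)%N)) \o dirV p q) z -> - (3 * a)%N%:Z <= z.2 <= (3 * a)%N.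
  by rewrite /= norm_dirV /normInf; clear; lia.
have cols (z : site) : (X p q \o dirV p q) z -> a%:Z <= z.1 <= (3 * a)%N.
  by rewrite /X /= dirVK => /andP[/andP[]].
have [w [w1 _ w2]] := crossing k1 k2' rows cols (le_of_eq e1) (ge_of_eq e2) (le_of_eq f1) (ge_of_eq f2).
move: w1 (lk_snd w2) => /= /andP[/andP[/eqP -> _] _] /andP[_]; by case: (t).
Qed.

(** The site v is chosen before the path, so any two paths that cross the annulus are joined to each
    other through it. *)
Lemma ring_hub : ring t a s -> exists v, forall (W : site -> bool) x y, (forall z, W z -> s z == t) ->
  lk (radj t) W x y -> (normInf x <= a)%N -> (3 * a <= normInf y)%N ->
  lk (radj t) (fun z => (normInf z <= 3 * a)%N && (s z == t)) v x.
Proof.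
move=> rg; pose Z z := (normInf z <= 3 * a)%N && (s z == t).
have [yy Hy] : exists yy : bool -> bool -> site, forall p q, exists y',
  [/\ (dir p q (yy p q)).2 = - (3 * a)%N%:Z, (dir p q y').2 = (3 * a)%N & lk (radj t) (X p q) (yy p q) y'].
  by exists (fun p q => sval (cid (strip_path (rg p q)))) => p q; apply: svalP (cid (strip_path (rg p q))).
have [y0' [e0 e0' h0]] := Hy false false; have [y1' [e1 e1' h1]] := Hy false true.
have [y2' [e2 e2' h2]] := Hy true false; have [y3' [e3 e3' h3]] := Hy true true.
rewrite /dir /= in e0 e0' e1 e1' e2 e2' e3 e3'.
have j20 : lk (radj t) Z (yy true false) (yy false false).
  apply: (@join t _ _ Z a (3 * a)%N a (3 * a)%N _ _ _ _ h2 h0 (@XZ true false) (@XZ false false)).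
  - by move=> z /andP[/andP[]].
  - by move=> z /andP[/andP[]].
  - by rewrite e2; clear; lia.
  - by rewrite e2'.
  - by rewrite e0; clear; lia.
  - by rewrite e0'.
have j30 : lk (radj t) Z (yy true true) (yy false false).
  apply: (@join t _ _ Z a (3 * a)%N (- (3 * a)%N%:Z) (- a%:Z) _ _ _ _ h3 h0 (@XZ true true) (@XZ false false)).
  - by move=> z /andP[/andP[+ _] _]; rewrite /dir /=; clear; lia.
  - by move=> z /andP[/andP[]].
  - by rewrite e3; clear; lia.
  - by rewrite e3'.
  - by rewrite e0; clear; lia.
  - by rewrite e0'; clear; lia.
have j21 : lk (radj t) Z (yy true false) (yy false true).
  apply: (@join t _ _ Z (- (3 * a)%N%:Z) (- a%:Z) a (3 * a)%N _ _ _ _ h2 h1 (@XZ true false) (@XZ false true)).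
  - by move=> z /andP[/andP[]].
  - by move=> z /andP[/andP[+ _] _]; rewrite /dir /=; clear; lia.
  - by rewrite e2.
  - by rewrite e2'; clear; lia.
  - by rewrite e1; clear; lia.
  - by rewrite e1'.
have rs := radj_sym t.
exists (yy false false) => W x y hW h hx hy.
have [p [q [x' [y' [k0 f1 f2 k1]]]]] := arm_side rs (@radj_sadj _) h hx hy.
have [u' [g1 g2 h4]] := Hy p q; set u := yy p q in g1 h4.
have WZ (z : site) : W z && (normInf z <= 3 * a)%N -> Z z.
  by case/andP => /hW; rewrite /Z => -> ->.
have ju : lk (radj t) Z x' u.
  apply: (@join_iso t p q _ _ Z a (3 * a)%N (- (3 * a)%N%:Z) (3 * a)%N _ _ _ _ k1 h4 _ (@XZ p q)).
  - by move=> z /andP[/WZ].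
  - by move=> z /andP[/andP[_]]; rewrite -(norm_dir p q) /normInf; move: (dir p q z) => w; clear; lia.
  - by move=> z /andP[/andP[]].
  - by rewrite f1.
  - by rewrite f2.
  - by rewrite g1.
  - by rewrite g2.
have xu : lk (radj t) Z x u by apply: lk_trans ju; apply: lk_sub k0.
have u0 : lk (radj t) Z u (yy false false).
  rewrite /u; case: (p) (q) => [] [] //; last exact: lk_refl (lk_fst (lk_sub (@XZ false false) h0)).
  exact: (lk_trans (lk_sym rs j21) j20).
exact: (lk_sym rs (lk_trans xu u0)).
Qed.

End Ring.

Lemma strip_on t a p q (s s' : config) : (forall z, (a <= normInf z <= 3 * a)%N -> s z = s' z) ->
  strip t a p q s -> strip t a p q s'.
Proof.
move=> ss [x [y [e1 e2 h]]]; exists x, y; split=> //; apply: lk_sub h => z /andP[rz sz].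
rewrite rz /= -ss // norm_dirV; move: rz; rewrite /rect /normInf; clear; lia.
Qed.

Lemma ring_on t a (s s' : config) : (forall z, (a <= normInf z <= 3 * a)%N -> s z = s' z) ->
  ring t a s -> ring t a s'.
Proof. by move=> ss h p q; apply: strip_on ss (h p q). Qed.

Lemma strip_local t a p q : local (3 * a) (strip t a p q).
Proof. by move=> s s' ss; apply: strip_on => z /andP[_ hz]; apply: ss. Qed.

Lemma ring_local t a : local (3 * a) (ring t a).
Proof. by move=> s s' ss; apply: ring_on => z /andP[_ hz]; apply: ss. Qed.

Lemma tmono_comp t E (f : site -> site) : tmono t E -> tmono t (fun s => E (s \o f)).
Proof. by case: t => mE s s' ss; apply: mE => x; apply: ss. Qed.

Lemma strip_mono t a p q : tmono t (strip t a p q).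
Proof. exact/tmono_comp/TB_mono. Qed.

(** * Arms and their probabilities *)

Definition arm t (m n : nat) : event := fun s => exists x y, [/\ normInf x = m, normInf y = n &
  lk (radj t) (fun z => (m <= normInf z <= n)%N && (s z == t)) x y].

Lemma norm_radj t u v : radj t u v -> (absz ((normInf u)%:Z - (normInf v)%:Z) <= 1)%N.
Proof. by move/radj_sadj; rewrite /sadj /normInf; lia. Qed.

Lemma arm_of t (X : site -> bool) m n s x y : (m <= n)%N -> lk (radj t) X x y ->
  (normInf x <= m)%N -> (n <= normInf y)%N -> (forall z, X z -> s z == t) -> arm t m n s.
Proof.
move=> mn hl hx hy hX.
have [|||x' [y' [e1 e2 _ h']]] := @lk_cross _ _ (fun z => (normInf z)%:Z) m n _ _ (radj_sym t) (@norm_radj t) _ hl;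
  rewrite ?lez_nat //.
exists x', y'; split; [by case: e1|by case: e2|].
by apply: lk_sub h' => z /andP[/hX ->]; rewrite !lez_nat andbT.
Qed.

Lemma arm_sub t m n m' n' s : (m <= m')%N -> (m' <= n')%N -> (n' <= n)%N -> arm t m n s -> arm t m' n' s.
Proof.
move=> h1 h2 h3 [x [y [e1 e2 hl]]]; apply: (arm_of h2 hl); rewrite ?e1 ?e2 //.
by move=> z /andP[].
Qed.

Lemma arm_on t m n (s s' : config) : (forall z, (m <= normInf z <= n)%N -> s z = s' z) ->
  arm t m n s -> arm t m n s'.
Proof.
move=> ss [x [y [e1 e2 h]]]; exists x, y; split=> //; apply: lk_sub h => z /andP[rz sz].
by rewrite rz -ss.
Qed.

Lemma arm_local t m n : local n (arm t m n).
Proof. by move=> s s' ss; apply: arm_on => z /andP[_ hz]; apply: ss. Qed.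

Lemma arm_outside t m n k : (k < m)%N -> outside k (arm t m n).
Proof. by move=> km s s' ss; apply: arm_on => z /andP[hz _]; apply: ss; apply: leq_trans hz. Qed.

Lemma arm_mono t m n : tmono t (arm t m n).
Proof.
apply: tmono_of => s s' ss [x [y [e1 e2 h]]]; exists x, y; split=> //.
by apply: lk_sub h => z /andP[-> /ss ->].
Qed.

Lemma Bev_arm m n s : Bev m n s <-> arm true m n s.
Proof.
split=> [[x [p /and3P[/andP[pp ap] /eqP e1 /eqP e2]]]|[x [y [e1 e2 [p [pp ap lp]]]]]].
  exists x, (last x p); split=> //; exists p; split=> //.
  by apply: sub_all ap => z; rewrite eqb_id.
exists x, p; rewrite /plus_path pp e1 lp e2 !eqxx !andbT /=.
by apply: sub_all ap => z; rewrite eqb_id.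
Qed.

Lemma Aplus_LR n s : Aplus n s <-> LRev true (- n%:Z) n (- n%:Z) n s.
Proof.
have e z : (normInf z <= n)%N = rect (- n%:Z) n (- n%:Z) n z.
  by rewrite /normInf /rect; lia.
split=> [[x [p /and3P[/andP[pp ap] /eqP e1 /eqP e2]]]|[x [y [e1 e2 [p [pp ap lp]]]]]].
  exists x, (last x p); split=> //; exists p; split=> //.
  by apply: sub_all ap => z; rewrite eqb_id -e.
exists x, p; rewrite /plus_path pp e1 lp e2 !eqxx !andbT /=.
by apply: sub_all ap => z; rewrite eqb_id e.
Qed.

Lemma connO_lk n s : connO n s <-> exists2 y, normInf y = n & lk adj s origin y.
Proof.
split=> [[p /andP[/andP[pp ap] /eqP e2]]|[y e [p [pp ap lp]]]].
  by exists (last origin p) => //; exists p.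
by exists p; rewrite /plus_path pp lp e eqxx andbT.
Qed.

Lemma connO_arm m n s : (m <= n)%N -> connO n s -> arm true m n s.
Proof.
move=> mn /connO_lk[y e hl]; apply: (@arm_of true _ m n _ _ _ mn hl); rewrite ?e //.
by move=> z; rewrite eqb_id.
Qed.

Lemma connO_exit n s : connO n s <-> exists2 y, normInf y = n & lk adj (fun z => s z && (normInf z <= n)%N) origin y.
Proof.
split=> [/connO_lk[y e hl]|[y e hl]]; last by apply/connO_lk; exists y => //; apply: lk_sub hl => z /andP[].
by have [||y' e' h'] := arm_exit adj_sym adj_sadj hl (n := n); rewrite ?e //; exists y'.
Qed.

Lemma connO_local n : local n (connO n).
Proof.
move=> s s' ss /connO_exit[y e hl]; apply/connO_exit; exists y => //.
by apply: lk_sub hl => z /andP[sz nz]; rewrite -ss ?sz.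
Qed.

Lemma connO_mono n : tmono true (connO n).
Proof.
by move=> s s' ss /connO_lk[y e hl]; apply/connO_lk; exists y => //; apply: lk_sub hl => z /ss.
Qed.

Lemma Aplus_local n : local n (Aplus n).
Proof.
move=> s s' ss /Aplus_LR h; apply/Aplus_LR; move: h; apply: LR_local ss => z.
by rewrite /rect /normInf; clear; lia.
Qed.

(** Points at spacing r along the sides of the boundary of S(m); the translates of S(r) to them
    cover this boundary ([box_cover]). *)
Definition cpt (m r : nat) (p q : bool) (i : nat) : site := dirV p q (m%:Z, - m%:Z + (i * r)%N%:Z).

Lemma cpt_norm m r p q i : (i <= 2 * m %/ r)%N -> normInf (cpt m r p q i) = m.
Proof.
move=> hi; rewrite norm_dirV /normInf /=.
have : (i * r <= 2 * m)%N by apply: leq_trans (leq_trunc_div _ r); rewrite leq_mul2r hi orbT.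
clear; lia.
Qed.

Lemma box_cover m r y : (0 < r)%N -> normInf y = m ->
  exists p q i, (i <= 2 * m %/ r)%N /\ (normInf (transl (oppz (cpt m r p q i)) y) <= r)%N.
Proof.
move=> r0 ny.
have [p [q e]] : exists p q, (dir p q y).1 = m.
  have [e|[e|[e|e]]] : y.1 = m \/ - y.1 = m \/ y.2 = m \/ - y.2 = m.
    by move: ny; rewrite /normInf; clear; lia.
  - by exists false, false.
  - by exists false, true.
  - by exists true, false.
  - by exists true, true.
have n2 : (absz (dir p q y).2 <= m)%N by rewrite -ny -(norm_dir p q y) leq_maxr.
pose j := absz ((dir p q y).2 + m%:Z)%R.
exists p, q, (j %/ r)%N; split; first by apply: leq_div2r; move: n2; rewrite /j; clear; lia.
have ej := divn_eq j r; have lj := ltn_pmod j r0.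
have dD u v : dir p q (transl (oppz (dirV p q u)) v) = transl (oppz u) (dir p q v).
  case: u v => [u1 u2] [v1 v2]; rewrite /dir /dirV /transl /oppz /swap /flip1.
  by case: (p); case: (q) => /=; rewrite ?opprD ?opprK.
have hj : j%:Z = (dir p q y).2 + m%:Z by rewrite /j; move: n2; clear; lia.
rewrite -(norm_dir p q) dD /normInf /transl /oppz /= e; clear -ej lj hj r0.
move: (dir p q y).2 (j %/ r)%N (j %% r)%N ej lj hj => d2 a c ej lj hj; rewrite ej in hj.
by move: (a * r)%N hj => w hj; lia.
Qed.

Section Prob.
Variables (T : R).
Hypothesis hT : Tc < T.
Let T0 : 0 < T. Proof. exact: le_lt_trans Tc_ge0 hT. Qed.
Variable h : R.

Lemma local_shift N E z : local N E -> local (N + normInf z) (fun s => E (s \o transl z)).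
Proof. by move=> lE s s' ss; apply: lE => x hx; apply: ss; apply: (leq_trans (norm_transl z x)); rewrite leq_add2r. Qed.

Lemma mu_shift N E z : local N E -> mu T h (fun s => E (s \o transl z)) = mu T h E.
Proof.
move=> lE; apply: (mu_isom T0 h (isom_translV z) lE (k := normInf z)) => x.
  by rewrite -(norm_oppz z) norm_transl.
by rewrite -(norm_oppz z) norm_translV.
Qed.

Lemma mu_dir N E p q : local N E -> mu T h (fun s => E (s \o dirV p q)) = mu T h E.
Proof.
by move=> lE; apply: (mu_isom T0 h (isom_dir p q) lE (k := 0)) => x; rewrite norm_dir addn0.
Qed.

Lemma mu_eand N E F : local N E -> local N F -> mu T h E + mu T h F - 1 <= mu T h (eand E F).
Proof.
move=> lE lF; have := mu_add T0 h lE lF.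
have : mu T h (eand E (enot F)) <= mu T h (enot F).
  by apply: (mu_le T0 h (localI lE (localC lF)) (localC lF)) => s [].
rewrite (mu_not T0 h lF); lra.
Qed.

Lemma mu_true : mu T h (fun=> True) = 1.
Proof.
have l1 : local 0 (fun=> True) by [].
apply/le_anti/andP; split; first exact: (mu_le1 T0 h l1).
apply: (mu_ge_of T0 l1); exists 0%N => n _.
rewrite -[leLHS](gibbs_cst T^-1 h (boxsites n) (ctrue : config)); apply: gibbs_le => s _.
by rewrite ind_true.
Qed.

Section Lists.
Variables (I : eqType) (N : nat) (E : I -> event).
Implicit Types r : seq I.

Lemma local_all r : (forall i, i \in r -> local N (E i)) -> local N (fun s => forall i, i \in r -> E i s).
Proof. by move=> lE s s' ss H i ir; apply: (lE i ir _ _ ss); apply: H. Qed.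

Lemma local_ex r : (forall i, i \in r -> local N (E i)) -> local N (fun s => exists2 i, i \in r & E i s).
Proof. by move=> lE s s' ss [i ir Ei]; exists i => //; apply: (lE i ir _ _ ss). Qed.

Let all_cons i r s : (forall j, j \in i :: r -> E j s) <-> eand (E i) (fun s => forall j, j \in r -> E j s) s.
Proof.
split=> [H|[H1 H2] j]; first by split=> [|j jr]; apply: H; rewrite inE ?eqxx // jr orbT.
by rewrite inE => /predU1P[->|/H2].
Qed.

Lemma mu_all r (eps : R) : (forall i, i \in r -> local N (E i)) ->
  (forall i, i \in r -> 1 - eps <= mu T h (E i)) ->
  1 - (size r)%:R * eps <= mu T h (fun s => forall i, i \in r -> E i s).
Proof.
elim: r => [|i r IH] lE hE.
  by rewrite mul0r subr0 -mu_true; apply: le_of_eq; apply: (mu_eq T h).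
rewrite (mu_eq T h (all_cons i r)).
have l1 : local N (E i) by apply: lE; rewrite mem_head.
have sub j : j \in r -> j \in i :: r by move=> jr; rewrite inE jr orbT.
have l2 : forall j, j \in r -> local N (E j) by move=> j jr; apply/lE/sub.
have {}IH := IH l2 (fun j jr => hE j (sub j jr)); have := hE i (mem_head _ _).
have := mu_eand l1 (local_all l2).
by rewrite /= -natr1; lra.
Qed.

Lemma mu_all_fkg c r (x : R) : 0 <= x -> (forall i, i \in r -> local N (E i)) ->
  (forall i, i \in r -> tmono c (E i)) -> (forall i, i \in r -> x <= mu T h (E i)) ->
  x ^+ size r <= mu T h (fun s => forall i, i \in r -> E i s).
Proof.
move=> x0; elim: r => [|i r IH] lE mE hE.
  by rewrite expr0 -mu_true; apply: le_of_eq; apply: (mu_eq T h).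
rewrite (mu_eq T h (all_cons i r)) exprS.
have sub j : j \in r -> j \in i :: r by move=> jr; rewrite inE jr orbT.
have l1 : local N (E i) by apply: lE; rewrite mem_head.
have l2 : forall j, j \in r -> local N (E j) by move=> j jr; apply/lE/sub.
have m2 : forall j, j \in r -> tmono c (E j) by move=> j jr; apply/mE/sub.
have {}IH := IH l2 m2 (fun j jr => hE j (sub j jr)).
have mA : tmono c (fun s => forall j, j \in r -> E j s).
  case: (c) m2 => m2 s s' ss H j jr; apply: (m2 j jr _ _ ss); exact: H.
apply: le_trans (mu_fkg T0 h l1 (local_all l2) (mE i (mem_head _ _)) mA).
by apply: ler_pM => //; [exact: exprn_ge0|apply/hE/mem_head].
Qed.

Lemma mu_ex r (c : R) : (forall i, i \in r -> local N (E i)) ->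
  (forall i, i \in r -> mu T h (E i) <= c) ->
  mu T h (fun s => exists2 i, i \in r & E i s) <= (size r)%:R * c.
Proof.
elim: r => [|i r IH] lE hE.
  rewrite mul0r; have := mu_not T0 h (N := 0) (E := fun=> True) ltac:(by []).
  rewrite mu_true subrr => <-; apply: le_of_eq; apply: (mu_eq T h) => s; split=> [[]//|nt].
  by case: nt.
have sub j : j \in r -> j \in i :: r by move=> jr; rewrite inE jr orbT.
have l1 : local N (E i) by apply: lE; rewrite mem_head.
have l2 : forall j, j \in r -> local N (E j) by move=> j jr; apply/lE/sub.
have {}IH := IH l2 (fun j jr => hE j (sub j jr)); have := hE i (mem_head _ _).
have := mu_or T0 h l1 (local_ex l2).
rewrite (mu_eq T h (E := fun s => exists2 j, j \in i :: r & E j s) (F := eor (E i) (fun s => exists2 j, j \in r & E j s))).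
  by rewrite /= -natr1; lra.
move=> s; split=> [[j]|[Ei|[j jr Ej]]]; last 2 first.
- by exists i => //; apply: mem_head.
- by exists j => //; apply: sub.
by rewrite inE => /predU1P[->|jr] Ej; [left|right; exists j].
Qed.

End Lists.

Definition idx (k : nat) : seq (bool * bool * nat) :=
  [seq (pq, i) | pq <- [:: (true, true); (true, false); (false, true); (false, false)], i <- iota 0 k.+1].

Lemma size_idx k : size (idx k) = (4 * k.+1)%N.
Proof. by rewrite size_allpairs size_iota. Qed.

Lemma mem_idx k p q i : ((p, q, i) \in idx k) = (i <= k)%N.
Proof.
apply/allpairsP/idP => [[[pq j] [_ hj [_ ->]]]|ik]; first by move: hj; rewrite mem_iota /= add0n ltnS.
exists ((p, q), i); rewrite mem_iota; split=> //; by case: p q => [] [].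
Qed.

Lemma ring_lower t a : crp T h t (6 * a) (2 * a) ^+ 4 <= mu T h (ring t a).
Proof.
pose E (pq : bool * bool) := strip t a pq.1 pq.2.
pose r := [:: (true, true); (true, false); (false, true); (false, false)].
have lE pq : local (3 * a) (E pq) by apply: strip_local.
have e pq : mu T h (E pq) = crp T h t (6 * a) (2 * a).
  have lT : local (3 * a) (TBev t a (3 * a)%N (- (3 * a)%N%:Z) (3 * a)%N).
    by apply: TB_local => z; rewrite /rect /normInf; clear; lia.
  by rewrite /E /strip (mu_dir _ _ lT); apply: (mu_TB T0); clear; lia.
have := @mu_all_fkg _ (3 * a) E t r _ (crp_ge0 T0 h t (6 * a) (2 * a)).
move=> /(_ (fun i _ => lE i) (fun i _ => @strip_mono _ _ _ _)) H.
have {}H := H (fun i _ => ge_of_eq (e i)).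
apply: (le_trans H); apply: le_of_eq; apply: (mu_eq T h) => s; split=> [H' p q|rg [p q] _].
  by apply: (H' (p, q)); rewrite /r; case: p q => [] [].
exact: rg.
Qed.

(** Successive radii have ratio 10: the annulus at scale a ends at 3 a, the next begins at 10 a, and
    the gap of 6 a used for mixing fits strictly between them. *)
Lemma no_rings t (delta : R) J a0 : 0 <= delta <= 1 ->
  (forall i, (i < J)%N -> delta <= mu T h (ring t (a0 * 10 ^ i))) ->
  (forall i, (i < J)%N -> 2 * Delta T^-1 (3 * (a0 * 10 ^ i)) (6 * (a0 * 10 ^ i)) <= delta / 2) -> (0 < a0)%N ->
  mu T h (fun s => forall i, (i < J)%N -> ~ ring t (a0 * 10 ^ i) s) <= (1 - delta / 2) ^+ J.
Proof.
move=> d01; elim: J a0 => [|J IH] a0 hr hD a00.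
  by rewrite expr0 -mu_true; apply: le_of_eq; apply: (mu_eq T h) => s; split.
have e10 i : (a0 * 10 ^ i.+1 = 10 * a0 * 10 ^ i)%N by rewrite expnS mulnCA mulnA.
pose F : event := fun s => forall i, (i < J)%N -> ~ ring t (10 * a0 * 10 ^ i) s.
have hF : mu T h F <= (1 - delta / 2) ^+ J.
  by apply: IH => [i iJ|i iJ|]; rewrite -?e10 ?muln_gt0 ?a00 //; [apply: hr|apply: hD].
have lF : local (3 * (10 * a0 * 10 ^ J)) F.
  move=> s s' ss H i iJ; apply: contra_not (H i iJ); apply: ring_on => z /andP[_ hz].
  apply/esym/ss/(leq_trans hz); rewrite leq_mul2l leq_mul2l leq_exp2l // (ltnW iJ) !orbT //.
have oF : outside (3 * a0 + 6 * a0) F.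
  move=> s s' ss H i iJ; apply: contra_not (H i iJ); apply: ring_on => z /andP[hz _].
  apply/esym/ss; apply: leq_trans hz; have : (1 <= 10 ^ i)%N by rewrite expn_gt0.
  by move: (10 ^ i)%N a00 => m; clear; nia.
have lE : local (3 * a0) (enot (ring t a0)) := localC (@ring_local t a0).
have := mix_prod T0 h lE lF oF.
have r0 := hr 0%N isT; have D0 := hD 0%N isT; rewrite expn0 muln1 in r0 D0.
rewrite (mu_not T0 h (@ring_local t a0)) => H.
rewrite (mu_eq T h (F := eand (enot (ring t a0)) F)); last first.
  move=> s; split=> [nr|[n0 nr] [|i] iJ].
  - by split=> [|i iJ]; [have := nr 0%N isT; rewrite expn0 muln1|rewrite -e10; apply: nr].
  - by rewrite expn0 muln1.
  - by rewrite e10; apply: nr.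
apply: (le_trans H); rewrite exprS; apply: ler_pM => //; last by lra.
- have := mu_le1 T0 h (@ring_local t a0); have : 0 <= Delta T^-1 (3 * a0) (6 * a0).
    by rewrite /Delta mulr_ge0 ?ler0n // mdec_ge0 // invr_ge0 ltW.
  lra.
- exact: mu_ge0 lF.
Qed.

(* An arm to distance M crosses the boundary of S(3 n) in one of the covering translates of
   S(Rr), from which it goes on to distance M - 4 n. *)
Lemma arm_branch t Rr n : (0 < Rr)%N -> (Rr <= n)%N ->
  (mu T h (arm t Rr n) + 2 * Delta T^-1 n n) * (4 * (2 * (3 * n) %/ Rr).+1)%:R <= 2^-1 ->
  forall k, mu T h (arm t Rr (Rr + 4 * n * k)) <= 2^-1 ^+ k.
Proof.
move=> R0 Rn hq; elim=> [|k IH]; first by rewrite expr0; apply: (mu_le1 T0 h (@arm_local _ _ _)).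
set M := (Rr + 4 * n * k.+1)%N; set M' := (Rr + 4 * n * k)%N in IH.
have eM : M = (M' + 4 * n)%N by rewrite /M /M' mulnS; clear; lia.
have lM : local M (arm t (3 * n) M) := @arm_local _ _ _.
have H1 : mu T h (arm t Rr M) <= (mu T h (arm t Rr n) + 2 * Delta T^-1 n n) * mu T h (arm t (3 * n) M).
  apply: le_trans (mix_prod T0 h (@arm_local t Rr n) lM _); last first.
    by apply: arm_outside; move: R0 Rn; clear; lia.
  have lA : local (n + M) (eand (arm t Rr n) (arm t (3 * n) M)).
    by apply: localI; apply: local_le (@arm_local _ _ _); clear; lia.
  apply: (mu_le T0 h (local_le _ (@arm_local t Rr M)) lA); first by clear; lia.
  by move=> s hs; split; apply: arm_sub hs => //; move: R0 Rn eM; clear; lia.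
pose K := (2 * (3 * n) %/ Rr)%N.
pose G (i : bool * bool * nat) : event := fun s => arm t Rr M' (s \o transl (cpt (3 * n) Rr i.1.1 i.1.2 i.2)).
have lG i : i \in idx K -> local (M' + 3 * n) (G i).
  case: i => -[p q] i; rewrite mem_idx => hi.
  by have := local_shift (z := cpt (3 * n) Rr p q i) (@arm_local t Rr M'); rewrite cpt_norm.
have H2 : mu T h (arm t (3 * n) M) <= (4 * K.+1)%:R * mu T h (arm t Rr M').
  rewrite -size_idx; apply: le_trans (mu_ex lG _); last first.
    by move=> [[p q] i] _; apply: le_of_eq; apply: mu_shift (@arm_local _ _ _).
  apply: (mu_le T0 h (N := (M + (M' + 3 * n))%N)).
  - by apply: local_le lM; clear; lia.
  - by apply: local_le (local_ex lG); clear; lia.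
  move=> s [x [y [e1 e2 hl]]].
  have [p [q [i [hi hx]]]] := box_cover R0 e1.
  exists (p, q, i); first by rewrite mem_idx.
  rewrite /G /=; set c := cpt _ _ _ _ _ in hx *.
  have cn : normInf c = (3 * n)%N by apply: cpt_norm.
  have hl' : lk (radj t) (fun z => s (transl c z) == t) (transl (oppz c) x) (transl (oppz c) y).
    apply: (lk_map _ _ hl) => [u v _ _|z /andP[_ sz]]; first by rewrite transl_radj.
    by rewrite translVK.
  apply: (arm_of _ hl') => //; first by rewrite /M'; clear; lia.
  have := norm_translV (oppz c) y; rewrite norm_oppz cn e2 eM; clear; lia.
have mu0 := mu_ge0 T0 h (@arm_local t Rr M'); have mu3 := mu_ge0 T0 h lM.
have q0 : 0 <= mu T h (arm t Rr n) + 2 * Delta T^-1 n n.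
  have := mu_ge0 T0 h (@arm_local t Rr n); have : 0 <= Delta T^-1 n n.
    by rewrite /Delta mulr_ge0 ?ler0n // mdec_ge0 // invr_ge0 ltW.
  lra.
apply: (le_trans H1); apply: (le_trans (ler_wpM2l q0 H2)); rewrite mulrA exprS.
by apply: ler_pM => //; apply: mulr_ge0 => //; rewrite ler0n.
Qed.

End Prob.

(** The mixing error is uniform in the field, so continuity in one large box suffices. *)
Lemma mu_cont (T : R) h N E (eps : R) : Tc < T -> local N E -> 0 < eps ->
  exists2 delta : R, 0 < delta & forall h', `|h' - h| < delta -> `|mu T h' E - mu T h E| < eps.
Proof.
move=> hT lE e0; have T0 := le_lt_trans Tc_ge0 hT.
have [M HM] := Delta_small 1 hT (divr_gt0 e0 (ltr0n R 4)).
have D : Delta T^-1 N (M + N) <= eps / 4 by apply: HM; lia.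
have [delta d0 H] := @Pn_cont T h (N + (M + N)) E (eps / 4) (divr_gt0 e0 (ltr0n R 4)).
exists delta => // h' /H; have := mix_mu T0 h (M + N) lE; have := mix_mu T0 h' (M + N) lE.
by rewrite !ler_norml !ltr_norml; lra.
Qed.

Lemma ring_prob (T : R) : Tc < T -> exists2 c : R, 0 < c & exists j0, forall j, (j0 <= j)%N ->
  forall h, exists t, c <= mu T h (ring t (60 * j)).
Proof.
move=> hT; have [c c0 [j0 H]] := strip_prob hT; exists (c ^+ 4); first exact: exprn_gt0.
exists j0 => j hj h; have [t ht] := H j hj h; exists t.
apply: le_trans (ring_lower hT h t (60 * j)).
have e1 : (6 * (60 * j) = 360 * j)%N by clear; lia.
have e2 : (2 * (60 * j) = 120 * j)%N by clear; lia.
by rewrite e1 e2; apply: exp_le ht; apply: ltW.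
Qed.

(** * From likely arms to crossings of wide rectangles *)

Definition dst (z x : site) : nat := normInf (transl (oppz z) x).

Lemma ring_hub_at t a s z : ring t a (s \o transl z) -> exists v, forall (W : site -> bool) x y,
  (forall u, W u -> s u == t) -> lk (radj t) W x y -> (dst z x <= a)%N -> (3 * a <= dst z y)%N ->
  lk (radj t) (fun u => (dst z u <= 3 * a)%N && (s u == t)) v x.
Proof.
move=> /ring_hub[v hv]; exists (transl z v) => W x y hW hl hx hy.
have hl' : lk (radj t) (fun u => s (transl z u) == t) (transl (oppz z) x) (transl (oppz z) y).
  apply: (lk_map _ _ hl) => [u u' _ _|u /hW]; first by rewrite transl_radj.
  by rewrite translVK.
have := hv (fun u => s (transl z u) == t) _ _ (fun u h => h) hl' hx hy => h.
rewrite -[x](translVK z); apply: (lk_map _ _ h) => [u u' _ _|u]; first by rewrite transl_radj.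
by rewrite /dst translK.
Qed.

Definition link (n w : nat) (c : site) : event := fun s => exists x y, [/\ (normInf x <= w)%N,
  (dst c y <= w)%N & lk adj (fun z => (normInf z <= n)%N && s z) x y].

Lemma link_local n w c : local n (link n w c).
Proof.
move=> s s' ss [x [y [e1 e2 h]]]; exists x, y; split=> //; apply: lk_sub h => z /andP[nz sz].
by rewrite nz -ss.
Qed.

Lemma link_mono n w c : tmono true (link n w c).
Proof.
move=> s s' ss [x [y [e1 e2 h]]]; exists x, y; split=> //; apply: lk_sub h => z /andP[nz /ss sz].
by rewrite nz.
Qed.

Lemma arm_link n w s : (0 < w)%N -> arm true w n s -> exists p q i, (i <= 2 * n %/ w)%N /\ link n w (cpt n w p q i) s.
Proof.
move=> w0 [x [y [e1 e2 h]]]; have [p [q [i [hi hy]]]] := box_cover w0 e2.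
exists p, q, i; split=> //; exists x, y; split; rewrite ?e1 //.
by apply: lk_sub h => z /andP[/andP[_ ->]]; rewrite eqb_id.
Qed.

Section Chain.
Variables (s : config) (n w : nat) (y0 : int).
Hypothesis (y0n : (absz y0 <= n)%N).
(** The nodes alternate between heights 0 and [y0]: a link in direction (n, y0) is followed by its
    reflection, equally likely, so the chain stays in a horizontal strip. *)
Definition node (i : nat) : site := ((i * n)%N%:Z, if odd i then y0 else 0).

Definition node_step (i : nat) : site := ((n : int), if odd i then - y0 else y0).
Lemma node_stepE i : node i.+1 = transl (node i) (node_step i).
Proof.
rewrite /node /node_step /transl /= mulSn PoszD.
by case: (odd i) => /=; rewrite ?add0r ?addNr ?subrr //; congr (_, _); ring.
Qed.

Let Z z := s z && (absz z.2 <= 2 * n)%N.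

(** At a node the incoming and the outgoing link both cross an annulus around it; the plus circuit
    there joins them. *)
Lemma chain_link L : (0 < L)%N ->
  (forall i, (i < L)%N -> link n w (node_step i) (s \o transl (node i))) ->
  (forall i, (i < L)%N -> exists2 a, (w <= a)%N && (3 * a + w <= n)%N & ring true a (s \o transl (node i))) ->
  exists x y, [/\ (dst (node 0) x <= w)%N, (dst (node L) y <= w)%N &
    lk adj (fun z => s z && (absz z.2 <= 2 * n)%N) x y].
Proof.
move=> L0 hl hr.
have nd2 i : (absz (node i).2 <= n)%N by rewrite /node /=; case: ifP.
have ldl i : (i < L)%N -> exists x y, [/\ (dst (node i) x <= w)%N, (dst (node i.+1) y <= w)%N &
   lk adj (fun z => s z && (dst (node i) z <= n)%N) x y].
  move=> iL; have [x [y [e1 e2 h]]] := hl i iL.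
  exists (transl (node i) x), (transl (node i) y); split.
  - by rewrite /dst translK.
  - move: e2; rewrite node_stepE /dst /transl /oppz /normInf /=; clear.
    by move: (node i) (node_step i) => [a b] [a' b'] /=; lia.
  - apply: (lk_map _ _ h) => [u v _ _ uv|z /andP[nz sz]].
      by have := transl_radj true (node i) u v; rewrite /= uv => ->.
    by rewrite /dst translK nz andbT.
have sZ i z : s z && (dst (node i) z <= n)%N -> Z z.
  move=> /andP[sz]; rewrite /Z sz; move: (nd2 i); move: (node i) => [a b].
  by rewrite /dst /normInf /transl /oppz /=; clear; lia.
have far i u v : (dst (node i) u <= w)%N -> (dst (node i.+1) v <= w)%N ->
    (n <= dst (node i.+1) u + w)%N /\ (n <= dst (node i) v + w)%N.
  have e : (node i.+1).1 = (node i).1 + n%:Z by rewrite node_stepE [LHS]addrC.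
  have d1 z p : (absz (p.1 - z.1)%R <= dst z p)%N by apply: leq_maxl.
  move=> /(leq_trans (d1 _ _)) hu /(leq_trans (d1 _ _)) hv.
  have := d1 (node i.+1) u; have := d1 (node i) v; rewrite e in hv *.
  move: (node i).1 (dst _ v) (dst _ u) hu hv => a dv du; clear; lia.
have key k : (k < L)%N -> exists x u v, [/\ (dst (node 0) x <= w)%N, (dst (node k) u <= w)%N, (dst (node k.+1) v <= w)%N,
   lk adj (fun z => s z && (dst (node k) z <= n)%N) u v & lk adj Z x v].
  elim: k => [|k IH] kL.
    have [x [y [e1 e2 h]]] := ldl 0%N kL; exists x, x, y; split=> //; exact: (lk_sub (@sZ 0%N) h).
  have [x [u [v [e1 e2 e3 h1 h2]]]] := IH (ltnW kL).
  have [x' [y' [f1 f2 h3]]] := ldl _ kL.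
  have [a /andP[wa an] /ring_hub_at[hub Hh]] := hr _ kL.
  have ts (W : site -> bool) : (forall z, s z && W z -> s z == true) by move=> z /andP[->].
  have [d1 _] := far k u v e2 e3; have [_ d2] := far k.+1 x' y' f1 f2.
  have g1 := Hh _ _ _ (ts _) (lk_sym adj_sym h1) (leq_trans e3 wa) _.
  have g2 := Hh _ _ _ (ts _) h3 (leq_trans f1 wa) _.
  have {}g1 := g1 ltac:(by move: d1 an; clear; lia).
  have {}g2 := g2 ltac:(by move: d2 an; clear; lia).
  have hZ z : (dst (node k.+1) z <= 3 * a)%N && (s z == true) -> Z z.
    rewrite eqb_id => /andP[dz sz]; apply: (@sZ k.+1); rewrite sz /=.
    by apply: (leq_trans dz); move: an; clear; lia.
  exists x, x', y'; split=> //.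
  apply: (lk_trans h2); apply: (lk_trans (lk_sym adj_sym (lk_sub hZ g1))).
  by apply: (lk_trans (lk_sub hZ g2)); exact: (lk_sub (@sZ k.+1) h3).
have [|x [u [v [e1 _ e2 _ h]]]] := key L.-1; first by rewrite prednK.
by rewrite prednK // in e2; exists x, v.
Qed.
End Chain.

Section Wide.
Variables (T : R).
Hypothesis hT : Tc < T.
Let T0 : 0 < T. Proof. exact: le_lt_trans Tc_ge0 hT. Qed.
Variable h : R.

Lemma plus_ring (delta : R) w n a t : 1 - delta < mu T h (arm true w n) -> delta <= mu T h (ring t a) ->
  (w <= a)%N -> (3 * a <= n)%N -> t = true.
Proof.
case: t => // ha hr wa an; exfalso.
have lA : local (n + 3 * a) (arm true w n) by apply: local_le (@arm_local _ _ _); rewrite leq_addr.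
have lR : local (n + 3 * a) (ring false a) by apply: local_le (@ring_local _ _); rewrite leq_addl.
have : mu T h (arm true w n) <= mu T h (enot (ring false a)).
  apply: (mu_le T0 h lA (localC lR)) => s [x [y [e1 e2 hl]]] rg.
  apply: (@ring_block false a s x y rg); rewrite ?e1 ?e2 //.
  by apply: lk_sub hl => z /andP[].
rewrite (mu_not T0 h lR); lra.
Qed.

(* The square root trick: by FKG one of the [4 (2 n / w + 1)] ways to realize the arm has
   probability close to 1. *)
Lemma sqrt_trick (th : R) n w : (0 < w)%N -> 0 <= th ->
  1 - th ^+ (4 * (2 * n %/ w).+1) < mu T h (arm true w n) ->
  exists p q i, (i <= 2 * n %/ w)%N /\ 1 - th <= mu T h (link n w (cpt n w p q i)).
Proof.
move=> w0 th0 ha; apply: contrapT => no.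
pose E (i : bool * bool * nat) : event := enot (link n w (cpt n w i.1.1 i.1.2 i.2)).
have lE i : local n (E i) := localC (@link_local _ _ _).
have mE i : tmono false (E i) := tmonoC (@link_mono _ _ _).
have H := @mu_all_fkg T hT h _ n E false (idx (2 * n %/ w)) th th0 (fun i _ => lE i) (fun i _ => mE i).
have hE i : i \in idx (2 * n %/ w) -> th <= mu T h (E i).
  case: i => -[p q] i; rewrite mem_idx => hi; rewrite (mu_not T0 h (@link_local _ _ _)) /=.
  have : ~ (1 - th <= mu T h (link n w (cpt n w p q i))) by move=> k; apply: no; exists p, q, i.
  move/negP; rewrite -ltNge; lra.
have {}H := H hE; rewrite size_idx in H.
have lA := local_all (fun i (_ : i \in idx (2 * n %/ w)) => lE i).
have : mu T h (arm true w n) <= mu T h (enot (fun s => forall i, i \in idx (2 * n %/ w) -> E i s)).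
  apply: (mu_le T0 h (@arm_local _ _ _) (localC lA)) => s /(arm_link w0)[p [q [i [hi hlk]]]] all_.
  by apply: (all_ (p, q, i)); rewrite ?mem_idx.
rewrite (mu_not T0 h lA); lra.
Qed.

Lemma link_isom (g g' : site -> site) n w c : isom g g' -> (forall u v, adj (g' u) (g' v) = adj u v) ->
  (forall u, normInf (g' u) = normInf u) -> (forall u v, dst (g' u) (g' v) = dst u v) ->
  mu T h (link n w (g' c)) = mu T h (link n w c).
Proof.
move=> ig ga gn gd; have [gK g'K _] := ig.
rewrite -(mu_isom T0 h ig (@link_local n w c) (k := 0)).
- apply: (mu_eq T h) => s; split=> -[x [y [e1 e2 hl]]].
    exists (g x), (g y); rewrite -(gn (g x)) -(gd c) !gK; split=> //.
    by apply: (lk_map _ _ hl) => [u v _ _|z]; [rewrite -(ga (g u)) !gK|rewrite /= -(gn (g z)) gK].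
  exists (g' x), (g' y); rewrite gn gd; split=> //.
  by apply: (lk_map _ _ hl) => [u v _ _|z]; [rewrite ga|rewrite /= gn].
- by move=> x; rewrite -(gn (g x)) gK addn0.
- by move=> x; rewrite -(gn (g x)) gK addn0.
Qed.

Lemma dst_dirV p q u v : dst (dirV p q u) (dirV p q v) = dst u v.
Proof.
case: u v => [a b] [a' b']; case: p q => [] []; rewrite /dst /dirV /transl /oppz /swap /flip1 /normInf /=; lia.
Qed.

Lemma dst_flip2 u v : dst (flip2 u) (flip2 v) = dst u v.
Proof. by case: u v => [a b] [a' b']; rewrite /dst /flip2 /transl /oppz /normInf /=; lia. Qed.

Lemma rings_whp (delta : R) w n a0 J : 0 <= delta <= 1 -> 1 - delta < mu T h (arm true w n) ->
  (0 < a0)%N -> (w <= a0)%N -> (3 * (a0 * 10 ^ J) <= n)%N ->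
  (forall i, exists t, delta <= mu T h (ring t (a0 * 10 ^ i))) ->
  (forall i, 2 * Delta T^-1 (3 * (a0 * 10 ^ i)) (6 * (a0 * 10 ^ i)) <= delta / 2) ->
  1 - (1 - delta / 2) ^+ J <= mu T h (fun s => exists2 i, i \in iota 0 J & ring true (a0 * 10 ^ i) s).
Proof.
move=> d01 ha a00 wa an hr hD.
have bnd i : (i < J)%N -> (w <= a0 * 10 ^ i)%N /\ (a0 * 10 ^ i <= a0 * 10 ^ J)%N.
  move=> iJ; split; last by rewrite leq_mul2l leq_exp2l // ltnW ?orbT.
  by apply: (leq_trans wa); rewrite leq_pmulr // expn_gt0.
have hr' i : (i < J)%N -> delta <= mu T h (ring true (a0 * 10 ^ i)).
  move=> iJ; have [b1 b2] := bnd i iJ; have [t ht] := hr i.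
  have e := plus_ring ha ht b1; rewrite -(e _) //.
  by apply: leq_trans an; rewrite leq_mul2l.
have H := no_rings hT d01 hr' (fun i _ => hD i) a00.
pose E i : event := ring true (a0 * 10 ^ i).
have lE : forall i, i \in iota 0 J -> local (3 * (a0 * 10 ^ J)) (E i).
  move=> i; rewrite mem_iota => iJ; have [_ b2] := bnd i iJ.
  by apply: local_le (@ring_local _ _); rewrite leq_mul2l.
have lX := local_ex lE.
have := mu_not T0 h lX.
rewrite (mu_eq T h (F := fun s => forall i, (i < J)%N -> ~ ring true (a0 * 10 ^ i) s)); first by move=> e; rewrite /E in e; lra.
move=> s; split=> [nx i iJ rg|nr [i]]; first by apply: nx; exists i; rewrite ?mem_iota.
by rewrite mem_iota => iJ; apply: nr.
Qed.

Lemma wide_at (delta th : R) w n a0 J L : (0 < L)%N -> 0 <= delta <= 1 -> 0 <= th -> (0 < w)%N ->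
  1 - delta < mu T h (arm true w n) -> 1 - th ^+ (4 * (2 * n %/ w).+1) < mu T h (arm true w n) ->
  (0 < a0)%N -> (w <= a0)%N -> (3 * (a0 * 10 ^ J) + w <= n)%N ->
  (forall i, exists t, delta <= mu T h (ring t (a0 * 10 ^ i))) ->
  (forall i, 2 * Delta T^-1 (3 * (a0 * 10 ^ i)) (6 * (a0 * 10 ^ i)) <= delta / 2) ->
  1 - L%:R * (th + (1 - delta / 2) ^+ J) <= crp T h true (L * n - 2 * w) (4 * n).
Proof.
move=> L0 d01 th0 w0 ha ha' a00 wa an hr hD.
have an' : (3 * (a0 * 10 ^ J) <= n)%N by apply: leq_trans an; rewrite leq_addr.
have HR := rings_whp d01 ha a00 wa an' hr hD.
have [p [q [i [hi HL]]]] := sqrt_trick w0 th0 ha'.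
pose y0 : int := - n%:Z + (i * w)%N%:Z.
have y0n : (absz y0 <= n)%N.
  have : (i * w <= 2 * n)%N by apply: leq_trans (leq_trunc_div _ w); rewrite leq_mul2r hi orbT.
  by rewrite /y0; clear; lia.
have HL1 : 1 - th <= mu T h (link n w ((n : int), y0)).
  move: HL; rewrite /cpt -/y0 (link_isom n w _ (isom_dir p q)) //.
  - by move=> u v; apply: (dirV_radj true).
  - by move=> u; apply: norm_dirV.
  - exact: dst_dirV.
have HL2 : 1 - th <= mu T h (link n w ((n : int), - y0)).
  rewrite -[((n : int), - y0)]/(flip2 ((n : int), y0)) (link_isom n w _ isom_flip2) //.
  - by move=> u v; apply: (flip2_radj true).
  - by move=> u; rewrite /normInf /flip2 /= abszN.
  - exact: dst_flip2.
pose Rg : event := fun s => exists2 i, i \in iota 0 J & ring true (a0 * 10 ^ i) s.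
have lRg : local n Rg.
  apply: local_ex => j; rewrite mem_iota => /= jJ; apply: local_le (@ring_local _ _).
  by apply: leq_trans an'; rewrite !leq_mul2l leq_exp2l // ltnW ?orbT.
pose E k : event := fun s => eand (link n w (node_step n y0 k)) Rg (s \o transl (node n y0 k)).
have l0 k : local n (eand (link n w (node_step n y0 k)) Rg) := localI (@link_local _ _ _) lRg.
pose N := (n + L * n + n)%N.
have lE k : k \in iota 0 L -> local N (E k).
  rewrite mem_iota => /= kL; apply: local_le (local_shift (z := node n y0 k) (l0 k)).
  have : (k * n <= L * n)%N by rewrite leq_mul2r ltnW ?orbT.
  by move: y0n; rewrite /N /node /normInf; case: (odd k) => /=; clear; lia.
have HE k : k \in iota 0 L -> 1 - (th + (1 - delta / 2) ^+ J) <= mu T h (E k).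
  move=> _; rewrite /E (mu_shift hT h (node n y0 k) (l0 k)).
  have := mu_eand hT h (@link_local n w (node_step n y0 k)) lRg.
  have : 1 - th <= mu T h (link n w (node_step n y0 k)) by rewrite /node_step; case: (odd k).
  by move: HR; rewrite -/Rg; lra.
have := mu_all hT lE HE; rewrite size_iota => H; apply: (le_trans H).
case: (leqP (2 * w) (L * n)) => wl; last first.
  have : (n < 2 * w)%N by apply: leq_trans wl; rewrite ltnS leq_pmull.
  move: an wa; have : (1 <= 10 ^ J)%N by rewrite expn_gt0.
  by move: (10 ^ J)%N => m; clear; nia.
rewrite -(@mu_LR T T0 h true w ((L * n)%N%:Z - w%:Z) (- (2 * n)%N%:Z) (2 * n)%N); last 2 first.
- by move: wl; clear; lia.
- by clear; lia.
have lLR : local (L * n + 2 * n) (LRev true w ((L * n)%N%:Z - w%:Z) (- (2 * n)%N%:Z) (2 * n)%N).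
  by apply: LR_local => z; rewrite /rect /normInf; clear; lia.
apply: (mu_le T0 h (local_le _ (local_all lE)) (local_le _ lLR) (N := N + (L * n + 2 * n))%N).
- by clear; lia.
- by clear; lia.
move=> s all_.
have [||x [y [e1 e2 hl]]] := @chain_link s n w y0 y0n L L0.
- by move=> k kL; have [] := all_ k ltac:(by rewrite mem_iota).
- move=> k kL; have [_ [j + rg]] := all_ k ltac:(by rewrite mem_iota).
  rewrite mem_iota => /= jJ; exists (a0 * 10 ^ j)%N => //; apply/andP; split.
    by apply: (leq_trans wa); rewrite leq_pmulr // expn_gt0.
  by apply: leq_trans an; rewrite leq_add2r !leq_mul2l leq_exp2l // ltnW ?orbT.
apply: (lk_LR (t := true) hl).
- by move: wl; clear; lia.
- by move: e1; rewrite /dst /node /normInf /transl /oppz /=; clear; lia.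
- by move: e2; rewrite /dst /node /normInf /transl /oppz /=; clear; lia.
- by move=> z /andP[sz z2] z1; rewrite eqb_id sz andbT /rect z1 /=; move: z2; clear; lia.
Qed.

End Wide.

Lemma pow_small (x eps : R) : 0 <= x < 1 -> 0 < eps -> exists J, x ^+ J <= eps.
Proof.
move=> /andP[x0 x1] e0; have c : ((x ^+ n) @[n --> \oo] --> (0 : R))%classic.
  by apply: cvg_expr; rewrite ger0_norm.
have := cvgr_lt 0 c eps e0; case=> N _ H; exists N; apply/ltW/H => /=; exact: leqnn.
Qed.

(** Closeness of the arm probability to 1 is used twice: [delta] forces the circuits to be plus
    circuits, and [th ^+ M] feeds the square root trick with its M translates. *)
Lemma wide (T kappa : R) : Tc < T -> 0 < kappa -> exists2 eps : R, 0 < eps <= 1 &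
  exists N w0, [/\ (2 <= N)%N, (0 < w0)%N & forall h w, (w0 <= w)%N -> 1 - eps < mu T h (arm true w (N * w)) ->
    1 - kappa <= crp T h true (12 * (N * w)) (4 * (N * w))].
Proof.
move=> hT k0; have T0 := le_lt_trans Tc_ge0 hT.
have [c c0 [j0 Hr]] := ring_prob hT.
pose delta := Num.min c 1; have d01 : 0 < delta <= 1.
  by rewrite /delta lt_min c0 ltr01 /= ge_min lexx orbT.
have dc : delta <= c by rewrite /delta ge_min lexx.
have [|J HJ] := @pow_small (1 - delta / 2) (kappa / 26) _ (divr_gt0 k0 (ltr0n R 26)).
  by apply/andP; split; lra.
have [D0 HD] := Delta_small 1 hT (ltac:(lra) : 0 < delta / 4).
(* There will be 13 links, whose length 13 N w - 2 w is at least 12 N w. Each fails through the link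
   or through the circuits, with probability at most kappa / 26 for either. *)
pose th : R := Num.min (kappa / 26) 1; have th0 : 0 < th by rewrite /th lt_min ltr01 andbT divr_gt0 // ltr0n.
have th1 : th <= 1 by rewrite /th ge_min lexx orbT.
have thk : th <= kappa / 26 by rewrite /th ge_min lexx.
(* The circuit scales are 60 w 10 ^ i for i < J; the multiple of 60 is inherited from [ring_prob],
   and 360 leaves room for three times the scale 60 w 10 ^ J and for w. *)
pose N := (360 * 10 ^ J)%N.
pose M := (4 * (2 * N).+1)%N.
have tM : 0 < th ^+ M by apply: exprn_gt0.
exists (Num.min delta (th ^+ M)).
  by rewrite lt_min tM; case/andP: d01 => -> /= d1; rewrite ge_min d1.
have N2 : (2 <= N)%N.
  have : (1 <= 10 ^ J)%N by rewrite expn_gt0.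
  by rewrite /N; move: (10 ^ J)%N => m; clear; lia.
exists N, (D0 + j0).+1; split=> //.
move=> h w hw ha.
have w0 : (0 < w)%N by apply: leq_trans hw.
have hd : 1 - delta < mu T h (arm true w (N * w)).
  by apply: le_lt_trans ha; rewrite lerD2l lerN2 ge_min lexx.
have ht : 1 - th ^+ (4 * (2 * (N * w) %/ w).+1) < mu T h (arm true w (N * w)).
  by rewrite mulnA mulnK //; apply: le_lt_trans ha; rewrite lerD2l lerN2 ge_min lexx orbT.
have e60 i : (60 * w * 10 ^ i = 60 * (w * 10 ^ i))%N by rewrite mulnA.
have wi i : (w <= w * 10 ^ i)%N by rewrite leq_pmulr // expn_gt0.
have d01' : 0 <= delta <= 1 by case/andP: d01 => /ltW -> ->.
have := @wide_at T hT h delta th w (N * w) (60 * w) J 13 isT d01' (ltW th0) w0 hd ht.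
have a1 : (0 < 60 * w)%N by rewrite muln_gt0.
have a2 : (w <= 60 * w)%N by rewrite leq_pmull.
have a3 : (3 * (60 * w * 10 ^ J) + w <= N * w)%N.
  have : (1 <= 10 ^ J)%N by rewrite expn_gt0.
  by rewrite /N; move: (10 ^ J)%N => m; clear; nia.
move=> /(_ a1 a2 a3) H.
have {}H := H ltac:(move=> i; rewrite e60; have [|t ht'] := Hr (w * 10 ^ i)%N _ h;
  [by apply: leq_trans (wi i); apply: leq_trans hw; clear; lia|exists t; exact: le_trans ht']).
have {}H : 1 - 13%:R * (th + (1 - delta / 2) ^+ J) <= crp T h true (13 * (N * w) - 2 * w) (4 * (N * w)).
  apply: H => i; set a := (60 * w * 10 ^ i)%N.
  have : Delta T^-1 (3 * a) (6 * a) <= delta / 4.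
    apply: HD; last by clear; lia.
    rewrite /a e60; have := wi i; move: (w * 10 ^ i)%N hw => m; clear; lia.
  lra.
have cm : crp T h true (13 * (N * w) - 2 * w) (4 * (N * w)) <= crp T h true (12 * (N * w)) (4 * (N * w)).
  apply: (crp_mono T0) => //.
  by move: N2; move: (N) => m; clear; nia.
by apply: le_trans cm; apply: le_trans H; lra.
Qed.

(** * Percolation and the critical field *)

Lemma line_link (X : site -> bool) (f : int -> site) (n : nat) : (forall k, adj (f k) (f (k + 1))) ->
  (forall k : int, (absz k <= n)%N -> X (f k)) -> forall k : int, (absz k <= n)%N -> lk adj X (f 0) (f k).
Proof.
move=> hf hX.
have pos m : (m <= n)%N -> lk adj X (f 0) (f m%:Z).
  elim: m => [|m IH] hm; first exact/lk_refl/hX.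
  apply: (lk_trans (IH (ltnW hm))); rewrite (_ : (m.+1%:Z = m%:Z + 1)); last by clear; lia.
  apply: lk_step => //; apply: hX; first exact: ltnW.
  by move: hm; clear; lia.
have neg m : (m <= n)%N -> lk adj X (f 0) (f (- m%:Z)).
  elim: m => [|m IH] hm; first exact/lk_refl/hX.
  apply: (lk_trans (IH (ltnW hm))).
  have e : - m%:Z = - m.+1%:Z + 1 by clear; lia.
  apply: lk_step; first by apply: hX; move: hm; clear; lia.
    by apply: hX; move: hm; clear; lia.
  by rewrite e adj_sym; apply: hf.
move=> k hk; case: (leP 0 k) => k0.
  by rewrite (_ : k = (absz k)%:Z); [apply: pos|move: k0; clear; lia].
by rewrite (_ : k = - (absz k)%:Z); [apply: neg|move: k0; clear; lia].
Qed.

Lemma box_link (s : config) n x : all_plus n s -> (normInf x <= n)%N -> lk adj s origin x.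
Proof.
move=> ap hx.
have h1 : lk adj s (0, 0) (x.1, 0).
  apply: (@line_link s (fun k => (k, 0)) n) => [k|k hk|].
  - by rewrite /adj /=; clear; lia.
  - by apply: ap; rewrite /normInf /= maxn0.
  - by apply: leq_trans hx; apply: leq_maxl.
apply: (lk_trans h1); rewrite [X in lk _ _ _ X]surjective_pairing.
apply: (@line_link s (fun k => (x.1, k)) n) => [k|k hk|].
- by rewrite /adj /=; clear; lia.
- by apply: ap; rewrite geq_max hk andbT; apply: leq_trans hx; apply: leq_maxl.
- by apply: leq_trans hx; apply: leq_maxr.
Qed.

Lemma connO_of (s : config) m n y : (m <= n)%N -> normInf y = n -> lk adj s origin y -> connO m s.
Proof.
move=> mn e hl; apply/connO_lk.
have [||y' e' h'] := arm_exit adj_sym adj_sadj hl (n := m); rewrite ?e //.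
by exists y' => //; apply: lk_sub h' => z /andP[].
Qed.

(** Rectangles 2 ^ (i + 1) by 2 ^ i with a corner at the origin, crossed the long way and
    alternating in direction, so that consecutive crossings must meet. *)
Definition stair (i : nat) : event := if odd i then TBev true 0 (2 ^ i)%N 0 (2 ^ i.+1)%N
  else LRev true 0 (2 ^ i.+1)%N 0 (2 ^ i)%N.

Lemma stair_local i : local (2 ^ i.+1) (stair i).
Proof.
have e : (2 ^ i <= 2 ^ i.+1)%N by rewrite leq_exp2l.
by rewrite /stair; case: ifP => _; [apply: TB_local|apply: LR_local] => z; rewrite /rect /normInf; move: e; clear; lia.
Qed.

Lemma stair_mono i : tmono true (stair i).
Proof. by rewrite /stair; case: ifP => _; [apply: TB_mono|apply: LR_mono]. Qed.

Lemma stairs_connect (s : config) i0 m : all_plus (2 ^ i0.+1) s ->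
  (forall i, (i <= m)%N -> stair (i0 + i) s) -> connO (2 ^ (i0 + m)) s.
Proof.
move=> ap st.
have sub (D : site -> bool) x y : lk (radj true) (fun z => D z && (s z == true)) x y -> lk adj s x y.
  by apply: lk_sub => z /andP[_]; rewrite eqb_id.
have sub' (D : site -> bool) : forall z, D z && (s z == true) -> s z by move=> z /andP[_]; rewrite eqb_id.
have key k : (k <= m)%N -> exists x y : site, [/\ lk adj s origin x &
    if odd (i0 + k) then [/\ x.2 = 0, y.2 = (2 ^ (i0 + k).+1)%N & lk (radj true) (fun z => rect 0 (2 ^ (i0 + k))%N 0 (2 ^ (i0 + k).+1)%N z && (s z == true)) x y]
    else [/\ x.1 = 0, y.1 = (2 ^ (i0 + k).+1)%N & lk (radj true) (fun z => rect 0 (2 ^ (i0 + k).+1)%N 0 (2 ^ (i0 + k))%N z && (s z == true)) x y]].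
  elim: k => [|k IH] km.
    have := st 0%N (leq0n m); rewrite addn0 /stair.
    have e : (2 ^ i0 <= 2 ^ i0.+1)%N by rewrite leq_exp2l.
    case: ifP => _ [x [y [e1 e2 h]]]; exists x, y; split=> //; apply: (box_link ap);
    by have /andP[] := lk_fst h; rewrite /rect /normInf; move: e; clear; lia.
  have [x [y [ox hk]]] := IH (ltnW km).
  have := st _ km; move: hk; rewrite addnS /stair /=; set i := (i0 + k)%N.
  have e1 : (2 ^ i <= 2 ^ i.+1)%N by rewrite leq_exp2l.
  have e2 : (2 ^ i.+1 <= 2 ^ i.+2)%N by rewrite leq_exp2l.
  have e3 : (2 ^ i <= 2 ^ i.+2)%N := leq_trans e1 e2.
  case: ifP => _ /= [a1 a2 h] [x' [y' [b1 b2 h']]]; exists x', y'; split=> //.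
    apply: (lk_trans ox); apply: (lk_sym adj_sym).
    apply: (@join true _ _ s 0 (2 ^ i)%N 0 (2 ^ i.+1)%N _ _ _ _ h' h (sub' _) (sub' _)); rewrite ?a1 ?a2 ?b1 ?b2 ?lez_nat //.
    - by move=> z /andP[/andP[]].
    - by move=> z /andP[/andP[]].
  apply: (lk_trans ox).
  apply: (@join true _ _ s 0 (2 ^ i.+1)%N 0 (2 ^ i)%N _ _ _ _ h h' (sub' _) (sub' _)); rewrite ?a1 ?a2 ?b1 ?b2 ?lez_nat //.
  - by move=> z /andP[/andP[]].
  - by move=> z /andP[/andP[]].
have [x [y [ox hk]]] := key m (leqnn m).
have e1 : (2 ^ (i0 + m) <= 2 ^ (i0 + m).+1)%N by rewrite leq_exp2l.
have [oy ny] : lk adj s origin y /\ (2 ^ (i0 + m) <= normInf y)%N.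
  move: hk; case: ifP => _ [a1 a2 h]; split; try exact: (lk_trans ox (sub _ _ _ h)).
    by rewrite /normInf a2 leq_max e1 orbT.
  by rewrite /normInf a2 leq_max e1.
exact: (connO_of ny erefl oy).
Qed.

Lemma expn_dominates (A B : nat) : exists i0, forall i, (i0 <= i)%N -> (A + B * i <= 2 ^ i)%N.
Proof.
have sq i : (4 <= i)%N -> (i * i <= 2 ^ i)%N.
  elim: i => // i IH; rewrite leq_eqVlt => /predU1P[<- //|hi].
  by have := IH hi; rewrite expnS; move: (2 ^ i)%N hi => m; clear; nia.
exists (4 + A + B)%N => i hi; apply: leq_trans (sq i _); last by move: hi; clear; lia.
by move: hi; clear; nia.
Qed.

Section Perc.
Variables (T : R).
Hypothesis hT : Tc < T.
Let T0 : 0 < T. Proof. exact: le_lt_trans Tc_ge0 hT. Qed.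

Lemma connO_anti m n s : (m <= n)%N -> connO n s -> connO m s.
Proof. by move=> mn /connO_lk[y e hl]; apply: connO_of e hl. Qed.

Lemma mu_connO_anti h m n : (m <= n)%N -> mu T h (connO n) <= mu T h (connO m).
Proof.
move=> mn; apply: (mu_le T0 h (@connO_local n) (local_le mn (@connO_local m))) => s.
exact: connO_anti.
Qed.

Lemma perc_cvg h : (mu T h (connO n) @[n --> \oo] --> perc T h)%classic.
Proof.
apply: nonincreasing_is_cvgn.
  by move=> m n mn; apply: mu_connO_anti.
by exists 0 => _ [n _ <-]; apply: (mu_ge0 T0 h (@connO_local n)).
Qed.

Lemma perc_le h n : perc T h <= mu T h (connO n).
Proof.
apply: (cvgr_to_le (@perc_cvg h)); exists n => // m /= nm; exact: mu_connO_anti.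
Qed.

Lemma perc_ge h (c : R) : (forall n, c <= mu T h (connO n)) -> c <= perc T h.
Proof. by move=> H; apply: (cvgr_to_ge (@perc_cvg h)); apply: nearW. Qed.

Lemma perc_mono h1 h2 : h1 <= h2 -> perc T h1 <= perc T h2.
Proof.
move=> h12; apply: perc_ge => n; apply: (le_trans (perc_le h1 n)).
exact: (mu_mono_h T0 (@connO_local n) (@connO_mono n) h12).
Qed.

(** By duality a stair fails only if a star arm starts on its long side, so the failure
    probabilities are summable. All stairs from [i0] on hold with probability at least 1/2, and FKG
    with a box of plus spins joins them to the origin. *)
Lemma star_perc h Rr n : (0 < n)%N -> (forall k, mu T h (arm false Rr (Rr + 4 * n * k)) <= 2^-1 ^+ k) -> 0 < perc T h.
Proof.
move=> n0 dec.
have [i0 Hi] := expn_dominates (Rr + 16 * n) (8 * n).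
have crs i : (i0 <= i)%N -> 1 - mu T h (stair i) <= 2^-1 ^+ (i + 2).
  move=> ii; have -> : mu T h (stair i) = crp T h true (2 ^ i.+1) (2 ^ i).
    by rewrite /stair; case: ifP => _; [apply: (mu_TB T0)|apply: (mu_LR T0)]; rewrite add0r.
  pose M := (2 ^ i)%N; pose M2 := (2 ^ i.+1)%N.
  have lA := @LR_local true 0 M2 0 M _ (@rect_norm _ _ _ _).
  have RM : (Rr + 4 * n * (2 * i + 4) <= M)%N.
    by apply: leq_trans (Hi i ii); clear; lia.
  pose E (j : nat) : event := fun s => arm false Rr M (s \o transl (j%:Z, 0)).
  have lE j : j \in iota 0 M2.+1 -> local (M + M2) (E j).
    rewrite mem_iota => /= hj; apply: local_le (local_shift (z := (j%:Z, 0)) (@arm_local false Rr M)).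
    by rewrite leq_add2l /normInf /= maxn0.
  have hE j : j \in iota 0 M2.+1 -> mu T h (E j) <= 2^-1 ^+ (2 * i + 4).
    move=> _; rewrite /E (mu_shift hT h (j%:Z, 0) (@arm_local false Rr M)).
    apply: le_trans (dec (2 * i + 4)%N).
    apply: (mu_le T0 h (@arm_local _ _ _) (local_le RM (@arm_local _ _ _))) => s.
    by apply: arm_sub => //; rewrite leq_addr.
  have H := mu_ex hT lE hE; rewrite size_iota in H.
  rewrite -/(crp T h true M2 M) -(mu_not T0 h lA).
  apply: (@le_trans _ _ (M2.+1%:R * 2^-1 ^+ (2 * i + 4))).
    apply: le_trans H; apply: (mu_le T0 h (local_le _ (localC lA)) (local_le _ (local_ex lE)) (N := (M2 + M + (M + M2))%N)).
    - by clear; lia.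
    - by clear; lia.
    move=> s nA; have [[x [y [e1 e2 hl]]]|[x [y [e1 e2 hl]]]] := @expl_dichotomy false 0 M2 0 M s ltac:(by []) ltac:(by []).
      by case: nA; exists x, y.
    have /andP[/andP[/andP[x1 x1'] _] _] := lk_fst hl.
    exists (absz x.1); first by rewrite mem_iota; move: x1 x1'; clear; lia.
    have ex : x = ((absz x.1)%:Z, 0) by rewrite [LHS]surjective_pairing e1; congr (_, _); move: x1; clear; lia.
    rewrite /E -ex.
    have hl' : lk (radj false) (fun z => s (transl x z) == false) (transl (oppz x) x) (transl (oppz x) y).
      apply: (lk_map _ _ hl) => [u v _ _|z /andP[_ sz]]; first by rewrite transl_radj.
      by rewrite translVK.
    apply: (arm_of _ hl') => //; first by apply: leq_trans RM; rewrite leq_addr.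
      by rewrite /transl /oppz /normInf /= !subrr.
    by rewrite /transl /oppz /normInf /= e1 e2 subr0 leq_max leqnn orbT.
  have -> : (2 * i + 4 = (i + 2) + (i + 2))%N by clear; lia.
  rewrite exprD mulrA ler_piMl ?exprn_ge0 ?invr_ge0 // exprVn ler_pdivrMr ?exprn_gt0 // mul1r.
  rewrite -natrX ler_nat /M2 addn2 !expnS; have : (0 < 2 ^ i)%N by rewrite expn_gt0.
  by move: (2 ^ i)%N => m; clear; lia.
(* The term 2 ^ - (m + 1) is the reserve for the later stairs; the stair [i0 + m] uses at most half
   of it. *)
have all_ m : 2^-1 + 2^-1 ^+ m.+1 <= mu T h (fun s => forall i, (i < m)%N -> stair (i0 + i) s).
  elim: m => [|m IH].
    rewrite expr1 (mu_eq T h (F := fun=> True)) ?(mu_true hT) //; lra.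
  have lS i : (i <= m)%N -> local (2 ^ (i0 + m).+1) (stair (i0 + i)).
    by move=> im; apply: local_le (@stair_local _); rewrite leq_exp2l // ltnS leq_add2l.
  have lL : local (2 ^ (i0 + m).+1) (fun s => forall i, (i < m)%N -> stair (i0 + i) s).
    by move=> s s' ss H i im; apply: (lS i (ltnW im) _ _ ss); apply: H.
  rewrite (mu_eq T h (F := eand (fun s => forall i, (i < m)%N -> stair (i0 + i) s) (stair (i0 + m)))).
    have := mu_eand hT h lL (lS m (leqnn m)); have := crs (i0 + m)%N (leq_addr _ _).
    have : 2^-1 ^+ (i0 + m + 2) <= 2^-1 ^+ m.+2 :> R.
      by apply: ler_wiXn2l; [rewrite invr_ge0|lra|clear; lia].
    have : 2^-1 ^+ m.+1 = 2 * 2^-1 ^+ m.+2 :> R by rewrite [in RHS]exprS mulrA divff // mul1r.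
    move: IH; move: (2^-1 ^+ (i0 + m + 2)) (2^-1 ^+ m.+1) (2^-1 ^+ m.+2) => u v w; lra.
  move=> s; split=> [H|[H1 H2] i]; first by split=> [i im|]; apply: H => //; apply: ltnW.
  by rewrite ltnS leq_eqVlt => /predU1P[->|/H1].
pose c := mu T h (all_plus (2 ^ i0.+1)) * 2^-1.
have c0 : 0 < c by rewrite /c mulr_gt0 ?invr_gt0 // (mu_all_plus T0).
apply: (lt_le_trans c0); apply: perc_ge => m.
have mm : (m <= 2 ^ (i0 + m))%N by apply: (leq_trans (ltnW (ltn_expl m (ltnSn 1)))); rewrite leq_exp2l // leq_addl.
apply: le_trans (mu_connO_anti h mm).
pose F : event := fun s => forall i, (i < m.+1)%N -> stair (i0 + i) s.
have lF : local (2 ^ (i0 + m).+1) F.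
  move=> s s' ss H i im; apply: (@stair_local (i0 + i) s s' _ (H i im)) => x hx; apply: ss.
  by apply: (leq_trans hx); rewrite leq_exp2l // ltnS leq_add2l.
have mF : tmono true F by move=> s s' ss H i im; apply: (@stair_mono (i0 + i) s s' ss (H i im)).
have lP : local (2 ^ (i0 + m).+1) (all_plus (2 ^ i0.+1)).
  by apply: local_le (@local_all_plus _); rewrite leq_exp2l // ltnS leq_addr.
have := mu_fkg T0 h (c := true) lP lF (@tmono_all_plus _) mF.
have : c <= mu T h (all_plus (2 ^ i0.+1)) * mu T h F.
  rewrite /c ler_pM2l ?(mu_all_plus T0) //; apply: le_trans (all_ m.+1).
  by rewrite lerDl exprn_ge0 // invr_ge0.
move=> h1 h2; apply: (le_trans h1); apply: (le_trans h2).
apply: (mu_le T0 h (localI lP lF) (local_le _ (@connO_local _))); first by rewrite leq_exp2l.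
by move=> s [ap H]; apply: stairs_connect ap _ => i im; apply: H.
Qed.

End Perc.

(** * Finite-size criteria at the critical field *)

Section Critical.
Variables (T : R).
Hypothesis hT : Tc < T.
Let T0 : 0 < T. Proof. exact: le_lt_trans Tc_ge0 hT. Qed.
Let Ti0 : 0 < T^-1. Proof. by rewrite invr_gt0. Qed.

(** In an extreme field spins of the unfavoured type are so rare that already one scale starts the
    branching argument. For the two types this makes the percolating fields a nonempty set bounded
    below, so that [hc] is a true infimum. *)
Lemma arm_extreme t : exists n (H0 : R), (0 < n)%N /\ forall h, (if t then h else - h) <= H0 ->
  forall k, mu T h (arm t n (n + 4 * n * k)) <= 2^-1 ^+ k.
Proof.
have [N HN] := Delta_small 1 hT (ltac:(lra) : 0 < 224^-1 :> R).
pose n := N.+1; have Dn : Delta T^-1 n n <= 224^-1 by apply: HN; rewrite ?mul1n // ltnW.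
pose S := size (boxsites n).
(* The boundary is covered by 28 translates, and (1/112 + 2/224) * 28 = 1/2. *)
pose kap : R := (112 * S.+1%:R)^-1.
have kap0 : 0 < kap by rewrite /kap invr_gt0 mulr_gt0 // ltr0n.
pose H0 := ln kap / (2 * T^-1) - 4.
exists n, H0; split=> // h hh.
have b2 : 0 < 2 * T^-1 by rewrite mulr_gt0.
have site_small x : mu T h (fun s => s x = t) <= kap.
  apply: (le_trans (mu_site T0 h x t)); rewrite -[leRHS](lnK (x := kap)) ?posrE // ler_expR.
  have : (if t then h else - h) + 4 <= ln kap / (2 * T^-1) by move: hh; rewrite /H0; lra.
  by rewrite ler_pdivlMr // mulrC.
have lE x : x \in boxsites n -> local n (fun s : config => s x = t).
  by rewrite mem_boxsites => hx s s' ss <-; rewrite ss.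
apply: (arm_branch hT (Rr := n) (n := n)) => //.
have -> : (2 * (3 * n) %/ n = 6)%N by rewrite mulnA mulnK.
have : mu T h (arm t n n) <= S%:R * kap.
  apply: le_trans (mu_ex hT lE (fun x _ => site_small x)).
  apply: (mu_le T0 h (@arm_local _ _ _) (local_ex lE)) => s [x [y [e1 _ hl]]].
  by exists x; [rewrite mem_boxsites e1|have /andP[_ /eqP] := lk_fst hl].
have : S%:R * kap <= 112^-1.
  rewrite /kap invfM mulrCA ler_piMr ?invr_ge0 ?ler0n // ler_pdivrMr ?ltr0n // mul1r ler_nat; exact: leqnSn.
have -> : ((4 * 7)%:R = 28 :> R) by [].
move: (S%:R * kap) (Delta T^-1 n n) Dn (mu T h _) => u v hv x; lra.
Qed.

Lemma perc_set_nonempty : exists h, 0 < perc T h.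
Proof.
have [n [H0 [n0 H]]] := arm_extreme false; exists (- H0).
by apply: (star_perc hT (Rr := n) n0) => k; apply: H; rewrite opprK.
Qed.

Lemma perc_zero h Rr n : (forall k, mu T h (arm true Rr (Rr + 4 * n * k)) <= 2^-1 ^+ k) -> perc T h <= 0.
Proof.
move=> H; apply/ler_addgt0Pl => e e0; rewrite addr0.
have [|k hk] := @pow_small 2^-1 e _ e0; first by apply/andP; split; lra.
apply: le_trans hk; apply: le_trans (H k); apply: (le_trans (perc_le hT h (Rr + 4 * n * k))).
apply: (mu_le T0 h (@connO_local _) (@arm_local _ _ _)) => s; apply: connO_arm; exact: leq_addr.
Qed.

Lemma perc_set_lb : exists H0, forall h, 0 < perc T h -> H0 <= h.
Proof.
have [n [H0 [n0 H]]] := arm_extreme true; exists H0 => h hp.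
rewrite leNgt; apply/negP => /ltW hh; have := perc_zero (H h hh); lra.
Qed.

Lemma perc_above h : hc T < h -> 0 < perc T h.
Proof.
have [h1 p1] := perc_set_nonempty; move=> /inf_lt [|h2 p2 h2h]; first by exists h1.
exact: lt_le_trans p2 (perc_mono hT (ltW h2h)).
Qed.

Lemma perc_below h : h < hc T -> perc T h <= 0.
Proof.
move=> hh; rewrite leNgt; apply/negP => hp; have [H0 HH] := perc_set_lb.
have := @ge_inf R [set h : R | 0 < perc T h]%classic ltac:(by exists H0 => x /HH) h hp.
by rewrite -/(hc T) leNgt hh.
Qed.

Lemma arm_ring_excl h t a : mu T h (arm t a (3 * a)) + mu T h (ring (~~ t) a) <= 1.
Proof.
have lR := @ring_local (~~ t) a; have lA := @arm_local t a (3 * a).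
have : mu T h (arm t a (3 * a)) <= mu T h (enot (ring (~~ t) a)).
  apply: (mu_le T0 h lA (localC lR)) => s [x [y [e1 e2 hl]]] rg.
  apply: (@ring_block (~~ t) a s x y rg); rewrite ?e1 ?e2 // negbK.
  by apply: lk_sub hl => z /andP[].
rewrite (mu_not T0 h lR); lra.
Qed.

(** Wide plus crossings at scale a would make a plus ring likely and a star arm unlikely. The arm
    costs 4/2000, the passage to a smaller field 1/2000, mixing 2/2000; times the 76 covering
    translates this is below 1/2. Star arms would then decay in a field below [hc], and [star_perc]
    would give percolation there. *)
Lemma wide_supercritical : exists2 kap : R, 0 < kap & exists M, forall h a, (M <= a)%N -> h <= hc T ->
  crp T h true (6 * a) (2 * a) < 1 - kap.
Proof.
have [D0 HD] := Delta_small 1 hT (ltac:(lra) : 0 < 2000^-1 :> R).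
exists 2000^-1; first by rewrite invr_gt0 ltr0n.
exists D0.+1 => h a Ma hh; rewrite ltNge; apply/negP => wide_.
have a0 : (0 < a)%N by apply: leq_trans Ma.
set p := crp T h true (6 * a) (2 * a) in wide_.
have p4 : 1 - 4 * 2000^-1 <= mu T h (ring true a).
  apply: le_trans (ring_lower hT h true a); rewrite -/p.
  have := crp_le1 T0 h true (6 * a) (2 * a); rewrite -/p => p1.
  have -> : p ^+ 4 = (p * p) * (p * p) by ring.
  have : 1 - 2 * 2000^-1 <= p * p by move: wide_ p1; move: (p) => x; nra.
  have : p * p <= 1 by move: wide_ p1; move: (p) => x; nra.
  by move: (p * p) => x; nra.
have := arm_ring_excl h false a => ex.
have A1 : mu T h (arm false a (3 * a)) <= 4 * 2000^-1 by move: ex p4; rewrite /=; lra.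
have [del d0 Hd] := mu_cont h hT (@arm_local false a (3 * a)) (ltac:(lra) : 0 < 2000^-1 :> R).
pose h' := h - del / 2.
have hlt : h' < hc T by apply: lt_le_trans hh; rewrite /h'; lra.
have := perc_below hlt.
suff : 0 < perc T h' by lra.
apply: (star_perc hT (Rr := a) (n := (3 * a)%N)); first by rewrite muln_gt0.
apply: (arm_branch hT) => //; first by rewrite leq_pmull.
have -> : (2 * (3 * (3 * a)) %/ a = 18)%N by rewrite !mulnA mulnK.
have : `|h' - h| < del.
  by rewrite /h' addrC addKr normrN gtr0_norm; lra.
move=> /Hd; rewrite ltr_norml => /andP[_ hx].
have Da : Delta T^-1 (3 * a) (3 * a) <= 2000^-1.
  by apply: HD; rewrite ?mul1n //; move: Ma; clear; lia.
have -> : ((4 * 19)%:R = 76 :> R) by [].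
move: Da hx; move: (Delta _ _ _) (mu T h' _) => u v; lra.
Qed.

(** The crossing of the 12 N w by 4 N w rectangle implies one of a square of side 6 N w. This is S(3
    N w) up to translation, whence the condition 3 N w <= n. *)
Lemma one_step (eps0 : R) : 0 < eps0 -> exists2 eps : R, 0 < eps <= 1 & exists N w0, [/\ (2 <= N)%N, (0 < w0)%N &
  forall h w n, (w0 <= w)%N -> (3 * (N * w) <= n)%N -> belowL T h eps0 n -> mu T h (arm true w (N * w)) <= 1 - eps].
Proof.
move=> e0; have [kap k0 [M HM]] := wide_supercritical.
have m0 : 0 < Num.min eps0 kap by rewrite lt_min e0.
have [eps eps01 [N [w0 [N2 w00 HW]]]] := wide hT m0.
exists eps => //; exists N, (w0 + M)%N; split=> //; first by rewrite addn_gt0 w00.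
move=> h w n hw hn hb; rewrite leNgt; apply/negP => ha.
have hw0 : (w0 <= w)%N by apply: leq_trans hw; rewrite leq_addr.
have := HW h w hw0 ha => wide_.
case: (ltP (hc T) h) => hh; last first.
  have Ma : (M <= 2 * (N * w))%N.
    by apply: leq_trans (leq_trans (leq_addl _ _) hw) _; move: N2; clear; nia.
  have := HM h _ Ma hh.
  have -> : (6 * (2 * (N * w)) = 12 * (N * w))%N by rewrite mulnA.
  have -> : (2 * (2 * (N * w)) = 4 * (N * w))%N by rewrite mulnA.
  move: wide_; have : Num.min eps0 kap <= kap by rewrite ge_min lexx orbT.
  lra.
move: hb; rewrite /belowL hh => /(_ _ hn).
have -> : mu T h (Aplus (3 * (N * w))) = crp T h true (6 * (N * w)) (6 * (N * w)).
  rewrite (mu_eq T h (@Aplus_LR _)); apply: (mu_LR T0); clear; lia.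
have : crp T h true (12 * (N * w)) (4 * (N * w)) <= crp T h true (6 * (N * w)) (6 * (N * w)).
  by apply: (crp_mono T0); rewrite leq_mul2r ?orbT.
move: wide_; have : Num.min eps0 kap <= eps0 by rewrite ge_min lexx.
lra.
Qed.

End Critical.

(** * Power-law bounds *)

Section Bounds.
Variables (T : R).
Hypothesis hT : Tc < T.
Let T0 : 0 < T. Proof. exact: le_lt_trans Tc_ge0 hT. Qed.

(** The solution of q m ^ alpha = 1; it is below 1 because 1 / q <= 2 < m. *)
Lemma power_exponent (q : R) (m : nat) : 2^-1 <= q < 1 -> (4 <= m)%N ->
  exists2 alpha : R, 0 < alpha < 1 & q * powR m%:R alpha = 1.
Proof.
move=> /andP[q2 q1] m4; have q0 : 0 < q by lra.
have m4' : 4 <= m%:R :> R by rewrite (ler_nat _ 4).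
have m0 : 0 < m%:R :> R by lra.
have lm : 0 < ln (m%:R : R) by rewrite ln_gt0 //; lra.
have lq : ln q < 0 by rewrite ln_lt0 // q0.
exists (- ln q / ln m%:R).
  apply/andP; split; first by rewrite divr_gt0 // oppr_gt0.
  rewrite ltr_pdivrMr // mul1r -lnV ?posrE // ltr_ln ?posrE ?invr_gt0 //.
  by apply: (@le_lt_trans _ _ 2); [rewrite invf_ple ?posrE|lra].
rewrite /powR gt_eqF // mulfVK ?gt_eqF // expRN lnK ?posrE // divff // gt_eqF //.
Qed.

Lemma upper_power (eps0 : R) : 0 < eps0 -> exists C alpha : R, exists w0 : nat, [/\ 0 < C, 0 < alpha < 1, (0 < w0)%N &
  forall h Rr n, (w0 <= Rr)%N -> (Rr <= n)%N -> belowL T h eps0 n ->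
    mu T h (arm true Rr n) <= C * powR (Rr%:R / n%:R) alpha].
Proof.
move=> e0; have [eps /andP[ep0 ep1] [N [w1 [N2 w10 H]]]] := one_step hT e0.
have [||alpha /andP[a0 a1] qa] := @power_exponent (1 - eps / 2) (2 * N).
- by apply/andP; split; lra.
- by move: N2; clear; lia.
have [D0 HD] := Delta_small 2 hT (ltac:(lra) : 0 < eps / 4).
have C0 : 0 < (3 * N)%:R :> R by rewrite ltr0n; move: N2; clear; lia.
(* With this constant the bound is trivial unless 3 N Rr <= n, since a number in (0, 1] is at most
   its power alpha. *)
exists (3 * N)%:R, alpha, (w1 + D0 + 2)%N; split; rewrite ?a0 //; first by rewrite addn2.
move=> h Rr n hR hn hb.
have [m hm] := ubnP (n - Rr); elim: m Rr hR hn hm => // m IH Rr hR hn hm.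
have R0 : (0 < Rr)%N by apply: leq_trans hR; rewrite addn2.
have n0 : (0 < n)%N by apply: leq_trans hn.
have R0' : 0 < Rr%:R :> R by rewrite ltr0n.
have n0' : 0 < n%:R :> R by rewrite ltr0n.
have lA := @arm_local true Rr n.
case: (leqP (3 * (N * Rr)) n) => h3; last first.
  apply: (@le_trans _ _ 1); first exact: (mu_le1 T0 h lA).
  apply: (@le_trans _ _ ((3 * N)%:R * (Rr%:R / n%:R))).
    by rewrite mulrA ler_pdivlMr // mul1r -natrM ler_nat -mulnA ltnW.
  rewrite ler_pM2l //; apply: ger1_powR; last exact: ltW.
  by rewrite divr_gt0 //= ler_pdivrMr // mul1r ler_nat.
(* The arm is cut at radii N Rr and 2 N Rr; the annulus between them is left for mixing. *)
pose R2 := (2 * N * Rr)%N.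
have RR2 : (Rr < R2)%N by rewrite /R2; move: N2 R0; clear; nia.
have R2n : (R2 <= n)%N by apply: leq_trans h3; rewrite /R2; clear; lia.
have IH2 : mu T h (arm true R2 n) <= (3 * N)%:R * powR (R2%:R / n%:R) alpha.
  apply: IH => //; first by apply: leq_trans hR (ltnW RR2).
  by move: hm RR2 R2n; clear; lia.
have NR2 : (2 <= N * Rr)%N by move: N2 R0; clear; nia.
have D : Delta T^-1 (N * Rr) (N * Rr - 1) <= eps / 4.
  apply: HD; last by move: NR2; clear; lia.
  have : (Rr <= N * Rr - 1)%N \/ (Rr = 0)%N by left; move: N2 R0; clear; nia.
  by move: hR NR2; clear; lia.
have step : mu T h (arm true Rr n) <= (1 - eps / 2) * mu T h (arm true R2 n).
  have l1 : local n (arm true R2 n) := @arm_local _ _ _.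
  have l2 : local (N * Rr + n) (arm true Rr (N * Rr)) by apply: local_le (@arm_local _ _ _); rewrite leq_addr.
  have l3 : local (N * Rr + n) (arm true R2 n) by apply: local_le (@arm_local _ _ _); rewrite leq_addl.
  have ou : outside (N * Rr + (N * Rr - 1)) (arm true R2 n).
    by apply: arm_outside; rewrite /R2; move: NR2; clear; lia.
  have := mix_prod T0 h (@arm_local true Rr (N * Rr)) l1 ou.
  have hA := H h Rr n ltac:(by apply: leq_trans hR; clear; lia) h3 hb.
  have m2 := mu_ge0 T0 h l1.
  have : mu T h (arm true Rr n) <= mu T h (eand (arm true Rr (N * Rr)) (arm true R2 n)).
    apply: (mu_le T0 h (local_le _ lA) (localI l2 l3)); first by rewrite leq_addl.
    have NRn : (N * Rr <= n)%N by apply: leq_trans h3; clear; lia.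
    move=> s hs; split; apply: arm_sub hs => //; first by rewrite leq_pmull //; move: N2; clear; lia.
    exact: ltnW.
  move=> h1 h2; apply: (le_trans h1); apply: (le_trans h2); apply: ler_wpM2r => //.
  by lra.
apply: (le_trans step).
have q0 : 0 <= 1 - eps / 2 by lra.
apply: (le_trans (ler_wpM2l q0 IH2)).
have -> : R2%:R / n%:R = (2 * N)%:R * (Rr%:R / n%:R) :> R by rewrite /R2 natrM mulrA.
rewrite powRM ?ler0n ?divr_ge0 //.
by rewrite mulrCA (mulrA (1 - eps / 2)) qa mul1r.
Qed.

(** At most 28 n / Rr translates cover the boundary. The arm and the mixing error may each take Rr /
    (112 n), in all Rr / (56 n), which makes the branching factor at most 1/2. *)
Lemma lower_above : exists N1, forall h Rr n, hc T <= h -> (0 < Rr)%N -> (Rr <= n)%N -> (N1 <= n)%N ->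
  Rr%:R / (112 * n%:R) <= mu T h (arm true Rr n).
Proof.
have [N HN] := mdec_decay hT (ltac:(lra) : 0 < 224^-1 :> R).
exists N => h Rr n hh R0 Rn Nn.
rewrite leNgt; apply/negP => small.
have n0 : (0 < n)%N by apply: leq_trans Rn.
have R1' : 1 <= Rr%:R :> R by rewrite ler1n.
have n0' : 0 < n%:R :> R by rewrite ltr0n.
have c0 : 0 <= Delta T^-1 n n by rewrite /Delta mulr_ge0 ?ler0n // mdec_ge0 // invr_ge0 ltW.
have D : Delta T^-1 n n <= Rr%:R / (224 * n%:R).
  have e : ((2 * n).+1 ^ 3)%:R * mdec T^-1 n = (2 * n%:R + 1) * Delta T^-1 n n :> R.
    by rewrite /Delta expnS natrM -natr1 natrM mulrA.
  have := HN n Nn; rewrite e => hd.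
  rewrite ler_pdivlMr ?mulr_gt0 ?ltr0n //; move: hd c0 R1' n0'; move: (Delta _ _ _) => x; nra.
have K : (4 * (2 * (3 * n) %/ Rr).+1)%:R * Rr%:R <= 28 * n%:R :> R.
  rewrite -natrM -(natrM _ 28) ler_nat.
  have := leq_trunc_div (2 * (3 * n)) Rr; move: (_ %/ _)%N => u; move: Rn R0; clear; nia.
pose gap := Rr%:R / (112 * n%:R) - mu T h (arm true Rr n).
have g0 : 0 < gap by rewrite subr_gt0.
have [del d0 Hd] := mu_cont h hT (@arm_local true Rr n) g0.
pose h' := h + del / 2.
have hlt : hc T < h' by apply: (le_lt_trans hh); rewrite /h' ltrDl divr_gt0.
have := perc_above hT hlt; suff : perc T h' <= 0 by move=> h1 h2; have := lt_le_trans h2 h1; rewrite ltxx.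
apply: (perc_zero hT (Rr := Rr) (n := n)); apply: (arm_branch hT) => //.
have : `|h' - h| < del.
  by rewrite /h' addrC addKr gtr0_norm ?divr_gt0 // ltr_pdivrMr // ltr_pMr // ltr1n.
move=> /Hd; rewrite ltr_norml => /andP[_ hx].
have {}hx : mu T h' (arm true Rr n) < Rr%:R / (112 * n%:R) by move: hx; rewrite /gap; lra.
have m0 := mu_ge0 T0 h' (@arm_local true Rr n).
move: K; set k := (4 * _)%:R => K.
have k0 : 0 <= k by rewrite /k ler0n.
have s1 : mu T h' (arm true Rr n) + 2 * Delta T^-1 n n <= Rr%:R / (56 * n%:R).
  have e1 : Rr%:R / (112 * n%:R) = 2^-1 * (Rr%:R / (56 * n%:R)) :> R by field; rewrite gt_eqF.
  have e2 : Rr%:R / (224 * n%:R) = 4^-1 * (Rr%:R / (56 * n%:R)) :> R by field; rewrite gt_eqF.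
  by move: hx D; rewrite e1 e2; lra.
apply: (le_trans (ler_wpM2r k0 s1)).
rewrite mulrAC ler_pdivrMr ?mulr_gt0 ?ltr0n //; move: K; rewrite mulrC; lra.
Qed.

(** The left side of S(n) is covered by at most 4 (2 n / Rr + 1) <= 12 n / Rr translates, from one
    of which the crossing continues to distance n. *)
Lemma lower_below h (eps0 : R) Rr n : eps0 < mu T h (Aplus n) -> (0 < Rr)%N -> (Rr <= n)%N ->
  0 <= eps0 -> eps0 / 12 * (Rr%:R / n%:R) <= mu T h (arm true Rr n).
Proof.
move=> ha R0 Rn e0; have n0 : (0 < n)%N by apply: leq_trans Rn.
have R0' : 0 < Rr%:R :> R by rewrite ltr0n.
have n0' : 0 < n%:R :> R by rewrite ltr0n.
pose k := (2 * n %/ Rr)%N.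
pose E (i : bool * bool * nat) : event := fun s => arm true Rr n (s \o transl (cpt n Rr i.1.1 i.1.2 i.2)).
have lE i : i \in idx k -> local (n + n) (E i).
  case: i => -[p q] i; rewrite mem_idx => hi.
  by have := local_shift (z := cpt n Rr p q i) (@arm_local true Rr n); rewrite cpt_norm.
have H := mu_ex hT (h := h) (c := mu T h (arm true Rr n)) lE; rewrite size_idx in H.
have {}H := H (fun i _ => le_of_eq (mu_shift hT h _ (@arm_local true Rr n))).
have : mu T h (Aplus n) <= mu T h (fun s => exists2 i, i \in idx k & E i s).
  apply: (mu_le T0 h (local_le _ (@Aplus_local n)) (local_ex lE)); first by rewrite leq_addr.
  move=> s /Aplus_LR[x [y [e1 e2 hl]]].
  have nx : normInf x = n.
    by have /andP[] := lk_fst hl; rewrite /rect /normInf e1; clear; lia.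
  have [p [q [i [hi hx]]]] := box_cover R0 nx.
  exists (p, q, i); first by rewrite mem_idx.
  rewrite /E /=; set c := cpt _ _ _ _ _ in hx *.
  have hl' : lk (radj true) (fun z => s (transl c z) == true) (transl (oppz c) x) (transl (oppz c) y).
    apply: (lk_map _ _ hl) => [u v _ _ uv|z /andP[_ sz]]; first by rewrite transl_radj.
    by rewrite translVK.
  apply: (arm_of _ hl') => //.
  move: hx; rewrite /normInf /transl /oppz /= e1 e2; move: Rn; clear; lia.
move=> hm; have {}hm := le_trans hm H.
have K : (4 * k.+1)%:R * Rr%:R <= 12 * n%:R :> R.
  rewrite -natrM -(natrM _ 12) ler_nat /k.
  have := leq_trunc_div (2 * n) Rr; move: (_ %/ _)%N => u; move: Rn R0; clear; nia.
have m0 := mu_ge0 T0 h (@arm_local true Rr n).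
rewrite mulrA ler_pdivrMr //.
move: ha hm K m0; move: (mu T h (arm _ _ _)) (mu T h (Aplus n)) ((4 * k.+1)%:R) => x z kk ha hm K m0.
have h1 : eps0 <= kk * x by lra.
have h2 : eps0 * Rr%:R <= kk * x * Rr%:R by rewrite ler_pM2r.
have h3 : x * (kk * Rr%:R) <= x * (12 * n%:R) by apply: ler_wpM2l.
have h4 : kk * x * Rr%:R = x * (kk * Rr%:R) by ring.
lra.
Qed.

(** A plus box S(1), of fixed positive probability, joins the origin to any arm that starts on its
    boundary; FKG combines the two events. *)
Lemma connO_lower h n : (0 < n)%N -> mu T h (all_plus 1) * mu T h (arm true 1 n) <= mu T h (connO n).
Proof.
move=> n0; have l1 : local n (all_plus 1) by apply: local_le (@local_all_plus 1).
apply: le_trans (mu_fkg T0 h (c := true) l1 (@arm_local true 1 n) (@tmono_all_plus 1) (@arm_mono true 1 n)) _.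
apply: (mu_le T0 h (localI l1 (@arm_local true 1 n)) (@connO_local n)) => s [ap [x [y [e1 e2 hl]]]].
have ox : lk adj s origin x by apply: (box_link ap); rewrite e1.
apply: (connO_of (leqnn n) e2); apply: (lk_trans ox).
by apply: lk_sub hl => z /andP[_]; rewrite eqb_id.
Qed.

End Bounds.

Unset Implicit Arguments.

Theorem theorem7p1 (T : R) (hT : Tc < T) :
  exists eps_bar : R, 0 < eps_bar /\
  forall eps0 : R, 0 < eps0 -> eps0 <= eps_bar ->
  exists J : nat, forall j1 : nat, (J <= j1)%N ->
  exists C5 C6 alpha : R, [/\ 0 < C5, 0 < C6, 0 < alpha < 1,
    (forall h : R, 0 <= h -> h <= 2 * hc T ->
       forall Rr n : nat, (2 ^ j1 < Rr)%N -> (Rr < n)%N -> belowL T h eps0 n ->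
         C5 * (Rr%:R / n%:R) <= mu T h (Bev Rr n) /\
         mu T h (Bev Rr n) <= C6 * powR (Rr%:R / n%:R) alpha)
  & (forall n : nat, (2 ^ j1 <= n)%N ->
       C5 / n%:R <= pi_cr T n /\ pi_cr T n <= C6 * powR n%:R (- alpha))].
Proof.
have T0 := le_lt_trans Tc_ge0 hT.
exists 1; split=> // eps0 e0 _.
have [C [alpha [w0 [C0 a01 w00 HU]]]] := upper_power hT e0.
have [N1 HL] := lower_above hT.
exists (w0 + N1)%N => j1 hj.
have jw : (w0 + N1 <= 2 ^ j1)%N by apply: (leq_trans hj); apply/ltnW/ltn_expl.
pose ap := mu T (hc T) (all_plus 1).
have ap0 : 0 < ap := mu_all_plus T0 (hc T) 1.
(* The three terms serve h >= hc, h < hc and the connection of the origin at hc. *)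
pose C5 := Num.min (Num.min (112^-1) (eps0 / 12)) (ap / 112).
have C5a : C5 <= 112^-1 by rewrite /C5 !ge_min lexx.
have C5b : C5 <= eps0 / 12 by rewrite /C5 !ge_min lexx orbT.
have C5c : C5 <= ap / 112 by rewrite /C5 !ge_min lexx orbT.
have C50 : 0 < C5 by rewrite /C5 !lt_min !divr_gt0 ?ltr0n // invr_gt0 ltr0n.
have w0' : 0 < powR w0%:R alpha by apply: powR_gt0; rewrite ltr0n.
(* The summand [powR w0%:R alpha] is for [pi_cr]: the connection of the origin is bounded by an arm
   that starts at the fixed radius [w0]. *)
exists C5, (C * (1 + powR w0%:R alpha)), alpha; split=> //.
- by rewrite mulr_gt0 // addr_gt0.
- move=> h _ _ Rr n hR hn hb.
  have R0 : (0 < Rr)%N by apply: leq_trans hR.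
  have Rn := ltnW hn.
  have n0' : 0 < n%:R :> R by rewrite ltr0n (leq_trans R0).
  have R0' : 0 < Rr%:R :> R by rewrite ltr0n.
  have x0 : 0 < Rr%:R / n%:R :> R by rewrite divr_gt0.
  rewrite (mu_eq T h (@Bev_arm Rr n)); split; last first.
    apply: (le_trans (HU h Rr n _ Rn hb)).
      by apply: leq_trans (ltnW hR); apply: leq_trans jw; rewrite leq_addr.
    apply: ler_wpM2r; first exact: powR_ge0.
    by rewrite ler_peMr ?(ltW C0) // lerDl ltW.
  case: (leP (hc T) h) => hh.
    apply: (@le_trans _ _ (112^-1 * (Rr%:R / n%:R))); first by rewrite ler_pM2r.
    have -> : 112^-1 * (Rr%:R / n%:R) = Rr%:R / (112 * n%:R) :> R.
      by rewrite invfM mulrCA.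
    apply: HL => //; apply: leq_trans Rn; apply: leq_trans (ltnW hR); apply: leq_trans jw.
    by rewrite leq_addl.
  apply: (@le_trans _ _ (eps0 / 12 * (Rr%:R / n%:R))); first by rewrite ler_pM2r.
  apply: lower_below => //; last exact: ltW.
  by move: hb; rewrite /belowL ltNge (ltW hh) /= hh; apply.
- move=> n hn; rewrite /pi_cr.
  have wn : (w0 + N1 <= n)%N by apply: leq_trans hn.
  have n0 : (0 < n)%N by apply: leq_trans wn; rewrite addn_gt0 w00.
  have n0' : 0 < n%:R :> R by rewrite ltr0n.
  split.
    apply: (le_trans _ (connO_lower hT (hc T) n0)).
    have := HL (hc T) 1%N n (lexx _) isT n0 (leq_trans (leq_addl _ _) wn) => h1.
    apply: (@le_trans _ _ (ap * (1%:R / (112 * n%:R)))); last by rewrite ler_pM2l.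
    by rewrite mul1r invfM mulrA ler_pM2r ?invr_gt0.
  have w0n : (w0 <= n)%N by apply: leq_trans wn; rewrite leq_addr.
  have bl : belowL T (hc T) eps0 n by rewrite /belowL ltxx.
  apply: (@le_trans _ _ (mu T (hc T) (arm true w0 n))).
    apply: (mu_le T0 _ (@connO_local n) (@arm_local _ _ _)) => s; exact: connO_arm.
  apply: (le_trans (HU _ _ _ (leqnn _) w0n bl)).
  have -> : powR (w0%:R / n%:R) alpha = powR w0%:R alpha * powR n%:R (- alpha).
    by rewrite powRM ?ler0n ?invr_ge0 // -powR_inv1 ?ler0n // -powRrM mulN1r.
  rewrite mulrA; apply: ler_wpM2r; first exact: powR_ge0.
  by rewrite ler_pM2l // lerDr.
Qed.
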